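(* Let $t \geq 1$ be an integer. For each $n$, let $\widehat N_{t,n}$ be the random variable on the set $\mathcal{SC}(n)$ of self-conjugate partitions of $n$ (equipped with the uniform probability measure) given by $\lambda \mapsto N_t(\lambda)$, the number of hooks of length $t$ in $\lambda$. Let $\mu_t(n)$ and $\sigma_t(n)^2$ denote the mean and variance of $\widehat N_{t,n}$. Then as $n \to \infty$, $$\mu_t(n) = \frac{\sqrt{6n}}{\pi}-\frac{t}{2}+\frac{3}{\pi^2}+\frac{\delta_{t}}{4} +O\left(\frac{1}{\sqrt{n}}\right), \qquad \sigma_t(n)^2 = \frac{(\pi^2-6)\sqrt{6n}}{\pi^3}+\frac{3(\pi^2-12)}{\pi^4}-\frac{\delta_{t}}{8} + O\left(\frac{1}{\sqrt{n}}\right),$$ and $\widehat N_{t,n}$ is asymptotically normally distributed, i.e. $(\widehat N_{t,n}-\mu_t(n))/\sigma_t(n)$ converges in distribution to the standard normal distribution.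
   Context: A partition $\lambda$ of $n$ is a non-increasing sequence of positive integers $(\lambda_1,\dots,\lambda_\ell)$ summing to $n$; its conjugate is $\lambda'$ with $\lambda'_k = \#\{j : \lambda_j \ge k\}$, and $\lambda$ is self-conjugate if $\lambda=\lambda'$. For a cell $(j,k)$ of the Young diagram of $\lambda$, its hook length is $h(j,k) = (\lambda_j - j) + (\lambda'_k - k) + 1$. $N_t(\lambda)$ is the number of cells of $\lambda$ with hook length exactly $t$. Here $\delta_t = 1$ if $t$ is odd and $\delta_t = 0$ if $t$ is even. *)

(* Defs.v *)
From HB Require Import structures.
From mathcomp Require Import all_boot all_order all_algebra.
From mathcomp Require Import all_classical all_reals all_analysis.

Set Implicit Arguments.
Unset Strict Implicit.
Unset Printing Implicit Defensive.

Import Order.TTheory GRing.Theory Num.Theory.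
Import numFieldNormedType.Exports.

Definition is_partition (n : nat) (la : seq nat) : bool :=
  [&& sorted geq la, all (leq 1) la & sumn la == n].

Record partition (n : nat) := Partition {
  parts :> seq nat;
  partsP : is_partition n parts }.

HB.instance Definition _ n := [isSub for @parts n].
HB.instance Definition _ n := [Countable of partition n by <:].

Section PartitionFinite.
Variable n : nat.

Let enc (la : partition n) : n.-bseq 'I_n.+1 :=
  insub_bseq n [seq inord p | p <- parts la].
Let dec (b : n.-bseq 'I_n.+1) : option (partition n) :=
  insub [seq val i | i <- b].

Lemma partition_encK : pcancel enc dec.
Proof.
move=> la; have /and3P[_ la_gt0 /eqP sum_la] := partsP la.
have le_size : (size la <= n)%N.
  rewrite -[leqRHS]sum_la.
  elim: (parts la) la_gt0 => //= p s IHs /andP[p_gt0 /IHs].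
  by rewrite -add1n; apply: leq_add.
have le_part p : p \in parts la -> (p <= n)%N.
  rewrite -[leqRHS]sum_la; elim: (parts la) => //= q s IHs.
  rewrite inE => /predU1P[-> | /IHs le_p]; first exact: leq_addr.
  exact: leq_trans le_p (leq_addl _ _).
rewrite /dec /enc val_insubd size_map le_size -map_comp map_id_in ?valK //.
by move=> p la_p /=; rewrite inordK // ltnS le_part.
Qed.

HB.instance Definition _ :=
  fintype.isFinite.Build (partition n) (pcan_enumP partition_encK).
End PartitionFinite.

(* The conjugate of la has la_1 parts. *)
Definition conjugate (la : seq nat) : seq nat :=
  [seq count (leq k) la | k <- iota 1 (head 0%N la)].

Definition SC (n : nat) : {set partition n} :=
  [set la : partition n | conjugate la == la :> seq nat].

(* Parts, rows and columns are numbered from 1. *)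
Definition part (la : seq nat) (j : nat) : nat := nth 0%N la j.-1.

Definition cells (la : seq nat) : seq (nat * nat) :=
  [seq (j, k) | j <- iota 1 (size la), k <- iota 1 (part la j)].

(* The two summands may be negative, hence the arithmetic in int. *)
Definition hook_length (la : seq nat) (c : nat * nat) : int :=
  ((part la c.1)%:Z - c.1%:Z + ((part (conjugate la) c.2)%:Z - c.2%:Z) + 1)%R.

Definition hooks (t : nat) (la : seq nat) : nat :=
  count (fun c => hook_length la c == t%:Z)%R (cells la).

Local Open Scope ring_scope.

(* Uniform probability on a finite set A; all three are 0 when A is empty,
   as is the case for SC 2. *)
Section Uniform.
Variables (R : realType) (T : finType) (A : {set T}).

Definition unif_prob (E : pred T) : R :=
  #|[set w in A | E w]|%:R / #|A|%:R.

Definition unif_mean (X : T -> R) : R :=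
  (\sum_(w in A) X w) / #|A|%:R.

Definition unif_variance (X : T -> R) : R :=
  unif_mean (fun w => (X w - unif_mean X) ^+ 2).
End Uniform.

Section HookStatistics.
Variables (R : realType) (t n : nat).

Definition hookRV (la : partition n) : R := (hooks t la)%:R.
Definition hook_mean : R := unif_mean (SC n) hookRV.
Definition hook_variance : R := unif_variance (SC n) hookRV.
Definition hook_sigma : R := Num.sqrt hook_variance.
End HookStatistics.

(* Main.v *)
(* A self-conjugate partition of n is encoded by the set D of its nonnegative Frobenius coordinates: n is the sum of
   the 2i+1 for i in D, and N_t is twice the number of i outside D with i+t in D, plus a boundary term that depends
   only on the residues below t.  Uniform measure on SC(n) is therefore the product measure with weights
   exp(-s(2i+1)) conditioned on the weight n, for every s.  A local limit theorem (Fourier inversion) controls the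
   conditioning.  For the mean and the variance this costs too much precision, so the conditioned measure is instead
   written, up to a high power of a ~ n^(-1/2), as a finite signed combination of product measures with parameters
   close to a; moments of product measures telescope.  For normality, the moment generating function at l >= 0 is
   expanded over the sets of hooks, with s shifted by O(l) to recentre the weight.  Convergence on l >= 0 suffices,
   because exp(cy) p(sin(y/L)) approximates indicators and is a limit of combinations of y^k exp(cy). *)
Require Import Defs.
From mathcomp Require Import all_boot all_order all_algebra.
From mathcomp Require Import all_classical all_reals all_analysis.
From mathcomp Require Import measurable_realfun zify ring lra complex.
Set Implicit Arguments. Unset Strict Implicit. Unset Printing Implicit Defensive.
Import Order.TTheory GRing.Theory Num.Theory.
Import numFieldNormedType.Exports.

Local Open Scope ring_scope.

(* The obstacle is precision. The local limit theorem has a relative error that is only a small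
   power of [a], while the second moment of the hook count has size [a^-2] and is needed up to
   [O(a)]. Hence the mixture: ratios of coefficients are expanded in finite differences, each order
   gaining [a^(1/2)], and powers of the shift are fitted by exponentials, which correspond to
   changes of the parameter. This only yields the existence of mixing weights; their values stay
   unknown. What the moments require are four averages over the weights, of [1], [s], [1/s] and
   [1/s^2]. Total mass and mean weight supply two of them. The average of [1/s] has another source:
   the summatory function of the number of self-conjugate partitions, divided by that number, obeys
   an exact recurrence, which contracts and so forces its own asymptotic expansion. The constant
   [A = pi^2/24] is the leading coefficient of the mean weight [A/s^2] of a product measure, and [a]
   is fixed by [a^2 n = A]. For the generating function, [l >= 0] makes the expansion over sets of
   hooks a sum of nonnegative terms, so errors can be averaged by moment bounds. *)
Tactic Notation "via" uconstr(y) := refine (@Order.POrderTheory.le_trans _ _ y _ _ _ _).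
Tactic Notation "lel" uconstr(h) := refine (le_trans h _).
Tactic Notation "bigr" ident(i) := apply: eq_bigr => i _.
Tactic Notation "lsum" ident(i) := apply: ler_sum => i _.
Ltac is_der := apply: is_derive_eq; rewrite /GRing.scale /=.
Ltac le_eq := rewrite le_eqVlt; apply/orP; left; apply/eqP.
Ltac clra := clear; lra.
Local Notation sqrt := Num.sqrt.
Local Notation andI p q := (introT andP (conj p q)).

Ltac pz := solve [first
 [ done | exact: ltW
 | lazymatch goal with
   | |- is_true (_ && _) => apply/andP; split; pz
   | |- is_true (_ != 0) => rewrite gt_eqF //; pz
   | |- is_true (0 < _ * _) => apply: mulr_gt0; pz
   | |- is_true (0 < _^-1) => rewrite invr_gt0; pz
   | |- is_true (0 < _ ^+ _) => apply: exprn_gt0; pz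
   | |- is_true (0 < expR _) => exact: expR_gt0
   | |- is_true (0 < Num.sqrt _) => rewrite sqrtr_gt0; pz
   | |- is_true (0 < _ + _) => first [apply: addr_gt0; pz | apply: ltr_wpDr; pz | apply: ltr_wpDl; pz]
   | |- is_true (0 <= _ * _) => apply: mulr_ge0; pz
   | |- is_true (0 <= _^-1) => rewrite invr_ge0; pz
   | |- is_true (0 <= _ ^+ _) => first [exact: sqr_ge0 | apply: exprn_ge0; pz]
   | |- is_true (0 <= expR _) => exact: expR_ge0
   | |- is_true (0 <= Num.sqrt _) => exact: sqrtr_ge0
   | |- is_true (0 <= `|_|) => exact: normr_ge0
   | |- is_true (0 <= _%:R) => exact: ler0n
   | |- is_true (0 <= _ + _) => apply: addr_ge0; pz
   | |- is_true (0 <= \sum_(_ <- _ | _) _) => apply: sumr_ge0 => * /=; pz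
   | |- is_true (_^-1 <= _^-1) => rewrite lef_pV2 ?posrE; pz
   | |- is_true (_ * _ <= _ * _) => first [apply: ler_wpM2l; pz | apply: ler_wpM2r; pz | apply: ler_pM; pz]
   | |- is_true (_ ^+ _ <= _ ^+ _) => apply: lerXn2r; rewrite ?nnegrE; pz
   | |- is_true (_ + _ <= _ + _) => apply: lerD; pz
   end ]].

Ltac fld := field; pz.

Local Close Scope ring_scope.

(** * Self-conjugate partitions as sets of Frobenius coordinates *)

Definition symmetric_diagram (la : seq nat) : Prop :=
 forall j k, (k < nth 0 la j) = (j < nth 0 la k).

Lemma nth_noninc (la : seq nat) j k :
 sorted geq la -> j <= k -> nth 0 la k <= nth 0 la j.
move=> srt le_jk; have [lek|ltk] := leqP (size la) k.
 by rewrite (nth_default _ lek).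
have geq_tr : transitive geq by move=> a b c /= ba cb; exact: leq_trans cb ba.
have geq_rf : reflexive geq by move=> a /=.
have := sorted_leq_nth geq_tr geq_rf 0 srt.
by move=> /(_ j k); rewrite !inE; apply=> //; lia.
Qed.

Lemma nth_pos (la : seq nat) j : all (leq 1) la -> (0 < nth 0 la j) = (j < size la).
move=> pos; have [lej|ltj] := leqP (size la) j; first by rewrite nth_default.
exact: (allP pos _ (mem_nth _ ltj)).
Qed.

Lemma lt_count_leq (la : seq nat) j k :
 sorted geq la -> 0 < k -> (j < count (leq k) la) = (k <= nth 0 la j).
elim: la j => [|a la IH] j srt k0 /=; first by rewrite nth_nil; lia.
have srt' : sorted geq la by exact: path_sorted srt.
have [ka|ka] := leqP k a.
 case: j => [|j] /=; first by rewrite ka; lia.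
 by rewrite add1n ltnS IH.
have -> : count (leq k) la = 0.
 apply/eqP; rewrite -leqn0 leqNgt -has_count; apply/hasPn => x xla.
 have := order_path_min (fun a b c (ba : geq b a) (cb : geq a c) => leq_trans cb ba) srt.
 by move=> /allP /(_ x xla) /=; lia.
case: j => [|j] /=; first by lia.
have := nth_noninc (j := 0) (k := j.+1) srt isT; rewrite /=; lia.
Qed.

Lemma nth_conjugate (la : seq nat) k : sorted geq la ->
 nth 0 (conjugate la) k = if k < head 0 la then count (leq k.+1) la else 0.
move=> srt; rewrite /conjugate; case: ltnP => hk.
 by rewrite (nth_map 0) ?size_iota // nth_iota // add1n.
by rewrite nth_default // size_map size_iota.
Qed.

Lemma conjugate_symmetric (la : seq nat) : sorted geq la -> all (leq 1) la ->
 conjugate la = la -> symmetric_diagram la.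
move=> srt pos cla j k.
have nthE i : nth 0 la i = if i < head 0 la then count (leq i.+1) la else 0.
 by rewrite -{1}cla nth_conjugate.
rewrite [nth 0 la k]nthE; case: ifP => hk; first by rewrite lt_count_leq.
have := nth_noninc (j := 0) (k := j) srt isT; rewrite nth0; lia.
Qed.

Lemma symmetric_conjugate (la : seq nat) : sorted geq la -> all (leq 1) la ->
 symmetric_diagram la -> conjugate la = la.
move=> srt pos sym.
have hd : head 0 la = size la.
 have e j : (j < size la) = (j < head 0 la).
 by rewrite -nth_pos // sym nth0.
 by have := e (size la); have := e (head 0 la); lia.
apply: (@eq_from_nth _ 0) => [|k]; rewrite /conjugate size_map size_iota ?hd // => hk.
rewrite (nth_map 0) ?size_iota // nth_iota // add1n.
have e j : (j < count (leq k.+1) la) = (j < nth 0 la k) by rewrite lt_count_leq.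
by have := e (nth 0 la k); have := e (count (leq k.+1) la); lia.
Qed.

(** With rows numbered from 0, the diagonal hook in row [j] has arm [nth 0 la j - j.+1]; by symmetry
    arm and leg agree, so one list serves as both rows of the Frobenius symbol. The filter keeps the
    rows that reach the diagonal, where the truncated subtraction is exact. *)
Definition frob (la : seq nat) : seq nat :=
 [seq nth 0 la j - j.+1 | j <- iota 0 (size la) & j < nth 0 la j].

Section Symmetric.
Variable la : seq nat.
Hypotheses (srt : sorted geq la) (pos : all (leq 1) la) (sym : symmetric_diagram la).
Let L := nth 0 la.
Let l := size la.

Let Lmon j k : j <= k -> L k <= L j. Proof. exact: nth_noninc. Qed.
Let Lpos j : (0 < L j) = (j < l). Proof. exact: nth_pos. Qed.
Let L0 : L 0 = l.
have e j : (j < L 0) = (j < l) by rewrite -Lpos /L sym.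
by have := e l; have := e (L 0); lia.
Qed.
Let Lle j : L j <= l. Proof. by rewrite -L0 Lmon. Qed.

(** [P] and [Q] sort the rows by the signed quantity [L j - j]: it equals [v + 1] in the rows
    counted by [P v] and [- v] in those counted by [Q v]. It decreases strictly in [j], hence both
    counts are at most 1. *)
Let P v := \sum_(j < l) (L j == v + j + 1).
Let Q v := \sum_(j < l) (L j + v == j).

Let sum_le1 (p : nat -> bool) : (forall i j, i < j -> p i -> p j -> False) ->
 forall m, \sum_(j < m) p j <= 1.
move=> pP; elim=> [|m IH]; first by rewrite big_ord0.
rewrite big_ord_recr /=; case: (boolP (p m)) => pm; last by rewrite addn0.
rewrite big1 // => i _; case: (boolP (p i)) => // pi'.
by have := pP i m (ltn_ord i) pi' pm.
Qed.

Let Ple v : P v <= 1.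
apply: (sum_le1 (p := fun j => L j == v + j + 1)) => i j ij /eqP h1 /eqP h2.
by have := Lmon (ltnW ij); lia.
Qed.
Let Qle v : Q v <= 1.
apply: (sum_le1 (p := fun j => L j + v == j)) => i j ij /eqP h1 /eqP h2.
by have := Lmon (ltnW ij); lia.
Qed.

Let sum_ge1 (p : nat -> bool) m j : j < m -> p j -> 0 < \sum_(i < m) p i.
Proof. by move=> jm pj; rewrite (bigD1 (Ordinal jm)) //= pj; lia. Qed.

Let Pge v j : L j = v + j + 1 -> 0 < P v.
move=> e; apply: (sum_ge1 (p := fun j => L j == v + j + 1) (j := j)); last by rewrite e.
by rewrite -Lpos e; lia.
Qed.

Let Qge v j : j < l -> L j + v = j -> 0 < Q v.
Proof. by move=> jl e; apply: (sum_ge1 (p := fun j => L j + v == j) jl); apply/eqP. Qed.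

Let sum_gt0 (p : nat -> bool) m : 0 < \sum_(i < m) p i -> exists2 j, j < m & p j.
rewrite lt0n sum_nat_eq0 => /forallPn[[j jm]] /=; rewrite -lt0n lt0b => pj.
by exists j.
Qed.

(** The Maya diagram of a self-conjugate partition: of a position and its mirror image exactly one
    carries a row. Two hits contradict the symmetry of the diagram at that pair of rows. For
    existence take the first row [j0] with [L j0 <= v + j0]: either the row before it has length
    exactly [v + j0], or column [v + j0] has height exactly [j0]. *)
Let PQ v : v < l -> P v + Q v = 1.
move=> vl; apply/eqP; rewrite eqn_leq; apply/andP; split.
 rewrite leqNgt; apply/negP => h.
 have [hP hQ] : 0 < P v /\ 0 < Q v by have := Ple v; have := Qle v; lia.
 have [j _ /eqP ej] := sum_gt0 (p := fun j => L j == v + j + 1) hP.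
 have [k _ /eqP ek] := sum_gt0 (p := fun j => L j + v == j) hQ.
 by have := sym j k; rewrite -/L; lia.
have ex : exists j, L j <= v + j by exists l; rewrite (leq_trans (Lle _)) //; lia.
case: (ex_minnP ex) => j0 hj0 minj.
have j00 : 0 < j0 by case: (posnP j0) => // e; move: hj0; rewrite e L0; lia.
have h1 : v + j0.-1 < L j0.-1.
 by rewrite ltnNge; apply/negP => /minj; lia.
have [e|ne] := eqVneq (L j0.-1) (v + j0).
 by have := @Pge v j0.-1; rewrite e; lia.
have k1 := sym j0.-1 (v + j0); have k2 := sym j0 (v + j0).
rewrite -/L in k1 k2.
have e : L (v + j0) = j0 by lia.
have := @Qge v (v + j0); rewrite e -Lpos e; lia.
Qed.

Let P0 v : l <= v -> P v = 0.
Proof. by move=> lv; rewrite /P big1 // => j _; have := Lle j; case: eqP => //; lia. Qed.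

Let mem_frob v : (v \in frob la) = (0 < P v).
apply/idP/idP.
 move=> /mapP[j]; rewrite mem_filter => /andP[hj _] ->.
 by apply: (@Pge _ j); rewrite -/L; move: hj; rewrite -/L; lia.
move=> /(sum_gt0 (p := fun j => L j == v + j + 1))[j jl /eqP e].
apply/mapP; exists j; last by rewrite -/L; lia.
by rewrite mem_filter mem_iota -/l -/L; lia.
Qed.

Let PE v : P v = (v \in frob la).
Proof. by rewrite mem_frob; have := Ple v; lia. Qed.

Let sum_row (c d : nat) : \sum_(k < l) (L k + c == d + k) =
 if d <= c then Q (c - d) else P (d - c).-1.
by case: leqP => h; bigr k; congr nat_of_bool; apply/eqP/eqP; lia.
Qed.

(** Each row has exactly one sign and one [v], so a sum over rows can be indexed by [v]; the bound
    [L j <= l] keeps all these [v] below [l]. *)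
Let sum_split (G : nat -> nat) (Gp Gn : nat -> nat) :
 (forall j v, j < l -> L j = v + j + 1 -> G j = Gp v) ->
 (forall j v, j < l -> L j + v = j -> G j = Gn v) ->
 \sum_(j < l) G j = \sum_(v < l) (P v * Gp v + Q v * Gn v).
move=> hp hn; rewrite big_split /=.
under [X in _ = X + _]eq_bigr => v _ do rewrite big_distrl /=.
under [X in _ = _ + X]eq_bigr => v _ do rewrite big_distrl /=.
rewrite exchange_big /= [X in _ = _ + X]exchange_big /= -big_split /=.
apply: eq_bigr => -[j jl] _ /=.
have [jL|Lj] := ltnP j (L j).
 have vl : L j - j.+1 < l by have := Lle j; lia.
 rewrite (bigD1 (Ordinal vl)) //= big1 ?addn0; last first.
 by move=> [v vl']; rewrite -val_eqE /=; case: eqP => //; lia.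
 rewrite big1 ?addn0; last by move=> [v vl'] _; case: eqP => //; lia.
 have -> : L j == (L j - j.+1) + j + 1 by lia.
 by rewrite mul1n; apply: hp => //; lia.
have vl : j - L j < l by lia.
rewrite big1 ?add0n; last by move=> [v vl'] _; case: eqP => //; lia.
rewrite (bigD1 (Ordinal vl)) //= big1 ?addn0; last first.
 by move=> [v vl']; rewrite -val_eqE /=; case: eqP => //; lia.
have -> : L j + (j - L j) == j by lia.
by rewrite mul1n; apply: hn => //; lia.
Qed.

Lemma frob_lt v : v \in frob la -> v < l.
Proof. by rewrite mem_frob (ltnNge v); apply: contraL => /P0 ->. Qed.

(** Write [L j - j] as [v + 1] or as [- u]. The equation asks that two such numbers add up to
    [t + 1]. Two nonpositive ones cannot; one of each sign means [v = u + t] with [u] outside and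
    [v] inside [frob la], and this arises twice; two positive ones mean [v + v' = t - 1], the
    boundary term. *)
Lemma pair_count_frob t : 0 < t ->
 \sum_(j < l) \sum_(k < l) (L j + L k == t + j + k + 1) =
 2*(\sum_(i < l) ((val i \notin frob la) && (i + t \in frob la)))
 + \sum_(i < t) ((val i \in frob la) && (t.-1 - i \in frob la)).
move=> t0.
rewrite (sum_split (G := fun j => \sum_(k < l) (L j + L k == t + j + k + 1))
 (Gp := fun v => if t <= v then Q (v - t) else P (t - v).-1)
 (Gn := fun u => P (t + u))); last 2 first.
- move=> j v jl e; rewrite -sum_row; bigr k.
 by congr nat_of_bool; apply/eqP/eqP; lia.
- move=> j v jl e.
 have := sum_row 0 (t + v + 1); rewrite addn1 ltn0 subn0 /= => <-.
 by bigr k; congr nat_of_bool; apply/eqP/eqP; lia.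
rewrite big_split /= mul2n -addnn.
have E1 : \sum_(i < l) Q i * P (t + i) =
 \sum_(i < l) ((val i \notin frob la) && (i + t \in frob la)).
 apply: eq_bigr => -[i il] _ /=; have := PQ il; rewrite !PE addnC [t + i]addnC.
 by case: (i \in _); case: (_ \in _); lia.
have E2 : \sum_(v < l) P v*(if t <= v then Q (v - t) else P (t - v).-1) =
 \sum_(i < l) ((val i \notin frob la) && (i + t \in frob la)) +
 \sum_(i < t) ((val i \in frob la) && (t.-1 - i \in frob la)).
 rewrite -E1.
 pose F v := P v*(if t <= v then Q (v - t) else P (t - v).-1).
 have -> : \sum_(v < l) F v = \sum_(0 <= v < t + l) F v.
 rewrite [RHS](@big_cat_nat _ _ _ l) //= ?leq_addl // big_mkord.
 rewrite [X in _ = _ + X]big_nat_cond [X in _ = _ + X]big1 ?addn0 // => i /andP[/andP[li _] _].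
 by rewrite /F P0.
 rewrite (@big_cat_nat _ _ _ t) //= ?leq_addr // addnC; congr (_ + _).
 rewrite -{1}[t]add0n big_addn addKn big_mkord; bigr i.
 by rewrite /F leq_addl addnK mulnC addnC.
 rewrite big_mkord; bigr i; rewrite /F leqNgt ltn_ord /= !PE.
 have -> : (t - i).-1 = t.-1 - i by have := ltn_ord i; lia.
 by case: (_ \in _); case: (_ \in _).
by rewrite E1 E2; rewrite addnAC.
Qed.

(** Pairs outside the diagram may be included for free: there [L j <= k] and [L k <= j], so the left
    side of the equation is too small. *)
Lemma hooks_pair_count t : 0 < t -> conjugate la = la ->
 hooks t la = \sum_(j < l) \sum_(k < l) (L j + L k == t + j + k + 1).
move=> t0 cla; rewrite /hooks /cells -sum1_count big_mkcond /= big_allpairs_dep /=.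
rewrite (iotaDl 1 0 l) big_map -{1}[l]subn0 big_mkord; apply: eq_bigr => -[j jl] _ /=.
rewrite /part add1n /= -/L (iotaDl 1 0) big_map -{1}[L j]subn0 big_mkord.
rewrite (big_ord_widen l (fun k => if (hook_length la (1 + j, 1 + k)%N == t%:Z)%R then 1 else 0)) //=.
rewrite big_mkcond /=; apply: eq_bigr => -[k kl] _ /=.
rewrite /hook_length /part cla /= -/L !add0n.
have := sym j k; rewrite -/L; case: ltnP => h1 /esym h2.
 by case: eqP; case: eqP; lia.
by case: eqP; lia.
Qed.

(** The diagonal hook with arm [v] has [2 v + 1] cells. In the proof the cells below the diagonal
    are reflected, so each row is counted from the diagonal on, once with the diagonal cell and once
    without it. *)
Lemma sumn_frob : sumn la = \sum_(v < l) (val v \in frob la) * v.*2.+1.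
have -> : sumn la = \sum_(j < l) \sum_(k < l) (k < L j).
 rewrite sumnE (big_nth 0) big_mkord; bigr j.
 rewrite -[nth 0 la j]/(L j) -{1}[L j]card_ord -sum1_card.
 rewrite (big_ord_widen l (fun=> 1)) ?Lle // big_mkcond /=.
 by [].
have sumlt (m b : nat) : m <= l -> b <= l ->
 \sum_(k < l) ((m <= k) && (k < b)) = b - m.
 move=> ml bl; rewrite -(big_mkord xpredT (fun k => (m <= k) && (k < b) : nat)).
 rewrite (@big_cat_nat _ _ _ m) //=.
 rewrite big_nat_cond big1 ?add0n; last by move=> i; lia.
 have [bm|mb] := leqP b m.
 rewrite big_nat_cond big1; first by lia.
 by move=> i; lia.
 rewrite (@big_cat_nat _ _ _ b) //=; last by lia.
 rewrite [X in _ + X]big_nat_cond [X in _ + X]big1 ?addn0; last by move=> i; lia.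
 rewrite (eq_big_nat _ _ (F2 := fun=> 1)) ?sum_nat_const_nat ?muln1 //.
 by move=> i; lia.
have -> : \sum_(j < l) \sum_(k < l) (k < L j) =
 \sum_(j < l) ((L j - j) + (L j - j.+1)).
 have e : \sum_(j < l) \sum_(k < l) (k < L j) =
 \sum_(j < l) \sum_(k < l) ((j <= k) && (k < L j)) +
 \sum_(j < l) \sum_(k < l) ((j.+1 <= k) && (k < L j)).
 rewrite [X in _ = _ + X]exchange_big /= -big_split /=; bigr j.
 rewrite -big_split /=; bigr k; have := sym j k; rewrite -/L => ->.
 by case: (ltngtP j k) => /=; lia.
 rewrite e -big_split /=; bigr j.
 by rewrite !sumlt // ltnW.
rewrite (sum_split (G := fun j => (L j - j) + (L j - j.+1)) (Gp := fun v => v.*2.+1) (Gn := fun=> 0)).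
- by bigr v; rewrite muln0 addn0 PE.
- by move=> j v _ ->; lia.
- by move=> j v _ e; lia.
Qed.

Lemma frob_sorted : sorted gtn (frob la).
have ltn_tr : transitive ltn by move=> ? ? ?; exact: ltn_trans.
apply: (homo_sorted_in (e := ltn) (P := [pred j | j < L j])).
- move=> i j; rewrite !inE => hi hj ij /=.
 by have := Lmon (ltnW ij); rewrite /L in hi hj *; lia.
- by apply/allP => i; rewrite mem_filter => /andP[].
- by apply: sorted_filter => //; exact: iota_ltn_sorted.
Qed.

Lemma nth_frob j : j < l -> (j < size (frob la)) = (j < L j) /\
 (j < L j -> nth 0 (frob la) j = L j - j.+1).
move=> jl.
have [d dl hd] : exists2 d, d <= l & forall i, i < l -> (i < L i) = (i < d).
 have ex : exists i, L i <= i by exists l; exact: Lle.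
 case: (ex_minnP ex) => d hd mind; exists d.
 exact: mind (Lle l).
 move=> i il; apply/idP/idP => hi.
 by rewrite ltnNge; apply/negP => di; have := Lmon di; lia.
 by rewrite ltnNge; apply/negP => /mind; lia.
have -> : frob la = [seq L i - i.+1 | i <- iota 0 d].
 rewrite /frob; congr map; rewrite -/l -/L.
 have -> : iota 0 l = iota 0 d ++ iota d (l - d) by rewrite -iotaD subnKC.
 rewrite filter_cat (_ : [seq x <- iota d _ | _] = [::]) ?cats0.
 apply/all_filterP/allP => i; rewrite mem_iota => hi /=.
 by have := hd i; lia.
 apply/eqP; rewrite -(negbK (_ == _)) -has_filter; apply/hasPn => i.
 by rewrite mem_iota => hi; have := hd i; lia.
rewrite size_map size_iota (hd j jl); split => // jd.
by rewrite (nth_map 0) ?size_iota // nth_iota.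
Qed.

End Symmetric.

(** The coordinates, in decreasing order, give the lengths of all rows that cross the diagonal;
    symmetry of the diagram gives the rest. *)
Lemma frob_inj (la mu : seq nat) :
 sorted geq la -> all (leq 1) la -> symmetric_diagram la ->
 sorted geq mu -> all (leq 1) mu -> symmetric_diagram mu ->
 frob la =i frob mu -> la = mu.
move=> s1 p1 y1 s2 p2 y2 eqi.
have gtn_tr : transitive gtn by move=> a b c /= ba cb; exact: ltn_trans cb ba.
have gtn_irr : irreflexive gtn by move=> a /=; rewrite ltnn.
have e : frob la = frob mu.
 apply: (irr_sorted_eq gtn_tr gtn_irr _ _ eqi); exact: frob_sorted.
have main l1 l2 : sorted geq l1 -> all (leq 1) l1 -> symmetric_diagram l1 ->
 sorted geq l2 -> all (leq 1) l2 -> symmetric_diagram l2 ->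
 frob l1 = frob l2 -> forall j k, k < nth 0 l1 j -> k < nth 0 l2 j.
 move=> t1 q1 z1 t2 q2 z2 ee.
 have top j k : j < nth 0 l1 j -> k < nth 0 l1 j -> k < nth 0 l2 j.
 move=> hj; have jl : j < size l1 by rewrite -(nth_pos _ q1); lia.
 have [a b] := nth_frob t1 q1 z1 jl.
 have hs : j < size (frob l2) by rewrite -ee a.
 have jl2 : j < size l2.
 apply: leq_trans hs _; rewrite /frob size_map size_filter.
 by rewrite (leq_trans (count_size _ _)) // size_iota.
 have [a2 b2] := nth_frob t2 q2 z2 jl2.
 have h2 : j < nth 0 l2 j by rewrite -a2.
 by have := b hj; have := b2 h2; rewrite -ee; lia.
 move=> j k hk; have [hj|hj] := ltnP j (nth 0 l1 j); first exact: top.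
 rewrite z2; apply: top; last by rewrite -z1.
 have := z1 j k; rewrite hk => /esym; lia.
have s : size la = size mu.
 have := main _ _ s1 p1 y1 s2 p2 y2 e (size mu) 0.
 have := main _ _ s2 p2 y2 s1 p1 y1 (esym e) (size la) 0.
 by rewrite !nth_pos //; lia.
apply: (@eq_from_nth _ 0) => // j _.
have h1 := main _ _ s1 p1 y1 s2 p2 y2 e j (nth 0 mu j).
have h2 := main _ _ s2 p2 y2 s1 p1 y1 (esym e) j (nth 0 la j).
by lia.
Qed.

(** Total on [nat] and false from [n] on, so that [i + t] and [t.-1 - i] need no range condition. *)
Definition bit n (D : {set 'I_n}) (i : nat) : bool := i \in [seq val x | x in D].

Definition weight n (D : {set 'I_n}) : nat := \sum_(i in D) (val i).*2.+1.

Definition cfg_hooks n (t : nat) (D : {set 'I_n}) : nat :=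
 2*(\sum_(i < n) (~~ bit D i && bit D (i + t)))
 + \sum_(i < t) (bit D i && bit D (t.-1 - i)).

Lemma bitE n (D : {set 'I_n}) (i : 'I_n) : bit D i = (i \in D).
rewrite /bit; apply/fintype.imageP/idP => [[j jD /val_inj ->] | iD] //; by exists i.
Qed.

Lemma bit_lt n (D : {set 'I_n}) i : bit D i -> i < n.
Proof. by rewrite /bit => /fintype.imageP[j _ ->]; exact: ltn_ord. Qed.

Lemma sum_nat_support (P : nat -> bool) (f : nat -> nat) m n :
 (forall v, P v -> v < m) -> (forall v, P v -> v < n) ->
 \sum_(v < m) P v * f v = \sum_(v < n) P v * f v.
have aux a b : (forall v, P v -> v < a) -> a <= b ->
 \sum_(v < a) P v * f v = \sum_(v < b) P v * f v.
 move=> ha ab; rewrite -(big_mkord xpredT (fun v => P v * f v)).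
 rewrite -(big_mkord xpredT (fun v => P v * f v)) [RHS](@big_cat_nat _ _ _ a) //=.
 rewrite [X in _ = _ + X]big_nat_cond [X in _ = _ + X]big1 ?addn0 // => i.
 by case: (boolP (P i)) => [/ha|]; lia.
move=> hm hn; have [mn|/ltnW nm] := leqP m n; first exact: aux.
by rewrite (aux n m).
Qed.

Section FromSet.
Variables (n : nat) (D : {set 'I_n}).

(** The partition is rebuilt from [D]: [e] lists [D] in decreasing order, [d] is the side of the
    Durfee square, [T k] is the length of row [k] for [k < d], and the rows below the square are
    read off as column heights of the top part [tl]. *)
Let e := [seq i <- rev (iota 0 n) | bit D i].
Let d := size e.
Let T k := nth 0 e k + k + 1.
Let tl := mkseq T d.
Let L j := if j < d then nth 0 tl j else count (leq j.+1) tl.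

Let e_sorted : sorted gtn e.
apply: sorted_filter; first by move=> a b c /= ba cb; exact: ltn_trans cb ba.
by rewrite rev_sorted; exact: iota_ltn_sorted.
Qed.

Let T_step k : k.+1 < d -> T k.+1 <= T k.
move=> hk; have := e_sorted; move=> /(sortedP 0) /(_ k hk) /=; rewrite /T; lia.
Qed.

Let tl_sorted : sorted geq tl.
apply/(sortedP 0) => i; rewrite size_mkseq => hi; rewrite !nth_mkseq //; last by lia.
exact: T_step.
Qed.

Let tl_ge j : j < d -> d <= nth 0 tl j.
move=> jd; apply: (@leq_trans (nth 0 tl d.-1)).
 by rewrite nth_mkseq /T; lia.
by apply: nth_noninc => //; lia.
Qed.

Let symL j k : (k < L j) = (j < L k).
rewrite /L; case: (ltnP j d) => jd; case: (ltnP k d) => kd.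
- by have := tl_ge jd; have := tl_ge kd; lia.
- by rewrite lt_count_leq.
- by rewrite lt_count_leq.
- have := count_size (leq j.+1) tl; have := count_size (leq k.+1) tl.
 by rewrite size_mkseq; lia.
Qed.

Let la := mkseq L (L 0).

Let nthL j : nth 0 la j = L j.
have [h|h] := ltnP j (L 0); first by rewrite nth_mkseq.
by rewrite nth_default ?size_mkseq //; have := symL 0 j; lia.
Qed.

Lemma exists_symmetric_partition : exists la : seq nat,
 [/\ sorted geq la, all (leq 1) la, symmetric_diagram la & forall v, (v \in frob la) = bit D v].
exists la; split.
- apply/(sortedP 0) => i _; rewrite !nthL /= leqNgt; apply/negP => h.
 by have := symL i.+1 (L i); have := symL i (L i); lia.
- apply/seq.allP => x /(seq.nthP 0); case=> i; rewrite size_mkseq nthL => hi <-.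
 by have := symL 0 i; lia.
- by move=> j k; rewrite !nthL symL.
move=> v; have Ld j : (j < L j) = (j < d).
 rewrite /L; case: (ltnP j d) => jd; first by have := tl_ge jd; lia.
 by have := count_size (leq j.+1) tl; rewrite size_mkseq; lia.
have -> : bit D v = (v \in e).
 rewrite mem_filter mem_rev mem_iota /=; case: (boolP (bit D v)) => //= h.
 by rewrite (bit_lt h).
apply/mapP/idP => [[j]|].
 rewrite mem_filter => /andP[]; rewrite nthL => hj _ ->; have jd : j < d by rewrite -Ld.
 rewrite /L jd nth_mkseq // /T (_ : _ - _ = nth 0 e j); last by lia.
 exact: mem_nth.
move=> ve; have jd : index v e < d by rewrite index_mem.
have Lj : L (index v e) = v + index v e + 1.
 by rewrite /L jd nth_mkseq // /T nth_index.
exists (index v e); last by rewrite nthL Lj; lia.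
by rewrite mem_filter nthL Lj mem_iota size_mkseq /= add0n symL Lj; lia.
Qed.

End FromSet.

Lemma weight_bit n (D : {set 'I_n}) : weight D = \sum_(i < n) bit D i * i.*2.+1.
rewrite /weight big_mkcond; bigr i; rewrite bitE.
by case: ifP => _; rewrite ?mul1n ?mul0n.
Qed.

Definition frob_set n (la : Defs.partition n) : {set 'I_n} := [set i | val i \in frob la].

Section PartitionSC.
Variables (n : nat) (la : Defs.partition n).

Let srt : sorted geq la. Proof. by have /and3P[] := partsP la. Qed.
Let pos : all (leq 1) la. Proof. by have /and3P[] := partsP la. Qed.
Let sum : sumn la = n. Proof. by have /and3P[_ _ /eqP] := partsP la. Qed.

Lemma SC_symmetric : la \in SC n <-> symmetric_diagram la.
rewrite inE; split=> [/eqP cla|sym]; first exact: conjugate_symmetric.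
by apply/eqP; exact: symmetric_conjugate.
Qed.

Let size_le : size la <= n.
rewrite -[leqRHS]sum; elim: (parts la) pos => //= a s IH /andP[a0 /IH]; lia.
Qed.

Lemma bit_frob_set v : la \in SC n -> bit (frob_set la) v = (v \in frob la).
move=> /SC_symmetric sym; apply/idP/idP.
 by move=> h; have vn := bit_lt h; move: h; rewrite (bitE _ (Ordinal vn)) inE.
move=> h; have vn : v < n by apply: leq_trans (frob_lt srt pos sym h) size_le.
by rewrite (bitE _ (Ordinal vn)) inE.
Qed.

Lemma weight_frob_set : la \in SC n -> weight (frob_set la) = n.
move=> laSC; have sym := SC_symmetric.1 laSC.
rewrite weight_bit -[RHS]sum (sumn_frob srt pos sym).
under eq_bigr => i _ do rewrite bit_frob_set //.
apply: (sum_nat_support (P := fun v => v \in frob la) (fun v => v.*2.+1)) => v h.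
 exact: leq_trans (frob_lt srt pos sym h) size_le.
exact: (frob_lt srt pos sym h).
Qed.

Lemma hooks_frob_set t : 0 < t -> la \in SC n -> hooks t la = cfg_hooks t (frob_set la).
move=> t0 laSC; have sym := SC_symmetric.1 laSC.
have cla : conjugate la = la by move: laSC; rewrite inE => /eqP.
rewrite (hooks_pair_count srt pos sym t0 cla) (pair_count_frob srt pos sym t0).
rewrite /cfg_hooks; congr (2 * _ + _); last first.
 by bigr i; rewrite !bit_frob_set.
under [RHS]eq_bigr => i _ do rewrite !bit_frob_set // -[nat_of_bool _]muln1.
under [LHS]eq_bigr => i _ do rewrite -[nat_of_bool _]muln1.
apply: (sum_nat_support (P := fun v => (v \notin frob la) && (v + t \in frob la)) (fun=> 1)) => v /andP[_ h].
 by have := frob_lt srt pos sym h; lia.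
by have := frob_lt srt pos sym h; have := size_le; lia.
Qed.

End PartitionSC.

(** Frobenius coordinates are smaller than the number of parts, hence than [n], so ['I_n] is a large
    enough ground set. From here on partitions are replaced by sets until the final statements are
    assembled. *)
Theorem SC_big (V : nmodType) n t (F : nat -> V) : 0 < t ->
 (\sum_(la in SC n) F (hooks t la) =
 \sum_(D : {set 'I_n} | weight D == n) F (cfg_hooks t D))%R.
move=> t0.
have inj : {in SC n &, injective (@frob_set n)}.
 move=> la mu laS muS e; apply: val_inj => /=.
 have [/and3P[s1 p1 _] /and3P[s2 p2 _]] := (partsP la, partsP mu).
 apply: frob_inj => //; try exact/SC_symmetric.
 by move=> v; rewrite -!bit_frob_set // e.
have im : frob_set (n:=n) @: SC n = [set D | weight D == n].
 apply/setP => D; rewrite inE; apply/imsetP/eqP => [[la laS ->]|wD].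
 exact: weight_frob_set.
 have [la [s p y fE]] := exists_symmetric_partition D.
 have sumla : sumn la == n.
 rewrite -wD weight_bit (sumn_frob s p y); apply/eqP.
 under eq_bigr => i _ do rewrite fE.
 apply: (sum_nat_support (P := bit D) (fun v => v.*2.+1)) => v; last exact: bit_lt.
 by rewrite -fE; exact: frob_lt.
 have lap : is_partition n la by rewrite /is_partition s p sumla.
 pose la' := Partition lap.
 have laS : la' \in SC n by apply/SC_symmetric.
 exists la' => //; apply/setP => i; by rewrite inE /= fE bitE.
rewrite (eq_bigl (fun D => D \in frob_set (n:=n) @: SC n)); last by move=> D; rewrite im inE.
by rewrite big_imset //=; apply: eq_bigr => la laS; rewrite hooks_frob_set.
Qed.

Local Open Scope ring_scope.

(** * Elementary bounds for sine, cosine and complex moduli *)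

Section Fourier.
Variable R : realType.
Implicit Types (x y th : R) (Q : {poly R}).

Definition cis x : R[i] := (cos x +i* sin x)%C.
(** The norm of [R[i]] takes its values in [R[i]]; this version is real-valued and can be compared
    with real bounds. *)
Definition modulus (z : R[i]) : R := Normc.normc z.

Lemma modulusM (z w : R[i]) : modulus (z * w) = modulus z * modulus w.
Proof. exact: Normc.normcM. Qed.

Lemma modulusD (z w : R[i]) : modulus (z + w) <= modulus z + modulus w.
Proof. exact: le_normcD. Qed.

Lemma modulusN (z : R[i]) : modulus (- z) = modulus z.
Proof. exact: normcN. Qed.

Lemma modulus_ge0 (z : R[i]) : 0 <= modulus z.
Proof. by case: z => a b; exact: sqrtr_ge0. Qed.

Lemma modulus1 : modulus 1 = 1. Proof. exact: Normc.normc1. Qed.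

Lemma modulusX (z : R[i]) n : modulus (z^+n) = modulus z^+n.
Proof. by elim: n => [|n IH]; rewrite ?modulus1 // !exprS modulusM IH. Qed.

Lemma modulus_prod (I : Type) (r : seq I) (P : pred I) (F : I -> R[i]) :
 modulus (\prod_(i <- r | P i) F i) = \prod_(i <- r | P i) modulus (F i).
Proof. exact: (big_morph _ modulusM modulus1). Qed.

Lemma modulus_sqr (a b : R) : modulus (a +i* b)%C^+2 = a^+2 + b^+2.
Proof. by rewrite /modulus sqr_sqrtr // addr_ge0 ?sqr_ge0. Qed.

Lemma modulus_le (a b : R) : modulus (a +i* b)%C <= `|a| + `|b|.
rewrite -[leRHS]ger0_norm ?addr_ge0 // -ler_sqr ?nnegrE ?modulus_ge0 //.
rewrite modulus_sqr real_normK ?num_real // sqrrD !real_normK ?num_real //.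
by have := mulr_ge0 (normr_ge0 a) (normr_ge0 b); lra.
Qed.

Lemma Re_le_modulus (z : R[i]) : `|complex.Re z| <= modulus z.
case: z => a b /=; rewrite -ler_sqr ?nnegrE //.
by rewrite modulus_sqr real_normK ?num_real; have := sqr_ge0 b; lra.
Qed.

Lemma modulus_real (a : R) : modulus (a%:C)%C = `|a|.
apply/eqP; rewrite -(@eqrXn2 _ 2) ?modulus_ge0 //.
by rewrite modulus_sqr real_normK ?num_real // expr0n addr0.
Qed.

Lemma cisD x y : cis (x + y) = cis x * cis y.
Proof. by rewrite /cis cosD sinD; simpc; congr (_ +i* _)%C; ring. Qed.

Lemma cis0 : cis 0 = 1.
Proof. by rewrite /cis cos0 sin0. Qed.

Lemma cisX x n : cis x^+n = cis (n%:R * x).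
elim: n => [|n IH]; first by rewrite mul0r cis0 expr0.
by rewrite exprS IH -cisD -[n.+1]addn1 natrD; congr cis; ring.
Qed.

Lemma modulus_cis x : modulus (cis x) = 1.
apply/eqP; rewrite -(@eqrXn2 _ 2) ?modulus_ge0 //.
by rewrite modulus_sqr cos2Dsin2 expr1n.
Qed.

Lemma le_of_derive (f df : R -> R) (a b : R) : a <= b ->
 (forall x, is_derive x 1 f (df x)) -> (forall x, a <= x <= b -> 0 <= df x) ->
 f a <= f b.
move=> ab D pos.
have [|c] := @MVT_segment R f df a b ab (fun x _ => D x).
 apply: continuous_subspaceT => x; apply: differentiable_continuous.
 by apply/derivable1_diffP; have [] := D x.
rewrite in_itv /= => cab e; rewrite -subr_ge0 e mulr_ge0 ?subr_ge0 //.
exact: pos.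
Qed.

Lemma sin_le x : 0 <= x -> sin x <= x.
move=> x0; rewrite -subr_ge0.
have -> : 0 = 0 - sin 0 :> R by rewrite sin0 subrr.
apply: (@le_of_derive (fun x => x - sin x) (fun x => 1 - cos x) _ _ x0) => y _.
by [].
Qed.

Lemma norm_sin_le x : `|sin x| <= `|x|.
wlog x0 : x/0 <= x => [H|].
 have [/H //|/ltW x0] := leP 0 x.
 by have := H (- x); rewrite sinN !normrN; apply; rewrite oppr_ge0.
rewrite [leRHS]ger0_norm // ler_norml sin_le //= andbT.
have [h|h] := leP x pi.
 by have := @sin_ge0_pi R x; rewrite x0 h => /(_ isT); lra.
by have := sin_geN1 x; have := pi_ge2 R; lra.
Qed.

Lemma cos_ge x : 1 - x^+2/2 <= cos x.
rewrite [in leRHS](_ : x = (x/2) *+ 2); last by rewrite -mulr_natr divfK.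
rewrite cos_mulr2n cos2sin2.
have : sin (x/2)^+2 <= (x/2)^+2.
 rewrite -[X in X <= _]real_normK ?num_real // -[leRHS]real_normK ?num_real //.
 by rewrite ler_sqr ?norm_sin_le.
lra.
Qed.

Lemma sin_ge x : 0 <= x -> x - x^+3/6 <= sin x.
move=> x0; rewrite -subr_ge0.
have -> : 0 = sin 0 - (0 - 0^+3/6) :> R by rewrite sin0 expr0n /=; lra.
apply: (@le_of_derive (fun x => sin x - (x - x^+3/6))
 (fun x => cos x - (1 - x^+2/2)) _ _ x0) => [y|y _].
 by is_der; field.
by rewrite subr_ge0 cos_ge.
Qed.

Lemma norm_sinB x : `|sin x - x| <= `|x|^+3.
wlog x0 : x/0 <= x => [H|].
 have [/H //|/ltW x0] := leP 0 x.
 have := H (- x); rewrite sinN !normrN -opprD normrN; apply; lra.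
rewrite [`|x|]ger0_norm // ler_norml.
have := sin_le x0; have := sin_ge x0; have : 0 <= x^+3 by pz.
lra.
Qed.

Lemma norm_cosB x : `|cos x - 1 + x^+2/2| <= `|x|^+3.
wlog x0 : x/0 <= x => [H|].
 have [/H //|/ltW x0] := leP 0 x.
 have := H (- x); rewrite cosN sqrrN normrN; apply; lra.
rewrite [`|x|]ger0_norm // ger0_norm; last by have := cos_ge x; lra.
have [x1|x1] := leP x 1; last first.
 via (x^+2/2); first by have := cos_le1 x; lra.
 rewrite [x^+3]exprS; have : 0 <= x^+2 by pz.
 by nra.
have -> : x^+3 = x^+3/2 + x^+3/2 by lra.
rewrite -subr_ge0.
pose f (x : R) := x^+3 - (cos x - 1 + x^+2/2).
have -> : 0 = f 0 by rewrite /f cos0 !expr0n /=; lra.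
have -> : x^+3/2 + x^+3/2 - (cos x - 1 + x^+2/2) = f x by rewrite /f; lra.
apply: (@le_of_derive f (fun x => 3 * x^+2 - (x - sin x)) _ _ x0) => [y|y /andP[y0 yx]].
 by is_der; field.
have := sin_ge y0; have := sqr_ge0 y; have : y^+3 <= y^+2.
 by rewrite [y^+3]exprS; have := sqr_ge0 y; have := le_trans yx x1; nra.
by lra.
Qed.

End Fourier.

(** * Discrete Fourier inversion on an odd number of nodes *)

Section Dft.
Variable R : realType.
Implicit Types (x y th : R) (Q : {poly R}) (F G : R -> R).

Definition theta (H l : nat) : R := 2 * pi * l%:R/(H.*2.+1)%:R.

(** The mean of an even function over the [2 H + 1] angles [2 pi l / (2 H + 1)], the nodes [l] and
    [- l] being merged. For polynomials of size at most [2 H + 1] it replaces the inversion integral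
    exactly ([coef_avg]), so [H] can be chosen as large as convenient and no integration is
    involved. *)
Definition avg (H : nat) F : R :=
 (F 0 + 2*\sum_(1 <= l < H.+1) F (theta H l))/(H.*2.+1)%:R.

Lemma theta_range H l : (1 <= l < H.+1)%N -> 0 < theta H l <= pi.
move=> hl; rewrite /theta; have p0 := pi_gt0 R.
have l0 : 0 < l%:R :> R by rewrite ltr0n; lia.
have L0 : 0 < (H.*2.+1)%:R :> R by rewrite ltr0n.
rewrite divr_gt0 ?mulr_gt0 //= ler_pdivrMr //.
have : (l.*2)%:R <= (H.*2.+1)%:R :> R by rewrite ler_nat; lia.
rewrite -mul2n natrM; nra.
Qed.

Lemma le_avg H F G : (forall th, 0 <= th <= pi -> F th <= G th) -> avg H F <= avg H G.
move=> FG; rewrite /avg ler_pM2r //.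
apply: lerD; first by rewrite FG // lexx pi_ge0.
rewrite ler_pM2l //; apply: ler_sum_nat => l hl; apply: FG.
by have /andP[/ltW -> ->] := theta_range hl.
Qed.

Lemma eq_avg H F G : (forall th, F th = G th) -> avg H F = avg H G.
Proof. by move=> FG; rewrite /avg FG; under eq_bigr do rewrite FG. Qed.

Lemma avgD H F G : avg H (fun th => F th + G th) = avg H F + avg H G.
Proof. by rewrite /avg big_split /=; ring. Qed.

Lemma avgZ H c F : avg H (fun th => c * F th) = c * avg H F.
Proof. by rewrite /avg -mulr_sumr; ring. Qed.

Lemma avg_sum H n (F : nat -> R -> R) :
 avg H (fun th => \sum_(k < n) F k th) = \sum_(k < n) avg H (F k).
elim: n => [|n IH].
 by rewrite big_ord0 /avg big_ord0 big1 ?mulr0 ?addr0 ?mul0r // => l _; rewrite big_ord0.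
rewrite big_ord_recr /= -IH -avgD; apply: eq_avg => th.
by rewrite big_ord_recr.
Qed.

Lemma avg_norm H F : `|avg H F| <= avg H (fun th => `|F th|).
rewrite /avg normrM [X in _ * X]ger0_norm ?invr_ge0 ?ler0n // ler_pM2r //.
lel (ler_normD _ _); rewrite lerD2l normrM ger0_norm // ler_pM2l //.
exact: ler_norm_sum.
Qed.

Lemma avg_cst H c : avg H (fun=> c) = c.
rewrite /avg sumr_const_nat subSS subn0.
have -> : c + 2*(c *+ H) = c*(H.*2.+1)%:R.
 by rewrite -[H.*2.+1]addn1 natrD -mul2n natrM -[c *+ H]mulr_natr; ring.
by rewrite mulfK // pnatr_eq0.
Qed.

Lemma sin_natpi k : sin (k%:R * pi) = 0 :> R.
elim: k => [|k IH]; first by rewrite mul0r sin0.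
by rewrite -[k.+1]addn1 natrD mulrDl mul1r sinDpi IH oppr0.
Qed.

(** Dirichlet kernel: multiplied by [2 sin (x/2)] the sum of cosines telescopes, and at [n = H] the
    last sine is [sin (k pi) = 0]. *)
Lemma avg_cos H k : (0 < k < H.*2.+1)%N -> avg H (fun th => cos (k%:R * th)) = 0.
move=> /andP[k0 kL]; rewrite /avg mulr0 cos0.
set L := (H.*2.+1)%:R : R; have L0 : 0 < L by rewrite ltr0n.
pose x : R := 2 * pi * k%:R/L.
have s0 : sin (x/2) != 0.
 rewrite gt_eqF // sin_gt0_pi // /x; have p0 := pi_gt0 R.
 have k1 : 0 < k%:R :> R by rewrite ltr0n.
 have kl : k%:R < L by rewrite ltr_nat.
 rewrite divr_gt0 ?divr_gt0 ?mulr_gt0 //= ltr_pdivrMr // ltr_pdivrMr; nra.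
have key n : 2 * sin (x/2) * \sum_(1 <= l < n.+1) cos (k%:R * theta H l) =
 sin ((n%:R + 2^-1) * x) - sin (x/2).
 elim: n => [|n IH].
 by rewrite big_geq // mulr0 add0r mulrC subrr.
 rewrite big_nat_recr //= mulrDr IH.
 have -> : k%:R * theta H n.+1 = (n.+1)%:R * x by rewrite /theta /x -/L; fld.
 have -> : (n.+1%:R + 2^-1) * x = n.+1%:R * x + x/2 by ring.
 have -> : (n%:R + 2^-1) * x = n.+1%:R * x - x/2 by rewrite -[n.+1]addn1 natrD; field.
 by rewrite !sinD cosN sinN; ring.
have eH : (H%:R + 2^-1) * x = k%:R * pi.
 rewrite /x /L -[H.*2.+1]addn1 natrD -mul2n natrM; field.
 by [].
have := key H; rewrite eH sin_natpi sub0r => e.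
have e2 : 2*\sum_(1 <= l < H.+1) cos (k%:R * theta H l) = -1.
 by apply: (mulfI s0); rewrite mulrN1 -e; ring.
by rewrite e2 subrr mul0r.
Qed.

Definition cf Q th : R[i] := (map_poly (real_complex R) Q).[cis th].

Lemma cfM Q1 Q2 th : cf (Q1 * Q2) th = cf Q1 th * cf Q2 th.
Proof. by rewrite /cf rmorphM hornerM. Qed.

Lemma cf1 th : cf 1 th = 1.
Proof. by rewrite /cf rmorph1 hornerC. Qed.

Lemma cfD Q1 Q2 th : cf (Q1 + Q2) th = cf Q1 th + cf Q2 th.
Proof. by rewrite /cf rmorphD hornerD. Qed.

Lemma cfC (c : R) th : cf c%:P th = (c%:C)%C.
Proof. by rewrite /cf map_polyC hornerC. Qed.

Lemma cfX th : cf 'X th = cis th.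
Proof. by rewrite /cf map_polyX hornerX. Qed.

Lemma cfXn n th : cf 'X^n th = cis (n%:R * th).
Proof. by rewrite /cf map_polyXn hornerXn cisX. Qed.

Lemma cf_exp Q n th : cf (Q^+n) th = cf Q th^+n.
Proof. by elim: n => [|n IH]; rewrite ?cf1 // !exprS cfM IH. Qed.

Lemma cf_prod (I : Type) (r : seq I) (P : pred I) (F : I -> {poly R}) th :
 cf (\prod_(i <- r | P i) F i) th = \prod_(i <- r | P i) cf (F i) th.
Proof. exact: (big_morph (fun Q => cf Q th) (fun a b => cfM a b th) (cf1 th)). Qed.

Lemma ReD (z w : R[i]) : complex.Re (z + w) = complex.Re z + complex.Re w.
Proof. by case: z w => a b [c d]. Qed.

Lemma Re_cf Q m th : complex.Re (cf Q th * cis (- (m%:R * th))) =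
 \sum_(k < size Q) Q`_k * cos ((k%:R - m%:R) * th).
have -> : cf Q th = \sum_(k < size Q) cf (Q`_k *: 'X^k) th.
 rewrite -{1}[Q]coefK poly_def.
 apply: (big_morph (fun Q => cf Q th) (fun a b => cfD a b th) _).
 by rewrite -[0 in LHS]/(0%:P) cfC.
rewrite mulr_suml (big_morph (@complex.Re R) ReD (erefl _)).
bigr k; rewrite -mul_polyC cfM cfC cfXn -mulrA -cisD /cis.
rewrite -[k%:R * th - m%:R * th]mulrBl; simpc.
by [].
Qed.

Lemma coef_avg Q H m : (size Q <= H.*2.+1)%N -> (m < H.*2.+1)%N ->
 Q`_m = avg H (fun th => complex.Re (cf Q th * cis (- (m%:R * th)))).
move=> sQ mL.
rewrite (eq_avg _ (fun th => Re_cf Q m th)).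
rewrite (avg_sum _ _ (fun k th => Q`_k * cos ((k%:R - m%:R) * th))).
have av (k : nat) : (k < size Q)%N -> avg H (fun th => Q`_k * cos ((k%:R - m%:R) * th)) =
 if k == m then Q`_m else 0.
 move=> kQ; rewrite avgZ; case: eqP => [->|/eqP km].
 rewrite (eq_avg _ (G := fun=> 1)) ?avg_cst ?mulr1 // => th.
 by rewrite subrr mul0r cos0.
 have [lt_km|lt_mk|e] := ltngtP k m; last by rewrite e eqxx in km.
 rewrite (eq_avg _ (G := fun th => cos ((m - k)%N%:R * th))) ?avg_cos ?mulr0 //; first by lia.
 by move=> th; rewrite natrB ?(ltnW lt_km) // -cosN -mulNr opprB.
 rewrite (eq_avg _ (G := fun th => cos ((k - m)%N%:R * th))) ?avg_cos ?mulr0 //; first by lia.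
 by move=> th; rewrite natrB ?(ltnW lt_mk).
rewrite (eq_bigr (fun k : 'I__ => if val k == m then Q`_m else 0)); last by move=> k _; rewrite av.
have [hm|hm] := ltnP m (size Q).
 rewrite (bigD1 (Ordinal hm)) //= eqxx big1 ?addr0 // => k.
 by rewrite -val_eqE => /negbTE ->.
rewrite big1 ?nth_default // => k _; case: eqP => _; by [].
Qed.

Lemma coef_le_avg Q H m : (size Q <= H.*2.+1)%N -> (m < H.*2.+1)%N ->
 `|Q`_m| <= avg H (fun th => modulus (cf Q th)).
move=> sQ mL; rewrite (coef_avg sQ mL); lel (avg_norm _ _).
apply: le_avg => th _; lel (Re_le_modulus _).
by rewrite modulusM modulus_cis mulr1.
Qed.

(** An envelope for functions concentrated on the scale [h]: quadratic decay is all that must be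
    checked in the tail, and the average is still of order [h]. *)
Definition bump (h th : R) : R := if th <= h then 1 else (h/th)^+2.

Lemma bump_ge0 h th : 0 <= bump h th.
Proof. by rewrite /bump; case: ifP => // _; rewrite sqr_ge0. Qed.

Lemma avg_bump H h : 0 < h -> avg H (bump h) <= (H.*2.+1)%:R^-1 + 2 * h.
move=> h0; set L := (H.*2.+1)%:R : R; have L0 : 0 < L by rewrite ltr0n.
have p0 := pi_gt0 R; have p2 := pi_ge2 R.
pose y : R := h * L/(2 * pi).
have y0 : 0 < y by rewrite divr_gt0 ?mulr_gt0.
(* With [y = h L / (2 pi)] the node number [l] is [l h / y]; each term is dominated by [4 y^2] times
   a difference of consecutive values of [1 / (y + n)], so the sum telescopes. *)
have key n : \sum_(1 <= l < n.+1) bump h (theta H l) <= 4 * y^+2*(y^-1 - (y + n%:R)^-1).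
 elim: n => [|n IH]; first by rewrite big_geq // addr0 subrr mulr0.
 rewrite big_nat_recr //=; lel (lerD IH (lexx _)).
 rewrite -subr_ge0.
 have n0 : 0 <= n%:R :> R by rewrite ler0n.
 have -> : n.+1%:R = n%:R + 1 :> R by rewrite -[n.+1]addn1 natrD.
 have yn : 0 < y + n%:R by lra.
 have yn1 : 0 < y + (n%:R + 1) by lra.
 have -> : 4 * y^+2*(y^-1 - (y + (n%:R + 1))^-1) -
 (4 * y^+2*(y^-1 - (y + n%:R)^-1) + bump h (theta H n.+1)) =
 4 * y^+2/((y + n%:R) * (y + (n%:R + 1))) - bump h (theta H n.+1).
 by fld.
 rewrite subr_ge0 ler_pdivlMr ?mulr_gt0 // /bump.
 have et : theta H n.+1 = (n%:R + 1) * (h/y).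
 rewrite /theta /y -[n.+1]addn1 natrD -/L.
 move: (pi : R) (L) p0 L0 {y y0 IH yn yn1 p2} => P M P0 M0.
 by fld.
 have le1 : (theta H n.+1 <= h) = (n%:R + 1 <= y).
 by rewrite et mulrA ler_pdivrMr // [h * y]mulrC ler_pM2r.
 rewrite le1; case: (leP (n%:R + 1) y) => hy.
 by rewrite mul1r; nra.
 rewrite et; have -> : h/((n%:R + 1) * (h/y)) = y/(n%:R + 1).
 by fld.
 rewrite expr_div_n mulrAC ler_pdivrMr; last by pz; lra.
 have y20 : 0 < y^+2 by rewrite exprn_gt0.
 rewrite [4 * _]mulrC -[leRHS]mulrA ler_pM2l //; nra.
rewrite /avg {1}/bump (ltW h0).
have := key H; set S := \sum_(_ <= _ < _) _ => hS.
have S4 : S <= 4 * y.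
 lel hS; rewrite -subr_ge0.
 have -> : 4 * y - 4 * y^+2*(y^-1 - (y + H%:R)^-1) = 4 * y^+2/(y + H%:R).
 field; rewrite !gt_eqF //; have : 0 <= H%:R :> R by [].
 by lra.
 apply: divr_ge0; first by apply: mulr_ge0; rewrite ?sqr_ge0.
 by pz.
rewrite (_ : (H.*2.+1)%:R = L) // ler_pdivrMr // [leRHS]mulrDl mulVf ?gt_eqF // lerD2l.
via (2*(4 * y)); first by pz.
rewrite /y mulrA mulrA ler_pdivrMr ?mulr_gt0 //.
have : 0 < h * L by pz.
nra.
Qed.

Lemma avg_indicator H k : 0 <= k <= pi ->
 k/pi - (H.*2.+1)%:R^-1 <= avg H (fun th => ((th <= k)%R)%:R).
move=> /andP[k0 kp]; set L := (H.*2.+1)%:R : R; have L0 : 0 < L by rewrite ltr0n.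
have p0 := pi_gt0 R.
pose y : R := k * L/(2 * pi).
have y0 : 0 <= y by rewrite divr_ge0 ?mulr_ge0 // ltW.
have key n : Num.min (y - 1) n%:R <= \sum_(1 <= l < n.+1) ((theta H l <= k)%R)%:R.
 elim: n => [|n IH]; first by rewrite big_geq // ge_min lexx orbT.
 rewrite big_nat_recr //=.
 have et : (theta H n.+1 <= k) = (n.+1%:R <= y).
 rewrite /theta /y -/L ler_pdivrMr // ler_pdivlMr ?mulr_gt0 //.
 by congr (_ <= _); ring.
 rewrite et; case: (leP n.+1%:R y) => hy.
 rewrite /= -natr1 ge_min.
 move: IH; rewrite ge_min => /orP[h|h]; apply/orP; [left|right]; rewrite ?mulr1n; lra.
 rewrite addr0; move: hy; rewrite -natr1 => hy.
 by rewrite ge_min; move: IH; rewrite ge_min => /orP[h|h]; apply/orP; left; lra.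
have yH : y <= H%:R + 2^-1.
 rewrite /y ler_pdivrMr ?mulr_gt0 // /L -[H.*2.+1]addn1 natrD -mul2n natrM.
 have : 0 <= H%:R :> R by [].
 by nra.
have := key H; set S := \sum_(_ <= _ < _) _ => hS.
rewrite /avg k0 /= -/S ler_pdivlMr // mulrBl mulVf ?gt_eqF //.
have -> : k/pi * L = 2 * y by rewrite /y; move: (pi : R) p0 => P P0; fld.
suff : y - 1 <= S by rewrite mulr1n; lra.
by move: hS; rewrite ge_min => /orP[//|]; lra.
Qed.

End Dft.

(** * Characteristic functions of sums of independent weighted Bernoulli variables *)

Section Bern.
Variable R : realType.
Implicit Types (x y th s : R) (p : nat -> R) (M : nat).

Definition jj (i : nat) : R := (i.*2.+1)%:R.

Lemma jj_gt0 i : 0 < jj i. Proof. by []. Qed.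

(** The generating polynomial of a Bernoulli variable of parameter [p i] multiplied by [2 i + 1].
    For parameters in [[0, 1]], coefficient [m] of [bpoly p M] is the probability that independent
    sites below [M] have total weight [m]. *)
Definition bfactor p i : {poly R} := (1 - p i)%:P + (p i)%:P * 'X^(i.*2.+1).
Definition bpoly p M : {poly R} := \prod_(i < M) bfactor p i.
Definition bmean p M : R := \sum_(i < M) jj i * p i.
Definition bvar p M : R := \sum_(i < M) jj i^+2*(p i*(1 - p i)).
(** The exponent in [modulus_bpoly]: one site damps the characteristic function according to [|1 - p
    + p e^(iy)|^2 = 1 - 2 p (1 - p) (1 - cos y)]. *)
Definition energy p M th : R := \sum_(i < M) p i*(1 - p i) * (1 - cos (jj i * th)).

Lemma expR_ge_pow k x : 0 <= x -> x^+k/k`!%:R <= expR x.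
case: k => [|k] x0; first by rewrite expr0 fact0 divr1; have := expR_ge1Dx x; lra.
by apply: le_trans (expR_ge1Dxn k x0); lra.
Qed.

Lemma pow_expRN k x : 0 <= x -> x^+k * expR (- x) <= k`!%:R.
move=> x0; rewrite expRN ler_pdivrMr ?expR_gt0 //.
have := expR_ge_pow k x0; rewrite ler_pdivrMr //; lra.
Qed.

Lemma expRN_le1 x : 0 <= x -> expR (- x) <= 1.
Proof. by move=> x0; rewrite expR_le1 oppr_le0. Qed.

Lemma cf_bfactor p i th : cf (bfactor p i) th =
 ((1 - p i)%:C)%C + ((p i)%:C)%C * cis (jj i * th).
Proof. by rewrite /bfactor cfD cfM !cfC cfXn. Qed.

Lemma modulus_bfactor p i th : 0 <= p i <= 1 ->
 modulus (cf (bfactor p i) th) <= expR (- (p i*(1 - p i) * (1 - cos (jj i * th)))).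
move=> /andP[p0 p1]; rewrite -ler_sqr ?nnegrE ?modulus_ge0 //.
rewrite cf_bfactor /cis; simpc; rewrite modulus_sqr.
have := cos2Dsin2 (jj i * th); move: (cos _) (sin _) => c d cd.
rewrite -expRM_natl; apply: le_trans (expR_ge1Dx _).
have -> : (p i * d)^+2 = p i^+2*(1 - c^+2) by rewrite -cd; ring.
lra.
Qed.

Lemma cf_bpoly p M th : cf (bpoly p M) th = \prod_(i < M) cf (bfactor p i) th.
Proof. exact: cf_prod. Qed.

Lemma modulus_bpoly p M th : (forall i, 0 <= p i <= 1) ->
 modulus (cf (bpoly p M) th) <= expR (- energy p M th).
move=> p01; rewrite cf_bpoly modulus_prod /energy -sumrN expR_sum.
by apply: ler_prod => i _; rewrite modulus_ge0 modulus_bfactor.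
Qed.

Lemma modulus_prodB (I : Type) (r : seq I) (z w : I -> R[i]) :
 (forall i, modulus (z i) <= 1) -> (forall i, modulus (w i) <= 1) ->
 modulus (\prod_(i <- r) z i - \prod_(i <- r) w i) <= \sum_(i <- r) modulus (z i - w i).
move=> z1 w1; elim: r => [|i r IH]; first by rewrite !big_nil subrr modulus_real normr0.
rewrite !big_cons.
have -> : z i*\prod_(j <- r) z j - w i*\prod_(j <- r) w j =
 (z i - w i) * (\prod_(j <- r) z j) + w i*(\prod_(j <- r) z j - \prod_(j <- r) w j) by ring.
lel (modulusD _ _); rewrite !modulusM; apply: lerD.
 rewrite -[leRHS]mulr1 ler_wpM2l ?modulus_ge0 // modulus_prod.
 by apply: prodr_ile1 => j _; rewrite modulus_ge0 z1.
by apply: le_trans IH; rewrite -[leRHS]mul1r ler_wpM2r ?modulus_ge0.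
Qed.

Lemma expRN_taylor2 x : 0 <= x -> `|expR (- x) - 1 + x| <= x^+2.
move=> x0; have h1 := expR_ge1Dx (- x); rewrite ger0_norm; last lra.
have h2 : expR (- x) <= (1 + x)^-1.
 by rewrite expRN lef_pV2 ?posrE ?expR_gt0 ?expR_ge1Dx; lra.
have h3 : (1 + x)^-1 <= 1 - x + x^+2.
 rewrite -div1r ler_pdivrMr; last lra.
 by have := exprn_ge0 3 x0; lra.
lra.
Qed.

Definition cis_err x : R[i] := cis x - ((1 - x^+2/2) +i* x)%C.

Lemma cis_errP x : modulus (cis_err x) <= 2 * `|x|^+3.
rewrite /cis_err /cis; simpc; lel (modulus_le _ _).
have -> : cos x + (x^+2/2 - 1) = cos x - 1 + x^+2/2 by lra.
by have := norm_cosB x; have := norm_sinB x; lra.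
Qed.

(** Second-order expansion of a centred Bernoulli variable: the linear terms cancel, the quadratic
    ones give the variance [q (1 - q) y^2], and every remainder keeps a factor [q]. That factor
    matters because the bounds are later summed over sites whose [q] decays exponentially. *)
Lemma centered_factor (q y : R) : 0 <= q <= 1 -> 0 <= y ->
 modulus (cis (- (q * y)) * (((1 - q)%:C)%C + (q%:C)%C * cis y)
 - ((expR (- (y^+2*(q*(1 - q))/2)))%:C)%C) <= 5 * q * y^+3.
move=> /andP[q0 q1] y0.
set x := y^+2*(q*(1 - q))/2.
have x0 : 0 <= x by rewrite /x !mulr_ge0 ?sqr_ge0 ?invr_ge0 //; lra.
have -> : cis (- (q * y)) * (((1 - q)%:C)%C + (q%:C)%C * cis y) - ((expR (- x))%:C)%C =
 ((1 - q)%:C)%C * cis_err (- (q * y)) + (q%:C)%C * cis_err ((1 - q) * y)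
 - ((expR (- x) - 1 + x)%:C)%C.
 have e : cis ((1 - q) * y) = cis (- (q * y)) * cis y by rewrite -cisD; congr cis; ring.
 have e1 : cis (- (q * y)) = cis_err (- (q * y)) + ((1 - (- (q * y))^+2/2) +i* (- (q * y)))%C by rewrite /cis_err subrK.
 have e2 : cis ((1 - q) * y) = cis_err ((1 - q) * y) + ((1 - ((1 - q) * y)^+2/2) +i* ((1 - q) * y))%C by rewrite /cis_err subrK.
 have -> : cis (- (q * y)) * (((1 - q)%:C)%C + (q%:C)%C * cis y) =
 ((1 - q)%:C)%C * cis (- (q * y)) + (q%:C)%C * cis ((1 - q) * y) by rewrite e; ring.
 rewrite e1 e2 /x; move: (cis_err _) (cis_err _) (expR _) => [a b] [c d] E.
 by simpc; congr (_ +i* _)%C; field.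
lel (modulusD _ _); rewrite modulusN modulus_real.
lel (lerD (modulusD _ _) (lexx _)); rewrite !modulusM !modulus_real.
have h1 : `|1 - q| * modulus (cis_err (- (q * y))) <= 2 * q * y^+3.
 rewrite ger0_norm; last lra.
 have h := cis_errP (- (q * y)).
 rewrite normrN ger0_norm ?mulr_ge0 // exprMn in h.
 have y3 : 0 <= y^+3 by rewrite exprn_ge0.
 have q3 : q^+3 <= q by rewrite -[leRHS]expr1 ler_wiXn2l.
 have m0 := modulus_ge0 (cis_err (- (q * y))).
 have : q^+3 * y^+3 <= q * y^+3 by pz.
 nra.
have h2 : `|q| * modulus (cis_err ((1 - q) * y)) <= 2 * q * y^+3.
 rewrite ger0_norm // -mulrA [2 * _]mulrCA ler_wpM2l //.
 lel (cis_errP _); rewrite ler_pM2l // lerXn2r //.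
 by rewrite ger0_norm; nra.
have h3 : `|expR (- x) - 1 + x| <= q * y^+3.
 have qq : q*(1 - q) <= q by nra.
 have qq0 : 0 <= q*(1 - q) by rewrite mulr_ge0 //; lra.
 have y20 := sqr_ge0 y.
 have xle : x <= q * y^+2/2 by rewrite /x; nra.
 have [y1|y1] := leP y 1.
 lel (expRN_taylor2 x0).
 have xx : x <= y^+2/2 by nra.
 have y2y : y^+2 <= y by rewrite expr2; nra.
 have : x^+2 <= (q * y^+2/2) * (y/2).
 by rewrite expr2 ler_pM //; lra.
 have -> : y^+3 = y^+2 * y by rewrite exprSr.
 by have := mulr_ge0 (mulr_ge0 q0 y20) y0; lra.
 have h1' := expR_ge1Dx (- x); have h2' := expRN_le1 x0.
 rewrite ger0_norm; last lra.
 have -> : y^+3 = y^+2 * y by rewrite exprSr.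
 have : q * y^+2 <= q*(y^+2 * y).
 by rewrite ler_wpM2l //; nra.
 have := mulr_ge0 q0 y20; lra.
lra.
Qed.

Lemma centered_bpoly p M th : (forall i, 0 <= p i <= 1) -> 0 <= th ->
 modulus (cis (- (bmean p M * th)) * cf (bpoly p M) th
 - ((expR (- (bvar p M * th^+2/2)))%:C)%C)
 <= 5 * th^+3*\sum_(i < M) jj i^+3 * p i.
move=> p01 th0.
have -> : cis (- (bmean p M * th)) = \prod_(i < M) cis (- (p i*(jj i * th))).
 rewrite /bmean mulr_suml -sumrN (big_morph (@cis R) (@cisD R) (@cis0 R)).
 by bigr i; congr cis; ring.
have -> : ((expR (- (bvar p M * th^+2/2)))%:C)%C =
 \prod_(i < M) ((expR (- ((jj i * th)^+2*(p i*(1 - p i))/2)))%:C)%C.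
 rewrite /bvar !mulr_suml -sumrN expR_sum rmorph_prod /=.
 by bigr i; congr ((expR (- _))%:C)%C; ring.
rewrite cf_bpoly -big_split /=.
lel (modulus_prodB _ _ _).
- move=> i; rewrite modulusM modulus_cis mul1r; lel (modulus_bfactor _ (p01 _)).
 have /andP[p0 p1] := p01 i.
 by rewrite expRN_le1 // !mulr_ge0 // subr_ge0.
- move=> i; rewrite modulus_real ger0_norm ?expR_ge0 // expRN_le1 //.
 have /andP[p0 p1] := p01 i.
 by rewrite !mulr_ge0 ?subr_ge0.
rewrite mulr_sumr; lsum i; rewrite cf_bfactor.
have := centered_factor (p01 i) (y := jj i * th); rewrite mulr_ge0 ?(ltW (jj_gt0 _)) // => /(_ isT).
lra.
Qed.

Lemma size_bpoly p M : (size (bpoly p M) <= (M ^ 2).+1)%N.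
elim: M => [|M IH]; first by rewrite /bpoly big_ord0 size_poly1.
rewrite /bpoly big_ord_recr /= -/(bpoly p M).
apply: (leq_trans (size_polyMleq _ _)).
have : (size (bfactor p M) <= M.*2.+2)%N.
 apply: (leq_trans (size_polyD _ _)); rewrite geq_max; apply/andP; split.
 by apply: (leq_trans (size_polyC_leq1 _)).
 apply: (leq_trans (size_polyMleq _ _)); rewrite size_polyXn.
 by have := size_polyC_leq1 (p M); lia.
nia.
Qed.

Lemma bpoly_coef_ge0 p M m : (forall i, 0 <= p i <= 1) -> 0 <= (bpoly p M)`_m.
move=> p01; elim: M m => [|M IH] m.
 by rewrite /bpoly big_ord0 coef1; case: eqP.
rewrite /bpoly big_ord_recr /= -/(bpoly p M) /bfactor mulrDr coefD coefMC.
rewrite mulrA coefMXn; have /andP[p0 p1] := p01 M.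
apply: addr_ge0; first by rewrite mulr_ge0 ?subr_ge0.
by case: ifP => // _; rewrite coefMC mulr_ge0.
Qed.

Lemma bpoly1 p M : (bpoly p M).[1] = 1.
rewrite /bpoly horner_prod big1 // => i _.
by rewrite /bfactor hornerD hornerM !hornerC hornerXn expr1n mulr1 subrK.
Qed.

End Bern.

(** * Occupation probabilities of the product measure and decay of the characteristic function *)

Section Energy.
Variable R : realType.
Implicit Types (x y th s a : R) (p : nat -> R) (M : nat).
Local Notation jj := (@jj R).

Lemma natS (n : nat) : n.+1%:R = n%:R + 1 :> R.
Proof. by rewrite natr1. Qed.

Lemma jjE i : jj i = 2 * i%:R + 1.
Proof. by rewrite /jj natS -mul2n natrM. Qed.

Lemma jjS i : jj i.+1 = jj i + 2.
Proof. by rewrite !jjE (natS i); lra. Qed.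

Lemma jj_ge1 i : 1 <= jj i. Proof. by rewrite ler1n. Qed.

Lemma jj_ge0 i : 0 <= jj i. Proof. by []. Qed.

Lemma jj_le i (N : nat) : (i < N)%N -> jj i <= 2 * N%:R.
Proof. by move=> iN; rewrite /jj -natrM ler_nat; lia. Qed.

Lemma sum_exp_jj s M : 0 < s -> \sum_(i < M) expR (- (s * jj i)) <= s^-1.
move=> s0; have key : (\sum_(i < M) expR (- (s * jj i))) * (expR s - expR (- s)) =
 1 - expR (- (s*(2 * M%:R))).
 elim: M => [|M IH]; first by rewrite big_ord0 mul0r !mulr0 oppr0 expR0 subrr.
 rewrite big_ord_recr /= mulrDl IH mulrBr -!expRD jjE (natS M).
 have -> : - (s*(2 * M%:R + 1)) + s = - (s*(2 * M%:R)) by ring.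
 have -> : - (s*(2 * M%:R + 1)) - s = - (s*(2*(M%:R + 1))) by ring.
 lra.
have ge : s <= expR s - expR (- s).
 have h1 := expR_ge1Dx s; have h2 := expRN_le1 (ltW s0); lra.
rewrite -div1r ler_pdivlMr //.
via (1 - expR (- (s*(2 * M%:R)))); last by pz; lra.
by rewrite -key ler_wpM2l // sumr_ge0 // => i _; exact: expR_ge0.
Qed.

Lemma jj_pow_exp k s i : 0 < s ->
 jj i^+k * expR (- (s * jj i)) <= k`!%:R/s^+k.
move=> s0; have sj : 0 <= s * jj i by rewrite mulr_ge0 ?ltW ?jj_gt0.
rewrite ler_pdivlMr ?exprn_gt0 // mulrAC -exprMn [jj i * s]mulrC.
exact: pow_expRN.
Qed.

Lemma sum_jj_pow_exp k s M : 0 < s ->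
 \sum_(i < M) jj i^+k * expR (- (s * jj i)) <= k`!%:R*2^+k.+1/s^+k.+1.
move=> s0; have s2 : 0 < s/2 by rewrite divr_gt0.
via (\sum_(i < M) (k`!%:R/(s/2)^+k) * expR (- (s/2 * jj i))).
 lsum i.
 have -> : expR (- (s * jj i)) = expR (- (s/2 * jj i)) * expR (- (s/2 * jj i)).
 by rewrite -expRD; congr expR; lra.
 by rewrite mulrA ler_wpM2r // jj_pow_exp.
rewrite -mulr_sumr; via (k`!%:R/(s/2)^+k*(s/2)^-1).
 rewrite ler_wpM2l ?sum_exp_jj // divr_ge0 // exprn_ge0 // ltW //.
le_eq; rewrite expr_div_n !exprSr; field.
by pz.
Qed.

(** The Fermi-Dirac form of the occupation probability [q / (1 + q)] for the weight
    [q = exp (- s (2 i + 1))], see [bpE]. *)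
Definition bp s i : R := (1 + expR (s * jj i))^-1.

Lemma bpE s i : bp s i = expR (- (s * jj i))/(1 + expR (- (s * jj i))).
rewrite /bp expRN; have e0 := expR_gt0 (s * jj i); field.
by pz.
Qed.

Lemma bp_gt0 s i : 0 < bp s i.
Proof. by rewrite invr_gt0 addr_gt0 ?expR_gt0. Qed.

Lemma bp_le_exp s i : bp s i <= expR (- (s * jj i)).
rewrite /bp expRN lef_pV2 ?posrE ?expR_gt0 //; lra.
Qed.

Lemma bp_le1 s i : bp s i <= 1.
Proof. by rewrite invf_le1; have := expR_gt0 (s * jj i); lra. Qed.

Lemma bp_half s i : 0 <= s -> bp s i <= 2^-1.
move=> s0; rewrite lef_pV2 ?posrE //.
have : 1 <= expR (s * jj i) by rewrite -expR0 ler_expR mulr_ge0 // ltW jj_gt0.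
lra.
Qed.

Lemma bpq_ge s i : 0 <= s -> expR (- (s * jj i))/4 <= bp s i*(1 - bp s i).
move=> s0; have h := bp_half i s0; have b0 := bp_gt0 s i.
have -> : expR (- (s * jj i)) = bp s i/(1 - bp s i).
 rewrite /bp expRN; have e0 := expR_gt0 (s * jj i); field.
 lra.
rewrite ler_pdivrMr // ler_pdivrMr; last lra.
have h4 : 2^-1^+2 <= (1 - bp s i)^+2 by rewrite ler_sqr ?nnegrE; lra.
by have := ler_wpM2l (ltW b0) h4; lra.
Qed.

Lemma onem_cos_ge x : 0 <= x <= 2 -> x^+2/3 <= 1 - cos x.
move=> /andP[x0 x2]; rewrite [in leRHS](_ : x = (x/2) *+ 2); last by rewrite -mulr_natr divfK.
rewrite cos_mulr2n cos2sin2.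
have y0 : 0 <= x/2 by lra.
have := sin_ge y0; set y := x/2 in y0 *.
have -> : x = 2 * y by rewrite /y; lra.
have y1 : y <= 1 by rewrite /y; lra.
have y3 : y^+3 <= y by rewrite -[leRHS]expr1 ler_wiXn2l.
move=> sy; have sy' : 5/6 * y <= sin y by lra.
have : (5/6 * y)^+2 <= sin y^+2 by rewrite ler_sqr ?nnegrE; lra.
by have := sqr_ge0 y; rewrite !exprMn; lra.
Qed.

Lemma cos_geN x : 0 <= x <= 2 -> - 2^-1 <= cos x.
move=> /andP[x0 x2]; rewrite [in leRHS](_ : x = (x/2) *+ 2); last by rewrite -mulr_natr divfK.
rewrite cos_mulr2n; have := cos_ge (x/2).
have : (x/2)^+2 <= 1 by rewrite expr_le1 //; lra.
move=> h1 h2; have h3 : 2^-1 <= cos (x/2) by lra.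
have : (2^-1)^+2 <= cos (x/2)^+2 by rewrite ler_sqr ?nnegrE; lra.
lra.
Qed.

Lemma sin_big (N : nat) x : (2 <= N)%N -> N%:R^-1 < x <= pi/2 ->
 3/5/N%:R <= sin x.
move=> N2 /andP[xN xp]; have N2' : 2 <= N%:R :> R by rewrite ler_nat.
have x2 : x < 2 by have := pihalf_lt2 R; lra.
have iN : 0 < N%:R^-1 :> R by rewrite invr_gt0; lra.
have iN2 : N%:R^-1 <= 2^-1 :> R by rewrite lef_pV2 ?posrE //; lra.
have x0 : 0 <= x by lra.
have := sin_ge x0; have [x1|x1] := leP x 1.
 have : x^+3 <= x by rewrite -[leRHS]expr1 ler_wiXn2l.
 lra.
have : x^+3 <= 4 * x by rewrite exprS [4 * x]mulrC ler_wpM2l // expr2; nra.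
lra.
Qed.

Lemma cosD_oddpi x i : cos (x + jj i * pi) = - cos x.
elim: i x => [|i IH] x; first by rewrite jjE mulr0 add0r mul1r cosDpi.
have -> : x + jj i.+1 * pi = (x + jj i * pi) + pi *+ 2 by rewrite jjS mulr2n; ring.
by rewrite cosD2pi IH.
Qed.

Lemma sum_cos_odd (N : nat) th : 2 * sin th*(\sum_(i < N) cos (jj i * th)) = sin (2 * N%:R * th).
elim: N => [|N IH]; first by rewrite big_ord0 !mulr0 mul0r sin0.
rewrite big_ord_recr /= mulrDr IH jjE (natS N).
have -> : 2*(N%:R + 1) * th = (2 * N%:R + 1) * th + th by ring.
have -> : 2 * N%:R * th = (2 * N%:R + 1) * th - th by ring.
by rewrite !sinD cosN sinN; ring.
Qed.

Lemma sum_jj_sqr (N : nat) : N%:R^+3 <= \sum_(i < N) jj i^+2.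
elim: N => [|N IH]; first by rewrite big_ord0 expr0n.
rewrite big_ord_recr /= (natS N) jjE; have : 0 <= N%:R :> R by [].
move: (N%:R) IH => n IH n0; nra.
Qed.

(** Small angles are covered by the quadratic lower bound for [1 - cos], intermediate ones by the
    closed form of the sum of cosines, where [sin th] is at least of order [1 / N]. Near [pi] the
    oddness of the frequencies gives [cos (jj i * th) = - cos (jj i * (pi - th))], so each term is
    at least 1/2 and there is no second peak. *)
Lemma sum_onem_cos (N : nat) th : (2 <= N)%N -> 0 <= th <= pi ->
 N%:R/6 * Num.min 1 ((th * N%:R)^+2) <= \sum_(i < N) (1 - cos (jj i * th)).
move=> N2 /andP[t0 tp]; have N2' : 2 <= N%:R :> R by rewrite ler_nat.
have NN : N%:R/6 * Num.min 1 ((th * N%:R)^+2) <= N%:R/6.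
 by rewrite -[leRHS]mulr1 ler_wpM2l ?ge_min //; lra.
have jN (i : 'I_N) : jj i <= 2 * N%:R.
 exact: jj_le.
have [h|h] := leP th N%:R^-1.
 via (N%:R/6*(th * N%:R)^+2).
 by rewrite ler_wpM2l ?ge_min ?lexx ?orbT //; lra.
 via (\sum_(i < N) jj i^+2*(th^+2/3)).
 rewrite -mulr_suml; via (N%:R^+3*(th^+2/3)).
 by have := mulr_ge0 (exprn_ge0 3 (ler0n R N)) (sqr_ge0 th); rewrite exprMn; lra.
 by rewrite ler_wpM2r ?sum_jj_sqr // divr_ge0 ?sqr_ge0.
 lsum i; apply: le_trans (onem_cos_ge _).
 lra.
 apply/andP; split; first by pz.
 via (2 * N%:R * N%:R^-1).
 by pz.
 by rewrite mulfK; lra.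
lel NN.
have region2 x : sin x = sin th -> N%:R^-1 < x <= pi/2 ->
 N%:R/6 <= \sum_(i < N) (1 - cos (jj i * th)).
 move=> ex hx; have := sin_big N2 hx; rewrite ex => hs.
 have iN : 0 < 3/5/N%:R :> R by rewrite !divr_gt0 //; lra.
 rewrite sumrB sumr_const card_ord; set S := \sum_(i < N) _.
 have hS : 2 * sin th * S <= 1 by rewrite /S sum_cos_odd sin_le1.
 have : S <= (2 * sin th)^-1.
 by rewrite -div1r ler_pdivlMr ?[S * _]mulrC //; lra.
 have : (2 * sin th)^-1 <= (6/5/N%:R)^-1.
 by rewrite lef_pV2 ?posrE; lra.
 have -> : (6/5/N%:R)^-1 = 5/6 * N%:R :> R by field; rewrite gt_eqF //; lra.
 lra.
have [hp|hp] := leP th (pi/2); first by apply: (region2 th); rewrite ?h.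
have [h3|h3] := ltP N%:R^-1 (pi - th).
 apply: (region2 (pi - th)); last by apply/andP; split => //; lra.
 by rewrite addrC sinDpi sinN opprK.
via (\sum_(i < N) (2^-1 : R)).
 by rewrite sumr_const card_ord -mulr_natr; lra.
lsum i.
have -> : jj i * th = - (jj i*(pi - th)) + jj i * pi by ring.
rewrite cosD_oddpi cosN; have : - 2^-1 <= cos (jj i*(pi - th)); last lra.
apply: cos_geN; apply/andP; split; first by rewrite mulr_ge0 ?subr_ge0 // ltW.
via (2 * N%:R * N%:R^-1); last by rewrite mulfK; lra.
by apply: ler_pM => //; rewrite ?subr_ge0 // ltW.
Qed.

Definition mth s th : R := Num.min 1 ((th/s)^+2).

Lemma expRN1_ge : 4^-1 <= expR (-1) :> R.
have := expR_ge1Dx (- 2^-1 : R) => h.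
have -> : (-1 : R) = - 2^-1 + - 2^-1 by lra.
by rewrite expRD; nra.
Qed.

Lemma energy_bp s M th : 0 < s <= 1/40 -> 1 <= 2 * s * M%:R -> 0 <= th <= pi ->
 mth s th/(15*10*10 * s) <= energy (bp s) M th.
move=> /andP[s0 s40] sM thp.
pose x := (2 * s)^-1; have x20 : 20 <= x.
 rewrite /x -[leLHS]invrK lef_pV2 ?posrE ?mulr_gt0 //; lra.
have /andP[Nx xN] : (Num.truncn x)%:R <= x < (Num.truncn x).+1%:R by apply: Num.Theory.truncn_itv; lra.
(* The sites below [N], which is about [1 / (2 s)], satisfy [s (2 i + 1) <= 1], so their variances
   [bp (1 - bp)] are at least [exp (-1) / 4 >= 1/16]; all other sites are dropped. *)
set N := Num.truncn x in Nx xN; rewrite (natS N) in xN.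
have xs : x * s = 1/2 by rewrite /x; fld.
have N19 : 19 <= N%:R :> R by lra.
have NM : (N <= M)%N.
 rewrite -(ler_nat R); lel Nx; rewrite /x -div1r ler_pdivrMr ?mulr_gt0 //; lra.
have N2 : (2 <= N)%N by rewrite -(ler_nat R); lra.
have Ns2 : N%:R * s <= 1/2 by rewrite -xs ler_pM2r.
have Ns : 2/5 <= N%:R * s.
 have := ler_wpM2r (ltW s0) (ltW xN); rewrite xs mulrDl mul1r; lra.
via (16^-1*\sum_(i < N) (1 - cos (jj i * th))); last first.
 rewrite /energy (big_ord_widen M (fun i => 1 - cos (jj i * th))) // mulr_sumr big_mkcond /=.
 lsum i; have c1 : 0 <= 1 - cos (jj i * th) by rewrite subr_ge0 cos_le1.
 have q := bpq_ge i (ltW s0).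
 case: ifP => iN; last by rewrite mulr_ge0 // (le_trans _ q) // divr_ge0.
 rewrite ler_wpM2r //; apply: le_trans q.
 have : expR (-1) <= expR (- (s * jj i)).
 rewrite ler_expR lerN2; via (s*(2 * N%:R)); last lra.
 by rewrite ler_pM2l // jj_le.
 by have := expRN1_ge; lra.
have := sum_onem_cos N2 thp; set S := \sum_(_ < _) _ => hS.
have m1 : 4/25 * mth s th <= Num.min 1 ((th * N%:R)^+2).
 rewrite /mth le_min; apply/andP; split.
 have : Num.min 1 ((th/s)^+2) <= 1 by rewrite ge_min lexx.
 lra.
 via (4/25*(th/s)^+2).
 by rewrite ler_pM2l // ge_min lexx orbT.
 have -> : th * N%:R = (th/s) * (N%:R * s) by fld.
 rewrite [leRHS]exprMn [4/25 * _]mulrC ler_wpM2l ?sqr_ge0 //.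
 by rewrite (_ : 4/25 = (2/5)^+2) ?ler_sqr ?nnegrE //; lra.
have m0 : 0 <= mth s th by rewrite /mth le_min ler01 sqr_ge0.
rewrite invfM mulrA ler_pdivrMr //.
have : N%:R/6*(4/25 * mth s th) <= S.
 by apply: le_trans hS; rewrite ler_pM2l //; lra.
move=> h; have : s*(N%:R/6*(4/25 * mth s th)) <= s * S by rewrite ler_pM2l.
have : 2/5 * mth s th <= N%:R * s * mth s th by pz.
lra.
Qed.

Definition kap : R := (24*10*10*10)^-1.

(** What the local limit theorem asks of a product measure, with constants common to all [s] in
    [[a, 2 a]] and stable under freezing of order [1/a] sites ([bpV_good]). The reference scale is
    [a], so that measures with different parameters can be compared. *)
Record good (a : R) (M : nat) (p : nat -> R) : Prop := Good {
 good01 : forall i, 0 <= p i <= 1;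
 good_energy : forall th, 0 <= th <= pi -> kap*(mth a th/a) <= energy p M th;
 good_third : \sum_(i < M) jj i^+3 * p i <= 96/a^+4;
 good_var : bvar p M <= 16/a^+3 }.

(** Sites of [V] are frozen at 0 and leave the generating polynomial. Sites forced to be occupied
    are frozen in the same way, their weight being supplied by a separate power of ['X]. *)
Definition bpV s (V : pred nat) i : R := if V i then 0 else bp s i.

Lemma bpV_le s V i : 0 <= bpV s V i <= bp s i.
Proof. by rewrite /bpV; case: ifP => _; rewrite ?lexx ?(ltW (bp_gt0 _ _)). Qed.

Lemma energy_bpV s M (V : pred nat) th : 0 < s ->
 energy (bp s) M th - (\sum_(i < M) nat_of_bool (V i))%:R * mth s th <= energy (bpV s V) M th.
move=> s0; rewrite natr_sum mulr_suml /energy -sumrB; lsum i.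
have c1 : 0 <= 1 - cos (jj i * th) by rewrite subr_ge0 cos_le1.
have c2 : 1 - cos (jj i * th) <= 2 by have := cos_geN1 (jj i * th); lra.
have b0 := bp_gt0 s i; have b1 := bp_le1 s i; have be := bp_le_exp s i.
rewrite /bpV; case: (V i) => /=; last by rewrite mul0r subr0.
rewrite !mul0r mul1r subr_le0 /mth le_min; apply/andP; split.
 have q1 : bp s i*(1 - bp s i) <= 1/4 by have := sqr_ge0 (1 - 2 * bp s i); lra.
 have q0 : 0 <= bp s i*(1 - bp s i) by rewrite mulr_ge0 //; lra.
 by have := ler_pM q0 c1 q1 c2; lra.
have h := jj_pow_exp 2 i s0; rewrite (_ : 2`! = 2%N) // in h.
have c3 : 1 - cos (jj i * th) <= (jj i * th)^+2/2 by have := cos_ge (jj i * th); lra.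
via (expR (- (s * jj i)) * ((jj i * th)^+2/2)).
 apply: ler_pM => //; first by rewrite mulr_ge0; lra.
 by apply: le_trans be; rewrite -[leRHS]mulr1 ler_wpM2l; lra.
have -> : expR (- (s * jj i)) * ((jj i * th)^+2/2) =
 (jj i^+2 * expR (- (s * jj i))) * (th^+2/2) by rewrite exprMn; lra.
via (2/s^+2*(th^+2/2)).
 by rewrite ler_wpM2r // divr_ge0 ?sqr_ge0.
lra.
Qed.

Lemma sum_jj_bpV k s M V : 0 < s ->
 \sum_(i < M) jj i^+k * bpV s V i <= k`!%:R*2^+k.+1/s^+k.+1.
move=> s0; apply: le_trans (sum_jj_pow_exp k M s0); lsum i.
rewrite ler_wpM2l ?exprn_ge0 ?jj_ge0 //; have /andP[_ h] := bpV_le s V i.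
exact: le_trans h (bp_le_exp s i).
Qed.

Lemma bpV_good a s M (V : pred nat) : 0 < a -> a <= s -> s <= 2 * a -> 2 * a <= 1/40 ->
 1 <= 2 * a * M%:R -> 6*10*10*10 * a*(\sum_(i < M) nat_of_bool (V i))%:R <= 1 ->
 good a M (bpV s V).
move=> a0 as_ sa a40 aM Va; have s0 : 0 < s by lra.
have ip k : (s^+k)^-1 <= (a^+k)^-1.
 have h : a^+k <= s^+k by rewrite lerXn2r ?nnegrE // ltW.
 by pz.
split.
- move=> i; have /andP[h1 h2] := bpV_le s V i; rewrite h1 /=.
 exact: le_trans h2 (bp_le1 s i).
- move=> th thp; apply: le_trans (energy_bpV M V th s0).
 have sM : 1 <= 2 * s * M%:R.
 by lel aM; rewrite ler_wpM2r //; lra.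
 have h := energy_bp (s := s) (M := M) (th := th) _ sM thp.
 have {h} := h ltac:(lra).
 set v := (\sum_(_ < _) _)%:R in Va *; have v0 : 0 <= v by rewrite ler0n.
 have mm : mth a th/4 <= mth s th.
 rewrite /mth le_min; apply/andP; split.
 have : Num.min 1 ((th/a)^+2) <= 1 by rewrite ge_min lexx.
 lra.
 have : Num.min 1 ((th/a)^+2) <= (th/a)^+2 by rewrite ge_min lexx orbT.
 have : (th/a)^+2/4 <= (th/s)^+2.
 rewrite !expr_div_n -mulrA ler_wpM2l ?sqr_ge0 // -invfM lef_pV2 ?posrE ?exprn_gt0 //; last first.
 by pz.
 rewrite (_ : a^+2*4 = (2 * a)^+2) ?ler_sqr ?nnegrE //; [lra|lra|].
 lra.
 lra.
 have m0 : 0 <= mth s th by rewrite /mth le_min ler01 sqr_ge0.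
 have ma0 : 0 <= mth a th by rewrite /mth le_min ler01 sqr_ge0.
 have ia : (2 * a)^-1 <= s^-1 by rewrite lef_pV2 ?posrE //; lra.
 have vle : v <= (6*10*10*10 * a)^-1 by rewrite -div1r ler_pdivlMr ?mulr_gt0 //; lra.
 have e1 : mth s th/(15*10*10 * s) = mth s th*(s^-1/(15*10*10)) by rewrite invfM; lra.
 have e2 : (6*10*10*10 * a)^-1 = a^-1/(6*10*10*10) by rewrite invfM; lra.
 have e3 : (2 * a)^-1 = a^-1/2 by rewrite invfM; lra.
 rewrite e1 => h; rewrite e2 in vle; rewrite e3 in ia.
 have ai0 : 0 < a^-1 by rewrite invr_gt0.
 have h2 : v * mth s th <= a^-1/(6*10*10*10) * mth s th by rewrite ler_wpM2r.
 have h3 : mth s th*(a^-1/2/(15*10*10)) <= mth s th*(s^-1/(15*10*10)) by rewrite ler_wpM2l //; lra.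
 have h4 : mth a th/4*(a^-1/(6*10*10*10)) <= mth s th*(a^-1/(6*10*10*10)) by rewrite ler_wpM2r // divr_ge0 // ltW.
 rewrite /kap; lra.
- lel (sum_jj_bpV 3 M V s0).
 by have := ip 4%N; rewrite (_ : 3`! = 6%N) //; lra.
- via (\sum_(i < M) jj i^+2 * bpV s V i).
 lsum i; rewrite ler_wpM2l ?exprn_ge0 //.
 have /andP[h1 h2] := bpV_le s V i.
 by rewrite -[leRHS]mulr1 ler_wpM2l //; lra.
 lel (sum_jj_bpV 2 M V s0).
 by have := ip 3%N; rewrite (_ : 2`! = 2%N) //; lra.
Qed.

End Energy.

(** * A local limit theorem uniform over good parameters *)

Section Llt.
Variable R : realType.
Implicit Types (x y th s a v : R) (p : nat -> R) (M H : nat).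
Local Notation jj := (@jj R).
Local Notation kap := (kap R).

(** [scale a = a^(3/2)] is the reciprocal of the order of the standard deviation of the weight;
    [eps a = a^(1/8)] will be the relative error of the local limit theorem. *)
Definition scale a : R := a * sqrt a.
Definition eps a : R := sqrt (sqrt (sqrt a)).

Lemma kap_gt0 : 0 < kap.
Proof. by rewrite invr_gt0 !mulr_gt0. Qed.

Section Scale.
Variable a : R.
Hypotheses (a0 : 0 < a) (a1 : a <= 1).

Lemma sqrt_gt0 : 0 < sqrt a. Proof. by pz. Qed.
Lemma sqrt_le1 : sqrt a <= 1. Proof. by rewrite -sqrtr1 ler_sqrt. Qed.
Lemma sqrt_sq : sqrt a^+2 = a. Proof. by rewrite sqr_sqrtr // ltW. Qed.
Lemma scale_gt0 : 0 < scale a. Proof. by rewrite mulr_gt0 ?sqrt_gt0. Qed.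
Lemma scale_le : scale a <= a.
Proof. by rewrite /scale -[leRHS]mulr1 ler_wpM2l ?sqrt_le1 // ltW. Qed.
Lemma scale_sqr : scale a^+2 = a^+3.
Proof. by rewrite /scale exprMn sqrt_sq; ring. Qed.
Lemma sqr_le_scale : a^+2 <= scale a.
rewrite /scale expr2 ler_wpM2l ?(ltW a0) //.
by have := ler_wpM2l (ltW sqrt_gt0) sqrt_le1; rewrite mulr1 -expr2 sqrt_sq.
Qed.
Lemma eps_gt0 : 0 < eps a. Proof. by rewrite !sqrtr_gt0. Qed.
Lemma eps_le1 : eps a <= 1.
Proof. by rewrite /eps -[leRHS]sqrtr1 ler_sqrt // -[leRHS]sqrtr1 ler_sqrt // sqrt_le1. Qed.
Lemma eps4 : eps a^+4 = sqrt a.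
Proof. by rewrite /eps (exprM _ 2 2) !sqr_sqrtr // sqrtr_ge0. Qed.
Lemma sqrt_le_eps : sqrt a <= eps a.
Proof. by rewrite -eps4 -[leRHS]expr1 ler_wiXn2l ?eps_le1 // ltW // eps_gt0. Qed.
Lemma sqr_le_eps : a^+2 <= eps a * scale a.
have -> : a^+2 = sqrt a * scale a by rewrite /scale mulrCA -expr2 sqrt_sq expr2.
by rewrite ler_wpM2r ?sqrt_le_eps // ltW // scale_gt0.
Qed.
End Scale.

Lemma exp_decay k c : 0 < c -> exists2 C : R, 0 < C &
 forall y, 0 < y -> expR (- (c * y)) <= C/y^+k.
move=> c0; exists (k`!%:R/c^+k); first by pz.
move=> y y0; rewrite ler_pdivlMr ?exprn_gt0 // ler_pdivlMr ?exprn_gt0 //.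
rewrite -mulrA -exprMn [y * c]mulrC [leLHS]mulrC; apply: pow_expRN.
by pz.
Qed.

(** Three ranges: below [scale a] the exponential is bounded by 1; up to [a] it is [exp (- kap x^2)]
    with [x = th / scale a], which beats [x^(-l-2)]; beyond [a] it is [exp (- kap / a)], smaller
    than any power of [a]. *)
Lemma tail_bound l : exists2 C : R, 0 < C & forall a th, 0 < a -> a <= 1 -> 0 <= th <= pi ->
 th^+l * expR (- (kap*(mth a th/a))) <= C*(scale a^+l * bump (scale a) th + scale a^+l.+1).
have [C1 C10 H1] := exp_decay (l + 2) kap_gt0.
have [C2 C20 H2] := exp_decay (2 * l.+1) kap_gt0.
exists (1 + C1 + 4^+l * C2); first by pz.
move=> a th a0 a1 /andP[t0 tp].
have h0 := scale_gt0 a0; have hl0 : 0 < scale a^+l by rewrite exprn_gt0.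
have hl1 : 0 < scale a^+l.+1 by rewrite exprn_gt0.
have c4 : 0 < 4^+l * C2 by rewrite mulr_gt0 ?exprn_gt0.
have b0 := bump_ge0 (scale a) th.
have hb0 : 0 <= scale a^+l * bump (scale a) th by rewrite mulr_ge0 // ltW.
have [hth|hth] := leP th (scale a).
 have e1 : expR (- (kap*(mth a th/a))) <= 1.
 by rewrite expRN_le1 // mulr_ge0 ?(ltW kap_gt0) // divr_ge0 ?(ltW a0) // /mth le_min ler01 sqr_ge0.
 have : th^+l * expR (- (kap*(mth a th/a))) <= scale a^+l.
 rewrite -[leRHS]mulr1 ler_pM ?exprn_ge0 //.
 by pz.
 rewrite /bump hth mulr1; have := ltW hl1; have := ltW hl0; nra.
have [ta|ta] := leP th a.
 have xE : mth a th/a = (th/scale a)^+2.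
 rewrite /mth min_r; last by rewrite expr_le1 ?divr_ge0 ?(ltW a0) // ler_pdivrMr // mul1r.
 rewrite !expr_div_n scale_sqr //; field; by pz.
 rewrite xE; set x := th/scale a.
 have x1 : 1 <= x by rewrite /x ler_pdivlMr // mul1r ltW.
 have x0 : 0 < x by lra.
 have h1 := H1 (x^+2) (exprn_gt0 2 x0).
 have -> : th = x * scale a by rewrite /x divfK // gt_eqF.
 have -> : bump (scale a) (x * scale a) = (x^+2)^-1.
 rewrite /bump ifF; last by apply/negbTE; rewrite -ltNge /x divfK ?gt_eqF.
 by fld.
 rewrite exprMn [x^+l * _]mulrC -mulrA mulrDr mulrCA.
 have : x^+l * expR (- (kap * x^+2)) <= C1*(x^+2)^-1.
 via (x^+l*(C1/(x^+2)^+(l + 2))).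
 by pz.
 rewrite mulrCA ler_wpM2l ?(ltW C10) // -exprM ler_pdivrMr ?exprn_gt0 //.
 rewrite [leRHS]mulrC ler_pdivlMr ?exprn_gt0 // -exprD.
 by apply: ler_weXn2l => //; clear; lia.
 move=> h2; have := ler_wpM2l (ltW hl0) h2.
 have : 0 <= scale a^+l*(x^+2)^-1 by rewrite mulr_ge0 ?(ltW hl0) // invr_ge0 exprn_ge0 // ltW.
 have := mulr_gt0 c4 hl1; have := mulr_gt0 C10 hl1; nra.
have -> : mth a th = 1.
 rewrite /mth min_l // expr_ge1 ?divr_ge0 ?(ltW a0) // ler_pdivlMr // mul1r ltW //.
rewrite div1r; have ai : 0 < a^-1 by rewrite invr_gt0.
have h2 := H2 _ ai.
have h3 : expR (- (kap/a)) <= C2 * scale a^+l.+1.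
 lel h2; rewrite ler_wpM2l ?(ltW C20) // exprVn invrK exprM.
 by rewrite lerXn2r ?nnegrE ?sqr_ge0 ?(ltW h0) // sqr_le_scale.
have h4 : th^+l <= 4^+l.
 by rewrite lerXn2r ?nnegrE //; have := pihalf_lt2 R; lra.
have : th^+l * expR (- (kap/a)) <= 4^+l*(C2 * scale a^+l.+1).
 by rewrite ler_pM ?exprn_ge0.
have := mulr_gt0 C10 hl1; have := mulr_ge0 (ltW c4) hb0; have := mulr_ge0 (ltW C10) hb0; lra.
Qed.

Lemma avg_bump3 H (h : R) : 0 < h -> (H.*2.+1)%:R^-1 <= h -> avg H (bump h) <= 3 * h.
move=> h0 Hh; lel (avg_bump H h0).
have -> : 3 * h = h + 2 * h by ring.
by pz.
Qed.

Lemma avg_tail l : exists2 C : R, 0 < C & forall a H, 0 < a -> a <= 1 ->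
 (H.*2.+1)%:R^-1 <= scale a ->
 avg H (fun th => th^+l * expR (- (kap*(mth a th/a)))) <= C * scale a^+l.+1.
have [C C0 HC] := tail_bound l; exists (C*4); first by pz.
move=> a H a0 a1 Hh; have h0 := scale_gt0 a0.
lel (le_avg _ (fun th h => HC a th a0 a1 h)).
rewrite avgZ avgD avgZ avg_cst -mulrA ler_pM2l // exprS.
have := avg_bump H h0; have hl0 : 0 < scale a^+l by rewrite exprn_gt0.
move=> h; have : scale a^+l * avg H (bump (scale a)) <= scale a^+l*(3 * scale a).
 by rewrite ler_pM2l // avg_bump3.
lra.
Qed.

Lemma modulus_good a M p th : good a M p -> 0 <= th <= pi ->
 modulus (cf (bpoly p M) th) <= expR (- (kap*(mth a th/a))).
move=> g thp; lel (modulus_bpoly M th (good01 g)).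
by rewrite ler_expR lerN2 (good_energy g).
Qed.

Lemma modulus_cisB1 x : modulus (cis x - 1) <= `|x|.
rewrite -ler_sqr ?nnegrE ?modulus_ge0 // real_normK ?num_real //.
rewrite -[1 in leLHS]/(1%:C)%C /cis; simpc; rewrite modulus_sqr.
have := cos2Dsin2 x; have := cos_ge x; rewrite sqrrB; lra.
Qed.

Lemma archi_inv x : 0 < x -> exists n : nat, forall H, (n <= H)%N -> (H.*2.+1)%:R^-1 <= x.
move=> x0; have /andP[_ h] : (Num.truncn x^-1)%:R <= x^-1 < (Num.truncn x^-1).+1%:R.
 by apply: Num.Theory.truncn_itv; rewrite invr_ge0 ltW.
exists (Num.truncn x^-1).+1 => H nH; rewrite -[leRHS]invrK lef_pV2 ?posrE ?invr_gt0 //.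
by lel (ltW h); rewrite ler_nat; lia.
Qed.

(** Multiplication by ['X - 1] takes a difference of consecutive coefficients and costs at most a
    factor [th] in the characteristic function. Only angles of order [scale a] count, so every
    difference gains a factor [scale a]. *)
Lemma fd_bound l : exists2 C : R, 0 < C & forall a M p k n, 0 < a -> a <= 1 -> good a M p ->
 `|(('X - 1)^+l * 'X^k * bpoly p M)`_n| <= C * scale a^+l.+1.
have [C C0 HC] := avg_tail l; exists C => // a M p k n a0 a1 g.
have [n0 Hn0] := archi_inv (scale_gt0 a0).
pose H := (n0 + l + k + M ^ 2 + n + 2)%N.
have Hh : (H.*2.+1)%:R^-1 <= scale a by apply: Hn0; rewrite /H; clear; lia.
apply: le_trans (HC a H a0 a1 Hh).
via (avg H (fun th => modulus (cf (('X - 1)^+l * 'X^k * bpoly p M) th))).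
 apply: coef_le_avg; last by rewrite /H; clear; lia.
 apply: (leq_trans (size_polyMleq _ _)).
 have h1 : (size ((('X - 1)^+l * 'X^k)%R : {poly R}) <= l + k + 2)%N.
 apply: (leq_trans (size_polyMleq _ _)); rewrite size_polyXn.
 have := size_poly_exp_leq ('X - 1 : {poly R}) l.
 have -> : size ('X - 1 : {poly R}) = 2%N by rewrite -polyC1 size_XsubC.
 by rewrite mul1n; move: (size _) => sz; clear; lia.
 by have := size_bpoly p M; rewrite /H; clear -h1; lia.
apply: le_avg => th thp; rewrite !cfM cf_exp !modulusM cfXn modulus_cis mulr1 modulusX.
apply: ler_pM => //; rewrite ?exprn_ge0 ?modulus_ge0 //; last exact: modulus_good.
have /andP[t0 _] := thp.
rewrite lerXn2r ?nnegrE ?modulus_ge0 // -polyC1 cfD cfX -polyCN cfC.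
have := modulus_cisB1 th; rewrite (ger0_norm t0).
by rewrite (_ : cis th - 1 = cis th + ((-1)%:C)%C) rmorphN1.
Qed.

(** A discretised Gaussian density of variance [v] at distance [x] from the mean. It is never
    evaluated: it mediates between two product measures, and a lower bound at [x = 0] is enough. *)
Definition gavg H v x : R := avg H (fun th => cos (x * th) * expR (- (v * th^+2/2))).

Lemma good_varE a M p th : good a M p -> 0 <= th <= pi ->
 kap*(mth a th/a) <= bvar p M * th^+2/2.
move=> g thp; lel (good_energy g thp).
rewrite /energy /bvar -mulrA mulr_suml; lsum i.
have /andP[p0 p1] := good01 g i.
have c3 : 1 - cos (jj i * th) <= (jj i * th)^+2/2 by have := cos_ge (jj i * th); lra.
have : p i*(1 - p i) * (1 - cos (jj i * th)) <= p i*(1 - p i) * ((jj i * th)^+2/2).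
 by rewrite ler_wpM2l // mulr_ge0 // subr_ge0.
lra.
Qed.

(** The centred characteristic function is compared with [exp (- v th^2 / 2)] angle by angle: the
    Taylor bound [centered_bpoly] serves small angles, the decay of both functions the larger
    ones. *)
Lemma llt : exists2 C : R, 0 < C & forall a M p m H, 0 < a -> a <= 1 -> good a M p ->
 (M ^ 2 + m + 1 <= H)%N -> (H.*2.+1)%:R^-1 <= scale a ->
 `|(bpoly p M)`_m - gavg H (bvar p M) (m%:R - bmean p M)| <= C*(scale a * eps a).
have [C1 C10 H1] := exp_decay 2 kap_gt0.
pose B : R := 48*10 + 2 * C1.
have B0 : 0 < B by rewrite addr_gt0 // mulr_gt0.
exists (4 * B); first by pz.
move=> a M p m H a0 a1 g MH Hh.
have h0 := scale_gt0 a0; have e0 := eps_gt0 a0; have e1 := eps_le1 a1.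
rewrite (coef_avg (H := H)); last 2 first.
- by have := size_bpoly p M; clear -MH; lia.
- by clear -MH; lia.
set F := fun th => _; set G := fun th => cos ((m%:R - bmean p M) * th) * expR (- (bvar p M * th^+2/2)).
have -> : avg H F - gavg H (bvar p M) (m%:R - bmean p M) = avg H (fun th => F th - G th).
 rewrite -[RHS](_ : avg H F + (-1) * avg H G = _); first by rewrite mulN1r.
 by rewrite -avgZ -avgD; apply: eq_avg => th; rewrite mulN1r.
lel (avg_norm _ _).
via (avg H (fun th => B*(eps a * bump (scale a) th + eps a * scale a))); last first.
 have -> : 4 * B*(scale a * eps a) = B*(4*(scale a * eps a)) by ring.
 rewrite avgZ avgD avgZ avg_cst ler_pM2l //.
 have : eps a * avg H (bump (scale a)) <= eps a*(3 * scale a).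
 by rewrite ler_pM2l // avg_bump3.
 lra.
apply: le_avg => th thp; have /andP[t0 tp] := thp.
have FG : `|F th - G th| <= modulus (cis (- (bmean p M * th)) * cf (bpoly p M) th
 - ((expR (- (bvar p M * th^+2/2)))%:C)%C).
 set z := _ - _ : R[i].
 have -> : F th - G th = complex.Re (z * cis (- ((m%:R - bmean p M) * th))).
 rewrite /z /F /G.
 have -> : cis (- (m%:R * th)) = cis (- (bmean p M * th)) * cis (- ((m%:R - bmean p M) * th)).
 by rewrite -cisD; congr cis; ring.
 rewrite mulrA [cf (bpoly p M) th * _]mulrC.
 move: (cis (- (bmean p M * th)) * cf (bpoly p M) th) (expR _) ((_ - _) * th) => [c d] E y.
 by rewrite /cis cosN sinN; simpc; rewrite /=; ring.
 by lel (Re_le_modulus _); rewrite modulusM modulus_cis mulr1.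
lel FG.
set Z := modulus _.
have Z1 : Z <= 48*10*(th^+3/a^+4).
 lel (centered_bpoly M (good01 g) t0).
 have : 5 * th^+3*(\sum_(i < M) jj i^+3 * p i) <= 5 * th^+3*(96/a^+4).
 by rewrite ler_wpM2l ?(good_third g) // mulr_ge0 // exprn_ge0.
 by lra.
have Z2 : Z <= 2 * expR (- (kap*(mth a th/a))).
 lel (modulusD _ _); rewrite modulusN modulus_real modulusM modulus_cis mul1r.
 rewrite (ger0_norm (expR_ge0 _)).
 have := modulus_good g thp; have : expR (- (bvar p M * th^+2/2)) <= expR (- (kap*(mth a th/a))).
 by rewrite ler_expR lerN2 (good_varE g thp).
 lra.
have s0 := sqrt_gt0 a0.
have eh0 : 0 < eps a * scale a by rewrite mulr_gt0.
have C1eh : 0 < C1*(eps a * scale a) by rewrite mulr_gt0.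
have th3 x : (x * scale a)^+3/a^+4 = x^+3 * sqrt a.
 rewrite /scale !exprMn [sqrt a^+3]exprS sqrt_sq //; field; by pz.
have [hth|hth] := leP th (scale a).
 rewrite /bump hth mulr1.
 have : th^+3/a^+4 <= sqrt a.
 have := th3 1; rewrite expr1n !mul1r => <-.
 by rewrite ler_wpM2r ?invr_ge0 ?exprn_ge0 ?(ltW a0) // lerXn2r ?nnegrE // ltW.
 have := sqrt_le_eps a0 a1; rewrite /B; have := mulr_gt0 C10 e0; lra.
have [ta|ta] := leP th a.
 have xE : mth a th/a = (th/scale a)^+2.
 rewrite /mth min_r; last by rewrite expr_le1 ?divr_ge0 ?(ltW a0) // ler_pdivrMr // mul1r.
 rewrite !expr_div_n scale_sqr //; field; by pz.
 rewrite xE in Z2; set x := th/scale a in Z2.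
 have x1 : 1 < x by rewrite /x ltr_pdivlMr // mul1r.
 have x0 : 0 < x by lra.
 have tx : th = x * scale a by rewrite /x divfK // gt_eqF.
 have bE : bump (scale a) th = (x^+2)^-1.
 rewrite /bump ifF; last by apply/negbTE; rewrite -ltNge.
 by rewrite tx -exprVn; congr (_^+2); fld.
 have x20 : 0 < x^+2 by rewrite exprn_gt0.
 rewrite bE; suff : Z <= B*(eps a*(x^+2)^-1).
 by have := mulr_gt0 B0 eh0; lra.
 rewrite mulrA ler_pdivlMr //.
 (* Here [sqrt a = eps a ^ 4]. If [x^5 eps^3 <= 1], the Taylor bound [x^3 eps^4] is at most
    [eps / x^2]. Otherwise, as [x > 1], [x^2 eps >= 1], and the exponential decay gives a multiple
    of [1 / x^4 <= eps / x^2]. The exponent 1/8 in [eps] is the one for which both halves work. *)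
 have [hx|hx] := leP (x^+5 * eps a^+3) 1.
 rewrite tx th3 -eps4 in Z1.
 have : Z * x^+2 <= 48*10*(x^+3 * eps a^+4) * x^+2 by rewrite ler_pM2r.
 have -> : 48*10*(x^+3 * eps a^+4) * x^+2 = 48*10 * eps a*(x^+5 * eps a^+3) by ring.
 have : 48*10 * eps a*(x^+5 * eps a^+3) <= 48*10 * eps a*1.
 by rewrite ler_pM2l // mulr_gt0.
 rewrite /B; have := mulr_gt0 C10 e0; lra.
 have x2e : 1 <= x^+2 * eps a.
 rewrite leNgt; apply/negP => hlt.
 have : (x^+2 * eps a)^+3 < 1 by rewrite exprn_ilt1 // mulr_ge0 ?ltW.
 have : x^+5 * eps a^+3 <= (x^+2 * eps a)^+3.
 have -> : (x^+2 * eps a)^+3 = x^+6 * eps a^+3 by ring.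
 rewrite ler_pM2r ?exprn_gt0 //.
 by apply: ler_weXn2l => //; rewrite ltW.
 lra.
 have h1 := H1 _ x20.
 have : Z * x^+2 <= 2*(C1/(x^+2)^+2) * x^+2 by rewrite ler_pM2r; lra.
 have -> : 2*(C1/(x^+2)^+2) * x^+2 = 2 * C1/x^+2 by fld.
 have : 2 * C1/x^+2 <= 2 * C1 * eps a.
 rewrite ler_pM2l ?mulr_gt0 // -div1r ler_pdivrMr // mulrC //.
 rewrite /B; lra.
have mE : mth a th = 1.
 rewrite /mth min_l // expr_ge1 ?divr_ge0 ?(ltW a0) // ler_pdivlMr // mul1r ltW //.
rewrite mE div1r in Z2; have ai : 0 < a^-1 by rewrite invr_gt0.
have h1 := H1 _ ai; rewrite exprVn invrK in h1.
have : C1 * a^+2 <= C1*(eps a * scale a) by rewrite ler_pM2l // sqr_le_eps.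
have := mulr_ge0 (ltW B0) (mulr_ge0 (ltW e0) (bump_ge0 (scale a) th)).
rewrite /B; lra.
Qed.

Lemma expRB_le (A B E : R) : E <= A -> E <= B -> `|expR (- A) - expR (- B)| <= `|A - B| * expR (- E).
wlog AB : A B/A <= B => [Hw|] EA EB.
 by have [/Hw|/ltW/Hw] := leP A B; [exact | rewrite distrC [`|A - B|]distrC; exact].
rewrite ger0_norm ?subr_ge0 ?ler_expR ?lerN2 //.
rewrite distrC ger0_norm ?subr_ge0 //.
have -> : expR (- B) = expR (- A) * expR (- (B - A)) by rewrite -expRD; congr expR; ring.
have h := expR_ge1Dx (- (B - A)).
have h2 : expR (- A) <= expR (- E) by rewrite ler_expR lerN2.
have e0 := expR_ge0 (- A).
have -> : expR (- A) - expR (- A) * expR (- (B - A)) = (1 - expR (- (B - A))) * expR (- A) by ring.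
apply: ler_pM => //; last lra.
by rewrite subr_ge0 expRN_le1 // subr_ge0.
Qed.

Lemma gavg_compare : exists2 C : R, 0 < C & forall a M1 p1 M2 p2 H x, 0 < a -> a <= 1 ->
 good a M1 p1 -> good a M2 p2 -> (H.*2.+1)%:R^-1 <= scale a ->
 `|gavg H (bvar p1 M1) x - gavg H (bvar p2 M2) 0| <=
 C * scale a*((x^+2 + `|bvar p1 M1 - bvar p2 M2|) * scale a^+2).
have [C C0 HC] := avg_tail 2; exists C => // a M1 p1 M2 p2 H x a0 a1 g1 g2 Hh.
set v1 := bvar p1 M1; set v2 := bvar p2 M2.
set F := fun th => cos (x * th) * expR (- (v1 * th^+2/2)).
set G := fun th => cos (0 * th) * expR (- (v2 * th^+2/2)).
rewrite /gavg -/F -/G.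
have -> : avg H F - avg H G = avg H (fun th => F th - G th).
 rewrite -[RHS](_ : avg H F + (-1) * avg H G = _); first by rewrite mulN1r.
 by rewrite -avgZ -avgD; apply: eq_avg => th; rewrite mulN1r.
lel (avg_norm _ _).
set K := x^+2 + `|v1 - v2|; have K0 : 0 <= K by rewrite addr_ge0 ?sqr_ge0.
have -> : C * scale a*(K * scale a^+2) = K*(C * scale a^+3) by ring.
apply: le_trans (ler_wpM2l K0 (HC a H a0 a1 Hh)).
rewrite -avgZ; apply: le_avg => th thp.
set E := kap*(mth a th/a).
have E1 : E <= v1 * th^+2/2 by exact: (good_varE g1 thp).
have E2 : E <= v2 * th^+2/2 by exact: (good_varE g2 thp).
have -> : F th - G th = (cos (x * th) - 1) * expR (- (v1 * th^+2/2)) +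
 (expR (- (v1 * th^+2/2)) - expR (- (v2 * th^+2/2))).
 by rewrite /F /G mul0r cos0; ring.
lel (ler_normD _ _).
have t20 := sqr_ge0 th.
have e0 := expR_ge0 (- E).
have b1 : `|(cos (x * th) - 1) * expR (- (v1 * th^+2/2))| <= x^+2 * th^+2/2 * expR (- E).
 rewrite normrM (ger0_norm (expR_ge0 _)); apply: ler_pM => //; rewrite ?ler_expR ?lerN2 //.
 have := cos_ge (x * th); have := cos_le1 (x * th); rewrite exprMn => h1 h2.
 by rewrite ler0_norm; lra.
have b2 := expRB_le E1 E2.
have b3 : `|v1 * th^+2/2 - v2 * th^+2/2| = `|v1 - v2| * th^+2/2.
 have -> : v1 * th^+2/2 - v2 * th^+2/2 = (v1 - v2) * (th^+2/2) by ring.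
 by rewrite normrM [X in _ * X]ger0_norm ?mulrA // divr_ge0.
rewrite b3 in b2.
have := mulr_ge0 (mulr_ge0 (sqr_ge0 x) t20) e0.
have := mulr_ge0 (mulr_ge0 (normr_ge0 (v1 - v2)) t20) e0.
rewrite /K; lra.
Qed.

Lemma gavg_lower : exists2 c : R, 0 < c & forall a M p H, 0 < a -> a <= 1 ->
 good a M p -> (H.*2.+1)%:R^-1 <= scale a/8 -> c * scale a <= gavg H (bvar p M) 0.
exists (expR (- 8)/8); first by [].
move=> a M p H a0 a1 g Hh; have h0 := scale_gt0 a0.
have p0 := pi_gt0 R; have p2 := pihalf_lt2 R; have pg := pi_ge2 R.
via (avg H (fun th => expR (- 8) * ((th <= scale a)%R)%:R)); last first.
 apply: le_avg => th /andP[t0 _]; rewrite mul0r cos0 mul1r.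
 have [th1|th1] := leP th (scale a); last by rewrite mulr0 expR_ge0.
 rewrite mulr1 ler_expR lerN2.
 have : th^+2 <= a^+3 by rewrite -scale_sqr // lerXn2r ?nnegrE // ltW.
 have a30 : 0 < a^+3 by rewrite exprn_gt0.
 have := good_var g; rewrite ler_pdivlMr // => hv ht.
 have v0 : 0 <= bvar p M.
 apply: sumr_ge0 => i _; have /andP[q0 q1] := good01 g i.
 by rewrite !mulr_ge0 // subr_ge0.
 have := ler_wpM2l v0 ht; lra.
rewrite avgZ -mulrA ler_pM2l //.
have sc1 : scale a <= 1 by exact: le_trans (scale_le a0 a1) a1.
have := @avg_indicator R H (scale a) => /(_ ltac:(lra)) h.
have : scale a/4 <= scale a/pi by rewrite ler_pM2l // lef_pV2 ?posrE //; lra.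
by move=> h4; apply: le_trans h; move: Hh h4; move: (_^-1) (_/pi) => u w; lra.
Qed.

(** Both coefficients are referred to the Gaussian peak of the second measure. Displacements from
    the means and the difference of the variances are measured against a variance of order [a^-3],
    whence the factor [scale a ^ 2]. *)
Theorem llt_compare : exists2 C : R, 0 < C & forall a M1 p1 m1 M2 p2 m2, 0 < a -> a <= 1 ->
 good a M1 p1 -> good a M2 p2 ->
 `|(bpoly p1 M1)`_m1 - (bpoly p2 M2)`_m2| <= C * scale a*(eps a +
 ((m1%:R - bmean p1 M1)^+2 + (m2%:R - bmean p2 M2)^+2
 + `|bvar p1 M1 - bvar p2 M2|) * scale a^+2).
have [C1 C10 H1] := llt; have [C2 C20 H2] := gavg_compare.
exists (2 * C1 + 2 * C2); first by pz.
move=> a M1 p1 m1 M2 p2 m2 a0 a1 g1 g2.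
have [n0 Hn0] := archi_inv (scale_gt0 a0).
pose H := (n0 + (M1 ^ 2 + m1 + 1) + (M2 ^ 2 + m2 + 1))%N.
have Hh : (H.*2.+1)%:R^-1 <= scale a by apply: Hn0; rewrite /H; clear; lia.
have l1 := H1 a M1 p1 m1 H a0 a1 g1 ltac:(rewrite /H; clear; lia) Hh.
have l2 := H1 a M2 p2 m2 H a0 a1 g2 ltac:(rewrite /H; clear; lia) Hh.
have c1 := H2 a M1 p1 M2 p2 H (m1%:R - bmean p1 M1) a0 a1 g1 g2 Hh.
have c2 := H2 a M2 p2 M2 p2 H (m2%:R - bmean p2 M2) a0 a1 g2 g2 Hh.
rewrite subrr normr0 addr0 in c2.
set x1 := m1%:R - _ in l1 c1 *; set x2 := m2%:R - _ in l2 c2 *.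
set P1 := (bpoly p1 M1)`_m1 in l1 *; set P2 := (bpoly p2 M2)`_m2 in l2 *.
set J1 := gavg H _ x1 in l1 c1; set J2 := gavg H _ x2 in l2 c2.
set J0 := gavg H _ 0 in c1 c2; set dv := `|bvar p1 M1 - bvar p2 M2| in c1 *.
have -> : P1 - P2 = (P1 - J1) + (J1 - J0) + ((J0 - J2) + (J2 - P2)) by ring.
lel (ler_normD _ _); lel (lerD (ler_normD _ _) (ler_normD _ _)).
rewrite (distrC J0 J2) (distrC J2 P2).
lel (lerD (lerD l1 c1) (lerD c2 l2)).
have h0 := scale_gt0 a0; have e0 := eps_gt0 a0.
have s20 : 0 <= scale a * scale a^+2 by rewrite mulr_ge0 ?sqr_ge0 // ltW.
have q1 := mulr_ge0 (sqr_ge0 x1) s20; have q2 := mulr_ge0 (sqr_ge0 x2) s20.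
have q3 : 0 <= dv*(scale a * scale a^+2) by exact: mulr_ge0 (normr_ge0 _) s20.
have q4 : 0 <= scale a * eps a by rewrite mulr_ge0 ?ltW.
have r1 := mulr_ge0 (ltW C10) q1; have r2 := mulr_ge0 (ltW C10) q2.
have r3 := mulr_ge0 (ltW C10) q3; have r4 := mulr_ge0 (ltW C20) q1.
have r5 := mulr_ge0 (ltW C20) q2; have r6 := mulr_ge0 (ltW C20) q3.
have r7 := mulr_ge0 (ltW C20) q4.
lra.
Qed.

Theorem llt_lower : exists c C : R, [/\ 0 < c, 0 < C & forall a M p m, 0 < a -> a <= 1 ->
 good a M p ->
 c * scale a <= (bpoly p M)`_m + C * scale a*(eps a + (m%:R - bmean p M)^+2 * scale a^+2)].
have [C1 C10 H1] := llt; have [C2 C20 H2] := gavg_compare; have [c c0 H3] := gavg_lower.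
exists c, (C1 + C2); split; rewrite ?addr_gt0 // => a M p m a0 a1 g.
have h0 := scale_gt0 a0; have e0 := eps_gt0 a0.
have [n0 Hn0] := @archi_inv (scale a/8) ltac:(lra).
pose H := (n0 + (M ^ 2 + m + 1))%N.
have Hh : (H.*2.+1)%:R^-1 <= scale a/8 by apply: Hn0; rewrite /H; clear; lia.
have Hh1 : (H.*2.+1)%:R^-1 <= scale a by lel Hh; lra.
have l1 := H1 a M p m H a0 a1 g ltac:(rewrite /H; clear; lia) Hh1.
have c1 := H2 a M p M p H (m%:R - bmean p M) a0 a1 g g Hh1.
rewrite subrr normr0 addr0 in c1; have c2 := H3 a M p H a0 a1 g Hh.
set x := m%:R - _ in l1 c1 *.
move: l1 c1; rewrite !ler_norml => /andP[l1 _] /andP[d1 _].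
have s20 : 0 <= scale a * scale a^+2 by rewrite mulr_ge0 ?sqr_ge0 // ltW.
have q1 := mulr_ge0 (sqr_ge0 x) s20.
have q4 : 0 <= scale a * eps a by rewrite mulr_ge0 ?ltW.
have r1 := mulr_ge0 (ltW C10) q1; have r7 := mulr_ge0 (ltW C20) q4.
lra.
Qed.

End Llt.

(** * The alternating sum of inverse squares *)

Section Basel.
Variable R : realType.
Implicit Types (x y s : R).
Local Notation jj := (@jj R).

Lemma tan_ge y : 0 <= y <= pi/2 -> y * cos y <= sin y.
move=> /andP[y0 yp]; rewrite -subr_ge0.
have -> : 0 = sin 0 - 0 * cos 0 :> R by rewrite sin0 mul0r subrr.
apply: (@le_of_derive _ (fun x => sin x - x * cos x) (fun x => x * sin x) _ _ y0) => [x|x /andP[x0 xy]].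
 by is_der; ring.
rewrite mulr_ge0 // sin_ge0_pi // x0 /=.
lra.
Qed.

Lemma inv_sin_sqr y : 0 < y -> y <= pi/2 ->
 (y^+2)^-1 <= (sin y^+2)^-1 <= (y^+2)^-1 + 1.
move=> y0 yp; have p2 := pi_ge2 R.
have s0 : 0 < sin y by rewrite sin_gt0_pi // y0 /=; lra.
have sy := sin_le (ltW y0).
have s20 : 0 < sin y^+2 by rewrite exprn_gt0.
have y20 : 0 < y^+2 by rewrite exprn_gt0.
apply/andP; split.
 by pz.
have h := @tan_ge y; rewrite (ltW y0) yp in h; have {}h := h isT.
have c0 : 0 <= cos y by rewrite cos_ge0_pihalf //; apply/andP; split => //; lra.
have h2 : (y * cos y)^+2 <= sin y^+2.
 by pz.
rewrite -(ler_pM2r s20) mulVf ?gt_eqF // -(ler_pM2r y20) mul1r.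
have -> : ((y^+2)^-1 + 1) * sin y^+2 * y^+2 = sin y^+2 + sin y^+2 * y^+2.
 by fld.
by move: h2; rewrite exprMn cos2sin2; lra.
Qed.

Definition odd_angle n k : R := jj k*(pi/2^+n.+2).

Lemma sum_fold N (f : nat -> R) :
 \sum_(0 <= k < N + N) f k = \sum_(0 <= k < N) (f k + f (N + N - k.+1)%N).
rewrite (@big_cat_nat _ _ _ N) //= ?leq_addr // big_split /=; congr (_ + _).
rewrite big_nat_rev /= -{1}[N]add0n big_addn addnK; apply: eq_big_nat => k hk.
by congr f; lia.
Qed.

(** Doubling of angles: [1 / sin^2 y + 1 / cos^2 y = 4 / sin^2 (2 y)], and the angles [y] and
    [pi/2 - y] of level [n + 1] pair up over the angle [2 y] of level [n]. Since [1 / sin^2 y] lies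
    between [1 / y^2] and [1 / y^2 + 1], this gives the sum of inverse odd squares with an explicit
    error. *)
Lemma sum_inv_sin n :
 \sum_(0 <= k < 2 ^ n) (sin (odd_angle n k)^+2)^-1 = 2*4^+n.
have p0 := pi_gt0 R; have p2 := pi_ge2 R.
elim: n => [|n IH].
 rewrite big_nat1 expr0 mulr1 /odd_angle jjE mulr0 add0r mul1r.
 have -> : (pi : R)/2^+2 = pi/2/2 by rewrite -mulrA -invfM.
 have e := cos_mulr2n (pi/2/2 : R).
 rewrite -[X in cos X]mulr_natr divfK // cos_pihalf cos2sin2 in e.
 have -> : sin (pi/2/2)^+2 = 2^-1 :> R by lra.
 by rewrite invrK.
rewrite expnS mul2n -addnn sum_fold exprS mulrCA -IH mulr_sumr.
apply: eq_big_nat => k /andP[_ kN].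
pose y := odd_angle n.+1 k.
have ey : odd_angle n k = y *+ 2.
 by rewrite /y /odd_angle -mulr_natr !exprS; move: (pi : R) => P; field; rewrite expf_neq0.
have ey2 : odd_angle n.+1 (2 ^ n + 2 ^ n - k.+1) = pi/2 - y.
 rewrite /y /odd_angle !jjE natrB ?(natS _ k) ?natrD ?natrX; last by lia.
 rewrite !exprS; move: (pi : R) => P; field; by [].
have y0 : 0 < y by rewrite mulr_gt0 ?jj_gt0 // divr_gt0 // exprn_gt0.
have yp : y < pi/2.
 rewrite /y /odd_angle mulrA ltr_pdivrMr ?exprn_gt0 // mulrC mulrAC -mulrA ltr_pM2l //.
 have -> : 2^+n.+3/2 = (2 ^ n.+2)%:R :> R by rewrite natrX !exprS; field.
 by rewrite ltr_nat !expnS; lia.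
have s0 : 0 < sin y by rewrite sin_gt0_pi // y0 /=; lra.
have c0 : 0 < cos y by rewrite cos_gt0_pihalf //; apply/andP; split => //; lra.
rewrite ey ey2 -/y sin_mulr2n.
have -> : sin (pi/2 - y) = cos y by rewrite sinB sin_pihalf cos_pihalf; ring.
rewrite -mulr_natr; have cs := cos2Dsin2 y.
have -> : (sin y^+2)^-1 + (cos y^+2)^-1 = (cos y^+2 + sin y^+2)/(sin y^+2 * cos y^+2).
 by fld.
by rewrite cs; fld.
Qed.

Lemma sum_odd_inv n :
 pi^+2/8 - pi^+2/16/2^+n <= \sum_(0 <= k < 2 ^ n) (jj k^+2)^-1 <= pi^+2/8.
have p0 := pi_gt0 R; have t0 : 0 < 2^+n :> R by rewrite exprn_gt0.
set B := \sum_(_ <= _ < _) _.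
pose c : R := (2^+n.+2/pi)^+2.
have cB : \sum_(0 <= k < 2 ^ n) (odd_angle n k^+2)^-1 = c * B.
 rewrite /B mulr_sumr; apply: eq_big_nat => k _; rewrite /c /odd_angle.
 have := jj_gt0 R k; move: (pi : R) p0 (jj k) => P P0 j j0.
 by fld.
have ang k : (k < 2 ^ n)%N -> 0 < odd_angle n k /\ odd_angle n k <= pi/2.
 move=> kn; rewrite /odd_angle mulr_gt0 ?jj_gt0 ?divr_gt0 ?exprn_gt0 //; split=> //.
 rewrite mulrA ler_pdivrMr ?exprn_gt0 // mulrC mulrAC -mulrA ler_pM2l //.
 have -> : 2^+n.+2/2 = (2 ^ n.+1)%:R :> R by rewrite natrX !exprS; field.
 by rewrite ler_nat expnS; lia.
have c0 : 0 < c by rewrite exprn_gt0 // divr_gt0 // exprn_gt0.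
have h1 : c * B <= 2*4^+n.
 rewrite -cB -sum_inv_sin; apply: ler_sum_nat => k /andP[_ kn].
 by have [a b] := ang k kn; have /andP[] := inv_sin_sqr a b.
have h2 : 2*4^+n <= c * B + 2^+n.
 rewrite -cB -sum_inv_sin.
 have -> : 2^+n = \sum_(0 <= k < 2 ^ n) (1 : R).
 by rewrite sumr_const_nat subn0 -natrX.
 rewrite -big_split /=; apply: ler_sum_nat => k /andP[_ kn].
 by have [a b] := ang k kn; have /andP[] := inv_sin_sqr a b.
have ec : c*(pi^+2/8) = 2*4^+n.
 rewrite /c; have -> : (4 : R) = 2^+2 by rewrite expr2; lra.
 rewrite -exprM mulnC exprM !exprS; move: (pi : R) p0 => P P0.
 by fld.
have ec2 : c*(pi^+2/16/2^+n) = 2^+n.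
 rewrite /c !exprS; move: (pi : R) p0 => P P0.
 by fld.
apply/andP; split; rewrite -(ler_pM2l c0) ?mulrBr ec ?ec2 //.
lra.
Qed.

Definition alt_sum (N : nat) : R := \sum_(0 <= e < N) (-1)^+e/(e.+1)%:R^+2.
Definition sq_sum (N : nat) : R := \sum_(0 <= e < N) ((e.+1)%:R^+2)^-1.

Lemma sum_pairs N (f : nat -> R) :
 \sum_(0 <= e < N + N) f e = \sum_(0 <= k < N) f k.*2 + \sum_(0 <= k < N) f k.*2.+1.
elim: N => [|N IH]; first by rewrite !big_geq // addr0.
by rewrite addnS addSn !big_nat_recr //= IH addnn; ring.
Qed.

Lemma alt_sum_even N :
 alt_sum (N + N) = \sum_(0 <= k < N) (jj k^+2)^-1 - sq_sum N/4.
rewrite /alt_sum sum_pairs /sq_sum mulr_suml -sumrN; congr (_ + _).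
 by apply: eq_big_nat => k _; rewrite -mul2n exprM sqrrN !expr1n mul1r mul2n.
apply: eq_big_nat => k _; rewrite exprS -mul2n exprM sqrrN !expr1n.
rewrite (_ : (2 * k).+2 = 2 * k.+1)%N; last by lia.
have k0 : (k.+1)%:R != 0 :> R by rewrite pnatr_eq0.
by fld.
Qed.

Lemma sq_sum_even N :
 sq_sum (N + N) = \sum_(0 <= k < N) (jj k^+2)^-1 + sq_sum N/4.
rewrite /sq_sum sum_pairs mulr_suml; congr (_ + _).
apply: eq_big_nat => k _.
rewrite (_ : k.*2.+2 = 2 * k.+1)%N; last by lia.
have k0 : (k.+1)%:R != 0 :> R by rewrite pnatr_eq0.
by fld.
Qed.

Lemma sq_sum_diff N : (0 < N)%N -> 0 <= sq_sum (N + N) - sq_sum N <= N%:R^-1.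
move=> N0; rewrite /sq_sum (@big_cat_nat _ _ _ N 0 (N + N)) //= ?leq_addr // addrAC subrr add0r.
have n0 : 0 < N%:R :> R by rewrite ltr0n.
apply/andP; split; first by pz; rewrite invr_ge0 sqr_ge0.
via (\sum_(N <= k < N + N) (N%:R^+2)^-1).
 apply: ler_sum_nat => k /andP[Nk _].
 rewrite lef_pV2 ?posrE ?exprn_gt0 // lerXn2r ?nnegrE // ler_nat; lia.
rewrite sumr_const_nat addKn -[_ *+ N]mulr_natr expr2 invfM -mulrA mulVf ?mulr1 //.
by pz.
Qed.

(** Let [B] be the sum of inverse odd squares. The two splittings by parity, together with
    [sq_sum (N + N)] being close to [sq_sum N], give [sq_sum N] near [4 B / 3]; so the alternating
    sum is near [2 B / 3], where [B] is near [pi^2 / 8]. *)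
Lemma alt_sum_lim n : `|alt_sum (2 ^ n + 2 ^ n) - pi^+2/12| <= 2/2^+n.
have := sum_odd_inv n; set B := \sum_(_ <= _ < _) _ => hB.
have N0 : (0 < 2 ^ n)%N by rewrite expn_gt0.
have := sq_sum_diff N0; rewrite sq_sum_even alt_sum_even -/B natrX.
have p2 := pihalf_lt2 R; have p0 := pi_gt0 R.
have pp : pi^+2 <= 16 :> R by rewrite (_ : 16 = 4^+2) ?ler_sqr ?nnegrE; [lra|lra|lra|rewrite expr2; lra].
have t0 : 0 < (2^+n)^-1 :> R by rewrite invr_gt0 exprn_gt0.
move: hB; rewrite ler_norml; move: (_^-1) t0 => w w0 /andP[b1 b2] /andP[z1 z2].
have : pi^+2/16 * w <= w by rewrite -[leRHS]mul1r ler_pM2r //; lra.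
lra.
Qed.

End Basel.

(** * Central differences with explicit remainders *)

Section Taylor.
Variable R : realType.
Implicit Types (x y s d D B : R).

Lemma abs_le_pow (f df : R -> R) (k : nat) (c D : R) :
 (forall x, is_derive x 1 f (df x)) -> f 0 = 0 ->
 (forall x, 0 <= x <= D -> `|df x| <= c * x^+k) ->
 forall d, 0 <= d <= D -> `|f d| <= c/(k.+1)%:R * d^+k.+1.
move=> Df f0 hdf d /andP[d0 dD].
have k0 : (k.+1)%:R != 0 :> R by rewrite pnatr_eq0.
have Dp (x : R) : is_derive x 1 (fun y : R => c/(k.+1)%:R * y^+k.+1) (c * x^+k).
 have E : (fun y : R => c/(k.+1)%:R * y^+k.+1) = (c/(k.+1)%:R) \*: ((id : R -> R)^+k.+1).
 apply/funext => y; rewrite /= /GRing.scale /=; congr (_ * _).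
 by elim: (k.+1) => [|m IH]; rewrite // !exprS IH.
 rewrite E; apply: (is_derive_eq (is_deriveZ (c/(k.+1)%:R) (is_deriveX k.+1 (is_derive_id x (1 : R))))).
 by rewrite /GRing.scale /= mulr1 mulrA divfK.
rewrite ler_norml; apply/andP; split.
 rewrite -subr_ge0 opprK.
 have -> : 0 = f 0 + c/(k.+1)%:R*0^+k.+1 by rewrite f0 expr0n /= mulr0 addr0.
 apply: (@le_of_derive _ (fun x => f x + c/(k.+1)%:R * x^+k.+1) (fun x => df x + c * x^+k) _ _ d0).
 move=> x /andP[x0 xd]; have := hdf x; rewrite x0 (le_trans xd dD) ler_norml => /(_ isT) /andP[]; lra.
rewrite -subr_ge0.
have -> : 0 = c/(k.+1)%:R*0^+k.+1 - f 0 by rewrite f0 expr0n /= mulr0 subr0.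
apply: (@le_of_derive _ (fun x => c/(k.+1)%:R * x^+k.+1 - f x) (fun x => c * x^+k - df x) _ _ d0).
move=> x /andP[x0 xd]; have := hdf x; rewrite x0 (le_trans xd dD) ler_norml => /(_ isT) /andP[]; lra.
Qed.

Lemma is_derive_shift (f df : R -> R) (x : R) : (forall x, is_derive x 1 f (df x)) ->
 forall d, is_derive d 1 (fun d => f (x + d)) (df (x + d)).
move=> Df d; have g1 : is_derive d 1 (fun d : R => x + d) (1 : R).
 by apply: (is_derive_eq (is_deriveD (is_derive_cst x d 1) (is_derive_id d (1 : R)))); rewrite add0r.
by have := is_derive1_comp (Df (x + d)) g1; rewrite mulr1.
Qed.

Lemma is_derive_shiftN (f df : R -> R) (x : R) : (forall x, is_derive x 1 f (df x)) ->
 forall d, is_derive d 1 (fun d => f (x - d)) (- df (x - d)).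
move=> Df d; have g1 : is_derive d 1 (fun d : R => x - d) (- 1 : R).
 by apply: (is_derive_eq (is_deriveB (is_derive_cst x d 1) (is_derive_id d (1 : R)))); rewrite sub0r.
by have := @is_derive1_comp R f (fun d : R => x - d) d _ _ (Df (x - d)) g1; rewrite mulrN1.
Qed.

Section Chain.
Variables (f0 f1 f2 f3 f4 : R -> R) (x D B : R).
Hypotheses (D0 : forall x, is_derive x 1 f0 (f1 x)) (D1 : forall x, is_derive x 1 f1 (f2 x))
 (D2 : forall x, is_derive x 1 f2 (f3 x)) (D3 : forall x, is_derive x 1 f3 (f4 x)).
Hypothesis B4 : forall y, x - D <= y <= x + D -> `|f4 y| <= B.

Let h3 d : 0 <= d <= D -> `|f3 (x + d) - f3 (x - d)| <= 2 * B * d.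
move=> hd.
have := @abs_le_pow (fun d => f3 (x + d) - f3 (x - d)) (fun d => f4 (x + d) + f4 (x - d)) 0 (2 * B) D.
move=> h; rewrite -[2 * B]divr1 -[X in _ * X]expr1; apply: h => //.
- move=> y; have := is_deriveB (is_derive_shift x D3 y) (is_derive_shiftN x D3 y).
 by rewrite opprK.
- by rewrite addr0 subr0 subrr.
move=> y /andP[y0 yD]; rewrite expr0 mulr1; lel (ler_normD _ _).
have a : `|f4 (x + y)| <= B by apply: B4; apply/andP; split; lra.
have b : `|f4 (x - y)| <= B by apply: B4; apply/andP; split; lra.
lra.
Qed.

Let h2 d : 0 <= d <= D -> `|f2 (x + d) + f2 (x - d) - 2 * f2 x| <= B * d^+2.
move=> hd.
have := @abs_le_pow (fun d => f2 (x + d) + f2 (x - d) - 2 * f2 x) (fun d => f3 (x + d) - f3 (x - d)) 1 (2 * B) D.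
have -> : 2 * B/2 = B by lra.
move=> h; apply: h => //.
- move=> y; have := is_deriveD (is_derive_shift x D2 y) (is_derive_shiftN x D2 y).
 by move=> h; apply: is_derive_eq; rewrite subr0.
- by rewrite addr0 subr0; ring.
Qed.

Lemma central_diff1 d : 0 <= d <= D -> `|f1 (x + d) - f1 (x - d) - 2 * d * f2 x| <= B/3 * d^+3.
apply: (@abs_le_pow (fun d => f1 (x + d) - f1 (x - d) - 2 * d * f2 x) (fun d => f2 (x + d) + f2 (x - d) - 2 * f2 x) 2 B D) => //.
- move=> y; have := is_deriveB (is_derive_shift x D1 y) (is_derive_shiftN x D1 y).
 by move=> h; apply: is_derive_eq; rewrite /GRing.scale /= opprK; ring.
- by rewrite addr0 subr0; ring.
Qed.

(** The remainder vanishes at [d = 0] and its derivative is the remainder of [central_diff1].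
    Starting from the bound [B] on the fourth derivative, each use of [abs_le_pow] raises the power
    of [d] by one. *)
Lemma central_diff2 d : 0 <= d <= D -> `|f0 (x + d) + f0 (x - d) - 2 * f0 x - d^+2 * f2 x| <= B/12 * d^+4.
have e : B/3/4 = B/12 by lra.
rewrite -e; apply: (@abs_le_pow (fun d => f0 (x + d) + f0 (x - d) - 2 * f0 x - d^+2 * f2 x)
 (fun d => f1 (x + d) - f1 (x - d) - 2 * d * f2 x) 3 (B/3) D).
- move=> y; have := is_deriveD (is_derive_shift x D0 y) (is_derive_shiftN x D0 y).
 by move=> h; is_der; ring.
- by rewrite addr0 subr0; ring.
by move=> y hy; apply: central_diff1.
Qed.

End Chain.
End Taylor.

(** * The Fermi-Dirac function and its derivatives *)

Section FermiDirac.
Variable R : realType.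
Implicit Types (x y s d X : R).
Local Notation jj := (@jj R).

Definition fd (x : R) : R := (1 + expR x)^-1.
(** The derivatives are kept as polynomials in [fd], starting from [fd' = - fd (1 - fd)]; this makes
    differentiation algebraic and leaves a factor [fd], hence exponential decay, in each of them. *)
Definition fd1 x := - (fd x*(1 - fd x)).
Definition fd2 x := (2 * fd x - 1) * fd1 x.
Definition fd3 x := 2 * fd1 x^+2 + (2 * fd x - 1) * fd2 x.
Definition fd4 x := 6 * fd1 x * fd2 x + (2 * fd x - 1) * fd3 x.

Lemma is_derive_fd x : is_derive x 1 fd (fd1 x).
have e0 := expR_gt0 x; have n0 : 1 + expR x != 0 by rewrite gt_eqF //; lra.
have h : is_derive x 1 (fun x : R => 1 + expR x) (expR x).
 by apply: (is_derive_eq (is_deriveD (is_derive_cst (1 : R) x (1 : R)) (is_derive_expR x))); rewrite add0r.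
have := @is_deriveV R (fun x => 1 + expR x) x (expR x) 1 n0 h.
move=> h2; apply: is_derive_eq; rewrite /fd1 /fd /GRing.scale /=; field.
exact: n0.
Qed.

Lemma is_derive_fd1 x : is_derive x 1 fd1 (fd2 x).
have h := is_derive_fd x; apply: is_derive_eq; rewrite /fd2 /GRing.scale /=; ring.
Qed.

Lemma is_derive_fd2 x : is_derive x 1 fd2 (fd3 x).
have h := is_derive_fd x; have h1 := is_derive_fd1 x.
apply: is_derive_eq; rewrite /fd3 /GRing.scale /=; ring.
Qed.

Lemma is_derive_fd3 x : is_derive x 1 fd3 (fd4 x).
have h := is_derive_fd x; have h1 := is_derive_fd1 x; have h2 := is_derive_fd2 x.
apply: is_derive_eq; rewrite /fd4 /fd3 /fd2 /GRing.scale /=; ring.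
Qed.

Definition gf x := x * fd x.
Definition gf1 x := fd x + x * fd1 x.
Definition gf2 x := 2 * fd1 x + x * fd2 x.
Definition gf3 x := 3 * fd2 x + x * fd3 x.
Definition gf4 x := 4 * fd3 x + x * fd4 x.

Lemma is_derive_gf x : is_derive x 1 gf (gf1 x).
have h := is_derive_fd x; apply: is_derive_eq; rewrite /gf1 /GRing.scale /=; ring.
Qed.
Lemma is_derive_gf1 x : is_derive x 1 gf1 (gf2 x).
have h := is_derive_fd x; have h1 := is_derive_fd1 x.
apply: is_derive_eq; rewrite /gf2 /GRing.scale /=; ring.
Qed.
Lemma is_derive_gf2 x : is_derive x 1 gf2 (gf3 x).
have h := is_derive_fd1 x; have h1 := is_derive_fd2 x.
apply: is_derive_eq; rewrite /gf3 /GRing.scale /=; ring.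
Qed.
Lemma is_derive_gf3 x : is_derive x 1 gf3 (gf4 x).
have h := is_derive_fd2 x; have h1 := is_derive_fd3 x.
apply: is_derive_eq; rewrite /gf4 /GRing.scale /=; ring.
Qed.

Lemma fd_bounds x : 0 < fd x <= 1 /\ fd x <= expR (- x).
have e0 := expR_gt0 x; have e1 : 0 < 1 + expR x by lra.
rewrite expRN /fd invr_gt0 e1 invf_le1 // lef_pV2 //.
lra.
Qed.

Lemma fd_derivs_le x : [/\ `|fd1 x| <= fd x, `|fd2 x| <= fd x, `|fd3 x| <= 3 * fd x & `|fd4 x| <= 9 * fd x].
have [/andP[p0 p1] _] := fd_bounds x.
have c : `|2 * fd x - 1| <= 1 by rewrite ler_norml; apply/andP; split; lra.
have a1 : `|fd1 x| <= fd x.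
 rewrite /fd1 normrN ger0_norm ?mulr_ge0 //; [|lra|lra].
 by rewrite -[leRHS]mulr1 ler_wpM2l; lra.
have a1' : `|fd1 x| <= 1 by lra.
have cm (u v : R) : `|u| <= v -> `|(2 * fd x - 1) * u| <= v.
 by move=> uv; rewrite normrM -[leRHS]mul1r ler_pM.
have a2 : `|fd2 x| <= fd x by exact: cm.
have a3 : `|fd3 x| <= 3 * fd x.
 lel (ler_normD _ _).
 have : `|2 * fd1 x^+2| <= 2 * fd x.
 rewrite normrM normrX (ger0_norm (ler0n R 2)) ler_pM2l // expr2 -[leRHS]mulr1.
 exact: ler_pM.
 have := cm _ _ a2; lra.
split => //.
lel (ler_normD _ _).
have : `|6 * fd1 x * fd2 x| <= 6 * fd x.
 have -> : `|6 * fd1 x * fd2 x| = 6*(`|fd1 x| * `|fd2 x|).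
 by move: (fd1 x) (fd2 x) => u v; rewrite !normrM (ger0_norm (ler0n R 6)) mulrA.
 by rewrite ler_pM2l // -[leRHS]mul1r ler_pM.
have := cm _ _ a3; lra.
Qed.

Lemma x_expRN_half x : 0 <= x -> x * expR (- x) <= 2 * expR (- (x/2)).
move=> x0; have -> : expR (- x) = expR (- (x/2)) * expR (- (x/2)) by rewrite -expRD; congr expR; lra.
have h := @pow_expRN R 1 (x/2) ltac:(lra); rewrite expr1 (_ : 1`! = 1%N) // in h.
rewrite mulrA ler_wpM2r //; lra.
Qed.

Lemma expRN_half x : 0 <= x -> expR (- x) <= expR (- (x/2)).
Proof. by move=> x0; rewrite ler_expR; lra. Qed.

Lemma gf4_le x : 0 <= x -> `|gf4 x| <= 30 * expR (- (x/2)).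
move=> x0; have [_ _ a3 a4] := fd_derivs_le x; have [_ b] := fd_bounds x.
lel (ler_normD _ _); rewrite !normrM (ger0_norm x0) (ger0_norm (ler0n R 4)).
have := x_expRN_half x0; have := expRN_half x0.
have : x * `|fd4 x| <= x*(9 * expR (- x)) by rewrite ler_wpM2l //; lra.
lra.
Qed.

Lemma gf1_le x : 0 <= x -> `|gf1 x| <= (1 + x) * expR (- x).
move=> x0; have [a1 _ _ _] := fd_derivs_le x; have [/andP[b0 _] b] := fd_bounds x.
lel (ler_normD _ _); rewrite normrM (ger0_norm x0) (ger0_norm (ltW b0)).
have : x * `|fd1 x| <= x * expR (- x) by rewrite ler_wpM2l //; lra.
lra.
Qed.

Lemma gf1_0 : gf1 0 = 2^-1.
Proof. by rewrite /gf1 mul0r addr0 /fd expR0. Qed.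

End FermiDirac.

(** * Asymptotics of the mean weight with its constant term *)

Section MeanSum.
Variable R : realType.
Implicit Types (x y s d X : R).
Local Notation jj := (@jj R).

(** A midpoint Riemann sum for the integral of [x fd x], with cells of width [2 s] centred at
    [s (2 i + 1)]. *)
Definition msum s M : R := \sum_(0 <= i < M) 2 * s * gf (s * jj i).

Lemma msumE s M : msum s M = 2 * s^+2 * bmean (bp s) M.
rewrite /msum /bmean -(big_mkord xpredT (fun i => jj i * bp s i)) mulr_sumr.
by bigr i; rewrite /gf /fd /bp; ring.
Qed.

Lemma sum_exp_le s M : 0 < s <= 1 -> \sum_(0 <= i < M) expR (- (s * i%:R)) <= 2/s.
move=> /andP[s0 s1].
have key : (\sum_(0 <= i < M) expR (- (s * i%:R))) * (1 - expR (- s)) = 1 - expR (- (s * M%:R)).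
 elim: M => [|M IH]; first by rewrite big_geq // mul0r mulr0 oppr0 expR0 subrr.
 rewrite big_nat_recr //= mulrDl IH (natS R M).
 have -> : - (s*(M%:R + 1)) = - (s * M%:R) + - s :> R by ring.
 by rewrite expRD; ring.
have ge : s/2 <= 1 - expR (- s).
 have h : expR (- s) <= (1 + s)^-1.
 by rewrite expRN lef_pV2 ?posrE ?expR_gt0 ?expR_ge1Dx; lra.
 have : (1 + s)^-1 <= 1 - s/2.
 rewrite -div1r ler_pdivrMr; last lra.
 have ss : s * s <= s*1 by rewrite ler_pM2l.
 lra.
 lra.
have i0 : 0 <= \sum_(0 <= i < M) expR (- (s * i%:R)) by apply: sumr_ge0 => i _; exact: expR_ge0.
rewrite ler_pdivlMr //; have := ler_wpM2l i0 ge; rewrite key.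
have := expR_ge0 (- (s * M%:R)); lra.
Qed.

Lemma telescope_cells (F : R -> R) s M :
 \sum_(0 <= i < M) (F (s * jj i + s) - F (s * jj i - s)) = F (2 * s * M%:R) - F 0.
elim: M => [|M IH]; first by rewrite big_geq // mulr0 subrr.
rewrite big_nat_recr //= IH jjE (natS R M).
have -> : s*(2 * M%:R + 1) + s = 2 * s*(M%:R + 1) by ring.
have -> : s*(2 * M%:R + 1) - s = 2 * s * M%:R by ring.
ring.
Qed.

Lemma sum_triple M (f : nat -> R) :
 \sum_(0 <= k < 3 * M) f k = \sum_(0 <= i < M) (f (3 * i)%N + f (3 * i + 1)%N + f (3 * i + 2)%N).
elim: M => [|M IH]; first by rewrite muln0 !big_geq.
have -> : (3 * M.+1 = (3 * M).+3)%N by rewrite mulnS.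
rewrite !big_nat_recr //= IH addn1 addn2; ring.
Qed.

Lemma gf4_cell s i : 0 < s -> forall y, s * jj i - s <= y <= s * jj i + s ->
 `|gf4 y| <= 30 * expR (- (s * i%:R)).
move=> s0 y; rewrite jjE => /andP[y1 _].
have i0 : 0 <= s * i%:R by rewrite mulr_ge0 ?ler0n // ltW.
have y0 : 0 <= y by lra.
by lel (gf4_le y0); rewrite ler_pM2l // ler_expR; lra.
Qed.

(** Cutting each cell in three keeps its midpoint and adds two nodes at distance [dl = 2 s / 3], so
    the change is a sum of second differences of [gf]. Its main part is [dl^2] times the sum of
    [gf2], and that sum is close to [(gf1 X - gf1 0) / (2 s)] with [gf1 0 = 1/2]; this produces the
    coefficient 2/27. *)
Lemma refine s M : 0 < s <= 1 ->
 `|msum s M - msum (s/3) (3 * M) - 2/27 * s^+2| <=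
 s^+2*((1 + 2 * s * M%:R) * expR (- (2 * s * M%:R))) + 4 * s^+4.
move=> /andP[s0 s1]; set X := 2 * s * M%:R; set W := (1 + X) * expR (- X).
have X0 : 0 <= X by rewrite mulr_ge0 ?ler0n //; lra.
pose dl := 2 * s/3.
pose J := \sum_(0 <= i < M) (gf (s * jj i + dl) + gf (s * jj i - dl) - 2 * gf (s * jj i)).
pose G2 := \sum_(0 <= i < M) gf2 (s * jj i).
have dls : 0 <= dl <= s by apply/andP; split; rewrite /dl; lra.
have sB : \sum_(0 <= i < M) 30 * expR (- (s * i%:R)) <= 60/s.
 rewrite -mulr_sumr; have := @sum_exp_le s M; rewrite s0 s1 => /(_ isT); lra.
have eJ : msum s M - msum (s/3) (3 * M) = - (dl * J).
 rewrite /msum sum_triple -sumrB /J mulr_sumr -sumrN; bigr i.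
 have -> : s/3 * jj (3 * i) = s * jj i - dl by rewrite !jjE natrM /dl; field.
 have -> : s/3 * jj (3 * i + 1) = s * jj i by rewrite !jjE natrD natrM; field.
 have -> : s/3 * jj (3 * i + 2) = s * jj i + dl by rewrite !jjE natrD natrM /dl; field.
 by rewrite /dl; field.
have hJ : `|J - dl^+2 * G2| <= dl^+4/12*(60/s).
 rewrite /J /G2 mulr_sumr -sumrB; lel (ler_norm_sum _ _ _).
 have dl4 : 0 <= dl^+4/12 by rewrite divr_ge0 ?exprn_ge0 //; case/andP: dls.
 apply: le_trans (ler_wpM2l dl4 sB); rewrite mulr_sumr; lsum i.
 have := @central_diff2 R (@gf R) (@gf1 R) (@gf2 R) (@gf3 R) (@gf4 R) (s * jj i) s
 (30 * expR (- (s * i%:R))) (@is_derive_gf R) (@is_derive_gf1 R) (@is_derive_gf2 R) (@is_derive_gf3 R)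
 (gf4_cell s0) dl dls.
 lra.
have hG : `|(gf1 X - 2^-1) - 2 * s * G2| <= s^+3/3*(60/s).
 rewrite -gf1_0 /X -telescope_cells /G2 mulr_sumr -sumrB; lel (ler_norm_sum _ _ _).
 have s3 : 0 <= s^+3/3 by rewrite divr_ge0 ?exprn_ge0 // ltW.
 apply: le_trans (ler_wpM2l s3 sB); rewrite mulr_sumr; lsum i.
 have ss : 0 <= s <= s by rewrite lexx ltW.
 have := @central_diff1 R (@gf1 R) (@gf2 R) (@gf3 R) (@gf4 R) (s * jj i) s
 (30 * expR (- (s * i%:R))) (@is_derive_gf1 R) (@is_derive_gf2 R) (@is_derive_gf3 R)
 (gf4_cell s0) s ss.
 lra.
have hX := gf1_le X0; rewrite -/W in hX.
rewrite eJ.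
have e1 : dl^+4/12*(60/s) = 80/81 * s^+3 by rewrite /dl; fld.
have e2 : s^+3/3*(60/s) = 20 * s^+2 by fld.
rewrite e1 in hJ; rewrite e2 in hG.
set e := J - dl^+2 * G2 in hJ; set e' := (gf1 X - 2^-1) - 2 * s * G2 in hG.
have -> : - (dl * J) - 2/27 * s^+2 = - (2/3*(s * e)) + 4/27*(s^+2 * e') - 4/27*(s^+2 * gf1 X).
 by rewrite /e /e' /dl; field.
have n1 : `|s * e| <= 80/81 * s^+4.
 rewrite normrM (ger0_norm (ltW s0)) (_ : 80/81 * s^+4 = s*(80/81 * s^+3)); last by ring.
 by pz.
have n2 : `|s^+2 * e'| <= 20 * s^+4.
 rewrite normrM (ger0_norm (sqr_ge0 s)) (_ : 20 * s^+4 = s^+2*(20 * s^+2)); last by ring.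
 by pz.
have n3 : `|s^+2 * gf1 X| <= s^+2 * W.
 by rewrite normrM (ger0_norm (sqr_ge0 s)) ler_pM2l // exprn_gt0.
have s4 : 0 <= s^+4 by rewrite exprn_ge0 // ltW.
move: n1 n2 n3; move: (s * e) (s^+2 * e') (s^+2 * gf1 X) (s^+2 * W) => a b c w.
rewrite !ler_norml => /andP[a1 a2] /andP[b1 b2] /andP[c1 c2].
lra.
Qed.

(** Summing [2/27 s^2 / 9^j] over the refinements gives [s^2 / 12] in the limit: the Euler-Maclaurin
    correction of the midpoint rule, obtained without an integral. *)
Lemma refine_iter k s M : 0 < s <= 1 ->
 `|msum s M - msum (s/3^+k) (3 ^ k * M) - s^+2/12*(1 - (9^+k)^-1)| <=
 2 * s^+2*((1 + 2 * s * M%:R) * expR (- (2 * s * M%:R))) + 5 * s^+4.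
elim: k s M => [|k IH] s M /andP[s0 s1].
 rewrite !expr0 divr1 mul1n invr1 !subrr mulr0 subr0 normr0.
 have : 0 <= 2 * s * M%:R by pz.
 move: (2 * s * M%:R) => X X0; rewrite addr_ge0 ?mulr_ge0 //; lra.
have s3 : 0 < s/3 <= 1 by apply/andP; split; lra.
have := IH (s/3) (3 * M)%N s3.
have := @refine s M; rewrite s0 s1 => /(_ isT).
have -> : 2*(s/3) * (3 * M)%:R = 2 * s * M%:R by rewrite natrM; field.
have -> : s/3/3^+k = s/3^+k.+1 by rewrite exprS; field; rewrite expf_neq0.
have -> : (3 ^ k*(3 * M) = 3 ^ k.+1 * M)%N by rewrite mulnA [(3 ^ k*3)%N]mulnC -expnS.
have X0 : 0 <= 2 * s * M%:R by rewrite mulr_ge0 ?ler0n //; lra.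
have -> : (9^+k.+1)^-1 = (9^+k)^-1/9 :> R by rewrite exprSr invfM.
have -> : (s/3)^+2 = s^+2/9 by rewrite expr_div_n; lra.
have -> : (s/3)^+4 = s^+4/81 by rewrite expr_div_n; lra.
have : 0 <= (1 + 2 * s * M%:R) * expR (- (2 * s * M%:R)) by pz.
have : 0 <= s^+4 by pz.
have : 0 <= s^+2 by pz.
move: (msum s M) (msum _ _) (msum _ _) (s^+2) (s^+4) ((1 + _) * _) ((9^+k)^-1) => a b c q r W i.
move=> q0 r0 W0; have := mulr_ge0 q0 W0; rewrite !ler_norml => qW /andP[h1 h2] /andP[h3 h4].
lra.
Qed.

Definition ge_ (e : R) x := - ((x/e + (e^+2)^-1) * expR (- (e * x))).
Definition fe_ (e : R) x := x * expR (- (e * x)).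
Definition fe1_ (e : R) x := (1 - e * x) * expR (- (e * x)).
Definition fe2_ (e : R) x := (e^+2 * x - 2 * e) * expR (- (e * x)).

Lemma is_derive_expRN (e x : R) : is_derive x 1 (fun x => expR (- (e * x))) (- e * expR (- (e * x))).
have h : is_derive x 1 (fun x : R => - (e * x)) (- e).
 by apply: is_derive_eq; rewrite /GRing.scale /= mulr1.
by have := @is_derive1_comp R expR (fun x : R => - (e * x)) x _ _ (is_derive_expR _) h; rewrite mulrC.
Qed.

Lemma is_derive_ge e x : 0 < e -> is_derive x 1 (ge_ e) (fe_ e x).
move=> e0; have h := is_derive_expRN e x.
by apply: is_derive_eq; rewrite /fe_ /GRing.scale /=; fld.
Qed.
Lemma is_derive_fe e x : is_derive x 1 (fe_ e) (fe1_ e x).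
have h := is_derive_expRN e x.
by apply: is_derive_eq; rewrite /fe1_ /GRing.scale /=; ring.
Qed.
Lemma is_derive_fe1 e x : is_derive x 1 (fe1_ e) (fe2_ e x).
have h := is_derive_expRN e x.
by apply: is_derive_eq; rewrite /fe2_ /GRing.scale /=; ring.
Qed.

(** The same Riemann sum for [x exp (- e x)], of which [ge_] is a primitive. The geometric series of
    [fd] reduces the integral of [x fd x] to the alternating sum of [1 / e^2]. *)
Definition tsum (e s : R) M : R := \sum_(0 <= i < M) 2 * s * fe_ e (s * jj i).

Lemma tsum_approx e s M : 0 < e -> 0 < s ->
 `|tsum e s M - (ge_ e (2 * s * M%:R) - ge_ e 0)| <= e * s^+3 * M%:R.
move=> e0 s0; rewrite -telescope_cells /tsum -sumrB.
lel (ler_norm_sum _ _ _).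
have -> : e * s^+3 * M%:R = \sum_(0 <= i < M) (3 * e/3 * s^+3).
 have -> : 3 * e/3 = e by fld.
 rewrite sumr_const_nat subn0.
 by rewrite mulr_natr.
apply: ler_sum_nat => i _; rewrite distrC.
have ss : 0 <= s <= s by rewrite lexx ltW.
apply: (@central_diff1 R (ge_ e) (fe_ e) (fe1_ e) (fe2_ e) (s * jj i) s (3 * e)) => //.
- by move=> x; exact: is_derive_ge.
- by move=> x; exact: is_derive_fe.
- by move=> x; exact: is_derive_fe1.
move=> y /andP[y1 _].
have y0 : 0 <= y.
 apply: le_trans y1; rewrite jjE; have : 0 <= s * i%:R by pz.
 lra.
have ey : 0 <= e * y by rewrite mulr_ge0 // ltW.
rewrite /fe2_ mulrBl; lel (ler_normB _ _).
rewrite !ger0_norm; [|by rewrite !mulr_ge0 // ltW | by rewrite !mulr_ge0 // ltW].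
have h1 := @pow_expRN R 1 (e * y) ey; rewrite expr1 (_ : 1`! = 1%N) // in h1.
have h2 := expRN_le1 ey.
have -> : e^+2 * y * expR (- (e * y)) = e*(e * y * expR (- (e * y))) by ring.
have := ler_wpM2l (ltW e0) h1; have := ler_wpM2l (ltW e0) h2; lra.
Qed.

Lemma geom_alt (u : R) E : 0 <= u ->
 `|u/(1 + u) - \sum_(0 <= e < E) (-1)^+e * u^+e.+1| <= u^+E.+1.
move=> u0; have u1 : 0 < 1 + u by lra.
have -> : u/(1 + u) - \sum_(0 <= e < E) (-1)^+e * u^+e.+1 = (-1)^+E * u^+E.+1/(1 + u).
 elim: E => [|E IH]; first by rewrite big_geq // expr0 subr0 mul1r expr1.
 rewrite big_nat_recr //= opprD addrA IH !exprS; field; by pz.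
rewrite !normrM normrX normrN1 expr1n mul1r.
rewrite (ger0_norm (exprn_ge0 _ u0)) [`|_^-1|]ger0_norm; last by pz.
by rewrite -[leRHS]mulr1; apply: ler_wpM2l; [exact: exprn_ge0 | rewrite invf_le1; lra].
Qed.

Lemma msum_tsum s M E : 0 < s ->
 `|msum s M - \sum_(0 <= e < E) (-1)^+e * tsum (e.+1)%:R s M| <= tsum (E.+1)%:R s M.
move=> s0.
have -> : \sum_(0 <= e < E) (-1)^+e * tsum (e.+1)%:R s M =
 \sum_(0 <= i < M) 2 * s*(s * jj i) * \sum_(0 <= e < E) (-1)^+e * expR (- (s * jj i))^+e.+1.
 rewrite /tsum; under eq_bigr => e _ do rewrite mulr_sumr.
 rewrite exchange_big /=; bigr i; rewrite mulr_sumr; bigr e.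
 have -> : fe_ (e.+1)%:R (s * jj i) = s * jj i * expR (- (s * jj i))^+e.+1 by rewrite /fe_ -mulrN expRM_natl.
 ring.
rewrite /msum -sumrB; lel (ler_norm_sum _ _ _); lsum i.
have sj : 0 <= s * jj i by rewrite mulr_ge0 ?jj_ge0 // ltW.
have -> : gf (s * jj i) = s * jj i*(expR (- (s * jj i))/(1 + expR (- (s * jj i)))).
 by rewrite /gf -bpE.
have -> : fe_ (E.+1)%:R (s * jj i) = s * jj i * expR (- (s * jj i))^+E.+1 by rewrite /fe_ -mulrN expRM_natl.
have h := geom_alt E (expR_ge0 (- (s * jj i))).
set S := \sum_(_ <= _ < _) _ in h *.
have -> : 2 * s*(s * jj i*(expR (- (s * jj i))/(1 + expR (- (s * jj i))))) - 2 * s*(s * jj i) * S =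
 2 * s*(s * jj i) * (expR (- (s * jj i))/(1 + expR (- (s * jj i))) - S) by ring.
rewrite normrM ger0_norm; last by pz.
rewrite [leRHS]mulrA; apply: ler_wpM2l => //; apply: mulr_ge0 => //; lra.
Qed.

Lemma archi_pow (b y : R) : 2 <= b -> exists k : nat, y <= b^+k.
move=> b2; exists (Num.truncn `|y|).+1.
have /andP[_ h] : (Num.truncn `|y|)%:R <= `|y| < (Num.truncn `|y|).+1%:R.
 by apply: Num.Theory.truncn_itv.
lel (ler_norm y); lel (ltW h).
elim: (_.+1) => [|m IH]; first by [].
rewrite exprS natS; have : 1 <= b^+m by rewrite exprn_ege1; lra.
nra.
Qed.

(** The value [pi^2 / 12] is reached through an arbitrary [eta]: first [n] fixes the length [E] of
    the geometric expansion, then [k] the number of refinements, so large that the Riemann errors of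
    all [E + 1] terms, collected in [c], become negligible. *)
Lemma msum_lim s M : 0 < s <= 1 -> 1 <= 2 * s * M%:R ->
 `|msum s M - (pi^+2/12 + s^+2/12)| <=
 (2 * s^+2 + 2) * ((1 + 2 * s * M%:R) * expR (- (2 * s * M%:R))) + 5 * s^+4.
move=> s01 X1; have /andP[s0 s1] := s01.
set X := 2 * s * M%:R in X1 *; set W := (1 + X) * expR (- X).
have X0 : 0 <= X by lra.
have eX : expR (- X) <= 2^-1.
 via (expR (-1)); first by rewrite ler_expR lerN2.
 by rewrite expRN lef_pV2 ?posrE //; have := expR_ge1Dx (1 : R); lra.
have W0 : 0 <= W by rewrite mulr_ge0 ?expR_ge0 //; lra.
apply/ler_addgt0Pr => eta eta0.
have [n hn] := @archi_pow 2 (12/eta) (lexx _).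
pose E := (2 ^ n + 2 ^ n)%N.
pose c : R := \sum_(0 <= e < E.+1) (e.+1)%:R * X.
have c0 : 0 <= c by apply: sumr_ge0 => e _; rewrite mulr_ge0 ?ler0n.
have [k hk] := @archi_pow 9 ((c + 1) * (4/eta)) ltac:(lra).
have t0 : 0 < 2^+n :> R by rewrite exprn_gt0.
have k0 : 0 < 9^+k :> R by rewrite exprn_gt0.
pose s' := s/3^+k; pose M' := (3 ^ k * M)%N.
have s'0 : 0 < s' by rewrite divr_gt0 // exprn_gt0.
have eX' : 2 * s' * M'%:R = X.
 by rewrite /s' /M' natrM natrX /X; field; rewrite expf_neq0.
have s'2 : s'^+2 = s^+2/9^+k.
 rewrite /s' expr_div_n -exprM mulnC exprM; congr (_/_^+_).
 lra.
have s'le : s'^+2 <= (9^+k)^-1.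
 by rewrite s'2 -[leRHS]mul1r ler_pM2r // expr_le1 // ltW.
have hit := refine_iter k M s01; rewrite -/s' -/M' -/X -/W in hit.
have hms := msum_tsum M' E s'0.
have happ e : `|tsum (e.+1)%:R s' M' - (ge_ (e.+1)%:R X - ge_ (e.+1)%:R 0)| <= (e.+1)%:R * X * s'^+2/2.
 have := @tsum_approx (e.+1)%:R s' M' ltac:(by rewrite ltr0n) s'0; rewrite eX' => h.
 lel h; rewrite -eX' le_eqVlt; apply/orP; left; apply/eqP.
 by fld.
have ge0E e : ge_ (e.+1)%:R 0 = - ((e.+1)%:R^+2)^-1.
 by rewrite /ge_ mul0r add0r mulr0 oppr0 expR0 mulr1.
have geX e : `|ge_ (e.+1)%:R X| <= (1 + X) * (expR (- X))^+e.+1.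
 rewrite /ge_ normrN -expRM_natl mulrN.
 have e1 : 1 <= (e.+1)%:R :> R by rewrite ler1n.
 have i1 : (e.+1%:R)^-1 <= 1 :> R by rewrite invf_le1 //; lra.
 have i2 : (e.+1%:R^+2)^-1 <= 1 :> R by rewrite invf_le1 ?exprn_ege1 // exprn_gt0; lra.
 have i0 : 0 <= (e.+1%:R)^-1 :> R by rewrite invr_ge0; lra.
 have i3 : 0 <= (e.+1%:R^+2)^-1 :> R by rewrite invr_ge0 exprn_ge0 //; lra.
 rewrite ger0_norm; last by apply: mulr_ge0 (expR_ge0 _); apply: addr_ge0 i3; exact: mulr_ge0.
 by rewrite ler_wpM2r // addrC lerD // -[leRHS]mulr1 ler_wpM2l.
have hgeo m : \sum_(0 <= e < m) (expR (- X))^+e.+1 <= 2 * expR (- X).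
 have := expR_ge0 (- X); move: (expR (- X)) eX => q q2 q0.
 suff : \sum_(0 <= e < m) q^+e.+1 + 2 * q^+m.+1 <= 2 * q.
 by have := exprn_ge0 m.+1 q0; lra.
 elim: m => [|m IH]; first by rewrite big_geq // expr1 add0r.
 rewrite big_nat_recr //=; have := exprn_ge0 m.+1 q0; rewrite [q^+m.+2]exprS; nra.
set S := \sum_(0 <= e < E) _ in hms.
have hS : `|S - alt_sum R E| <= 2 * W + c/2 * s'^+2.
 have -> : S - alt_sum R E = \sum_(0 <= e < E) (-1)^+e*(tsum (e.+1)%:R s' M' - (e.+1%:R^+2)^-1).
 by rewrite /S /alt_sum -sumrB; bigr e; ring.
 lel (ler_norm_sum _ _ _).
 via (\sum_(0 <= e < E) ((1 + X) * (expR (- X))^+e.+1 + (e.+1)%:R * X * s'^+2/2)).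
 lsum e; rewrite normrM normrX normrN1 expr1n mul1r.
 have -> : tsum (e.+1)%:R s' M' - (e.+1%:R^+2)^-1 = ge_ (e.+1)%:R X +
 (tsum (e.+1)%:R s' M' - (ge_ (e.+1)%:R X - ge_ (e.+1)%:R 0)) by rewrite ge0E; ring.
 by lel (ler_normD _ _); rewrite lerD.
 rewrite big_split /= -mulr_sumr; apply: lerD.
 rewrite /W mulrCA ler_wpM2l //; lra.
 rewrite -!mulr_suml -[leLHS]mulrA [_/2 * _]mulrAC -[leRHS]mulrA; apply: ler_wpM2r.
 by rewrite divr_ge0 ?sqr_ge0.
 by rewrite /c big_nat_recr //= mulr_suml lerDl mulr_ge0.
have hT : tsum (E.+1)%:R s' M' <= (2^+n)^-1 + c/2 * s'^+2.
 have := happ E; rewrite ler_norml => /andP[_ h].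
 have g1 : ge_ (E.+1)%:R X <= 0.
 rewrite /ge_ oppr_le0 mulr_ge0 // addr_ge0 ?divr_ge0 //.
 have g2 : - ge_ (E.+1)%:R 0 <= (2^+n)^-1.
 rewrite ge0E opprK lef_pV2 ?posrE //.
 rewrite -natrX -natrX ler_nat; have := expn_gt0 2 n; rewrite /E; clear; nia.
 have g3 : (E.+1)%:R * X * s'^+2/2 <= c/2 * s'^+2.
 rewrite mulrAC; apply: ler_wpM2r; first exact: sqr_ge0.
 apply: ler_wpM2r => //; rewrite /c big_nat_recr //= lerDr.
 by apply: sumr_ge0 => e _; rewrite mulr_ge0.
 lra.
have hA := alt_sum_lim R n; rewrite -/E in hA.
have hn' : (2^+n)^-1 <= eta/12.
 by rewrite -[leRHS]invrK lef_pV2 ?posrE ?invr_gt0 ?divr_gt0 // invf_div.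
have hk' : (c + 1) * (9^+k)^-1 <= eta/4.
 by rewrite ler_pdivrMr // mulrC -ler_pdivrMr ?divr_gt0 // invf_div.
have cs : c * s'^+2 <= c*(9^+k)^-1 by rewrite ler_wpM2l.
have s2k : s^+2/12*(9^+k)^-1 <= (9^+k)^-1.
 rewrite -[leRHS]mul1r ler_pM2r //.
 have : s^+2 <= 1 by rewrite expr_le1 // ltW.
 lra.
have s2k0 : 0 <= s^+2/12*(9^+k)^-1 by rewrite mulr_ge0 ?divr_ge0 ?sqr_ge0 // invr_ge0 ltW.
have i90 : 0 < (9^+k)^-1 :> R by rewrite invr_gt0.
have W2 : 0 <= s^+2 * W by rewrite mulr_ge0 ?sqr_ge0.
move: hit hms hS hA; rewrite !ler_norml.
move: (msum s M) (msum s' M') (alt_sum R E) (tsum _ _ _) hT cs hk' hn' i90 s2k s2k0 W2.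
rewrite !mulrBr !mulr1 !mulrDl mul1r.
move: (c * s'^+2) (c/2 * s'^+2) (mulrAC c 2^-1 (s'^+2)) => cs2 d ed.
move: ed; move: (c*(9^+k)^-1) ((2^+n)^-1) => ck i2.
move: (s^+2/12*(9^+k)^-1) ((9^+k)^-1) (s^+4) => sk ik s4 ed.
move=> a b al ts h1 h2 h3 h4 h5 h6 h7 h8 /andP[a1 a2] /andP[b1 b2] /andP[c1 c2] /andP[d1 d2].
lra.
Qed.

Definition AA : R := pi^+2/24.

Lemma AA_gt0 : 0 < AA.
Proof. by rewrite divr_gt0 // exprn_gt0 // pi_gt0. Qed.

(** The truncation at [M] is harmless because [X = 2 s M >= AA / s], so [(1 + X) exp (- X)] is
    [O(s^4)]; the rest is [msum_lim] divided by [2 s^2]. *)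
Theorem bmean_asymp : exists2 C : R, 0 < C & forall s M, 0 < s <= 1/6 -> AA/2 <= s^+2 * M%:R ->
 `|bmean (bp s) M - (AA/s^+2 + 24^-1)| <= C * s^+2.
have A0 := AA_gt0.
have AA4 : 0 < AA^+4 by rewrite exprn_gt0.
pose k4 : R := 4`!%:R/AA^+4; pose k5 : R := 5`!%:R/AA^+4.
exists (k4*2 + k5*2 + 3).
 by rewrite !addr_gt0 // mulr_gt0 // divr_gt0 // ltr0n fact_gt0.
move=> s M /andP[s0 s6] hM.
have s01 : 0 < s <= 1 by apply/andP; split; lra.
set X := 2 * s * M%:R.
have hX : AA/s <= X.
 rewrite ler_pdivrMr // /X; have -> : 2 * s * M%:R * s = 2*(s^+2 * M%:R) by ring.
 lra.
have A6 : 1/6 <= AA.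
 rewrite /AA; have : 2^+2 <= pi^+2 :> R by rewrite ler_sqr ?nnegrE ?pi_ge2 ?pi_ge0.
 lra.
have X1 : 1 <= X.
 by apply: le_trans hX; rewrite ler_pdivlMr // mul1r; lra.
have := msum_lim s01 X1; rewrite -/X msumE.
set W := (1 + X) * expR (- X).
have X0 : 0 < X by lra.
have hW : W <= (k4 + k5) * s^+4.
 rewrite /k4 /k5 -mulrDl.
 have h4 := @pow_expRN R 4 X (ltW X0); have h5 := @pow_expRN R 5 X (ltW X0).
 have hWX : X^+4 * W <= 4`!%:R + 5`!%:R.
 have -> : X^+4 * W = X^+4 * expR (- X) + X^+5 * expR (- X) by rewrite /W; ring.
 exact: lerD.
 have hXA : (AA/s)^+4 <= X^+4.
 by apply: lerXn2r => //; rewrite nnegrE ltW // divr_gt0.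
 have W0 : 0 <= W by rewrite mulr_ge0 ?expR_ge0 //; lra.
 rewrite mulrAC ler_pdivlMr //.
 have -> : W * AA^+4 = (AA/s)^+4 * W * s^+4.
 by fld.
 apply: ler_wpM2r; first by rewrite exprn_ge0 // ltW.
 by apply: le_trans hWX; apply: ler_wpM2r.
have s2 : 0 < s^+2 by rewrite exprn_gt0.
have -> : 2 * s^+2 * bmean (bp s) M - (pi^+2/12 + s^+2/12) =
 2 * s^+2*(bmean (bp s) M - (AA/s^+2 + 24^-1)).
 by rewrite /AA; move: (pi^+2) => P; fld.
rewrite normrM ger0_norm; last by pz.
move: (`|_|) => d hd.
have s21 : s^+2 <= 1 by rewrite expr_le1 ?(ltW s0) //; lra.
have W0 : 0 <= W by rewrite mulr_ge0 ?expR_ge0 //; lra.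
have h1 : s^+2 * W <= W by rewrite -[leRHS]mul1r ler_wpM2r.
rewrite -(ler_pM2l s2).
have e4 : s^+4 = s^+2 * s^+2 by ring.
move: hd hW h1; rewrite e4.
move: (W) (s^+2) s2 s21 W0 => w q; clearbody k4 k5; clear => q0 q1 w0; nra.
Qed.

End MeanSum.

(** * Coefficient ratios as signed sums of exponentials *)

Section Mixture.
Variable R : realType.
Implicit Types (a s h : R) (V : pred nat) (n k : nat).
Local Notation jj := (@jj R).

Definition cpoly V M : {poly R} := \prod_(i < M) (if V i then 1 else 1 + 'X^(i.*2.+1)).

(** Exponential tilting on coefficients: [p] arises from [q] by substituting [r 'X] and multiplying
    by [c]. It passes to products ([geomM]), which yields [bpoly_geom], the independence of the
    conditioned measure from [s]. *)
Definition geom (c r : R) (p q : {poly R}) := forall m, p`_m = c * r^+m * q`_m.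

Lemma geomM c r p q c' p' q' :
 geom c r p q -> geom c' r p' q' -> geom (c * c') r (p * p') (q * q').
move=> h h' m; rewrite !coefM mulr_sumr; bigr j; rewrite h h'.
have -> : r^+m = r^+j * r^+(m - j) by rewrite -exprD subnKC // -ltnS.
ring.
Qed.

Lemma geomX r k : r != 0 -> geom (r^-1^+k) r 'X^k 'X^k.
move=> r0 m; rewrite coefXn; case: eqP => [->|_]; last by rewrite !mulr0.
by rewrite mulr1 exprVn mulVf // expf_neq0.
Qed.

Lemma one_bpE s i : 1 - bp s i = (1 + expR (- (s * jj i)))^-1.
Proof. by rewrite bpE; have := expR_ge0 (- (s * jj i)); move: (expR _) => u u0; field; rewrite gt_eqF; lra. Qed.

Lemma one_bp_gt0 s i : 0 < 1 - bp s i.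
Proof. by rewrite one_bpE invr_gt0; have := expR_ge0 (- (s * jj i)); lra. Qed.

Lemma one_bpM s i : (1 - bp s i) * expR (- (s * jj i)) = bp s i.
Proof. by rewrite one_bpE mulrC -bpE. Qed.

(** The probability that all sites outside [V] are empty, which is also the reciprocal of the
    partition function [cpoly V M] at [exp (- s)]. *)
Definition cnorm s V M : R := \prod_(i < M) (if V i then 1 else 1 - bp s i).

Lemma cnorm_gt0 s V M : 0 < cnorm s V M.
Proof. by apply: prodr_gt0 => i _; case: (V i) => //; exact: one_bp_gt0. Qed.

Lemma bpoly_geom s V M : geom (cnorm s V M) (expR (- s)) (bpoly (bpV s V) M) (cpoly V M).
elim: M => [|M IH].
 move=> m; rewrite /bpoly /cnorm /cpoly !big_ord0 coef1; case: m => [|m]; last by rewrite mulr0.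
 by rewrite expr0 !mulr1.
rewrite /bpoly /cnorm /cpoly !big_ord_recr /=; apply: geomM IH _ => m.
rewrite /bfactor /bpV; case: (V M).
 rewrite subr0 polyC0 mul0r addr0 polyC1 coef1 mul1r; case: m => [|m]; last by rewrite mulr0.
 by rewrite expr0 mulr1.
rewrite coefD coefC coefCM coefD coef1 !coefXn.
case: m => [|m] /=; first by rewrite expr0 !mulr0 !addr0 !mulr1.
case: eqP => [[->]|_]; last by rewrite !(mulr0, addr0).
rewrite !add0r !mulr1 -expRM_natl.
have -> : (M.*2.+1)%:R * - s = - (s * jj M) by rewrite mulrN mulrC.
by rewrite one_bpM.
Qed.

Lemma coef_shift_geom s V M k m :
 ('X^k * bpoly (bpV s V) M)`_m =
 expR s^+k * cnorm s V M * expR (- s)^+m*('X^k * cpoly V M)`_m.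
have e0 : expR (- s) != 0 by rewrite gt_eqF ?expR_gt0.
have := geomM (geomX k e0) (@bpoly_geom s V M) => /(_ m) ->.
by rewrite expRN invrK.
Qed.

Lemma cpoly_peel V M i : (i < M)%N -> ~~ V i ->
 cpoly V M = (1 + 'X^(i.*2.+1)) * cpoly (predU1 i V) M.
move=> iM Vi; pose o := Ordinal iM.
rewrite /cpoly (bigD1 o) //= (negbTE Vi) [in RHS](bigD1 o) //= eqxx /= mul1r; congr (_ * _).
apply: eq_bigr => j jo; case: (eqVneq (val j) i) => //= ji.
by case/eqP: jo; apply: val_inj.
Qed.

(* Generating polynomial of the D containing O1 and avoiding O0. *)
Lemma pattern_poly n (O0 O1 : pred nat) : (forall i, ~~ (O0 i && O1 i)) ->
 \sum_(D : {set 'I_n} | [forall i : 'I_n, (O1 i ==> (i \in D)) && (O0 i ==> (i \notin D))]) 'X^(weight D)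
 = 'X^(\sum_(i < n | O1 i) i.*2.+1) * cpoly (predU O0 O1) n :> {poly R}.
move=> dis.
have -> : 'X^(\sum_(i < n | O1 i) i.*2.+1) * cpoly (predU O0 O1) n =
 \prod_(i < n) ((if O0 i then 0 else 'X^(i.*2.+1)) + (if O1 i then 0 else 1)) :> {poly R}.
 rewrite /cpoly.
 have -> : 'X^(\sum_(i < n | O1 i) i.*2.+1) = \prod_(i < n) (if O1 i then 'X^(i.*2.+1) else 1) :> {poly R}.
 by rewrite -big_mkcond (big_morph (fun k => 'X^k) (@exprD _ 'X) (@expr0 _ 'X)).
 rewrite -big_split /=; bigr i; have := dis i; rewrite /predU /=.
 by case: (O0 i); case: (O1 i) => //= _; rewrite ?mulr1 ?mul1r ?add0r ?addr0 // addrC.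
rewrite bigA_distr big_mkcond /=; bigr D.
case: ifP => [/forallP h|/forallPn[i hi]].
 rewrite /weight (big_morph (fun k => 'X^k) (@exprD _ 'X) (@expr0 _ 'X)) big_mkcond /=.
 bigr i; have /andP[/implyP h1 /implyP h2] := h i.
 case: ifP h1 h2 => iD h1 h2; first by case: (O0 i) h2 => // /(_ isT).
 by case: (O1 i) h1 => // /(_ isT).
rewrite (bigD1 i) //=; move: hi; rewrite negb_and !negb_imply.
by case: (i \in D) => /orP[/andP[]|/andP[]] //= ->; rewrite mul0r.
Qed.

(** Newton's forward expansion with exact remainder. Multiplied by a polynomial [P], it expresses a
    shifted coefficient through finite differences of [P]; by [fd_bound] the difference of order [l]
    has size [scale a ^ (l + 1)]. *)
Lemma newton_X k K :
 'X^k = \sum_(l < K.+1) ('X - 1)^+l *+ 'C(k, l) +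
 \sum_(j < k) (('X - 1)^+K.+1 * 'X^j) *+ 'C(k - j.+1, K) :> {poly R}.
elim: k => [|k IH].
 rewrite big_ord0 addr0 big_ord_recl big1 ?addr0 // => i _.
set Y : {poly R} := 'X - 1.
have XE : 'X = 1 + Y by rewrite /Y addrC subrK.
have e1 : \sum_(l < K.+1) Y^+l *+ 'C(k.+1, l) + Y^+K.+1 *+ 'C(k, K) = 'X*\sum_(l < K.+1) Y^+l *+ 'C(k, l).
 clear IH; elim: K => [|K IH]; first by rewrite !big_ord1 !bin0 !mulr1n expr1 expr0 mulr1 XE.
 rewrite big_ord_recr [in RHS]big_ord_recr /= mulrDr -IH binS mulrnDr.
 have -> : 'X*(Y^+K.+1 *+ 'C(k, K.+1)) = Y^+K.+1 *+ 'C(k, K.+1) + Y^+K.+2 *+ 'C(k, K.+1).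
 by rewrite XE mulrDl mul1r mulrnAr -exprS.
 move: (\sum_(_ < _) _) (Y^+K.+1 *+ 'C(k, K)) (Y^+K.+1 *+ _) (Y^+K.+2 *+ _) => u v w z; ring.
have e2 : \sum_(j < k.+1) (Y^+K.+1 * 'X^j) *+ 'C(k.+1 - j.+1, K) =
 Y^+K.+1 *+ 'C(k, K) + 'X*\sum_(j < k) (Y^+K.+1 * 'X^j) *+ 'C(k - j.+1, K).
 rewrite big_ord_recl /= subSS subn0 expr0 mulr1 mulr_sumr; congr (_ + _); bigr i.
 have -> : fintype.bump 0 i = i.+1 by [].
 by rewrite subSS ['X^(i.+1)]exprS mulrnAr mulrCA.
by rewrite exprS IH mulrDr -e1 -/Y e2 addrA.
Qed.

Lemma bin_le_exp m K : ('C(m, K) <= m ^ K)%N.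
elim: K => [|K IH]; first by rewrite bin0.
apply: (@leq_trans (K.+1 * 'C(m, K.+1))); first by rewrite leq_pmull.
by rewrite mul_bin_left expnS leq_mul // leq_subr.
Qed.

Lemma bin_poly l : exists tau : {poly R}, (size tau <= l.+1)%N /\ forall k, ('C(k, l))%:R = tau.[k%:R].
elim: l => [|l [tau [h1 h2]]].
 by exists 1; rewrite size_poly1; split=> // k; rewrite bin0 hornerE.
exists ((l.+1)%:R^-1 *: (tau*('X - l%:R%:P))); split.
 apply: (leq_trans (size_scale_leq _ _)); apply: (leq_trans (size_polyMleq _ _)).
 by rewrite size_XsubC addn2 ltnS.
move=> k; rewrite hornerZ hornerM hornerXsubC -h2.
have l0 : (l.+1)%:R != 0 :> R by rewrite pnatr_eq0.
apply: (mulfI l0); rewrite mulrA mulfV // mul1r -natrM mul_bin_left natrM.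
case: (leqP l k) => lk; first by rewrite natrB // mulrC.
by rewrite bin_small // mulr0 mul0r.
Qed.

(** The binomial [C(k, l)] is a polynomial in [k] of degree [l], and the bound [D h^l] on [d l]
    supplies the powers of [h] that turn its monomials into powers of [h k] with bounded
    coefficients; for the lower monomials [h <= 1] is used. *)
Lemma bin_rescale m : exists2 B : R, 0 < B & forall h D (d : nat -> R), 0 < h -> h <= 1 -> 0 <= D ->
 (forall l, (l < m)%N -> `|d l| <= D * h^+l) ->
 exists e : nat -> R, (forall j, `|e j| <= D * B) /\
 forall k, \sum_(l < m) d l*('C(k, l))%:R = \sum_(j < m) e j*(h * k%:R)^+j.
have [tau Htau] := choice bin_poly.
pose B : R := \sum_(l < m) \sum_(j < m) `|(tau l)`_j| + 1.
have S0 : 0 <= \sum_(l < m) \sum_(j < m) `|(tau l)`_j|.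
 by pz.
exists B; first by rewrite /B; lra.
move=> h D d h0 h1 D0 hd.
pose e j := if (j < m)%N then \sum_(l < m) d l*(tau l)`_j/h^+j else 0.
exists e; split.
 move=> j; rewrite /e; case: ifP => jm; last by rewrite normr0 mulr_ge0 // /B; lra.
 lel (ler_norm_sum _ _ _).
 via (D*\sum_(l < m) \sum_(j < m) `|(tau l)`_j|); last by rewrite ler_wpM2l // /B; lra.
 rewrite mulr_sumr; lsum l.
 via (D * `|(tau l)`_j|); last first.
 by rewrite ler_wpM2l // (bigD1 (Ordinal jm)) //= lerDl; apply: sumr_ge0.
 case: (ltnP l j) => lj.
 by rewrite [(tau l)`_j]nth_default ?mulr0 ?mul0r ?normr0 ?mulr0 //; apply: leq_trans lj; case: (Htau l).
 have hj : 0 < h^+j by rewrite exprn_gt0.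
 rewrite mulrAC normrM; apply: ler_wpM2r => //.
 rewrite normrM [`|_^-1|]ger0_norm; last by pz.
 rewrite ler_pdivrMr //; lel (hd l (ltn_ord l)).
 by rewrite ler_wpM2l // ler_wiXn2l // ltW.
move=> k.
have -> : \sum_(j < m) e j*(h * k%:R)^+j = \sum_(j < m) \sum_(l < m) d l*((tau l)`_j * k%:R^+j).
 bigr j; rewrite /e ltn_ord mulr_suml; bigr l.
 rewrite exprMn; have : h^+j != 0 by pz.
 by move: (h^+j) (k%:R^+j) => x y x0; field.
rewrite exchange_big /=; bigr l; rewrite -mulr_sumr; congr (_ * _).
have [h2 ->] := Htau l; apply: horner_coef_wide; exact: leq_trans h2 (ltn_ord l).
Qed.

Lemma expRN_taylor m (x : R) : 0 <= x ->
 `|expR (- x) - \sum_(i < m) (- x)^+i/i`!%:R| <= x^+m/m`!%:R.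
pose T m (x : R) : R := \sum_(i < m) (- x)^+i/i`!%:R.
have dT p (y : R) : is_derive y 1 (T p.+1) (- T p y).
 rewrite /T; elim: p => [|p IH].
 have -> : (fun x : R => \sum_(i < 1) (- x)^+i/i`!%:R) = cst 1.
 by apply/funext => z; rewrite big_ord_recr big_ord0 /= expr0 add0r divr1.
 by rewrite big_ord0 oppr0; exact: is_derive_cst.
 have -> : (fun x : R => \sum_(i < p.+2) (- x)^+i/i`!%:R) =
 (fun x => \sum_(i < p.+1) (- x)^+i/i`!%:R) + (fun x => (- x)^+p.+1/(p.+1)`!%:R).
 by apply/funext => z; rewrite big_ord_recr.
 rewrite big_ord_recr /= opprD; apply: is_deriveD.
 have -> : - ((- y)^+p/p`!%:R) = (p.+1)`!%:R^-1*((p.+1)%:R*(- y)^+p * -1).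
 rewrite factS natrM; have : p`!%:R != 0 :> R by [].
 have : (p.+1)%:R != 0 :> R by [].
 by move: ((p.+1)%:R : R) (p`!%:R : R) => u v u0 v0; field; rewrite u0 v0.
 have -> : (fun x : R => (- x)^+p.+1/(p.+1)`!%:R) = (p.+1)`!%:R^-1 \*: (fun x => (- x)^+p.+1).
 by apply/funext => z; rewrite /GRing.scale mulrC.
 have dN : is_derive y 1 (fun x : R => - x) (-1) by apply: is_deriveN.
 have := @is_derive1_comp R (fun z => z^+p.+1) (fun x : R => - x) y ((p.+1)%:R*(- y)^+p) (-1).
 move=> hc; apply: is_deriveZ; apply: hc => //.
 have := @is_deriveX R R id p.+1 (- y) 1 1 (is_derive_id _ _); rewrite /GRing.scale /= mulr1.
 suff -> : (fun z : R => z^+p.+1) = id^+p.+1 by [].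
 by apply/funext => z; rewrite exprfctE.
suff H : forall m (x : R), 0 <= x -> `|expR (- x) - T m x| <= x^+m/m`!%:R by move=> x0; exact: H.
clear m x; elim=> [|p IH] x x0.
 by rewrite /T big_ord0 subr0 expr0 divr1 ger0_norm // expRN_le1.
have d (y : R) : is_derive y 1 (fun y => expR (- y) - T p.+1 y) (- (expR (- y) - T p y)).
 rewrite opprB addrC; have dN : is_derive y 1 (fun x : R => - x) (-1) by apply: is_deriveN.
 have de := @is_derive1_comp R expR (fun x : R => - x) y _ _ (is_derive_expR _) dN.
 rewrite mulrN1 in de; rewrite -[T p y]opprK.
 exact: is_deriveB.
have f0 : expR (- (0 : R)) - T p.+1 0 = 0.
 rewrite oppr0 expR0 /T big_ord_recl /= expr0 divr1 big1 ?addr0 ?subrr // => i _.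
 by rewrite oppr0 expr0n mul0r.
have := @abs_le_pow R _ _ p (p`!%:R^-1) x d f0.
have xx : 0 <= x <= x by rewrite x0 lexx.
move=> /(_ _ x xx) h; apply: le_trans (h _) _.
 by move=> y /andP[y0 _]; rewrite normrN mulrC; exact: IH.
by rewrite factS natrM invfM mulrC [(p.+1)%:R^-1 * _]mulrC.
Qed.

(** Matching the Taylor coefficients at 0 of order below [m] is a Vandermonde system with nodes
    [- u], solvable because the nodes are distinct; the remainder is then of order [y^m]. *)
Lemma exp_fit m : exists v : nat -> nat -> R, exists2 C : R, 0 < C & forall j, (j < m)%N ->
 (forall u, `|v j u| <= C) /\
 forall y, 0 <= y -> `|\sum_(u < m) v j u * expR (- (u%:R * y)) - y^+j| <= C * y^+m.
pose x : 'rV[R]_m := \row_u (- u%:R).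
pose A := Vandermonde m x.
have uA : A \in unitmx.
 rewrite unitmxE det_Vandermonde unitfE; apply/prodf_neq0 => i _; apply/prodf_neq0 => j ij.
 by rewrite !mxE opprK addrC subr_eq0 eqr_nat neq_ltn ij.
pose v j u : R := if insub u is Some w then (if insub j is Some i then j`!%:R*(invmx A) w i else 0) else 0.
have vE (j u : 'I_m) : v j u = j`!%:R*(invmx A) u j by rewrite /v !valK.
have vA (i j : 'I_m) : \sum_(u < m) v j u*(- u%:R)^+i = (i == j)%:R * j`!%:R.
 have := mulmxV uA => /matrixP /(_ i j); rewrite !mxE => <-; rewrite mulr_suml; bigr u.
 by rewrite vE /A !mxE; ring.
pose B : R := \sum_(j < m) \sum_(u < m) `|v j u|.
have vB (j u : nat) : `|v j u| <= B.
 have B0 : 0 <= B by apply: sumr_ge0 => l _; apply: sumr_ge0.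
 case: (ltnP u m) => um; last by rewrite /v insubN -?leqNgt // normr0.
 case: (ltnP j m) => jm; last by rewrite /v (insubT (fun u => u < m)%N um) insubN -?leqNgt // normr0.
 rewrite /B (bigD1 (Ordinal jm)) //= (bigD1 (Ordinal um)) //=.
 by rewrite -addrA lerDl addr_ge0 //; apply: sumr_ge0 => l _ //; apply: sumr_ge0.
have B0 : 0 <= B := le_trans (normr_ge0 _) (vB 0%N 0%N).
exists v; exists (B + \sum_(u < m) B * u%:R^+m + 1).
 by rewrite ltr_pwDr // addr_ge0 // sumr_ge0 // => u _; rewrite mulr_ge0 // exprn_ge0 ler0n.
have S0 : 0 <= \sum_(u < m) B * u%:R^+m by apply: sumr_ge0 => u _; rewrite mulr_ge0 // exprn_ge0 ler0n.
move=> j jm; split=> [u|y y0]; first by lel (vB j u); lra.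
have -> : y^+j = \sum_(u < m) v j u*\sum_(i < m) (- (u%:R * y))^+i/i`!%:R.
 under eq_bigr => u _ do rewrite mulr_sumr.
 rewrite exchange_big (bigD1 (Ordinal jm)) //= [X in _ = _ + X]big1 ?addr0.
 have -> : \sum_(i < m) v j i*((- (i%:R * y))^+j/j`!%:R) =
 (\sum_(i < m) v j i*(- i%:R)^+j) * (y^+j/j`!%:R).
 by rewrite mulr_suml; bigr u; rewrite -mulNr exprMn; ring.
 rewrite (vA (Ordinal jm) (Ordinal jm)) eqxx mul1r /=.
 have : j`!%:R != 0 :> R by [].
 by move: (j`!%:R) => z z0; field.
 move=> i ij; have -> : \sum_(u < m) v j u*((- (u%:R * y))^+i/i`!%:R) =
 (\sum_(u < m) v j u*(- u%:R)^+i) * (y^+i/i`!%:R).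
 by rewrite mulr_suml; bigr u; rewrite -mulNr exprMn; ring.
 by rewrite (vA i (Ordinal jm)) (negbTE ij) !mul0r.
rewrite -sumrB; lel (ler_norm_sum _ _ _).
via ((\sum_(u < m) B * u%:R^+m) * y^+m); last first.
 by apply: ler_wpM2r; [exact: exprn_ge0 | lra].
rewrite mulr_suml; lsum u; rewrite -mulrBr normrM -mulrA -exprMn.
apply: ler_pM => //.
have uy : 0 <= u%:R * y by rewrite mulr_ge0 ?ler0n.
lel (expRN_taylor m uy); rewrite ler_pdivrMr //.
by rewrite ler_peMr ?exprn_ge0 // ler1n fact_gt0.
Qed.

Lemma fd_bound_upto m : exists2 C : R, 0 < C & forall l, (l <= m)%N ->
 forall a M (p : nat -> R) k n, 0 < a -> a <= 1 -> good a M p ->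
 `|((('X - 1)^+l * 'X^k * bpoly p M)`_n)| <= C * scale a^+l.+1.
elim: m => [|m [C C0 IH]].
 have [C C0 h] := fd_bound R 0; exists C => // l; rewrite leqn0 => /eqP ->; exact: h.
have [C' C'0 h] := fd_bound R m.+1; exists (C + C'); first exact: addr_gt0.
move=> l; rewrite leq_eqVlt => /orP[/eqP ->|]; last rewrite ltnS => lm.
 move=> a M p k n a0 a1 g; lel (h _ _ _ _ _ a0 a1 g).
 by rewrite ler_wpM2r ?exprn_ge0 ?(ltW (scale_gt0 a0)) //; lra.
move=> a M p k n a0 a1 g; lel (IH l lm _ _ _ _ _ a0 a1 g).
by rewrite ler_wpM2r ?exprn_ge0 ?(ltW (scale_gt0 a0)) //; lra.
Qed.

Local Notation A := (@AA R).

Lemma AA_ge : 1/6 <= A.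
rewrite /AA; have : 2^+2 <= pi^+2 :> R by rewrite ler_sqr ?nnegrE ?pi_ge2 ?pi_ge0.
lra.
Qed.

Lemma AA_le : A <= 1.
rewrite /AA; have : pi^+2 <= 4^+2 :> R.
 by rewrite ler_sqr ?nnegrE ?pi_ge0; have /andP[_] := @pihalf_02 R; lra.
move: (pi^+2) => P; lra.
Qed.

Lemma good_bpV a s n V : 0 < a -> a <= 1/80 -> a^+2 * n%:R = A -> a <= s <= 2 * a ->
 6*10*10*10 * a*(\sum_(i < n) (V i : nat))%:R <= 1 -> good a n (bpV s V).
move=> a0 a1 an /andP[s1 s2] hV; apply: bpV_good => //; first lra.
have := AA_ge; rewrite -an expr2 => h.
have h2 : a*(a * n%:R) <= 1/80*(a * n%:R) by rewrite ler_wpM2r // mulr_ge0 ?ler0n // ltW.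
have : a*(a * n%:R) = a * a * n%:R by rewrite mulrA.
lra.
Qed.

(** At parameter [a] the mean weight differs from [n] by [O(1)], which is little against a standard
    deviation of order [a^(-3/2)]; so the normalising probability is close to the Gaussian peak. *)
Lemma prob_lower : exists2 c : R, 0 < c & exists2 a1 : R, 0 < a1 <= 1/80 & forall a n,
 0 < a -> a <= a1 -> a^+2 * n%:R = A -> c * scale a <= (bpoly (bp a) n)`_n.
have [c [C [c0 C0 H]]] := llt_lower R.
have [D D0 HD] := bmean_asymp R.
pose K := C*(1 + (1 + D)^+2).
have K0 : 0 < K by rewrite mulr_gt0 // ltr_pwDl // sqr_ge0.
pose e0 : R := c/2/K.
have e00 : 0 < e0 by rewrite !divr_gt0.
exists (c/2); first by pz.
(* Since [eps a = a^(1/8)], the condition [a <= e0^8] makes [eps a <= e0]. *)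
have m0 : 0 < Num.min (1/80) (e0^+8) by rewrite lt_min exprn_gt0 // andbT; lra.
exists (Num.min (1/80) (e0^+8)); first by rewrite m0 ge_min lexx.
move=> a n a0; rewrite le_min => /andP[a1 a2] an.
have aa : a <= 1 by lra.
have g : good a n (bpV a pred0).
 apply: (good_bpV a0 a1 an); first by rewrite lexx; lra.
 by rewrite big1 ?mulr0.
have := H a n _ n a0 aa g; have -> : bpV a pred0 = bp a by [].
have a2' : 0 < a^+2 by rewrite exprn_gt0.
have nE : n%:R = A/a^+2 by rewrite -an mulrAC mulfV ?mul1r // gt_eqF.
have hb : `|n%:R - bmean (bp a) n| <= 1 + D.
 have := HD a n; rewrite a0 (_ : a <= 1/6) ?an /=; last lra.
 have := @AA_gt0 R; have sq1 : a^+2 <= 1 by rewrite expr_le1 // ltW.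
 move=> A0 /(_ isT) /(_ ltac:(lra)); rewrite nE; move: (bmean _ _) (A/_) => b w.
 have := ler_wpM2l (ltW D0) sq1; rewrite !ler_norml => h /andP[h1 h2]; lra.
have he : eps a <= e0.
 have : eps a^+8 <= e0^+8.
 by rewrite (_ : 8 = 4*2)%N // exprM eps4 sqr_sqrtr // (ltW a0).
 by rewrite ler_pXn2r // nnegrE; [exact: ltW (eps_gt0 a0) | exact: ltW].
have hs : (n%:R - bmean (bp a) n)^+2 * scale a^+2 <= (1 + D)^+2 * eps a.
 apply: ler_pM; rewrite ?sqr_ge0 //.
 by rewrite -real_normK ?num_real // ler_sqr ?nnegrE //; lra.
 have sc := scale_le a0 aa; have sc0 := scale_gt0 a0; have se := sqrt_le_eps a0 aa.
 have sa : a <= sqrt a.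
 rewrite -[leLHS](sqr_sqrtr (ltW a0)) expr2 -[leRHS]mulr1 ler_wpM2l //.
 by rewrite -sqrtr1 ler_sqrt.
 have : scale a * scale a <= scale a*1 by rewrite ler_pM2l //; lra.
 rewrite expr2; lra.
move=> h; have sc := scale_gt0 a0.
have : C * scale a*(eps a + (n%:R - bmean (bp a) n)^+2 * scale a^+2) <= c/2 * scale a.
 have -> : c/2 * scale a = C * scale a*((1 + (1 + D)^+2) * e0).
 by rewrite /e0 /K; field; rewrite !gt_eqF // ltr_pwDl // sqr_ge0.
 apply: ler_wpM2l; first by apply: mulr_ge0; exact: ltW.
 have := ler_wpM2l (sqr_ge0 (1 + D)) he; rewrite mulrDl mul1r; lra.
move: h; rewrite -/(bp a); move: (C * _ * _) => z; lra.
Qed.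

(** Under the tilt [a], the ratio of the coefficients [n - k] and [n] is a polynomial in [h k] up to
    [(h k)^m], where [h = scale a]; its powers are fitted by [exp (- u h k)]. Undoing the tilt
    multiplies everything by [exp (- a k)]. Half of this factor absorbs
    [(h k)^m = (2 sqrt a)^m (a k / 2)^m], leaving [a^Q]; the other half stays as decay in [k]. *)
Lemma mixture_core Q : exists K, exists2 C : R, 0 < C & exists2 a1 : R, 0 < a1 <= 1/80 &
 forall a n, 0 < a -> a <= a1 -> a^+2 * n%:R = A ->
 [/\ 0 < (cpoly pred0 n)`_n & exists c : nat -> R, (forall u, `|c u| <= C) /\ forall k,
 `|('X^k * cpoly pred0 n)`_n/(cpoly pred0 n)`_n
 - \sum_(u < K) c u * expR (- ((a + u%:R * scale a) * k%:R))| <= C * a^+Q * expR (- (a * k%:R/2))].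
have [c c0 [a1 a1h HP]] := prob_lower.
(* One order of the expansion gains only [sqrt a], so about [2 Q] orders are needed for [a^Q]. *)
pose K := (2 * Q)%N; pose m := K.+1.
have [Cf Cf0 Hf] := fd_bound_upto m.
have [B B0 HB] := bin_rescale m.
have [v [Cv Cv0 Hv]] := exp_fit m.
pose D := Cf/c.
have D0 : 0 < D by rewrite divr_gt0.
pose C3 := m%:R*(D * B) * Cv.
have m0 : 0 < m%:R :> R by rewrite ltr0n.
have C30 : 0 < C3 by apply: mulr_gt0 => //; apply: mulr_gt0 => //; exact: mulr_gt0.
pose C2 := (D + C3) * (2^+m * m`!%:R).
have C20 : 0 < C2 by rewrite !mulr_gt0 ?addr_gt0 ?exprn_gt0 // ltr0n fact_gt0.
exists m, (C2 + C3); first exact: addr_gt0.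
exists a1 => // a n a0 aa1 an; have /andP[a10 a11] := a1h.
have aa : a <= 1 by lra.
have Pn := HP a n a0 aa1 an; set P := bpoly (bp a) n in Pn.
have h0 := scale_gt0 a0; set h := scale a in Pn h0 *.
have h1 : h <= 1 by apply: le_trans (scale_le a0 aa) _.
have g : good a n (bp a).
 apply: (@good_bpV a a n pred0 a0 _ an); [lra| by rewrite lexx; lra|].
 by rewrite big1 ?mulr0.
have ch : 0 < c * h by rewrite mulr_gt0.
have Pn0 : 0 < P`_n by apply: lt_le_trans Pn.
have iPn : 0 <= (P`_n)^-1 <= (c * h)^-1 by rewrite invr_ge0 (ltW Pn0) lef_pV2.
have Hdiv l x : `|x| <= Cf * h^+l.+1 -> `|x/P`_n| <= D * h^+l.
 move=> hx; have /andP[i1 i2] := iPn.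
 rewrite normrM [`|_^-1|]ger0_norm //; lel (ler_pM _ i1 hx i2) => //.
 rewrite /D exprS le_eqVlt; apply/orP; left; apply/eqP.
 by fld.
pose d l := (('X - 1)^+l * P)`_n/P`_n.
have hd l : (l < m)%N -> `|d l| <= D * h^+l.
 move=> lm; apply: Hdiv; have := Hf l (ltnW lm) a n (bp a) 0%N n a0 aa g.
 by rewrite expr0 mulr1.
have [e [he1 he2]] := HB h D d h0 h1 (ltW D0) hd.
pose cc u := \sum_(j < m) e j * v j u.
have rel k : ('X^k * P)`_n/P`_n = expR (a * k%:R) * (('X^k * cpoly pred0 n)`_n/(cpoly pred0 n)`_n)
 /\ 0 < (cpoly pred0 n)`_n.
 have e1 := @coef_shift_geom a pred0 n k n; have e2 := @bpoly_geom a pred0 n n.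
 rewrite -[bpoly _ _]/P in e1 e2.
 have z0 : 0 < cnorm a pred0 n * expR (- a)^+n by rewrite mulr_gt0 ?cnorm_gt0 // exprn_gt0 // expR_gt0.
 have S0 : 0 < (cpoly pred0 n)`_n by move: Pn0; rewrite e2 pmulr_rgt0.
 split=> //; rewrite e1 e2 mulrC -[a * _]mulrC expRM_natl.
 move: z0 S0; move: (cnorm _ _ _) (expR (- a)^+n) (cpoly pred0 n)`_n => x y S xy S0.
 have x0 : x != 0 by apply: contraTneq xy => ->; rewrite mul0r ltxx.
 have y0 : y != 0 by apply: contraTneq xy => ->; rewrite mulr0 ltxx.
 by fld.
split; first by case: (rel 0%N).
exists cc; split.
 move=> u; via C3; last lra.
 lel (ler_norm_sum _ _ _).
 via (\sum_(j < m) D * B * Cv).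
 lsum j; rewrite normrM; apply: ler_pM => //.
 by case: (Hv j (ltn_ord j)).
 by rewrite sumr_const card_ord -[_ *+ m]mulr_natl /C3 !mulrA.
move=> k; have [relk S0] := rel k.
have y0 : 0 <= h * k%:R by rewrite mulr_ge0 ?ler0n // ltW.
have hq : `|('X^k * P)`_n/P`_n - \sum_(l < m) d l*('C(k, l))%:R| <= D*(h * k%:R)^+m.
 rewrite (newton_X k K) mulrDl coefD !mulr_suml !coef_sum mulrDl.
 have -> : (\sum_(i < K.+1) (('X - 1)^+i *+ 'C(k, i) * P)`_n)/P`_n = \sum_(l < m) d l*('C(k, l))%:R.
 by rewrite mulr_suml; bigr l; rewrite mulrnAl coefMn -[_ *+ 'C(k, l)]mulr_natr mulrAC.
 rewrite addrAC subrr add0r mulr_suml; lel (ler_norm_sum _ _ _).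
 via (\sum_(j < k) D * h^+m * k%:R^+K).
 lsum j; rewrite mulrnAl coefMn -[_ *+ 'C(_, K)]mulr_natr mulrAC normrM; apply: ler_pM => //.
 by apply: Hdiv; exact: (Hf m (leqnn _)).
 rewrite ger0_norm ?ler0n // -natrX ler_nat; apply: (leq_trans (bin_le_exp _ _)).
 have := leq_subr j.+1 k; move: (k - j.+1)%N (K) => z [|K'] zk //; by rewrite leq_exp2r.
 by rewrite sumr_const card_ord -[_ *+ k]mulr_natr -mulrA -exprSr [(h * k%:R)^+m]exprMn mulrA.
have hfit : `|\sum_(l < m) d l*('C(k, l))%:R - \sum_(u < m) cc u * expR (- (u%:R*(h * k%:R)))| <=
 C3*(h * k%:R)^+m.
 rewrite he2; have -> : \sum_(u < m) cc u * expR (- (u%:R*(h * k%:R))) =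
 \sum_(j < m) e j*\sum_(u < m) v j u * expR (- (u%:R*(h * k%:R))).
 under eq_bigr => u _ do rewrite /cc mulr_suml.
 rewrite exchange_big; bigr j; rewrite mulr_sumr; bigr u; ring.
 rewrite -sumrB; lel (ler_norm_sum _ _ _).
 via (\sum_(j < m) D * B*(Cv*(h * k%:R)^+m)).
 lsum j; rewrite -mulrBr normrM; apply: ler_pM => //.
 by rewrite distrC; case: (Hv j (ltn_ord j)) => _; apply.
 by rewrite sumr_const card_ord -[_ *+ m]mulr_natl /C3 !mulrA.
have eak := expR_gt0 (- (a * k%:R)).
have -> : ('X^k * cpoly pred0 n)`_n/(cpoly pred0 n)`_n =
 expR (- (a * k%:R)) * (('X^k * P)`_n/P`_n).
 by rewrite relk mulrA -expRD addNr expR0 mul1r.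
have -> : \sum_(u < m) cc u * expR (- ((a + u%:R * h) * k%:R)) =
 expR (- (a * k%:R)) * \sum_(u < m) cc u * expR (- (u%:R*(h * k%:R))).
 rewrite mulr_sumr; bigr u.
 have -> : - ((a + u%:R * h) * k%:R) = - (a * k%:R) + - (u%:R*(h * k%:R)) by ring.
 by rewrite expRD mulrCA.
rewrite -mulrBr normrM (ger0_norm (ltW eak)).
have hall : `|('X^k * P)`_n/P`_n - \sum_(u < m) cc u * expR (- (u%:R*(h * k%:R)))| <= (D + C3) * (h * k%:R)^+m.
 move: hq hfit; rewrite mulrDl !ler_norml => /andP[u1 u2] /andP[w1 w2]; lra.
lel (ler_wpM2l (ltW eak) hall).
have ak0 : 0 <= a * k%:R/2 by rewrite divr_ge0 // mulr_ge0 ?ler0n // ltW.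
have -> : h * k%:R = 2 * sqrt a*(a * k%:R/2).
 by rewrite /h /scale; field.
have -> : - (a * k%:R) = - (a * k%:R/2) + - (a * k%:R/2) by fld.
rewrite expRD; move: (a * k%:R/2) ak0 => w ak0.
rewrite [(2 * sqrt a * w)^+m]exprMn [(2 * sqrt a)^+m]exprMn; have := pow_expRN m ak0.
have : sqrt a^+m <= a^+Q.
 rewrite -[X in _ <= X^+Q](sqr_sqrtr (ltW a0)) -exprM ler_wiXn2l //.
 by rewrite -sqrtr1 ler_sqrt.
have sm0 : 0 <= sqrt a^+m by rewrite exprn_ge0 ?sqrtr_ge0.
have aQ : 0 <= a^+Q by rewrite exprn_ge0 ?ltW.
have E0 := expR_ge0 (- w).
have X0 : 0 <= w^+m * expR (- w) by rewrite mulr_ge0 // exprn_ge0.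
rewrite /C2; move: (sqrt a^+m) (w^+m) sm0 X0 => s2 x sm0 X0 hs hx.
have t2 : 0 < 2^+m :> R by rewrite exprn_gt0.
have := ler_pM sm0 X0 hs hx.
set z := (D + C3) * 2^+m * expR (- w).
have z0 : 0 <= z by rewrite !mulr_ge0 // ltW // addr_gt0.
move=> hh; have hz := ler_wpM2l z0 hh.
via (z*(s2*(x * expR (- w)))).
 rewrite /z le_eqVlt; apply/orP; left; apply/eqP; ring.
lel hz.
have -> : z*(a^+Q * m`!%:R) = (D + C3) * (2^+m * m`!%:R) * a^+Q * expR (- w) by rewrite /z; ring.
by rewrite ler_wpM2r // ler_wpM2r // lerDl ltW.
Qed.

End Mixture.

(** * From shifted coefficients to prescribed sites *)

Section Sites.
Variable R : realType.
Implicit Types (a s h : R) (V : pred nat) (n k : nat) (O : seq nat).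
Local Notation jj := (@jj R).
Local Notation A := (@AA R).
Local Notation cpoly := (@cpoly R).

Definition lmem O : pred nat := fun i => i \in O.

(** If [O] has distinct elements below [n] and [k] is their total weight, this is the probability,
    given weight [n], that all sites of [O] are occupied ([Emean_allb]); [model] is the counterpart
    for the mixture. Other values of [k] serve the recursion in [err_sites]. *)
Definition gco n O k : R := ('X^k * cpoly (lmem O) n)`_n/(cpoly pred0 n)`_n.

Definition tilt a (u : nat) : R := a + u%:R * scale a.

Definition model K (c : nat -> R) a O k : R :=
 \sum_(u < K) c u*(expR (- (tilt a u * k%:R)) * \prod_(i <- O) (1 - bp (tilt a u) i)).

Lemma model_split K c a O k i :
 model K c a (i :: O) k + model K c a (i :: O) (k + i.*2.+1) = model K c a O k.
rewrite /model -big_split; apply: eq_bigr => u _ /=; rewrite !big_cons -mulrDr; congr (_ * _).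
move: (tilt a u) => s; rewrite natrD mulrDr opprD expRD.
have := one_bpM s i; rewrite /jj => h.
have h2 : (1 - bp s i) * (1 + expR (- (s*(i.*2.+1)%:R))) = 1 by rewrite mulrDr mulr1 h subrK.
move: (expR (- (s * k%:R))) (\prod_(_ <- _) _) => x y.
transitivity (x * y*((1 - bp s i) * (1 + expR (- (s*(i.*2.+1)%:R))))); first by ring.
by rewrite h2 mulr1.
Qed.

Lemma eq_cpoly V V' n : V =1 V' -> cpoly V n = cpoly V' n.
Proof. by move=> e; bigr i; rewrite e. Qed.

Lemma gco_split n O k i : (i < n)%N -> i \notin O ->
 gco n (i :: O) k + gco n (i :: O) (k + i.*2.+1) = gco n O k.
move=> iM iO; rewrite /gco -mulrDl -coefD; congr (_`_n/_).
rewrite (cpoly_peel R iM (V := lmem O) iO) (eq_cpoly n (V' := predU1 i (lmem O))).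
 by rewrite exprD mulrDl mul1r mulrDr mulrA.
by [].
Qed.

Lemma gco_big n O k : (n < k)%N -> gco n O k = 0.
Proof. by move=> nk; rewrite /gco coefXnM nk mul0r. Qed.

(** Both quantities satisfy [g (i :: O) k = g O k - g (i :: O) (k + 2 i + 1)], so the error at [k]
    is at most the error for [O] plus the error at a larger shift. Beyond [n], where [gco] vanishes,
    the error is known; descending from there, the weights [exp (- a k / 2)] form a geometric series
    that costs a factor [4 / a] per site. *)
Lemma err_sites K c a n (D0 : R) : 0 < a -> a <= 1 -> 0 <= D0 ->
 (forall O k, (n < k)%N -> `|model K c a O k| <= D0 * expR (- (a * k%:R/2))) ->
 (forall k, `|gco n [::] k - model K c a [::] k| <= D0 * expR (- (a * k%:R/2))) ->
 forall O, uniq O -> all (fun i => i < n)%N O -> forall k,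
 `|gco n O k - model K c a O k| <= D0*(4/a)^+size O * expR (- (a * k%:R/2)).
move=> a0 a1 D00 base core; elim=> [|i O IH] /=.
 by move=> _ _ k; rewrite expr0 mulr1.
move=> /andP[iO uO] /andP[iN aO] k.
have a4 : 1 <= 4/a by rewrite ler_pdivlMr //; lra.
have a40 : 0 <= (4/a)^+size O by rewrite exprn_ge0 //; lra.
set D := D0*(4/a)^+size O in IH.
have D0' : 0 <= D by rewrite mulr_ge0.
have eD : D0*(4/a)^+(size O).+1 = 4/a * D by rewrite exprS /D; ring.
rewrite eD.
(* The inner induction is on [d], a bound for how far [k] lies below the range where [gco]
   vanishes. *)
have [d] : exists d, (n < k + d)%N by exists n.+1; rewrite addnS ltnS leq_addl.
elim: d k => [|d IHd] k hk.
 rewrite addn0 in hk; rewrite gco_big // sub0r normrN; lel (base _ _ hk).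
 rewrite ler_wpM2r // -eD ler_peMr // exprn_ege1 //.
have hk' : (n < k + i.*2.+1 + d)%N by clear -hk; lia.
have := IHd (k + i.*2.+1)%N hk'.
have := IH uO aO k; rewrite -(gco_split k iN iO) -(model_split K c a O k i).
have E0 := expR_gt0 (- (a * k%:R/2)).
have -> : - (a*(k + i.*2.+1)%:R/2) = - (a * k%:R/2) + - (a/2 * jj i).
 by fld.
rewrite expRD.
have hexp : expR (- (a/2 * jj i)) <= 1 - a/4.
 have h1 : expR (- (a/2 * jj i)) <= expR (- (a/2)).
 by rewrite ler_expR lerN2 ler_peMr ?jj_ge1 //; lra.
 have h2 := @expRN_taylor2 R (a/2).
 have h3 : (a/2)^+2 <= a/4*1 by rewrite expr_div_n expr2; nra.
 move: (@expRN_taylor R 2 (a/2) ltac:(lra)); rewrite !big_ord_recr big_ord0 /= expr0 expr1 divr1 add0r.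
 rewrite (_ : 2`! = 2%N) // (_ : 1`! = 1%N) // divr1 ler_norml => /andP[_ h4].
 lra.
set E := expR _ in E0 *; set F := expR (- (a/2 * jj i)) in hexp *.
set x := gco n (i :: O) k; set y := gco n (i :: O) _; set x' := model K c a (i :: O) k; set y' := model K c a (i :: O) _.
have hEF : 4/a * D*(E * F) <= 4/a * D * E - D * E.
 have -> : 4/a * D * E - D * E = 4/a * D * E*(1 - a/4) by fld.
 rewrite [in leLHS]mulrA ler_wpM2l // !mulr_ge0 ?(ltW E0) //; lra.
rewrite !ler_norml => /andP[h1 h2] /andP[h3 h4]; lra.
Qed.

(** At most four sites are allowed because the square of the hook count has monomials in two pairs
    of sites. Each site costs [4 / a], so the core is applied with [Q + 4]. *)
Theorem mixture Q : exists K, exists2 C : R, 0 < C & exists2 a1 : R, 0 < a1 <= 1/80 &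
 forall a n, 0 < a -> a <= a1 -> a^+2 * n%:R = A ->
 [/\ 0 < (cpoly pred0 n)`_n & exists c : nat -> R, [/\ forall u, `|c u| <= C,
 forall k, `|gco n [::] k - model K c a [::] k| <= C * a^+Q * expR (- (a * k%:R/2)) &
 forall O k, uniq O -> all (fun i => i < n)%N O -> (size O <= 4)%N ->
 `|gco n O k - model K c a O k| <= C * a^+Q]].
have [K [C C0 [a1 a1h H]]] := mixture_core R (Q + 4).
have A20 : 0 < A/2 by rewrite divr_gt0 // AA_gt0.
have [C' C'0 HC'] := exp_decay (Q + 4) A20.
pose D := C + K%:R * C * C'.
have D0 : C <= D by rewrite lerDl !mulr_ge0 // ltW.
have Dp : 0 < D by apply: lt_le_trans D0.
have h44 : 1 <= 4^+4 :> R by rewrite exprn_ege1 //; lra.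
exists K, (D*4^+4); first by pz.
exists a1 => // a n a0 aa1 an; have /andP[a10 a11] := a1h.
have aa : a <= 1 by lra.
have [S0 [c [c1 c2]]] := H a n a0 aa1 an; split=> //.
have DD : D <= D*4^+4 by rewrite ler_peMr // ltW.
have gE k : gco n [::] k = ('X^k * cpoly pred0 n)`_n/(cpoly pred0 n)`_n.
 by [].
have mE k : model K c a [::] k = \sum_(u < K) c u * expR (- ((a + u%:R * scale a) * k%:R)).
 by bigr u; rewrite big_nil mulr1.
have aQ m : 0 <= a^+m by rewrite exprn_ge0 // ltW.
exists c; split.
- by move=> u; lel (c1 u); apply: le_trans DD.
- move=> k; rewrite gE mE; lel (c2 k).
 rewrite ler_wpM2r ?expR_ge0 //; apply: ler_pM => //; [exact: ltW | exact: le_trans DD |].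
 by rewrite ler_wiXn2l ?leq_addr // ltW.
have main := @err_sites K c a n (D * a^+(Q + 4)) a0 aa.
have DQ : 0 <= D * a^+(Q + 4) by rewrite mulr_ge0 // ltW.
move=> O k uO aO sO.
have : `|gco n O k - model K c a O k| <= D * a^+(Q + 4) * (4/a)^+size O * expR (- (a * k%:R/2)).
 apply: main => //.
 move=> O' k' nk; via (\sum_(u < K) C * expR (- (a * k'%:R))).
 lel (ler_norm_sum _ _ _); lsum u; rewrite normrM; apply: ler_pM => //.
 rewrite normrM ger0_norm ?expR_ge0 // -[leRHS]mulr1; apply: ler_pM; rewrite //.
 rewrite ler_expR lerN2 ler_wpM2r // /tilt lerDl mulr_ge0 // ltW // scale_gt0 //.
 elim: O' => [|i O' IHO]; first by rewrite big_nil normr1.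
 rewrite big_cons normrM -[leRHS]mulr1; apply: ler_pM => //.
 rewrite ger0_norm ?(ltW (one_bp_gt0 _ _)) //.
 by rewrite lerBlDr lerDl ltW // bp_gt0.
 have -> : - (a * k'%:R) = - (a * k'%:R/2) + - (a * k'%:R/2) by fld.
 rewrite sumr_const card_ord -[_ *+ K]mulr_natl expRD !mulrA ler_wpM2r //.
 have hk : expR (- (a * k'%:R/2)) <= C' * a^+(Q + 4).
 via (expR (- (A/2 * a^-1))).
 rewrite ler_expR lerN2 -an.
 have -> : a^+2 * n%:R/2 * a^-1 = a * n%:R/2 by fld.
 by rewrite ler_wpM2r // ler_wpM2l ?(ltW a0) // ler_nat ltnW.
 by lel (HC' _ _); rewrite ?invr_gt0 // exprVn invrK.
 have KC : 0 <= K%:R * C by rewrite mulr_ge0 ?ler0n // ltW.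
 lel (ler_wpM2l KC hk); rewrite mulrA ler_wpM2r // /D lerDr ltW //.
 move=> k'; rewrite gE mE; lel (c2 k').
 by pz.
move=> h; lel h.
have a4 : 1 <= 4/a by rewrite ler_pdivlMr //; lra.
have ak0 : 0 <= a * k%:R/2 by rewrite divr_ge0 // mulr_ge0 ?ler0n // ltW.
have X0 : 0 <= D * a^+(Q + 4) * (4/a)^+size O by rewrite mulr_ge0 // exprn_ge0 //; lra.
via (D * a^+(Q + 4) * (4/a)^+size O).
 by rewrite -[leRHS]mulr1 ler_wpM2l // expRN_le1.
have -> : D*4^+4 * a^+Q = D * a^+(Q + 4) * (4/a)^+4.
 rewrite expr_div_n exprD; have : a^+4 != 0 by pz.
 by move: (a^+4) (4^+4 : R) => x y x0; field.
by rewrite ler_wpM2l // ler_weXn2l.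
Qed.

End Sites.

(** * Expectations of hook statistics under the mixture *)

Section Expectation.
Variable R : realType.
Implicit Types (a s h : R) (n k : nat) (O : seq nat).
Local Notation jj := (@jj R).
Local Notation A := (@AA R).
Local Notation cpoly := (@cpoly R).

Definition Emean (n : nat) (F : {set 'I_n} -> R) : R :=
 (\sum_(D : {set 'I_n} | weight D == n) F D)/(\sum_(D : {set 'I_n} | weight D == n) 1).

Definition pprob n s (D : {set 'I_n}) : R := \prod_(i < n) (if i \in D then bp s i else 1 - bp s i).

Definition Eprod n s (F : {set 'I_n} -> R) : R := \sum_(D : {set 'I_n}) F D * pprob s D.

Definition allb n O (D : {set 'I_n}) : R := (all (bit D) O)%:R.

Lemma count_pattern n (O0 O1 : pred nat) : (forall i, ~~ (O0 i && O1 i)) ->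
 \sum_(D : {set 'I_n} | weight D == n)
 ([forall i : 'I_n, (O1 i ==> (i \in D)) && (O0 i ==> (i \notin D))])%:R
 = ('X^(\sum_(i < n | O1 i) i.*2.+1) * cpoly (predU O0 O1) n)`_n.
move=> dis; rewrite -pattern_poly // coef_sum big_mkcond [RHS]big_mkcond /=.
by bigr D; rewrite coefXn eq_sym; case: eqP => _; case: ifP.
Qed.

Lemma count_all n : \sum_(D : {set 'I_n} | weight D == n) 1 = (cpoly pred0 n)`_n.
have := @count_pattern n pred0 pred0 (fun _ => isT); rewrite big_pred0_eq expr0 mul1r => h.
rewrite (eq_cpoly _ n (V' := predU pred0 pred0)) // -h; bigr D.
by rewrite (_ : [forall _, _] = true) //; apply/forallP.
Qed.

Lemma allb_out n O (D : {set 'I_n}) : ~~ all (fun i => i < n)%N O -> allb O D = 0.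
move=> h; rewrite /allb; case: (boolP (all (bit D) O)) => // hb; case/negP: h.
by apply/seq.allP => i iO; apply: (@bit_lt _ D); exact: (seq.allP hb).
Qed.

Lemma allb_forall n O (D : {set 'I_n}) : all (fun i => i < n)%N O ->
 allb O D = ([forall i : 'I_n, (lmem O i ==> (i \in D)) && (pred0 (val i) ==> (i \notin D))])%:R.
move=> /seq.allP aO; rewrite /allb; congr ((nat_of_bool _)%:R); apply/seq.allP/forallP => h.
 by move=> i; rewrite andbT; apply/implyP => /h; rewrite bitE.
move=> i iO; have := h (Ordinal (aO i iO)); rewrite andbT /lmem /= iO /=.
by rewrite -bitE.
Qed.

Lemma sum_lmem n O (f : nat -> nat) : uniq O -> all (fun i => i < n)%N O ->
 (\sum_(i < n | lmem O i) f i = \sum_(i <- O) f i)%N.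
move=> uO /seq.allP aO; rewrite -(big_mkord (fun i => lmem O i)) -big_filter; apply: perm_big.
apply: uniq_perm => //; first by rewrite filter_uniq // iota_uniq.
by move=> i; rewrite mem_filter mem_index_iota /lmem; case: (boolP (i \in O)) => // /aO ->.
Qed.

Lemma Emean_allb n O : uniq O -> all (fun i => i < n)%N O ->
 Emean (@allb n O) = gco R n O (\sum_(i <- O) i.*2.+1).
move=> uO aO; rewrite /Emean count_all /gco; congr (_/_).
rewrite -(sum_lmem _ uO aO); have := @count_pattern n pred0 (lmem O) (fun _ => isT) => h.
rewrite (eq_cpoly _ n (V' := predU pred0 (lmem O))) // -h; bigr D.
exact: allb_forall.
Qed.

Lemma Eprod_allb n s O : uniq O -> all (fun i => i < n)%N O ->
 Eprod s (@allb n O) = \prod_(i <- O) bp s i.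
move=> uO aO.
have -> : \prod_(i <- O) bp s i = \prod_(i < n) (bp s i + (if lmem O i then 0 else 1 - bp s i)).
 have -> : \prod_(i <- O) bp s i = \prod_(i < n | lmem O i) bp s i.
 rewrite -(big_mkord (fun i => lmem O i)) -[RHS]big_filter; apply: perm_big.
 rewrite perm_sym; apply: uniq_perm => //; first by rewrite filter_uniq // iota_uniq.
 move=> i; rewrite mem_filter mem_index_iota /= /lmem; case: (boolP (i \in O)) => //.
 by move/(seq.allP aO) => ->.
 rewrite big_mkcond /=; bigr i; case: (lmem O i); rewrite ?addr0 //.
 by rewrite addrC subrK.
rewrite bigA_distr /Eprod; bigr D; rewrite allb_forall //.
case: (boolP [forall i : 'I_n, (lmem O i ==> (i \in D)) && (pred0 (val i) ==> (i \notin D))]) => [/forallP h|/forallPn[i hi]]; last first.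
 move: hi; rewrite /= andbT negb_imply => /andP[h1 h2].
 by rewrite mul0r (bigD1 i) //= (negbTE h2) h1 mul0r.
rewrite mul1r; bigr i; have := h i; rewrite /= andbT => /implyP.
by case: (i \in D) => //; case: (lmem O i) => // /(_ isT).
Qed.

Lemma allb_undup n O (D : {set 'I_n}) : allb (undup O) D = allb O D.
Proof. by rewrite /allb; congr ((nat_of_bool _)%:R); apply/seq.allP/seq.allP => h i; [rewrite -mem_undup|rewrite mem_undup]; exact: h. Qed.

Lemma allb_cat n O O' (D : {set 'I_n}) : allb O D * allb O' D = allb (O ++ O') D.
Proof. by rewrite /allb all_cat -natrM mulnb. Qed.

Lemma EmeanB n (F : {set 'I_n} -> R) K (c : nat -> R) a :
 Emean F - \sum_(u < K) c u * Eprod (tilt a u) F =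
 \sum_(D : {set 'I_n}) F D*((weight D == n)%:R/(\sum_(D : {set 'I_n} | weight D == n) 1)
 - \sum_(u < K) c u * pprob (tilt a u) D).
rewrite /Emean [in X in X/_]big_mkcond mulr_suml /=.
under [X in _ - X]eq_bigr => u _ do rewrite /Eprod mulr_sumr.
rewrite exchange_big -sumrB /=; bigr D; rewrite mulrBr mulr_sumr; congr (_ - _).
 by case: eqP => _; rewrite ?mul1r ?mul0r ?mulr0.
by bigr u; ring.
Qed.

Definition mixdef K (c : nat -> R) a n (F : {set 'I_n} -> R) : R := Emean F - \sum_(u < K) c u * Eprod (tilt a u) F.

Lemma mixdef_sum K c a n (I : Type) (r : seq I) (al : I -> R) (F : I -> {set 'I_n} -> R) :
 mixdef K c a (fun D => \sum_(x <- r) al x * F x D) = \sum_(x <- r) al x * mixdef K c a (F x).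
rewrite /mixdef EmeanB; under [RHS]eq_bigr => x _ do rewrite EmeanB mulr_sumr.
rewrite exchange_big /=; bigr D; rewrite mulr_suml.
by bigr x; rewrite mulrA.
Qed.

Lemma eq_mixdef K c a n (F G : {set 'I_n} -> R) : F =1 G -> mixdef K c a F = mixdef K c a G.
Proof. by move=> e; rewrite /mixdef !EmeanB; bigr D; rewrite e. Qed.

Lemma mixdef_allb K c a n O (C : R) : 0 <= C ->
 (forall O k, uniq O -> all (fun i => i < n)%N O -> (size O <= 4)%N ->
 `|gco R n O k - model K c a O k| <= C) ->
 (size O <= 4)%N -> `|mixdef K c a (@allb n O)| <= C.
move=> C0 H sO.
rewrite -(eq_mixdef K c a (F := @allb n (undup O))); last by move=> D; rewrite allb_undup.
have [aO|aO] := boolP (all (fun i => i < n)%N (undup O)); last first.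
 rewrite /mixdef EmeanB big1 ?normr0 // => D _; by rewrite allb_out // mul0r.
rewrite /mixdef Emean_allb ?undup_uniq //.
have e u := @Eprod_allb n (tilt a u) _ (undup_uniq O) aO.
have -> : \sum_(u < K) c u * Eprod (tilt a u) (@allb n (undup O)) =
 model K c a (undup O) (\sum_(i <- undup O) i.*2.+1).
 bigr u; rewrite e; congr (_ * _).
 rewrite natr_sum mulr_sumr -sumrN expR_sum -big_split; apply: eq_bigr => i _ /=.
 by rewrite mulrC one_bpM.
exact: H (undup_uniq _) aO (leq_trans (size_undup _) sO).
Qed.

Definition Nhk n t (D : {set 'I_n}) : R := (cfg_hooks t D)%:R.

(** The hook count as a signed sum of monomials in the bits, each with at most two sites: an empty
    site is encoded by subtracting the monomial where it is occupied. Repeated and out-of-range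
    sites are harmless by [allb_undup] and [allb_out]. *)
Definition Nmon n t : seq (R * seq nat) :=
 [seq (2, [:: (i + t)%N]) | i <- iota 0 n] ++ [seq (-2, [:: i; (i + t)%N]) | i <- iota 0 n] ++
 [seq (1, [:: i; (t.-1 - i)%N]) | i <- iota 0 t].

Lemma NhkE n t (D : {set 'I_n}) : Nhk t D = \sum_(x <- Nmon n t) x.1 * allb x.2 D.
rewrite /Nhk /cfg_hooks /Nmon !big_cat !big_map /= natrD natrM !natr_sum.
have io m : iota 0 m = index_iota 0 m by rewrite /index_iota subn0.
rewrite !io !big_mkord addrA -big_split /=; congr (_ + _).
 rewrite mulr_sumr; bigr i; rewrite /allb /= !andbT.
 by case: (bit D i); case: (bit D (i + t)) => /=; ring.
by bigr i; rewrite /allb /= andbT mul1r.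
Qed.

Lemma size_Nmon n t : size (Nmon n t) = (2 * n + t)%N.
Proof. by rewrite !size_cat !size_map !size_iota; lia. Qed.

Lemma Nmon_le n t x : x \in Nmon n t -> `|x.1| <= 2 /\ (size x.2 <= 2)%N.
rewrite !mem_cat => /or3P[] /mapP[i _ ->] /=; split=> //; rewrite ?normrN ?normr1 ?ger0_norm //.
by lra.
Qed.

Lemma sum_le_size (T : eqType) (r : seq T) (f : T -> R) (B : R) :
 (forall x, x \in r -> `|f x| <= B) -> `|\sum_(x <- r) f x| <= (size r)%:R * B.
elim: r => [|x r IH] h; first by rewrite big_nil normr0 mul0r.
rewrite big_cons /= natS mulrDl mul1r addrC; lel (ler_normD _ _); apply: lerD.
 by apply: IH => y yr; apply: h; rewrite inE yr orbT.
by apply: h; rewrite mem_head.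
Qed.

Lemma expr_add4 (x : R) q : x^+(q + 4) = x^+q*(x^+2 * x^+2).
Proof. by rewrite exprD; ring. Qed.

(** The error of the mixture is linear in the statistic, so monomials suffice. The count has
    [O(n) = O(a^-2)] of them and its square [O(a^-4)], which is paid by four further powers of
    [a]. *)
Theorem mix_expect t q : exists K, exists2 C : R, 0 < C & exists2 a1 : R, 0 < a1 <= 1/80 &
 forall a n, 0 < a -> a <= a1 -> a^+2 * n%:R = A ->
 [/\ 0 < (cpoly pred0 n)`_n & exists c : nat -> R, [/\ forall u, `|c u| <= C,
 forall k, `|gco R n [::] k - model K c a [::] k| <= C * a^+q * expR (- (a * k%:R/2)),
 `|mixdef K c a (fun D : {set 'I_n} => (weight D)%:R)| <= C * a^+q,
 `|mixdef K c a (@Nhk n t)| <= C * a^+q &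
 `|mixdef K c a (fun D : {set 'I_n} => Nhk t D^+2)| <= C * a^+q]].
have [K [C C0 [a1 a1h H]]] := mixture R (q + 4).
have /andP[a10 a11] := a1h.
pose B : R := (2*(2 + t%:R))^+2.
have t0 : 0 <= t%:R :> R by rewrite ler0n.
have b1 : 1 <= 2*(2 + t%:R) :> R by lra.
have B1 : 1 <= B by rewrite exprn_ege1.
have CB : C <= C * B by rewrite ler_peMr // ltW.
exists K, (C * B); first by rewrite mulr_gt0 // (lt_le_trans _ B1).
exists a1 => // a n a0 aa1 an; have aa : a <= 1 by lra.
have [S0 [c [c1 c2 c3]]] := H a n a0 aa1 an; split=> //.
have aQ m : 0 <= a^+m by rewrite exprn_ge0 // ltW.
have a40 : a^+(q + 4) <= a^+q by rewrite ler_wiXn2l ?leq_addr // ltW.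
have na : n%:R * a^+2 <= 1 by rewrite mulrC an AA_le.
have CQ : 0 <= C * a^+(q + 4) by rewrite mulr_ge0 // ltW.
have hO O : (size O <= 4)%N -> `|mixdef K c a (@allb n O)| <= C * a^+(q + 4).
 exact: mixdef_allb.
have a21 : a^+2 <= 1 by rewrite expr_le1 // ltW.
have szN : (size (Nmon n t))%:R*2 * a^+2 <= 2*(2 + t%:R) :> R.
 rewrite size_Nmon natrD natrM; have := ler_wpM2l t0 a21; lra.
have sz0 : 0 <= (size (Nmon n t))%:R*2 * a^+2 :> R by apply: mulr_ge0 => //; apply: mulr_ge0; rewrite ?ler0n.
exists c; split.
- by move=> u; lel (c1 u).
- move=> k; lel (c2 k); rewrite ler_wpM2r //.
 by pz.
- have e : (fun D : {set 'I_n} => (weight D)%:R : R) =1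
 (fun D => \sum_(i <- iota 0 n) (i.*2.+1)%:R * allb [:: i] D).
 move=> D; have io m : iota 0 m = index_iota 0 m by rewrite /index_iota subn0.
 rewrite weight_bit natr_sum io big_mkord.
 bigr i; rewrite natrM mulrC; by rewrite /allb /= andbT.
 rewrite (eq_mixdef _ _ _ e) mixdef_sum.
 via ((size (iota 0 n))%:R*(2 * n%:R*(C * a^+(q + 4)))).
 apply: sum_le_size => i; rewrite mem_iota add0n /= => iN; rewrite normrM; apply: ler_pM => //; last exact: hO.
 have i2 : (i.*2.+1 <= 2 * n)%N by rewrite mul2n ltn_double.
 by rewrite ger0_norm // -natrM ler_nat.
 have a44 : a^+(q + 4) = a^+q*(a^+2 * a^+2) by exact: expr_add4.
 rewrite size_iota a44.
 have -> : n%:R*(2 * n%:R*(C*(a^+q*(a^+2 * a^+2)))) =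
 C * a^+q*(2*((n%:R * a^+2) * (n%:R * a^+2))) by ring.
 rewrite [leRHS]mulrAC ler_wpM2l ?mulr_ge0 ?(ltW C0) //.
 have n2 : 0 <= n%:R * a^+2 by rewrite mulr_ge0 ?ler0n.
 have := ler_pM n2 n2 na na; have : 2*(2 + t%:R) <= B by rewrite /B expr2 ler_peMr //; lra.
 by move: (n%:R * a^+2) t0 => x; clearbody B; clear; move: (t%:R) => y; lra.
- have e : @Nhk n t =1 (fun D => \sum_(x <- Nmon n t) x.1 * allb x.2 D) by move=> D; rewrite NhkE.
 rewrite (eq_mixdef _ _ _ e) mixdef_sum.
 via ((size (Nmon n t))%:R*(2*(C * a^+(q + 4)))).
 apply: sum_le_size => x /Nmon_le[x1 x2]; rewrite normrM; apply: ler_pM => //; apply: hO.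
 exact: leq_trans x2 _.
 have h4 : a^+(q + 4) <= a^+q * a^+2 by rewrite -(exprD a q 2) ler_wiXn2l ?leq_add2l // ltW.
 via (C * a^+q*((size (Nmon n t))%:R*2 * a^+2)).
 have -> : C * a^+q*((size (Nmon n t))%:R*2 * a^+2) =
 (size (Nmon n t))%:R*(2*(C*(a^+q * a^+2))) by ring.
 by pz.
 rewrite [leRHS]mulrAC ler_wpM2l ?mulr_ge0 ?(ltW C0) //; lel szN.
 by rewrite /B expr2 ler_peMr //; lra.
have e : (fun D : {set 'I_n} => Nhk t D^+2) =1
 (fun D => \sum_(x <- Nmon n t) x.1*(\sum_(y <- Nmon n t) y.1 * allb (x.2 ++ y.2) D)).
 move=> D; rewrite expr2 {1}NhkE mulr_suml; bigr x; rewrite -mulrA; congr (_ * _).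
 rewrite NhkE mulr_sumr; bigr y; rewrite -allb_cat; ring.
rewrite (eq_mixdef _ _ _ e) mixdef_sum.
via ((size (Nmon n t))%:R*(2*((size (Nmon n t))%:R*(2*(C * a^+(q + 4)))))).
 apply: sum_le_size => x /Nmon_le[x1 x2]; rewrite normrM; apply: ler_pM => //.
 rewrite mixdef_sum; apply: sum_le_size => y /Nmon_le[y1 y2]; rewrite normrM; apply: ler_pM => //; apply: hO.
 by rewrite size_cat (leq_add x2 y2).
have a44 : a^+(q + 4) = a^+q*(a^+2 * a^+2) by exact: expr_add4.
rewrite a44.
set S := (size _)%:R in szN sz0 *.
have -> : S*(2*(S*(2*(C*(a^+q*(a^+2 * a^+2)))))) = C * a^+q*((S*2 * a^+2) * (S*2 * a^+2)) by ring.
rewrite [leRHS]mulrAC ler_wpM2l ?mulr_ge0 ?(ltW C0) //.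
by rewrite /B expr2; apply: ler_pM.
Qed.

End Expectation.

(** * Uniformly bounded functions, used for remainder terms *)

Section Bounded.
Variables (R : realType) (T : Type) (P : T -> Prop).

Definition bd (f : T -> R) := exists2 C : R, 0 <= C & forall v, P v -> `|f v| <= C.

Lemma bd_cst c : bd (fun=> c).
Proof. by exists `|c|. Qed.
Lemma bdD f g : bd f -> bd g -> bd (fun v => f v + g v).
move=> [C C0 hf] [D D0 hg]; exists (C + D) => [|v Pv]; first exact: addr_ge0.
by lel (ler_normD _ _); rewrite lerD ?hf ?hg.
Qed.
Lemma bdN f : bd f -> bd (fun v => - f v).
Proof. by move=> [C C0 hf]; exists C => // v Pv; rewrite normrN hf. Qed.
Lemma bdM f g : bd f -> bd g -> bd (fun v => f v * g v).
move=> [C C0 hf] [D D0 hg]; exists (C * D) => [|v Pv]; first exact: mulr_ge0.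
by rewrite normrM ler_pM ?hf ?hg.
Qed.
Lemma bdX f n : bd f -> bd (fun v => f v^+n).
by move=> [C C0 hf]; exists (C^+n) => [|v Pv]; rewrite ?exprn_ge0 // normrX lerXn2r ?hf.
Qed.
End Bounded.

Ltac bd_tac := repeat first [ assumption | apply: bd_cst | apply: bdD | apply: bdN | apply: bdM | apply: bdX ].

(** * A contracting recurrence and its asymptotic expansion *)

Section Rho.
Variable R : realType.
Implicit Types (x y A C : R).

Definition rb A : R := 2^-1 + A^-1/4.
Definition rk A : R := A^-1/24 + 12^-1.
Definition rg A : R := 12^-1 + 3/32 * A^-1^+2 - A^-1/48.
(** The ansatz for [rho n] with [x = sqrt (n / A)]; [rb] and [rg] are the constants for which it
    satisfies the recurrence up to [O(x^-3)], and [rk] is the constant term already known for the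
    companion sequence [w]. *)
Definition rr A x : R := x + rb A + rg A/x.

(** Normalised variables with bounds independent of [n]: [(x - y) y], [y / x], [1 / y] and the two
    rescaled errors of [w]. Written in them, the remainders [G] and [H] of [rho_step] are
    polynomials, hence bounded. *)
Record rv := Rv { re : R; rx : R; rt : R; rd : R; rd' : R }.

(** With [r = rr A y], the map sending [p] to [1 + p w / (w' + p)] has difference quotient
    [w' w / ((w' + p) (w' + r))]. This is at most [1 - 1 / (2 y)], as [w] is about [y^2] while
    [w' + r] is about [y^2 + y]. The other summand is the failure of the ansatz to solve the
    recurrence. *)
Lemma rho_step A C : 0 < A -> 0 < C -> exists2 Y : R, 1 <= Y & exists2 C' : R, 0 < C' &
 forall x y w w' p, Y <= y -> 0 < x -> x^+2 = y^+2 + A^-1 ->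
 `|w - (x^+2 - rk A)| <= C/y^+2 -> `|w' - (y^+2 - rk A)| <= C/y^+2 -> 0 <= p ->
 `|1 + p * w/(w' + p) - rr A x| <= (1 - (2 * y)^-1) * `|p - rr A y| + C' / y^+3.
move=> A0 C0; pose B := A^-1; have B0 : 0 < B by rewrite invr_gt0.
pose be := rb A; pose k0 := rk A; pose ga := rg A.
pose P v := [/\ 0 <= re v <= B/2, 0 <= rx v <= 1, 0 <= rt v <= 1, `|rd v| <= C & `|rd' v| <= C].
have be1 : bd P re by exists (B/2); [lra | move=> v [/andP[h1 h2] _ _ _ _]; rewrite ger0_norm].
have bx : bd P rx by exists 1 => // v [_ /andP[h1 h2] _ _ _]; rewrite ger0_norm.
have bt : bd P rt by exists 1 => // v [_ _ /andP[h1 h2] _ _]; rewrite ger0_norm.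
have bdd : bd P rd by exists C; [exact: ltW | move=> v []].
have bdd' : bd P rd' by exists C; [exact: ltW | move=> v []].
pose H v : R := (1 - rt v/2) * (be - k0 + ga * rt v + rd' v * rt v^+2) - 2^-1 - (B - k0 + rd v * rt v^+2).
have [CH CH0 hH] : bd P H by rewrite /H; bd_tac.
pose G v : R := re v^+2/2 + re v^+2 * rt v/2 + ga + re v * k0 + ga * re v * rx v*(1 - k0 * rt v^+2)
 + ga * B - re v * be - re v * ga * rt v + ga * re v * rx v * rt v - be * ga - ga * be * rx v - ga^+2 * rx v * rt v
 + (rt v - 1 - re v * rt v^+2 - be * rt v - ga * rx v * rt v^+2) * rd' v + (1 + be * rt v + ga * rt v^+2) * rd v.
have [CG CG0 hG] : bd P G by rewrite /G; bd_tac.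
pose Y := 1 + 2 * CH + `|k0| + `|ga| + C.
have Y1 : 1 <= Y by rewrite /Y; have := normr_ge0 k0; have := normr_ge0 ga; lra.
exists Y => //; exists (CG + 1); first lra.
move=> x y w w' p Yy x0 xy hw hw' p0.
have y1 : 1 <= y by lra.
have y0 : 0 < y by lra.
have y2 : 0 < y^+2 by rewrite exprn_gt0.
have yx : y <= x by rewrite -(@ler_pXn2r _ 2) ?nnegrE ?ltW // xy; rewrite -/B; lra.
pose v := Rv ((x - y) * y) (y/x) y^-1 ((w - (x^+2 - k0)) * y^+2) ((w' - (y^+2 - k0)) * y^+2).
have xyB : (x - y) * (x + y) = B.
 have -> : (x - y) * (x + y) = x^+2 - y^+2 by ring.
 by rewrite xy -/B addrAC subrr add0r.
have Pv : P v.
 split=> /=.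
 - apply/andP; split; first by rewrite mulr_ge0 ?subr_ge0 // ltW.
 have : (x - y) * (2 * y) <= B.
 by rewrite -xyB; apply: ler_wpM2l; [rewrite subr_ge0 | lra].
 lra.
 - by rewrite divr_ge0 ?(ltW x0) ?(ltW y0) //= ler_pdivrMr // mul1r.
 - by rewrite invr_ge0 (ltW y0) invf_le1.
 - by rewrite normrM [`|y^+2|]ger0_norm ?(ltW y2) // -ler_pdivlMr.
 - by rewrite normrM [`|y^+2|]ger0_norm ?(ltW y2) // -ler_pdivlMr.
have hk : - `|k0| <= - k0 <= `|k0| by rewrite -ler_norml normrN.
have [_ _ ht hd hd'] := Pv; rewrite /= in ht hd hd'.
have iy0 : 0 < y^-1 by rewrite invr_gt0.
have iy1 : y^-1 <= 1 by case/andP: ht.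
have hd2 : `|(w' - (y^+2 - k0))| <= C.
 by lel hw'; rewrite ler_pdivrMr // ler_peMr ?(ltW C0) // exprn_ege1.
have w'0 : 0 < w'.
 have : y <= y^+2 by rewrite expr2 ler_peMr // ltW.
 move: hd2 Yy hk; rewrite /Y !ler_norml => /andP[u1 u2] Yy /andP[u3 u4].
 have := normr_ge0 ga; lra.
have gy : - `|ga| <= ga/y <= `|ga|.
 rewrite -ler_norml normrM [`|y^-1|]ger0_norm ?(ltW iy0) // -[leRHS]mulr1.
 by apply: ler_wpM2l.
have be0 : 0 < be by rewrite /be /rb -/B; lra.
have den : y^+2 <= w' + rr A y.
 move: hd2 Yy hk gy; rewrite /Y /rr -/be -/ga !ler_norml => /andP[u1 u2] Yy /andP[u3 u4] /andP[u5 u6].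
 lra.
have den0 : 0 < w' + rr A y by apply: lt_le_trans den.
have yn0 : y != 0 by rewrite gt_eqF.
have xn0 : x != 0 by rewrite gt_eqF.
have EG : (1 - rr A x) * (w' + rr A y) + rr A y * w = y^-1 * G v.
 have wE : w = rd v/y^+2 + (x^+2 - k0) by rewrite /v /= mulfK ?gt_eqF // subrK.
 have w'E : w' = rd' v/y^+2 + (y^+2 - k0) by rewrite /v /= mulfK ?gt_eqF // subrK.
 rewrite {1}w'E {1}wE /G; move: (rd v) (rd' v) => d d' /=.
 rewrite /rr -/be -/ga /be /ga /k0 /rb /rg /rk -/B -xyB.
 by fld.
have hG1 : `|(1 - rr A x) * (w' + rr A y) + rr A y * w| <= CG/y.
 by rewrite EG normrM [`|y^-1|]ger0_norm ?(ltW iy0) // mulrC ler_pM2r // hG.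
have src : `|1 + rr A y * w/(w' + rr A y) - rr A x| <= CG/y^+3.
 have -> : 1 + rr A y * w/(w' + rr A y) - rr A x = ((1 - rr A x) * (w' + rr A y) + rr A y * w)/(w' + rr A y).
 by fld.
 rewrite normrM [`|_^-1|]ger0_norm; last by rewrite invr_ge0 (ltW den0).
 have -> : CG/y^+3 = CG/y*(y^+2)^-1 by fld.
 apply: ler_pM => //; first by rewrite invr_ge0 (ltW den0).
 by rewrite lef_pV2.
have EH : (1 - (2 * y)^-1) * (w' + rr A y) - w = y/2 + H v.
 have wE : w = rd v/y^+2 + (x^+2 - k0) by rewrite /v /= mulfK ?gt_eqF // subrK.
 have w'E : w' = rd' v/y^+2 + (y^+2 - k0) by rewrite /v /= mulfK ?gt_eqF // subrK.
 rewrite {1}w'E {1}wE xy /H; move: (rd v) (rd' v) => d d' /=.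
 by rewrite /rr -/be -/ga -/B; field; rewrite yn0.
have wle : w <= (1 - (2 * y)^-1) * (w' + rr A y).
 have := hH v Pv; rewrite ler_norml => /andP[u1 u2].
 have h1 := normr_ge0 k0; have h2 := normr_ge0 ga.
 have : 0 <= y/2 + H v by move: Yy; rewrite /Y; lra.
 lra.
have w0 : 0 <= w.
 have : `|w - (x^+2 - k0)| <= C.
 by lel hw; rewrite ler_pdivrMr // ler_peMr ?(ltW C0) // exprn_ege1.
 have : y <= y^+2 by rewrite expr2 ler_peMr // ltW.
 move: Yy hk; rewrite /Y xy -/B !ler_norml => Yy /andP[u3 u4] h /andP[u1 u2].
 have := normr_ge0 ga; lra.
have con : `|p * w/(w' + p) - rr A y * w/(w' + rr A y)| <= (1 - (2 * y)^-1) * `|p - rr A y|.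
 have wp0 : 0 < w' + p by lra.
 have -> : p * w/(w' + p) - rr A y * w/(w' + rr A y) =
 (w' / (w' + p)) * (w/(w' + rr A y)) * (p - rr A y) by fld.
 rewrite normrM; apply: ler_wpM2r => //.
 rewrite ger0_norm; last by apply: mulr_ge0; apply: divr_ge0 => //; exact: ltW.
 rewrite -[leRHS]mul1r; apply: ler_pM.
 - by pz.
 - by pz.
 - by rewrite ler_pdivrMr // mul1r lerDl.
 - by rewrite ler_pdivrMr.
have y3 : 0 <= (y^+3)^-1 by rewrite invr_ge0 exprn_ge0 // ltW.
have -> : 1 + p * w/(w' + p) - rr A x = (1 + rr A y * w/(w' + rr A y) - rr A x) +
 (p * w/(w' + p) - rr A y * w/(w' + rr A y)) by ring.
lel (ler_normD _ _); have -> : (CG + 1)/y^+3 = CG/y^+3 + (y^+3)^-1 by rewrite [LHS]mulrDl mul1r.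
by lel (lerD src con); rewrite [leRHS]addrC -addrA lerD2l lerDr.
Qed.

(** If the error is [M / y^2], one step removes [M / (2 y^3)]. This outweighs the source [C' / y^3]
    and the decrease of [1 / y^2] to [1 / x^2], which is of order [1 / y^4] only. So the bound
    propagates from any starting value, which merely enters [M]. *)
Lemma rho_asymp A C (rho w : nat -> R) n0 : 0 < A -> 0 < C -> 
 (forall n, (n0 <= n)%N -> [/\ 0 <= rho n, `|w n - (n%:R/A - rk A)| <= C/(n%:R/A) &
 rho n.+1 = 1 + rho n * w n.+1/(w n + rho n)]) ->
 exists2 M : R, 0 < M & exists n1, forall n, (n1 <= n)%N ->
 `|rho n - rr A (sqrt (n%:R/A))| <= M/(n%:R/A).
move=> A0 C0 H.
have [Y Y1 [C' C'0 step]] := rho_step A0 C0.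
pose Z := Y + 4/A.
have iA : 0 < A^-1 by rewrite invr_gt0.
have Z0 : 1 <= Z by rewrite /Z; lra.
pose N := maxn n0 (Num.truncn (Z^+2 * A)).+1.
pose yy n := sqrt (n%:R/A).
have yy2 n : yy n^+2 = n%:R/A by rewrite sqr_sqrtr // divr_ge0 ?ler0n // ltW.
have yyZ n : (N <= n)%N -> Z <= yy n.
 move=> Nn; rewrite -(@ler_pXn2r _ 2) ?nnegrE ?sqrtr_ge0 //; last lra.
 rewrite yy2 ler_pdivlMr //.
 have /andP[_ h] : (Num.truncn (Z^+2 * A))%:R <= Z^+2 * A < (Num.truncn (Z^+2 * A)).+1%:R.
 by apply: Num.Theory.truncn_itv; rewrite mulr_ge0 ?sqr_ge0 // ltW.
 by lel (ltW h); rewrite ler_nat; apply: leq_trans Nn; rewrite leq_maxr.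
pose M := 4 * C' + `|rho N - rr A (yy N)| * yy N^+2.
have M0 : 0 < M.
 by rewrite ltr_pwDl ?mulr_gt0 // mulr_ge0 // sqr_ge0.
exists M => //; exists N => n Nn; rewrite -/(yy n) -yy2.
rewrite -(subnKC Nn); move: (n - N)%N => k {n Nn}.
elim: k => [|k IH].
 have ZN := yyZ N (leqnn _); have y20 : 0 < yy N^+2 by rewrite exprn_gt0 //; lra.
 by rewrite addn0 ler_pdivlMr // /M lerDr mulr_ge0 // ltW.
rewrite addnS; set n := (N + k)%N in IH *.
have Nn : (N <= n)%N by rewrite leq_addr.
have n0n : (n0 <= n)%N by apply: leq_trans Nn; rewrite leq_maxl.
have [r0 wn rn] := H n n0n; have [_ wn1 _] := H n.+1 (leqW n0n).
have Zy := yyZ n Nn; set y := yy n in Zy IH *.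
have Zx := yyZ n.+1 (leqW Nn); set x := yy n.+1 in Zx *.
have x0 : 0 < x by lra.
have y0 : 0 < y by lra.
have xy : x^+2 = y^+2 + A^-1 by rewrite !yy2 natS mulrDl mul1r.
have y2 : 0 < y^+2 by rewrite exprn_gt0.
have hw1 : `|w n.+1 - (x^+2 - rk A)| <= C/y^+2.
 rewrite yy2; lel wn1; rewrite ler_pM2l // -yy2 lef_pV2 ?posrE ?exprn_gt0 // -/x xy; lra.
have hw0 : `|w n - (y^+2 - rk A)| <= C/y^+2 by rewrite yy2.
have Yy : Y <= y by apply: le_trans Zy; rewrite /Z lerDl divr_ge0 // ltW.
have := step x y (w n.+1) (w n) (rho n) Yy x0 xy hw1 hw0 r0; rewrite -rn => h.
lel h.
have iy : 0 <= 1 - (2 * y)^-1.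
 rewrite subr_ge0 invf_le1 ?mulr_gt0 //; lra.
lel (lerD (ler_wpM2l iy IH) (lexx _)).
rewrite xy.
have yA : 4 * A^-1 <= y by apply: le_trans Zy; rewrite /Z lerDr; lra.
have MC : 4 * C' <= M by rewrite /M lerDl mulr_ge0 // sqr_ge0.
clearbody M; move: iA yA; move: (A^-1) => B B0 yB.
have yB2 : 0 < y^+2 + B by lra.
rewrite ler_pdivlMr // -subr_ge0.
have -> : M - ((1 - (2 * y)^-1) * (M/y^+2) + C' / y^+3) * (y^+2 + B) =
 ((M/2 - C') * (y^+2 + B) - M * B * y)/y^+3 by fld.
rewrite divr_ge0 ?exprn_ge0 ?(ltW y0) //.
have h1 : M/4*(y^+2) <= (M/2 - C') * (y^+2) by apply: ler_wpM2r; [exact: ltW | lra].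
have h2 : 0 <= (M/2 - C') * B by apply: mulr_ge0; [lra | exact: ltW].
have h3 : M * y*(4 * B) <= M * y * y by apply: ler_wpM2l => //; apply: mulr_ge0; exact: ltW.
rewrite mulrDr; move: h1 h2 h3; rewrite expr2; lra.
Qed.

Lemma inv_exp_expand : exists2 C : R, 0 < C & forall s : R, 0 < s <= 1 ->
 s/2 <= 1 - expR (- s) /\ `|(1 - expR (- s))^-1 - (s^-1 + 2^-1 + s/12)| <= C * s^+3.
exists 2 => // s /andP[s0 s1].
have := expRN_taylor 5 (ltW s0); rewrite !big_ord_recr big_ord0 /= add0r.
rewrite (_ : 0`! = 1%N) // (_ : 1`! = 1%N) // (_ : 2`! = 2%N) // (_ : 3`! = 6%N) // (_ : 4`! = 24%N) // (_ : 5`! = 120%N) //.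
rewrite expr0 expr1 !divr1.
set e := expR (- s); set r := e - _ => hr.
have r5 : `|r| <= s^+5/100.
 lel hr; have s5 : 0 < s^+5 by rewrite exprn_gt0.
 rewrite ler_pM2l // lef_pV2 ?posrE ?ltr0n //.
 by rewrite (_ : 120 = 100 + 20)%N // natrD lerDl ler0n.
have eE : 1 - e = s - s^+2/2 + s^+3/6 - s^+4/24 - r by rewrite /r; ring.
have sp k : 0 <= s^+k.+1 <= s 
 by rewrite exprn_ge0 ?(ltW s0) //= exprS -[leRHS]mulr1 ler_wpM2l ?(ltW s0) // exprn_ile1 // (ltW s0).
have ge : s/2 <= 1 - e.
 have s5 : s^+5 <= s^+3 by rewrite ler_wiXn2l // ltW.
 have s4 : s^+4 <= s^+3 by rewrite ler_wiXn2l // ltW.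
 have s2 : s^+2 <= s by case/andP: (sp 1%N).
 have s3 : 0 <= s^+3 by case/andP: (sp 2%N).
 move: r5; rewrite eE ler_norml => /andP[h1 h2]; lra.
split=> //.
have d0 : 0 < 1 - e by lra.
have -> : (1 - e)^-1 - (s^-1 + 2^-1 + s/12) = (1 - (1 - e) * (s^-1 + 2^-1 + s/12))/(1 - e).
 by fld.
have -> : 1 - (1 - e) * (s^-1 + 2^-1 + s/12) = s^+4*(1/144 + s/288) + r*(s^-1 + 2^-1 + s/12).
 by rewrite eE; fld.
have s4 : 0 < s^+4 by rewrite exprn_gt0.
have b1 : `|s^+4*(1/144 + s/288)| <= s^+4*(2/100).
 rewrite normrM (ger0_norm (ltW s4)) ler_pM2l // ger0_norm; lra.
have b2 : `|r*(s^-1 + 2^-1 + s/12)| <= s^+4*(2/100).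
 rewrite normrM; via (s^+5/100*(2/s)).
 apply: ler_pM => //.
 have i1 : 1 <= s^-1 by rewrite invf_ge1.
 rewrite ger0_norm; lra.
 le_eq; field; by pz.
rewrite normrM [`|_^-1|]ger0_norm; last by rewrite invr_ge0 ltW.
rewrite ler_pdivrMr //; lel (ler_normD _ _).
lel (lerD b1 b2).
have : 2 * s^+3*(s/2) <= 2 * s^+3*(1 - e) by rewrite ler_wpM2l // mulr_ge0 ?exprn_ge0 ?ltW.
have -> : 2 * s^+3*(s/2) = s^+4 by fld.
lra.
Qed.

End Rho.

(** * Averages over the mixing weights and summatory functions of the counts *)

Section Moments.
Variable R : realType.
Implicit Types (a s h : R) (n k : nat).
Local Notation jj := (@jj R).
Local Notation A := (@AA R).
Local Notation cpoly := (@cpoly R).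

(** The unknown signed weights are seen only through this functional of the parameter; the
    expansions of the product moments call for [f = 1], [s], [1 / s] and [1 / s^2]. *)
Definition mx K (c : nat -> R) a (f : R -> R) : R := \sum_(u < K) c u * f (tilt a u).

Lemma mx_le K (c : nat -> R) a f g C D : (forall u, `|c u| <= C) -> 0 <= D ->
 (forall u, (u < K)%N -> `|f (tilt a u) - g (tilt a u)| <= D) -> `|mx K c a f - mx K c a g| <= K%:R * C * D.
move=> hc D0 h; rewrite /mx -sumrB; lel (ler_norm_sum _ _ _).
via (\sum_(u < K) C * D).
 by lsum u; rewrite -mulrBr normrM ler_pM // h.
by rewrite sumr_const card_ord -[_ *+ K]mulr_natl mulrA.
Qed.

Lemma tilt_bounds K a u : 0 < a -> a*(K%:R^+2) <= 1 -> (u < K)%N ->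
 a <= tilt a u <= 2 * a /\ (tilt a u - a)^+2 <= K%:R^+2 * a^+3.
move=> a0 ha uK.
have uK' : u%:R <= K%:R :> R by rewrite ler_nat ltnW.
have K0 : 0 <= K%:R :> R by rewrite ler0n.
have sK : sqrt a * K%:R <= 1.
 rewrite -(@ler_pXn2r _ 2) ?nnegrE //.
 by rewrite exprMn sqr_sqrtr ?expr1n // ltW.
have us : 0 <= sqrt a * u%:R <= 1.
 rewrite mulr_ge0 ?sqrtr_ge0 ?ler0n //=; apply: le_trans sK.
 by pz.
have -> : tilt a u = a + a*(sqrt a * u%:R) by rewrite /tilt /scale; ring.
split.
 case/andP: us => u1 u2; have := ler_wpM2l (ltW a0) u2; have := mulr_ge0 (ltW a0) u1.
 move: (a * _) => z; lra.
have -> : (a + a*(sqrt a * u%:R) - a)^+2 = u%:R^+2*(a^+2 * sqrt a^+2) by ring.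
rewrite sqr_sqrtr ?(ltW a0) // -exprSr; apply: ler_wpM2r; first by pz.
by pz.
Qed.

(** The number of self-conjugate partitions of [m], read as a coefficient. With
    [g k = sc (n - k) / sc n], the quotients [rho] and [wsc] are the sums of [g k] and of [k g k]
    ([rhoE], [wscE]), which the mixture turns into geometric sums. *)
Definition sc m : R := (cpoly pred0 m)`_m.
Definition Tsc n : R := \sum_(m < n.+1) sc m.
Definition Wsc n : R := \sum_(m < n) Tsc m.
Definition rho n := Tsc n/sc n.
Definition wsc n := Wsc n/sc n.

Lemma cpoly_stable m M : (m <= M)%N -> (cpoly pred0 M)`_m = sc m.
move=> mM; rewrite -(subnKC mM); elim: (M - m)%N => [|d IH]; first by rewrite addn0.
have rc : cpoly pred0 (m + d).+1 = cpoly pred0 (m + d) * (1 + 'X^((m + d).*2.+1)) by rewrite /cpoly big_ord_recr.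
rewrite addnS rc mulrDr mulr1 coefD coefMXn IH.
rewrite ifT ?addr0 //; apply: (@leq_ltn_trans (m + d)); first exact: leq_addr.
by rewrite -addnn ltnS leq_addl.
Qed.

Lemma gco_nil n k : (k <= n)%N -> gco R n [::] k = sc (n - k)/sc n.
move=> kn; rewrite /gco (eq_cpoly R n (V' := pred0)); last by move=> x; rewrite /lmem in_nil.
by rewrite coefXnM ltnNge kn cpoly_stable ?leq_subr.
Qed.

Lemma rhoE n : rho n = \sum_(k < n.+1) gco R n [::] k.
rewrite /rho /Tsc mulr_suml (reindex_inj rev_ord_inj) /=; bigr i.
by rewrite subSS gco_nil // -ltnS.
Qed.

Lemma WscE n : Wsc n = \sum_(m < n.+1) (n - m)%:R * sc m.
elim: n => [|n IH]; first by rewrite /Wsc big_ord0 big_ord1 subnn mul0r.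
rewrite /Wsc big_ord_recr /= -/(Wsc n) IH [RHS]big_ord_recr /= subnn mul0r addr0 /Tsc -big_split /=.
by bigr i; rewrite subSn -1?ltnS // natS mulrDl mul1r.
Qed.

Lemma wscE n : wsc n = \sum_(k < n.+1) k%:R * gco R n [::] k.
rewrite /wsc WscE mulr_suml (reindex_inj rev_ord_inj) /=; bigr i.
by rewrite subSS gco_nil -1?ltnS // subKn -1?ltnS // mulrA.
Qed.

Lemma sc_ge0 m : 0 <= sc m.
Proof. by rewrite /sc -count_all; apply: sumr_ge0. Qed.

(** Exact: adding [sc n.+1] to [Tsc n] and [Tsc n] to [Wsc n] gives the next summatory values, and
    eliminating the ratio of [sc n.+1] to [sc n] links consecutive [rho] through [wsc] alone. *)
Lemma rho_rec n : 0 < sc n -> 0 < sc n.+1 -> rho n.+1 = 1 + rho n * wsc n.+1/(wsc n + rho n).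
move=> s0 s1; rewrite /rho /wsc.
have -> : Tsc n.+1 = Tsc n + sc n.+1 by rewrite /Tsc big_ord_recr.
have -> : Wsc n.+1 = Wsc n + Tsc n by rewrite /Wsc big_ord_recr.
have T0 : 0 < Tsc n.
 by rewrite /Tsc big_ord_recr ltr_wpDl // sumr_ge0 // => i _; exact: sc_ge0.
have W0 : 0 <= Wsc n.
 by apply: sumr_ge0 => i _; apply: sumr_ge0 => j _; exact: sc_ge0.
have WT : Wsc n + Tsc n != 0 by rewrite gt_eqF // ltr_wpDl.
by fld.
Qed.

Lemma geo1 (x : R) m : x != 1 -> \sum_(k < m) x^+k = (1 - x^+m)/(1 - x).
move=> x1; have d0 : 1 - x != 0 by rewrite subr_eq0 eq_sym.
by rewrite -[1 - x^+m]opprB subrX1 -mulNr opprB mulrAC mulfV ?mul1r.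
Qed.

Lemma geo2 (x : R) m : x != 1 ->
 \sum_(k < m) k%:R * x^+k = x*(1 - x^+m)/(1 - x)^+2 - m%:R * x^+m/(1 - x).
move=> x1; have d0 : 1 - x != 0 by rewrite subr_eq0 eq_sym.
elim: m => [|m IH]; first by rewrite big_ord0 expr0 subrr mulr0 !mul0r subrr.
by rewrite big_ord_recr /= IH (natS R m) [x^+m.+1]exprS; field.
Qed.

Lemma expN_tail : exists2 C : R, 0 < C & forall a s n, 0 < a <= 1 -> a <= s -> a^+2 * n%:R = A ->
 expR (- s)^+n.+1 <= C * a^+8.
have [C C0 H] := exp_decay 8 (@AA_gt0 R); exists C => // a s n /andP[a0 a1] as_ an.
via (expR (- (A * a^-1))); last first.
 by lel (H _ _); rewrite ?invr_gt0 // exprVn invrK.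
rewrite -expRM_natl ler_expR mulrN lerN2 -an.
have -> : a^+2 * n%:R * a^-1 = n%:R * a by fld.
apply: ler_pM => //; first exact: ltW.
by rewrite ler_nat.
Qed.

(** The full geometric sums are [y] and [y^2 - y] with [y = 1 / (1 - exp (- s))], expanded by
    [inv_exp_expand]. Cutting them at [n] is negligible, since [s n >= A / a]. *)
Lemma geo_expand : exists2 C : R, 0 < C & forall a s n, 0 < a <= 1/4 -> a <= s <= 2 * a -> a^+2 * n%:R = A ->
 `|\sum_(k < n.+1) expR (- (s * k%:R)) - (s^-1 + 2^-1 + s/12)| <= C * a^+2 /\
 `|\sum_(k < n.+1) k%:R * expR (- (s * k%:R)) - ((s^+2)^-1 - 12^-1)| <= C * a^+2.
have [C C0 HC] := inv_exp_expand R; have [C' C'0 HC'] := expN_tail.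
exists (8 * C + 4*(1 + 3 * C + C^+2) + 20 * C').
 by rewrite addr_gt0 ?mulr_gt0 // addr_gt0 ?mulr_gt0 // addr_gt0 ?exprn_gt0 // addr_gt0 ?mulr_gt0.
move=> a s n /andP[a0 a1] /andP[s1 s2] an.
have s0 : 0 < s by lra.
have sle : s <= 1 by lra.
have [ylow hE] := HC s ltac:(by rewrite s0 sle).
have ht := HC' a s n ltac:(by apply/andP; split; lra) s1 an.
have xk k : expR (- (s * k%:R)) = expR (- s)^+k by rewrite -expRM_natl mulrN mulrC.
under eq_bigr => k _ do rewrite xk.
under [X in _ /\ `|X - _| <= _]eq_bigr => k _ do rewrite xk.
set x := expR (- s) in ylow hE ht *.
have d0 : 0 < 1 - x by lra.
have x1 : x != 1 by apply: contraTneq d0 => ->; rewrite subrr ltxx.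
rewrite geo1 // geo2 //.
set X := x^+n.+1 in ht *.
have X0 : 0 <= X by rewrite exprn_ge0 // expR_ge0.
set y := (1 - x)^-1 in hE.
have y0 : 0 < y by rewrite invr_gt0.
have yle : y <= 2/a.
 rewrite /y -[2/a]invrK lef_pV2 ?posrE ?invr_gt0 ?divr_gt0 // invf_div; lra.
have n2 : (n.+1)%:R <= 2/a^+2.
 have a2 : 0 < a^+2 by rewrite exprn_gt0.
 rewrite ler_pdivlMr // natS mulrDl mulrC an mul1r; have := AA_le R.
 have : a^+2 <= 1 by rewrite expr_le1 ?(ltW a0) //; lra.
 lra.
set E := y - _ in hE.
have yE : y = s^-1 + 2^-1 + s/12 + E by rewrite /E; ring.
have s3 : 0 <= s^+3 by rewrite exprn_ge0 // ltW.
have s2a : s^+2 <= 4 * a^+2.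
 by rewrite (_ : 4 * a^+2 = (2 * a)^+2); [rewrite lerXn2r ?nnegrE //; lra | ring].
have s32 : s^+3 <= 2 * a^+2.
 have : s * s^+2 <= (1/2) * (4 * a^+2) by apply: ler_pM => //; [exact: ltW | exact: sqr_ge0 | lra].
 lra.
have a20 : 0 <= a^+2 by rewrite sqr_ge0.
have a8 k : (k <= 6)%N -> a^+8/a^+k <= a^+2.
 move=> k6; have -> : a^+8/a^+k = a^+(8 - k).
 by rewrite -[in LHS](subnK (leq_trans k6 (isT : (6 <= 8)%N))) exprD mulfK // expf_neq0 // gt_eqF.
 rewrite ler_wiXn2l ?(ltW a0) //; first lra.
 by move: k6; do 7 (case: k => [//|k]).
have C2 : 0 <= C^+2 by rewrite sqr_ge0.
have q0 : 0 <= C * a^+2 by rewrite mulr_ge0 // ltW.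
have q1 : 0 <= C^+2 * a^+2 by rewrite mulr_ge0.
have q2 : 0 <= C' * a^+2 by rewrite mulr_ge0 // ltW.
have Xy : X * y <= 2 * C' * a^+2.
 via (C' * a^+8*(2/a)); first by apply: ler_pM => //; exact: ltW.
 have -> : C' * a^+8*(2/a) = 2 * C' * (a^+8/a^+1) by rewrite expr1; ring.
 by rewrite ler_wpM2l ?a8 // mulr_ge0 // ltW.
have Xy0 : 0 <= X * y by rewrite mulr_ge0 // ltW.
split.
 have -> : (1 - X) * y - (s^-1 + 2^-1 + s/12) = E - X * y by rewrite yE; ring.
 lel (ler_normB _ _); rewrite (ger0_norm Xy0).
 have : C * s^+3 <= C*(2 * a^+2) by rewrite ler_wpM2l // ltW.
 move: hE; rewrite !mulrDl; move: (`|E|) (s^+3) (a^+2) a20 q0 q1 q2 Xy C0; clear => *; lra.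
have xy : x/(1 - x)^+2 = y^+2 - y by rewrite /y; fld.
have -> : x*(1 - X)/(1 - x)^+2 - (n.+1)%:R * X/(1 - x) - ((s^+2)^-1 - 12^-1) =
 s^+2/144 + E*(2/s + s/6) + E^+2 - (X * y^+2 - X * y) - (n.+1)%:R*(X * y).
 have -> : x*(1 - X)/(1 - x)^+2 = (y^+2 - y) * (1 - X) by rewrite -xy; ring.
 rewrite -/y; have -> : (s^+2)^-1 = y^+2 - y + 12^-1 - (s^+2/144 + E*(2/s + s/6) + E^+2).
 by rewrite yE; fld.
 ring.
have h1 : `|s^+2/144| <= a^+2 by rewrite ger0_norm ?divr_ge0 ?sqr_ge0 //; lra.
have h2 : `|E*(2/s + s/6)| <= 12 * C * a^+2.
 rewrite normrM; via (C * s^+3*(3/s)).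
 apply: ler_pM => //; have i1 : 1 <= s^-1 by rewrite invf_ge1.
 rewrite ger0_norm; lra.
 have -> : C * s^+3*(3/s) = 3 * C * s^+2 by fld.
 have -> : 12 * C * a^+2 = 3 * C*(4 * a^+2) by ring.
 by rewrite ler_wpM2l // mulr_ge0 // ltW.
have h3 : `|E^+2| <= 4 * C^+2 * a^+2.
 rewrite normrX; via ((C * s^+3)^+2).
 by pz.
 have -> : (C * s^+3)^+2 = C^+2 * s^+6 by ring.
 have -> : 4 * C^+2 * a^+2 = C^+2*(4 * a^+2) by ring.
 apply: ler_wpM2l => //; via (s^+2) => //.
 by rewrite ler_wiXn2l // ltW.
have h4 : `|X * y^+2 - X * y| <= 6 * C' * a^+2.
 lel (ler_normB _ _); rewrite (ger0_norm Xy0) ger0_norm; last by rewrite mulr_ge0 ?sqr_ge0.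
 have : X * y^+2 <= 4 * C' * a^+2.
 via (C' * a^+8*(2/a)^+2).
 by apply: ler_pM => //; [exact: sqr_ge0 | rewrite lerXn2r ?nnegrE ?divr_ge0 ?(ltW y0) ?(ltW a0)].
 have -> : C' * a^+8*(2/a)^+2 = 4 * C' * (a^+8/a^+2) by rewrite expr_div_n; ring.
 by rewrite ler_wpM2l ?a8 // mulr_ge0 // ltW.
 lra.
have h5 : `|(n.+1)%:R*(X * y)| <= 4 * C' * a^+2.
 rewrite ger0_norm; last by rewrite mulr_ge0.
 via (2/a^+2*(C' * a^+8*(2/a))).
 apply: ler_pM => //; apply: ler_pM => //; exact: ltW.
 have -> : 2/a^+2*(C' * a^+8*(2/a)) = 4 * C' * (a^+8/a^+3) by fld.
 by rewrite ler_wpM2l ?a8 // mulr_ge0 // ltW.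
move: h1 h2 h3 h4 h5; rewrite !ler_norml.
move: (s^+2/144) (E*(2/s + s/6)) (E^+2) (X * y^+2 - X * y) (_*(X * y)) => u1 u2 u3 u4 u5.
have -> : (8 * C + 4*(1 + 3 * C + C^+2) + 20 * C') * a^+2 =
 20*(C * a^+2) + 4 * a^+2 + 4*(C^+2 * a^+2) + 20*(C' * a^+2) by ring.
rewrite -(mulrA 12) -(mulrA 4) -(mulrA 6) -(mulrA 4).
move: q0 q1 q2 a20; move: (C * a^+2) (C^+2 * a^+2) (C' * a^+2) (a^+2) => ? ? ? ? ? ? ? ?.
move=> /andP[? ?] /andP[? ?] /andP[? ?] /andP[? ?] /andP[? ?].
lra.
Qed.

End Moments.

(** * Averages over the mixing weights: what mass and mean weight determine *)

Section Moments2.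
Variable R : realType.
Implicit Types (a s h : R) (n k : nat).
Local Notation jj := (@jj R).
Local Notation A := (@AA R).
Local Notation cpoly := (@cpoly R).
Local Notation sc := (@sc R).
Local Notation rho := (@rho R).
Local Notation wsc := (@wsc R).

Lemma mixdef_weight_mean n s : Eprod s (fun D : {set 'I_n} => (weight D)%:R) = bmean (bp s) n.
have e (D : {set 'I_n}) : (weight D)%:R = \sum_(i < n) (i.*2.+1)%:R * allb R [:: val i] D.
 by rewrite weight_bit natr_sum; bigr i; rewrite natrM mulrC /allb /= andbT.
rewrite /Eprod; under eq_bigr => D _ do rewrite e mulr_suml.
rewrite exchange_big /bmean; bigr i.
have := @Eprod_allb R n s [:: val i] isT; rewrite /= andbT ltn_ord big_seq1 => /(_ isT) <-.
by rewrite /Eprod mulr_sumr; bigr D; rewrite mulrA.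
Qed.

Lemma n_le_inv a n : 0 < a -> a^+2 * n%:R = A -> n%:R <= (a^+2)^-1.
Proof. by move=> a0 an; rewrite -div1r ler_pdivlMr ?exprn_gt0 // mulrC an AA_le. Qed.

(** Exact facts about the conditioned measure are read through the mixture. Total mass 1 gives
    [M 1]; mean weight [n], with [bmean_asymp], gives [M (1 / s^2)] and then [wsc]. The ratio [rho]
    gives only the combination of [M (1 / s)] with [M s / 12], so a second source for [rho] is
    required. *)
Theorem mix_basic t : exists K, exists2 C : R, 0 < C & exists2 a1 : R, 0 < a1 <= 1/80 &
 forall a n, 0 < a -> a <= a1 -> a^+2 * n%:R = A ->
 0 < sc n /\ exists c : nat -> R, let M := mx K c a in
 [/\ (forall u, `|c u| <= C) /\ (forall u, (u < K)%N -> a <= tilt a u <= 2 * a /\ (tilt a u - a)^+2 <= K%:R^+2 * a^+3),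
 `|M (fun=> 1) - 1| <= C * a^+3,
 `|M (fun s => (s^+2)^-1) - ((a^+2)^-1 - 24^-1/A)| <= C * a^+2 /\ `|wsc n - ((a^+2)^-1 - rk A)| <= C * a^+2,
 `|rho n - (M (fun s => s^-1) + 2^-1 + M id/12)| <= C * a^+2 &
 `|mixdef K c a (@Nhk R n t)| <= C * a^+3 /\ `|mixdef K c a (fun D : {set 'I_n} => Nhk R t D^+2)| <= C * a^+3].
have [K [C C0 [a1 /andP[a10 a11] H]]] := mix_expect R t 8.
have [Cb Cb0 Hb] := bmean_asymp R; have [Cg Cg0 Hg] := geo_expand R.
have A0 := @AA_gt0 R; have A6 := AA_ge R; have A1 := AA_le R.
have K0 : 0 <= K%:R :> R by rewrite ler0n.
pose a2 := Num.min a1 (K.+1%:R^+2)^-1.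
have a20 : 0 < a2 by rewrite lt_min a10 invr_gt0 exprn_gt0 // ltr0n.
pose B := 10*(1 + C + K%:R * C*(4 * Cb + Cg)) * 6.
have KC : 0 <= K%:R * C by rewrite mulr_ge0 // ltW.
have KCb : 0 <= K%:R * C * Cb by rewrite mulr_ge0 // ltW.
have KCg : 0 <= K%:R * C * Cg by rewrite mulr_ge0 // ltW.
have BE : B = 60 + 60 * C + 240*(K%:R * C * Cb) + 60*(K%:R * C * Cg) by rewrite /B; ring.
exists K, B; first by rewrite BE; lra.
exists a2; first by rewrite a20 ge_min a11.
move=> a n a0; rewrite le_min => /andP[aa1 aK] an.
have a80 : a <= 1/80 by lra.
have [S0 [c [c1 c2 c3 c4 c5]]] := H a n a0 aa1 an; split=> //.
exists c => M.
have aK2 : a * K%:R^+2 <= 1.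
 have KK : K%:R^+2 <= K.+1%:R^+2 :> R by rewrite lerXn2r ?nnegrE ?ler0n // ler_nat.
 have k1 : 0 < K.+1%:R^+2 :> R by rewrite exprn_gt0 // ltr0n.
 have : a * K.+1%:R^+2 <= 1 by rewrite -ler_pdivlMr // mul1r.
 have := ler_wpM2l (ltW a0) KK; lra.
have tb u (uK : (u < K)%N) := tilt_bounds a0 aK2 uK.
have sq0 k : 0 <= a^+k by rewrite exprn_ge0 // ltW.
have le1 j k : (k <= j)%N -> a^+j <= a^+k by move=> kj; rewrite ler_wiXn2l ?(ltW a0) //; lra.
have inv2 : 0 < a^+2 by rewrite exprn_gt0.
have nle := n_le_inv a0 an.
have n1le : (n.+1)%:R <= 2/a^+2.
 rewrite natS; have : 1 <= (a^+2)^-1 by rewrite invf_ge1 // expr_le1 ?(ltW a0) //; lra.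
 lra.
have n10 : 0 <= (n.+1)%:R :> R by rewrite ler0n.
have sC k : 0 <= C * a^+k by rewrite mulr_ge0 // ltW.
have eqn k j : (k <= 8)%N -> (j <= 8 - k)%N -> C * a^+8*(2/a^+2) * (2/a^+2) <= 4*(C * a^+4).
 move=> _ _; have -> : C * a^+8*(2/a^+2) * (2/a^+2) = 4*(C * a^+4) by fld.
 by [].
have M1 : `|M (fun=> 1) - 1| <= C * a^+8.
 have := c2 0%N; rewrite gco_nil // subn0 divff ?gt_eqF // mulr0 mul0r oppr0 expR0 mulr1 distrC.
 have -> // : model K c a [::] 0 = M (fun=> 1).
 by bigr u; rewrite big_nil mulr0n mulr0 oppr0 expR0 !mulr1.
have exple k : C * a^+8 * expR (- (a * k%:R/2)) <= C * a^+8.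
 rewrite -[leRHS]mulr1; apply: ler_wpM2l => //; apply: expRN_le1.
 by rewrite divr_ge0 // mulr_ge0 // (ltW a0).
have modE k : model K c a [::] k = M (fun s => expR (- (s * k%:R))).
 by bigr u; rewrite big_nil mulr1.
have a43 : C * a^+4 <= C * a^+2 by rewrite ler_wpM2l ?le1 // ltW.
have a83 : C * a^+8 <= C * a^+3 by rewrite ler_wpM2l ?le1 // ltW.
have a32 : C * a^+3 <= C * a^+2 by rewrite ler_wpM2l ?le1 // ltW.
have Mrho : `|rho n - M (fun s => \sum_(k < n.+1) expR (- (s * k%:R)))| <= 4*(C * a^+2).
 have -> : M (fun s => \sum_(k < n.+1) expR (- (s * k%:R))) = \sum_(k < n.+1) model K c a [::] k.
 under eq_bigr => k _ do rewrite modE.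
 by rewrite /M /mx exchange_big; bigr u; rewrite mulr_sumr.
 rewrite rhoE -sumrB; lel (ler_norm_sum _ _ _).
 via (\sum_(k < n.+1) C * a^+8).
 by lsum k; lel (c2 k).
 rewrite sumr_const card_ord -[_ *+ n.+1]mulr_natr.
 lel (ler_wpM2l (sC 8) n1le).
 have -> : C * a^+8*(2/a^+2) = 2*(C * a^+6) by fld.
 have : C * a^+6 <= C * a^+2 by rewrite ler_wpM2l ?le1 // ltW.
 have := sC 2%N; lra.
have Mw : `|wsc n - M (fun s => \sum_(k < n.+1) k%:R * expR (- (s * k%:R)))| <= 4*(C * a^+2).
 have -> : M (fun s => \sum_(k < n.+1) k%:R * expR (- (s * k%:R))) = \sum_(k < n.+1) k%:R * model K c a [::] k.
 under [RHS]eq_bigr => k _ do rewrite modE /M /mx mulr_sumr.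
 rewrite /M /mx exchange_big; bigr u; rewrite mulr_sumr; bigr k; ring.
 rewrite wscE -sumrB; lel (ler_norm_sum _ _ _).
 via (\sum_(k < n.+1) (2/a^+2) * (C * a^+8)).
 lsum k; rewrite -mulrBr normrM; apply: ler_pM => //.
 by rewrite ger0_norm //; apply: le_trans n1le; rewrite ler_nat ltnW.
 exact: (le_trans (c2 k)).
 rewrite sumr_const card_ord -[_ *+ n.+1]mulr_natr.
 have w0 : 0 <= 2/a^+2*(C * a^+8) by rewrite mulr_ge0 // divr_ge0.
 lel (ler_wpM2l w0 n1le).
 have -> : 2/a^+2*(C * a^+8) * (2/a^+2) = 4*(C * a^+4) by fld.
 by pz.
have a04 : 0 < a <= 1/4 by rewrite a0 /=; move: a80; clra.
have g1 : `|M (fun s => \sum_(k < n.+1) expR (- (s * k%:R))) - M (fun s => s^-1 + 2^-1 + s/12)| <= K%:R * C*(Cg * a^+2).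
 apply: mx_le => // [|u uK]; first by rewrite mulr_ge0 // ltW.
 by have [u1 _] := tb u uK; case: (Hg a (tilt a u) n a04 u1 an).
have g2 : `|M (fun s => \sum_(k < n.+1) k%:R * expR (- (s * k%:R))) - M (fun s => (s^+2)^-1 - 12^-1)| <= K%:R * C*(Cg * a^+2).
 apply: mx_le => // [|u uK]; first by rewrite mulr_ge0 // ltW.
 by have [u1 _] := tb u uK; case: (Hg a (tilt a u) n a04 u1 an).
have e1 : M (fun s => s^-1 + 2^-1 + s/12) = M (fun s => s^-1) + M (fun=> 1)/2 + M id/12.
 by rewrite /M /mx !mulr_suml -!big_split; apply: eq_bigr => u _ /=; ring.
have e2 : M (fun s => (s^+2)^-1 - 12^-1) = M (fun s => (s^+2)^-1) - M (fun=> 1)/12.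
 by rewrite /M /mx !mulr_suml -!sumrB; bigr u; ring.
have g3 : `|M (fun s => bmean (bp s) n) - M (fun s => A/s^+2 + 24^-1)| <= K%:R * C*(Cb*(4 * a^+2)).
 apply: mx_le => // [|u uK]; first by rewrite !mulr_ge0 // ltW.
 have [/andP[u1 u2] _] := tb u uK.
 have s0 : 0 < tilt a u := lt_le_trans a0 u1.
 have s2 : a^+2 <= tilt a u^+2 by apply: lerXn2r => //; rewrite nnegrE ltW.
 have := Hb (tilt a u) n; rewrite s0 (_ : tilt a u <= 1/6) /=; last by move: a80 u2; clra.
 have hA : A/2 <= tilt a u^+2 * n%:R.
 have := ler_wpM2r (ler0n R n) s2; rewrite an; move: A0; clra.
 move=> /(_ isT hA) h; lel h; rewrite ler_wpM2l ?(ltW Cb0) //.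
 have -> : 4 * a^+2 = (2 * a)^+2 by ring.
 by apply: lerXn2r => //; rewrite nnegrE; move: a0 s0; clra.
have g4 : `|n%:R - M (fun s => bmean (bp s) n)| <= C * a^+8.
 have := c3; rewrite /mixdef.
 have -> : Emean (fun D : {set 'I_n} => (weight D)%:R : R) = n%:R.
 rewrite /Emean (eq_bigr (fun=> n%:R*1)); last by move=> D /eqP ->; rewrite mulr1.
 by rewrite -mulr_sumr mulfK // count_all gt_eqF.
 congr (`|_ - _| <= _); bigr u; by rewrite mixdef_weight_mean.
have e3 : M (fun s => A/s^+2 + 24^-1) = A * M (fun s => (s^+2)^-1) + M (fun=> 1)/24.
 by rewrite /M /mx mulr_sumr mulr_suml -big_split; apply: eq_bigr => u _ /=; ring.
rewrite e1 in g1; rewrite e2 in g2; rewrite e3 in g3.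
have nE : n%:R = A/a^+2 by rewrite -an mulrAC mulfV ?mul1r // gt_eqF.
have i2E : `|M (fun s => (s^+2)^-1) - ((a^+2)^-1 - 24^-1/A)| <= (6*(2 * C + 4*(K%:R * C * Cb))) * a^+2.
 have -> : M (fun s => (s^+2)^-1) - ((a^+2)^-1 - 24^-1/A) =
 (A * M (fun s => (s^+2)^-1) + M (fun=> 1)/24 - n%:R - (M (fun=> 1) - 1)/24)/A.
 by rewrite nE; fld.
 rewrite normrM [`|A^-1|]ger0_norm ?invr_ge0 ?(ltW A0) //.
 have iA : A^-1 <= 6 by rewrite -[leRHS]invrK lef_pV2 ?posrE ?invr_gt0 //; move: A6; clra.
 have iA0 : 0 <= A^-1 by rewrite invr_ge0 ltW.
 have hh : `|A * M (fun s => (s^+2)^-1) + M (fun=> 1)/24 - n%:R - (M (fun=> 1) - 1)/24| <= (2 * C + 4*(K%:R * C * Cb)) * a^+2.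
 move: g3 g4 M1 a83 a32; rewrite !ler_norml; move: (M (fun s => bmean (bp s) n)) (A * _) (M (fun=> 1)) => b z m.
 have := sC 3%N; have := sC 2%N.
 have -> : K%:R * C*(Cb*(4 * a^+2)) = 4*(K%:R * C * Cb * a^+2) by ring.
 have -> : (2 * C + 4*(K%:R * C * Cb)) * a^+2 = 2*(C * a^+2) + 4*(K%:R * C * Cb * a^+2) by ring.
 move: (C * a^+2) (C * a^+3) (C * a^+8) (K%:R * C * Cb * a^+2) n%:R; clear => p2 p3 p8 q N.
 lra.
 have -> : 6*(2 * C + 4*(K%:R * C * Cb)) * a^+2 = (2 * C + 4*(K%:R * C * Cb)) * a^+2*6 by ring.
 exact: ler_pM.
have Ba k : B * a^+k = 60 * a^+k + 60*(C * a^+k) + 240*(K%:R * C * Cb * a^+k) + 60*(K%:R * C * Cg * a^+k).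
 by rewrite BE; ring.
have pos k : [/\ 0 <= C * a^+k, 0 <= K%:R * C * Cb * a^+k & 0 <= K%:R * C * Cg * a^+k].
 by split=> //; rewrite mulr_ge0.
have E1 : 6*(2 * C + 4*(K%:R * C * Cb)) * a^+2 = 12*(C * a^+2) + 24*(K%:R * C * Cb * a^+2) by ring.
have E2 : K%:R * C*(Cg * a^+2) = K%:R * C * Cg * a^+2 by ring.
rewrite E1 in i2E; rewrite E2 in g1 g2.
have [P1 P2 P3] := pos 2%N; have [P4 P5 P6] := pos 3%N; have P7 := sq0 2%N; have P8 := sq0 3%N.
split.
- split=> // u; lel (c1 u); rewrite BE; have := pos 0%N; rewrite expr0 !mulr1 => -[]; clra.
- by rewrite Ba; lel M1; move: a83 P4 P5 P6 P8; clra.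
- split; first by rewrite Ba; lel i2E; move: P1 P2 P3 P7; clra.
 rewrite /rk Ba; move: Mw g2 M1 i2E; rewrite !ler_norml (_ : A^-1/24 = 24^-1/A); last by rewrite mulrC.
 move: (wsc n) (M (fun s => \sum_(k < _) _)) (M (fun s => (s^+2)^-1)) (M (fun=> 1)) (24^-1/A) ((a^+2)^-1) => w s0 s1 m iA ia; move: a83 a32 P1 P2 P3 P7; clear => ? ? ? ? ? ?.
 lra.
- rewrite Ba; move: Mrho g1 M1; rewrite !ler_norml.
 move: (rho n) (M (fun s => \sum_(k < _) _)) (M (fun s => s^-1)) (M (fun=> 1)) (M id) => w s0 s1 m i; move: a83 a32 P1 P2 P3 P7; clear => ? ? ? ? ? ?.
 lra.
by split; rewrite Ba; [lel c4 | lel c5]; move: a83 P4 P5 P6 P8; clra.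
Qed.

End Moments2.

(** * Averages over the mixing weights: what the recurrence determines *)

Section Moments3.
Variable R : realType.
Implicit Types (a s h : R) (n k : nat).
Local Notation A := (@AA R).
Local Notation sc := (@sc R).
Local Notation rho := (@rho R).
Local Notation wsc := (@wsc R).

Definition asize n : R := sqrt (A/n%:R).

Lemma asize_sqr n : (0 < n)%N -> asize n^+2 * n%:R = A.
move=> n0; have A0 := @AA_gt0 R; rewrite sqr_sqrtr ?(divr_ge0 (ltW A0) (ler0n _ _)) //.
by rewrite mulfVK // pnatr_eq0 -lt0n.
Qed.

Lemma asize_gt0 n : (0 < n)%N -> 0 < asize n.
Proof. by move=> n0; rewrite sqrtr_gt0; apply: divr_gt0; [exact: AA_gt0 | rewrite ltr0n]. Qed.

Lemma asize_small (a1 : R) : 0 < a1 -> exists n0, forall n, (n0 <= n)%N -> (0 < n)%N /\ asize n <= a1.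
move=> a10; exists (Num.truncn (A/a1^+2)).+1 => n hn.
have n0 : (0 < n)%N by apply: leq_trans hn.
split=> //; have A0 := @AA_gt0 R.
have a12 : 0 < a1^+2 by rewrite exprn_gt0.
rewrite -(@ler_pXn2r _ 2) ?nnegrE ?sqrtr_ge0 //; last exact: ltW.
rewrite sqr_sqrtr ?(divr_ge0 (ltW A0) (ler0n _ _)) //.
rewrite ler_pdivrMr ?ltr0n // mulrC -ler_pdivrMr //.
have /andP[_ h] : (Num.truncn (A/a1^+2))%:R <= A/a1^+2 < (Num.truncn (A/a1^+2)).+1%:R.
 by apply: Num.Theory.truncn_itv; apply: divr_ge0; exact: ltW.
by lel (ltW h); rewrite ler_nat.
Qed.

Lemma sqrt_nA n : (0 < n)%N -> sqrt (n%:R/A) = (asize n)^-1.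
Proof. by move=> n0; rewrite /asize -invf_div sqrtrV //; apply: divr_ge0; [exact: ltW (AA_gt0 R) | exact: ler0n]. Qed.

Definition kap3 : R := rg A - 12^-1.

(** As [wsc] is known, [rho_asymp] determines [rho], and with it [M (1 / s)] up to [O(1)]. The
    identity [1 / s - 2 / a + s / a^2 = (s - a)^2 / (a^2 s)], bounded because [s - a = O(a^(3/2))],
    turns this into [M s = a + O(a^2)]. Inserted back into [rho], it gives [M (1 / s)] up to
    [O(a^2)]; hence [kap3 = rg A - 1/12]. *)
Theorem mix_inv t : exists K, exists2 C : R, 0 < C & exists n0, forall n, (n0 <= n)%N ->
 let a := asize n in [/\ (0 < n)%N, a <= 1/80, 0 < sc n &
 exists c : nat -> R, let M := mx K c a in
 [/\ (forall u, `|c u| <= C) /\ (forall u, (u < K)%N -> a <= tilt a u <= 2 * a),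
 `|M (fun=> 1) - 1| <= C * a^+3,
 `|M (fun s => (s^+2)^-1) - ((a^+2)^-1 - 24^-1/A)| <= C * a^+2,
 `|M (fun s => s^-1) - (a^-1 + A^-1/4 + kap3 * a)| <= C * a^+2 /\ `|M id - a| <= C * a^+2 &
 `|mixdef K c a (@Nhk R n t)| <= C * a^+3 /\ `|mixdef K c a (fun D : {set 'I_n} => Nhk R t D^+2)| <= C * a^+3]].
have [K [C C0 [a1 /andP[a10 a11] H]]] := mix_basic R t.
have A0 := @AA_gt0 R.
have [n1 Hn1] := asize_small a10.
have rhoH n : (n1 <= n)%N -> [/\ 0 <= rho n, `|wsc n - (n%:R/A - rk A)| <= C/(n%:R/A) &
 rho n.+1 = 1 + rho n * wsc n.+1/(wsc n + rho n)].
 move=> hn; have [n0 an] := Hn1 n hn; have [n0' an'] := Hn1 n.+1 (leqW hn).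
 have [S0 [c [_ _ [_ hw] _ _]]] := H _ n (asize_gt0 n0) an (asize_sqr n0).
 have [S1 _] := H _ n.+1 (asize_gt0 n0') an' (asize_sqr n0').
 have nA : n%:R/A = (asize n^+2)^-1.
 by rewrite -(asize_sqr n0) invfM mulrCA mulfV ?mulr1 // pnatr_eq0 -lt0n.
 split; last exact: rho_rec.
 rewrite /rho divr_ge0 ?(ltW S0) //; apply: sumr_ge0 => i _; exact: sc_ge0.
 by rewrite nA invrK.
have [D D0 [n2 HD]] := rho_asymp A0 C0 rhoH.
have K0 : 0 <= K%:R :> R by rewrite ler0n.
pose E := K%:R * C * K%:R^+2.
have E0 : 0 <= E by rewrite mulr_ge0 ?exprn_ge0 // mulr_ge0 // ltW.
pose C1 := `|A^-1| + `|rg A| + C + D + K%:R * C*2 + 4.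
have C10 : 0 < C1.
 have := normr_ge0 A^-1; have := normr_ge0 (rg A); have : 0 <= K%:R * C*2 by pz.
 by rewrite /C1; move: C0 D0; clra.
pose C2 := 2 * C + E + C1.
pose B := C2 + C + D.
have B0 : 0 < B by rewrite /B /C2; move: C0 D0 E0 C10; clra.
exists K, B => //; exists (maxn n1 n2) => n; rewrite geq_max => /andP[h1 h2] a.
have [n0 an] := Hn1 n h1.
have a0 : 0 < a := asize_gt0 n0.
have a80 : a <= 1/80 := le_trans an a11.
have aA := asize_sqr n0; rewrite -/a in aA an.
have [S0 [c [[c1 c2] M1 [M2 _] Mr [N1 N2]]]] := H a n a0 an aA.
split=> //; exists c => M; rewrite -/M in M1 M2 Mr.
have hr := HD n h2; rewrite (sqrt_nA n0) -/a in hr.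
have nA : n%:R/A = (a^+2)^-1.
 by rewrite -aA invfM mulrCA mulfV ?mulr1 // pnatr_eq0 -lt0n.
rewrite nA invrK /rr invrK in hr.
have a20 : 0 < a^+2 by rewrite exprn_gt0.
have a3 : 0 <= a^+3 by rewrite exprn_ge0 // ltW.
have a32 : a^+3 <= a^+2 by rewrite ler_wiXn2l ?(ltW a0) //; move: a80; clra.
have a31 : a^+3 <= 1 by rewrite exprn_ile1 ?(ltW a0) //; move: a80; clra.
have a21 : a^+2 <= 1 by rewrite exprn_ile1 ?(ltW a0) //; move: a80; clra.
have CB : C <= B by rewrite /B /C2; move: C0 D0 E0 C10; clra.
have Ma : `|M id| <= K%:R * C*2.
 have := @mx_le R K c a id (fun=> 0) C 2 c1 (ler0n R 2).
 rewrite {2}/mx big1 ?subr0; last by move=> u _; rewrite mulr0.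
 apply=> u uK; have [/andP[u1 u2] _] := c2 u uK.
 by rewrite subr0 ger0_norm; move: a0 a80 u1 u2; clra.
have inv_crude : `|M (fun s => s^-1) - a^-1| <= C1.
 move: Mr hr Ma; rewrite /rb /C1 !ler_norml.
 have := ler_norm A^-1; have := ler_norm (- A^-1); rewrite normrN.
 have : - `|rg A| <= rg A * a <= `|rg A|.
 rewrite -ler_norml normrM (ger0_norm (ltW a0)) -[leRHS]mulr1.
 by apply: ler_wpM2l => //; move: a80; clra.
 have := ler_wpM2l (ltW C0) a21; have := ler_wpM2l (ltW D0) a21.
 move: (M (fun s => s^-1)) (M id) (rho n) (a^-1) (rg A * a) (`|rg A|) (A^-1) (`|A^-1|) (K%:R * C*2) (C * a^+2) (D * a^+2).
 clear => i m r ia g gg b bb k p q ? ? /andP[? ?] ? ? /andP[? ?] /andP[? ?] /andP[? ?].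
 lra.
have Mlin : `|M (fun s => s^-1 - 2/a + s/a^+2)| <= E.
 have := @mx_le R K c a (fun s => s^-1 - 2/a + s/a^+2) (fun=> 0) C (K%:R^+2) c1 (sqr_ge0 _).
 rewrite {2}/mx big1 ?subr0; last by move=> u _; rewrite mulr0.
 apply=> u uK; have [/andP[u1 u2] u3] := c2 u uK; move: (tilt a u) u1 u2 u3 => s s1 s2 s3.
 have s0 : 0 < s := lt_le_trans a0 s1.
 have -> : s^-1 - 2/a + s/a^+2 - 0 = (s - a)^+2/(a^+2 * s) by fld.
 rewrite ger0_norm; last by rewrite divr_ge0 ?sqr_ge0 // mulr_ge0 // ltW.
 rewrite ler_pdivrMr ?mulr_gt0 //; lel s3; apply: ler_wpM2l; first exact: sqr_ge0.
 by rewrite exprSr ler_wpM2l // ltW.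
have Mexp : M (fun s => s^-1 - 2/a + s/a^+2) = M (fun s => s^-1) - 2/a * M (fun=> 1) + M id/a^+2.
 by rewrite /M /mx mulr_sumr mulr_suml -sumrB -big_split; apply: eq_bigr => u _ /=; ring.
have Mid : `|M id - a| <= C2 * a^+2.
 have e : M id - a = a^+2*(M (fun s => s^-1 - 2/a + s/a^+2) - (M (fun s => s^-1) - a^-1)) +
 2 * a*(M (fun=> 1) - 1) by rewrite Mexp; fld.
 rewrite e; lel (ler_normD _ _); rewrite [`|a^+2 * _|]normrM (ger0_norm (ltW a20)) [`|2 * a * _|]normrM.
 have a2p : 0 <= 2 * a by move: a0; clra.
 rewrite (ger0_norm a2p).
 have q1 : a^+2 * `|M (fun s => s^-1 - 2/a + s/a^+2) - (M (fun s => s^-1) - a^-1)| <= a^+2*(E + C1).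
 rewrite ler_wpM2l ?(ltW a20) //; lel (ler_normB _ _); exact: lerD.
 have q2 : 2 * a * `|M (fun=> 1) - 1| <= 2*(C * a^+2).
 have : a * `|M (fun=> 1) - 1| <= 1*(C * a^+2).
 apply: ler_pM => //; [exact: ltW | move: a80; clra |].
 by lel M1; rewrite ler_wpM2l // ltW.
 move: (`|_|); clear; move=> x; lra.
 have -> : C2 * a^+2 = a^+2*(E + C1) + 2*(C * a^+2) by rewrite /C2; ring.
 exact: lerD.
have C3B : C * a^+3 <= B * a^+3 by rewrite ler_wpM2r.
have C2B : C * a^+2 <= B * a^+2 by rewrite ler_wpM2r // ltW.
have pC : 0 <= C * a^+2 by rewrite mulr_ge0 // ltW.
have pD : 0 <= D * a^+2 by rewrite mulr_ge0 // ltW.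
have pC2 : 0 <= C2 * a^+2 by apply: le_trans Mid.
have EB : B * a^+2 = C2 * a^+2 + C * a^+2 + D * a^+2 by rewrite /B; ring.
split.
- split=> [u|u uK]; first exact: le_trans (c1 u) CB.
 by case: (c2 u uK).
- exact: le_trans M1 C3B.
- exact: le_trans M2 C2B.
- split; last by lel Mid; rewrite EB; move: pC pD; clra.
 rewrite EB; move: Mr hr Mid pC pD pC2; rewrite /kap3 /rb !ler_norml; have -> : (rg A - 12^-1) * a = rg A * a - a/12 by ring.
 move: (M (fun s => s^-1)) (M id) (rho n) (a^-1) (rg A * a) (A^-1) (C * a^+2) (D * a^+2) (C2 * a^+2).
 clear => i m r ia g b p q w /andP[? ?] /andP[? ?] /andP[? ?] ? ? ?.
 lra.
split; [exact: le_trans N1 C3B | exact: le_trans N2 C3B].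
Qed.

End Moments3.

(** * Exact mean and variance of the hook count under a product measure *)

Section ProductMeasure.
Variables (R : realType) (n : nat) (s : R).
Implicit Types (O : seq nat) (F G : {set 'I_n} -> R).
Local Notation E F := (@Eprod R n s F).
Local Notation allb := (@allb R n).

Lemma EprodD F G : E (fun D => F D + G D) = E F + E G.
Proof. by rewrite /Eprod -big_split; bigr D; rewrite mulrDl. Qed.
Lemma EprodN F : E (fun D => - F D) = - E F.
Proof. by rewrite /Eprod -sumrN; bigr D; rewrite mulNr. Qed.
Lemma EprodZ c F : E (fun D => c * F D) = c * E F.
Proof. by rewrite /Eprod mulr_sumr; bigr D; rewrite mulrA. Qed.
Lemma Eprod_sum (m : nat) (F : nat -> {set 'I_n} -> R) : E (fun D => \sum_(i < m) F i D) = \sum_(i < m) E (F i).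
by rewrite /Eprod exchange_big; bigr D; rewrite mulr_suml.
Qed.
Lemma eq_Eprod F G : F =1 G -> E F = E G.
Proof. by move=> e; bigr D; rewrite e. Qed.

Definition Cv F G : R := E (fun D => F D * G D) - E F * E G.

Lemma CvC F G : Cv F G = Cv G F.
Proof. by rewrite /Cv (eq_Eprod (G := fun D => G D * F D)) 1?mulrC // => D; rewrite mulrC. Qed.
Lemma CvDl F G H : Cv (fun D => F D + G D) H = Cv F H + Cv G H.
rewrite /Cv (eq_Eprod (G := fun D => F D * H D + G D * H D)); last by move=> D; rewrite mulrDl.
by rewrite !EprodD; ring.
Qed.
Lemma CvZl c F H : Cv (fun D => c * F D) H = c * Cv F H.
rewrite /Cv (eq_Eprod (G := fun D => c*(F D * H D))); last by move=> D; rewrite mulrA.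
by rewrite !EprodZ; ring.
Qed.
Lemma Cv_suml (m : nat) (F : nat -> {set 'I_n} -> R) H :
 Cv (fun D => \sum_(i < m) F i D) H = \sum_(i < m) Cv (F i) H.
rewrite /Cv (eq_Eprod (G := fun D => \sum_(i < m) F i D * H D)); last by move=> D; rewrite mulr_suml.
by rewrite (Eprod_sum m (fun i D => F i D * H D)) Eprod_sum mulr_suml -sumrB.
Qed.

(** Sites from [n] on never belong to [D], so their occupation probability is 0; with this
    convention the moment formulas need no boundary case. *)
Definition pn i : R := if (i < n)%N then bp s i else 0.

Lemma Eallb O : uniq O -> E (allb O) = \prod_(i <- O) pn i.
move=> uO; have [aO|aO] := boolP (all (fun i => i < n)%N O).
 rewrite Eprod_allb //; apply: eq_big_seq => i iO; by rewrite /pn (seq.allP aO _ iO).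
rewrite /Eprod big1; last by move=> D _; rewrite allb_out // mul0r.
move/seq.allPn: aO => [i iO /negbTE ni]; apply/esym; apply/eqP; rewrite prodf_seq_eq0; apply/hasP.
by exists i => //=; rewrite /pn ni.
Qed.

Variable t : nat.
Hypothesis t0 : (0 < t)%N.

Definition Xf i D : R := allb [:: (i + t)%N] D - allb [:: i; (i + t)%N] D.
(** The sites of a boundary pair, listed once when they coincide, since the product of a bit with
    itself is that bit. This happens at [m = (t - 1) / 2], hence only for odd [t], and is the origin
    of the parity terms. *)
Definition Ly m : seq nat := if m == (t.-1 - m)%N then [:: m] else [:: m; (t.-1 - m)%N].
Definition Yf m D : R := allb (Ly m) D.

Definition piF (p : nat -> R) i : R := (1 - p i) * p (i + t)%N.
Definition yF (p : nat -> R) m : R := \prod_(i <- Ly m) p i.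

Lemma NhkXY D : Nhk R t D = 2*\sum_(i < n) Xf i D + \sum_(m < t) Yf m D.
rewrite NhkE /Nmon !big_cat !big_map /=.
have io m : iota 0 m = index_iota 0 m by rewrite /index_iota subn0.
rewrite !io !big_mkord addrA -big_split mulr_sumr /=; congr (_ + _).
 by bigr i; rewrite /Xf; ring.
bigr m; rewrite mul1r /Yf /Ly; case: eqP => // e.
by rewrite -e /allb /= !andbT andbb.
Qed.

Lemma EXf i : E (Xf i) = piF pn i.
have u1 : uniq [:: i; (i + t)%N] by rewrite /= !inE; clear -t0; lia.
by rewrite EprodD EprodN !Eallb // !big_cons !big_nil /piF; ring.
Qed.

Lemma Ly_uniq m : uniq (Ly m).
Proof. by rewrite /Ly; case: eqP => //= /eqP e; rewrite !inE e. Qed.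

Lemma EYf m : E (Yf m) = yF pn m.
Proof. by rewrite Eallb ?Ly_uniq. Qed.

(** [Xf i] reads the sites [i] and [i + t], so for [i < j] the two indicators share a site only if
    [j = i + t]. Then one wants it occupied and the other wants it empty, so the product
    vanishes. *)
Lemma CvXX_lt i j : (i < j)%N -> Cv (Xf i) (Xf j) = - ((j == i + t)%N%:R*(piF pn i * piF pn j)).
move=> ij; rewrite /Cv !EXf.
have -> : E (fun D => Xf i D * Xf j D) = E (fun D => allb [:: (i + t)%N; (j + t)%N] D
 + - allb [:: i; (i + t)%N; (j + t)%N] D + - allb [:: (i + t)%N; j; (j + t)%N] D
 + allb [:: i; (i + t)%N; j; (j + t)%N] D).
 apply: eq_Eprod => D; rewrite /Xf mulrBl !mulrBr !allb_cat; ring.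
have [e|ne] := eqVneq j (i + t)%N; last first.
 rewrite !EprodD !EprodN !Eallb; try by rewrite /= !inE; clear -ij t0 ne; lia.
 by rewrite !big_cons !big_nil /piF mul0r oppr0; ring.
rewrite mul1r (eq_Eprod (G := fun=> 0*0)); first by rewrite EprodZ mul0r sub0r.
move=> D; rewrite e /allb /= !andbT !andbA mulr0.
by case: (bit D i); case: (bit D (i + t)); case: (bit D (i + t + t)) => /=; ring.
Qed.

Lemma CvXX i j : Cv (Xf i) (Xf j) = (i == j)%:R*(piF pn i - piF pn i^+2)
 - (j == i + t)%N%:R*(piF pn i * piF pn j) - (i == j + t)%N%:R*(piF pn i * piF pn j).
have f1 k : ((k == k + t) = false)%N by clear -t0; lia.
case: (ltngtP i j) => ij.
- rewrite CvXX_lt // (_ : (i == j + t)%N = false); last by clear -ij t0; lia.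
 by rewrite !mul0r subr0 add0r.
- rewrite CvC CvXX_lt // (_ : (j == i + t)%N = false); last by clear -ij t0; lia.
 by rewrite !mul0r !sub0r; ring.
rewrite ij f1 !mul0r !subr0 mul1r /Cv EXf expr2; congr (_ - _).
rewrite -EXf; apply: eq_Eprod => D; rewrite /Xf /allb /= !andbT.
by case: (bit D j); case: (bit D (j + t)) => /=; ring.
Qed.

Lemma Ly_lt m i : (m < t)%N -> i \in Ly m -> (i < t)%N.
by move=> mt; rewrite /Ly; case: eqP => _; rewrite !inE => h; move: h mt t0; clear; lia.
Qed.

Lemma mem_Ly m i : (i \in Ly m) = (i == m) || (i == t.-1 - m)%N.
Proof. by rewrite /Ly; case: (m =P (t.-1 - m)%N) => e; rewrite !inE // -e orbb. Qed.

Lemma CvXY i m : (m < t)%N -> Cv (Xf i) (Yf m) = - ((i \in Ly m)%:R*(piF pn i * yF pn m)).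
move=> mt; rewrite /Cv EXf EYf.
have XE D : Xf i D * Yf m D = allb ((i + t)%N :: Ly m) D + - allb [:: i, (i + t)%N & Ly m] D.
 by rewrite /Xf /Yf mulrBl !allb_cat.
have [iL|iL] := boolP (i \in Ly m).
 rewrite (eq_Eprod (G := fun=> 0*0)); first by rewrite EprodZ mul0r sub0r mul1r.
 move=> D; rewrite XE mulr0 /allb /=.
 case: (boolP (all (bit D) (Ly m))) => [/seq.allP /(_ i iL) ->|_]; first by rewrite subrr.
 by rewrite !andbF subrr.
have itL : (i + t)%N \notin Ly m by apply/negP => /(Ly_lt mt); clear; lia.
have u1 : uniq ((i + t)%N :: Ly m) by rewrite /= itL Ly_uniq.
have u2 : uniq [:: i, (i + t)%N & Ly m].
 by rewrite cons_uniq u1 andbT inE negb_or iL andbT; clear -t0; lia.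
rewrite (eq_Eprod XE) EprodD EprodN !Eallb // !big_cons /piF /yF mul0r oppr0; ring.
Qed.

Lemma CvYY m m' : (m < t)%N -> (m' < t)%N ->
 Cv (Yf m) (Yf m') = (m' \in Ly m)%:R*(yF pn m - yF pn m^+2).
move=> mt mt'; rewrite /Cv !EYf.
have [h|h] := boolP (m' \in Ly m); last first.
 have dis : uniq (Ly m ++ Ly m').
 rewrite cat_uniq !Ly_uniq andbT /=; apply/hasPn => x; rewrite !mem_Ly.
 by move: h mt mt'; rewrite mem_Ly; clear; lia.
 rewrite (eq_Eprod (G := allb (Ly m ++ Ly m'))); last by move=> D; rewrite /Yf allb_cat.
 by rewrite Eallb // big_cat mul0r /yF subrr.
have pm : perm_eq (Ly m) (Ly m').
 apply: uniq_perm; rewrite ?Ly_uniq // => x; rewrite !mem_Ly.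
 by move: h mt mt'; rewrite mem_Ly; clear; lia.
rewrite mul1r (_ : yF pn m' = yF pn m); last by apply: perm_big; rewrite perm_sym.
rewrite -expr2; congr (_ - _); rewrite -EYf; apply: eq_Eprod => D.
rewrite /Yf {2}/allb -(perm_all _ pm) /allb -natrM mulnb andbb //.
Qed.

Definition ENf (p : nat -> R) : R := 2*\sum_(i < n) piF p i + \sum_(m < t) yF p m.

Definition VNf (p : nat -> R) : R :=
 4*\sum_(i < n) (piF p i - piF p i^+2 - 2*(piF p i * piF p (i + t)%N))
 - 4*\sum_(m < t) \sum_(i < t) (val i \in Ly m)%:R*(piF p i * yF p m)
 + \sum_(m < t) \sum_(i < t) (val i \in Ly m)%:R*(yF p m - yF p m^+2).

Lemma Eprod_Nhk : E (@Nhk R n t) = ENf pn.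
rewrite (eq_Eprod NhkXY) EprodD EprodZ !Eprod_sum /ENf; congr (2 * _ + _).
 by bigr i; rewrite EXf.
by bigr i; rewrite EYf.
Qed.

Lemma sum_shift (f : nat -> nat -> R) : (forall i j, (n <= j)%N -> f i j = 0) ->
 \sum_(i < n) \sum_(j < n) (val j == val i + t)%N%:R * f i j = \sum_(i < n) f i (i + t)%N.
move=> f0; bigr i; case: (ltnP (i + t) n) => h.
 rewrite (bigD1 (Ordinal h)) //= eqxx mul1r big1 ?addr0 // => j ji.
 rewrite (_ : (val j == i + t)%N = false) ?mul0r //; apply: contraNF ji => /eqP e.
 by apply/eqP; apply: val_inj.
rewrite f0 // big1 // => j _; rewrite (_ : (val j == i + t)%N = false) ?mul0r //.
by apply/negbTE; rewrite neq_ltn (leq_trans (ltn_ord j) h).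
Qed.

Lemma piF_out i : (n <= i)%N -> piF pn i = 0.
Proof. by move=> ni; rewrite /piF {2}/pn ltnNge (leq_trans ni (leq_addr _ _)) mulr0. Qed.

Lemma Eprod_Nhk_var : (t <= n)%N -> E (fun D => Nhk R t D^+2) - E (@Nhk R n t)^+2 = VNf pn.
move=> tn; have -> : E (fun D => Nhk R t D^+2) - E (@Nhk R n t)^+2 = Cv (@Nhk R n t) (@Nhk R n t) by [].
pose S D := \sum_(i < n) Xf i D; pose B D := \sum_(m < t) Yf m D.
have -> : Cv (@Nhk R n t) (@Nhk R n t) = Cv (fun D => 2 * S D + B D) (fun D => 2 * S D + B D).
 rewrite /Cv (eq_Eprod NhkXY); congr (_ - _); apply: eq_Eprod => D; by rewrite NhkXY.
rewrite CvDl CvZl ![Cv _ (fun D => _ + _)]CvC !CvDl !CvZl [Cv B S]CvC.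
have -> : Cv S S = \sum_(i < n) (piF pn i - piF pn i^+2 - 2*(piF pn i * piF pn (i + t)%N)).
 rewrite Cv_suml; under eq_bigr => i _ do rewrite CvC Cv_suml.
 under eq_bigr => i _ do under eq_bigr => j _ do rewrite CvC CvXX.
 under eq_bigr => i _ do rewrite !sumrB.
 rewrite !sumrB (sum_shift (f := fun i j => piF pn i * piF pn j)); last by move=> i j h; rewrite (piF_out h) mulr0.
 have -> : \sum_(i < n) \sum_(j < n) (val i == val j + t)%N%:R*(piF pn i * piF pn j) = \sum_(i < n) piF pn (i + t)%N * piF pn i.
 by rewrite exchange_big (sum_shift (f := fun j i => piF pn i * piF pn j)) // => i j h; rewrite (piF_out h) mul0r.
 have -> : \sum_(i < n) \sum_(j < n) (val i == val j)%:R*(piF pn i - piF pn i^+2) = \sum_(i < n) (piF pn i - piF pn i^+2).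
 bigr i; rewrite (bigD1 i) //= eqxx mul1r big1 ?addr0 // => j ji.
 rewrite (_ : (val i == val j) = false) ?mul0r //; apply: contraNF ji => /eqP e.
 by apply/eqP; apply: val_inj.
 by rewrite -!sumrB; bigr i; ring.
have -> : Cv S B = - \sum_(m < t) \sum_(i < t) (val i \in Ly m)%:R*(piF pn i * yF pn m).
 rewrite CvC Cv_suml -sumrN; bigr m; rewrite CvC Cv_suml.
 under eq_bigr => i _ do rewrite CvXY //.
 rewrite sumrN; congr (- _).
 rewrite (big_ord_widen n (fun i => (i \in Ly m)%:R*(piF pn i * yF pn m)) tn) [in RHS]big_mkcond /=.
 bigr i; case: ltnP => // ti; case: (boolP (val i \in Ly m)) => [|_]; last by rewrite mul0r.
 by move/(Ly_lt (ltn_ord m)); rewrite ltnNge ti.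
have -> : Cv B B = \sum_(m < t) \sum_(i < t) (val i \in Ly m)%:R*(yF pn m - yF pn m^+2).
 rewrite Cv_suml; bigr m; rewrite CvC Cv_suml; bigr i.
 by rewrite CvC CvYY.
rewrite /VNf; ring.
Qed.

End ProductMeasure.

(** * Taylor expansions with uniformly bounded remainder *)

Section Jets.
Variables (R : realType) (P : R -> Prop).
Hypothesis P01 : forall s, P s -> 0 < s <= 1.

Lemma bd_id : bd P id.
Proof. by exists 1 => // s /P01 /andP[s0 s1]; rewrite ger0_norm // ltW. Qed.

Definition J1 (f : R -> R) (f0 : R) := exists2 g, bd P g & forall s, P s -> f s = f0 + s * g s.
Definition jet (f : R -> R) (f0 f1 f2 : R) := exists2 g, bd P g & forall s, P s -> f s = f0 + f1 * s + f2 * s^+2 + s^+3 * g s.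

Lemma jet_J1 f f0 f1 f2 : jet f f0 f1 f2 -> J1 f f0.
move=> [g bg e]; have bs := bd_id; exists (fun s => f1 + f2 * s + s^+2 * g s); first by bd_tac.
by move=> s Ps; rewrite e //; ring.
Qed.
Lemma J1_cst c : J1 (fun=> c) c.
Proof. by exists (fun=> 0); [exact: bd_cst | move=> s _; rewrite mulr0 addr0]. Qed.
Lemma J1D f g f0 g0 : J1 f f0 -> J1 g g0 -> J1 (fun s => f s + g s) (f0 + g0).
move=> [u bu eu] [v bv ev]; exists (fun s => u s + v s); first by bd_tac.
by move=> s Ps; rewrite eu // ev //; ring.
Qed.
Lemma J1N f f0 : J1 f f0 -> J1 (fun s => - f s) (- f0).
move=> [u bu eu]; exists (fun s => - u s); first by bd_tac.
by move=> s Ps; rewrite eu //; ring.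
Qed.
Lemma J1M f g f0 g0 : J1 f f0 -> J1 g g0 -> J1 (fun s => f s * g s) (f0 * g0).
have bs := bd_id; move=> [u bu eu] [v bv ev]; exists (fun s => f0 * v s + g0 * u s + s * u s * v s); first by bd_tac.
by move=> s Ps; rewrite eu // ev //; ring.
Qed.
Lemma J1_sum m (f : nat -> R -> R) c : (forall i, (i < m)%N -> J1 (f i) (c i)) ->
 J1 (fun s => \sum_(i < m) f i s) (\sum_(i < m) c i).
elim: m => [|m IH] h.
 by exists (fun=> 0); [exact: bd_cst | move=> s _; rewrite !big_ord0 mulr0 addr0].
have [u bu eu] := IH (fun i im => h i (leqW im)); have [v bv ev] := h m (ltnSn _).
exists (fun s => u s + v s); first by bd_tac.
by move=> s Ps; rewrite !big_ord_recr /= eu // ev //; ring.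
Qed.
Lemma J1_shift f f0 : J1 f f0 -> jet (fun s => s * s * f s) 0 0 f0.
Proof. by move=> [u bu eu]; exists u => // s Ps; rewrite eu //; ring. Qed.

Lemma jet_cst c : jet (fun=> c) c 0 0.
Proof. by exists (fun=> 0); [exact: bd_cst | move=> s _; ring]. Qed.
Lemma jet_id : jet id 0 1 0.
Proof. by exists (fun=> 0); [exact: bd_cst | move=> s _; rewrite /=; ring]. Qed.
Lemma jetD f g f0 f1 f2 g0 g1 g2 : jet f f0 f1 f2 -> jet g g0 g1 g2 ->
 jet (fun s => f s + g s) (f0 + g0) (f1 + g1) (f2 + g2).
move=> [u bu eu] [v bv ev]; exists (fun s => u s + v s); first by bd_tac.
by move=> s Ps; rewrite eu // ev //; ring.
Qed.
Lemma jetN f f0 f1 f2 : jet f f0 f1 f2 -> jet (fun s => - f s) (- f0) (- f1) (- f2).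
move=> [u bu eu]; exists (fun s => - u s); first by bd_tac.
by move=> s Ps; rewrite eu //; ring.
Qed.
Lemma jetM f g f0 f1 f2 g0 g1 g2 : jet f f0 f1 f2 -> jet g g0 g1 g2 ->
 jet (fun s => f s * g s) (f0 * g0) (f0 * g1 + f1 * g0) (f0 * g2 + f1 * g1 + f2 * g0).
have bs := bd_id; move=> [u bu eu] [v bv ev].
exists (fun s => f1 * g2 + f2 * g1 + s*(f2 * g2) + u s*(g0 + g1 * s + g2 * s^+2) +
 v s*(f0 + f1 * s + f2 * s^+2) + s^+3 * u s * v s); first by bd_tac.
by move=> s Ps; rewrite eu // ev //; ring.
Qed.
Lemma jet_sum m (f : nat -> R -> R) c0 c1 c2 : (forall i, (i < m)%N -> jet (f i) (c0 i) (c1 i) (c2 i)) ->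
 jet (fun s => \sum_(i < m) f i s) (\sum_(i < m) c0 i) (\sum_(i < m) c1 i) (\sum_(i < m) c2 i).
elim: m => [|m IH] h.
 by exists (fun=> 0); [exact: bd_cst | move=> s _; rewrite !big_ord0 mulr0 !mul0r !addr0].
have [u bu eu] := IH (fun i im => h i (leqW im)); have [v bv ev] := h m (ltnSn _).
exists (fun s => u s + v s); first by bd_tac.
by move=> s Ps; rewrite !big_ord_recr /= eu // ev //; ring.
Qed.
Lemma eq_jet f g f0 f1 f2 g0 g1 g2 : jet f f0 f1 f2 -> (forall s, P s -> g s = f s) ->
 f0 = g0 -> f1 = g1 -> f2 = g2 -> jet g g0 g1 g2.
Proof. by move=> [u bu eu] e <- <- <-; exists u => // s Ps; rewrite e // eu. Qed.

End Jets.

(** * Small-parameter expansion of the mean and variance for infinitely many sites *)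

Section Expand.
Variables (R : realType) (t : nat).
Hypothesis t0 : (0 < t)%N.
Local Notation jj := (@jj R).
Local Notation A := (@AA R).
Implicit Types (s x y : R) (n i m k : nat).

Lemma fd_expand : exists2 C : R, 0 < C & forall y, 0 <= y -> `|fd y - (2^-1 - y/4)| <= C * y^+3.
exists 2 => // y y0.
have e0 := expR_gt0 (- y).
have fE : fd y = expR (- y)/(1 + expR (- y)).
 by rewrite /fd expRN; have := expR_gt0 y; move: (expR y) => u u0; field; rewrite !gt_eqF; lra.
have [y1|y1] := leP y 1; last first.
 have y3 : 1 <= y^+3 by rewrite exprn_ege1 // ltW.
 have yy : y <= y^+3 by rewrite -[leLHS]expr1 ler_weXn2l // ltW.
 have : 0 <= fd y <= 1.
 rewrite fE; apply/andP; split; first by pz; lra.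
 by rewrite ler_pdivrMr; lra.
 move=> /andP[h1 h2]; rewrite ler_norml; lra.
have := expRN_taylor 3 y0; rewrite !big_ord_recr big_ord0 /= add0r.
rewrite (_ : 0`! = 1%N) // (_ : 1`! = 1%N) // (_ : 2`! = 2%N) // (_ : 3`! = 6%N) // expr0 expr1 !divr1.
set e := expR (- y) in e0 fE *; set r := e - _ => hr.
have e2 : e = 1 - y + y^+2/2 + r by rewrite /r; ring.
have d0 : 0 < 1 + e by lra.
have -> : fd y - (2^-1 - y/4) = (y^+3/8 + r*(2^-1 + y/4))/(1 + e).
 rewrite fE; have -> : y^+3/8 + r*(2^-1 + y/4) = e*(2^-1 + y/4) - (2^-1 - y/4) by rewrite e2; field.
 by fld.
have y3 : 0 <= y^+3 by rewrite exprn_ge0.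
rewrite normrM [`|_^-1|]ger0_norm; last by rewrite invr_ge0 ltW.
rewrite ler_pdivrMr //; lel (ler_normD _ _).
have n1 : `|y^+3/8| <= y^+3 by rewrite ger0_norm; lra.
have n2 : `|r*(2^-1 + y/4)| <= y^+3.
 rewrite normrM -[leRHS]mulr1; apply: ler_pM => //; last by rewrite ger0_norm; lra.
 lra.
have : 0 <= y^+3 * e by pz.
by move: n1 n2 y3; clear; move: (`|_|) (`|_|) => u v *; lra.
Qed.

Definition Ps s := 0 < s <= (4 * t%:R)^-1.

Lemma t1 : 1 <= t%:R :> R.
Proof. by rewrite ler1n. Qed.

Lemma Ps01 s : Ps s -> 0 < s <= 1.
move=> /andP[s0 s1]; rewrite s0 /=; lel s1.
by rewrite invf_le1; have := t1; lra.
Qed.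

Let bs := bd_id Ps01.

(** The ratio of the weights of the sites [i + t] and [i]; [cc] and [th] are the rational functions
    of it that make [piF_telescope] and [Psi_telescope] true. *)
Definition XX s : R := expR (- (2 * t%:R * s)).
Definition cc s : R := XX s/(1 - XX s).
Definition th s : R := 2*(XX s/(1 + XX s)).

Lemma XX01 s : 0 < s -> 0 < XX s < 1.
move=> s0; rewrite expR_gt0 expR_lt1 oppr_lt0 mulr_gt0 // mulr_gt0 // ltr0n //.
Qed.

Lemma bp_fd s i : bp s i = fd (s * jj i).
Proof. by []. Qed.

Lemma jet_bp i : jet Ps (fun s => bp s i) (2^-1) (- (jj i/4)) 0.
have [C C0 h] := fd_expand.
exists (fun s => (bp s i - (2^-1 - s * jj i/4))/s^+3).
 exists (C * jj i^+3); first by rewrite mulr_ge0 ?exprn_ge0 // ltW.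
 move=> s /andP[s0 _]; have s3 : 0 < s^+3 by rewrite exprn_gt0.
 rewrite normrM [`|_^-1|]ger0_norm; last by rewrite invr_ge0 ltW.
 rewrite ler_pdivrMr // -[leRHS]mulrA -exprMn [jj i * s]mulrC bp_fd; apply: h.
 by pz.
move=> s /andP[s0 _]; rewrite [s^+3 * _]mulrC divfK; last by pz.
by ring.
Qed.

Lemma jet_th : jet Ps th 1 (- t%:R) 0.
have [C C0 h] := fd_expand.
exists (fun s => (th s - (1 - t%:R * s))/s^+3).
 exists (2 * C*(2 * t%:R)^+3); first by pz.
 move=> s /andP[s0 _]; have s3 : 0 < s^+3 by rewrite exprn_gt0.
 rewrite normrM [`|_^-1|]ger0_norm; last by pz.
 rewrite ler_pdivrMr // -[leRHS]mulrA -exprMn.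
 have y0 : 0 <= 2 * t%:R * s by rewrite !mulr_ge0 // ltW.
 have := h _ y0; have -> : fd (2 * t%:R * s) = XX s/(1 + XX s).
 by rewrite /fd /XX expRN; have := expR_gt0 (2 * t%:R * s); move: (expR _) => u u0; field; rewrite !gt_eqF //; lra.
 move=> h2; have -> : th s - (1 - t%:R * s) = 2*(XX s/(1 + XX s) - (2^-1 - 2 * t%:R * s/4)) by rewrite /th; move: (XX s/(1 + XX s)) => z; field.
 by rewrite normrM (ger0_norm (ler0n R 2)) -[leRHS]mulrA ler_pM2l.
move=> s /andP[s0 _]; rewrite [s^+3 * _]mulrC divfK; last by pz.
by ring.
Qed.

(** [cc] is [1 / (exp y - 1)] at [y = 2 t s]; its simple pole is removed by the factor [s]. *)
Lemma jet_cc : jet Ps (fun s => s * cc s) ((2 * t%:R)^-1) (- 2^-1) (t%:R/6).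
have [C C0 h] := inv_exp_expand R; have t1' := t1.
have tn0 : t%:R != 0 :> R by rewrite gt_eqF //; lra.
exists (fun s => s*((cc s - ((2 * t%:R * s)^-1 - 2^-1 + t%:R * s/6))/s^+3)).
 apply: bdM => //; exists (C*(2 * t%:R)^+3); first by pz; lra.
 move=> s /andP[s0 s1]; have s3 : 0 < s^+3 by rewrite exprn_gt0.
 rewrite normrM [`|_^-1|]ger0_norm; last by pz.
 rewrite ler_pdivrMr // -[leRHS]mulrA -exprMn.
 have x0 : 0 < 2 * t%:R * s by rewrite !mulr_gt0 //; lra.
 have x1 : 2 * t%:R * s <= 1.
 have h4 : 0 < 4 * t%:R :> R by lra.
 have : 4 * t%:R * s <= 1 by rewrite mulrC -ler_pdivlMr // mul1r.
 lra.
 have := h _ (andI x0 x1) => -[_].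
 have /andP[X0 X1] := XX01 s0; rewrite -[expR _]/(XX s).
 have -> : (1 - XX s)^-1 = cc s + 1 by rewrite /cc; field; rewrite gt_eqF //; lra.
 suff -> : cc s + 1 - ((2 * t%:R * s)^-1 + 2^-1 + 2 * t%:R * s/12) = cc s - ((2 * t%:R * s)^-1 - 2^-1 + t%:R * s/6) by [].
 by fld.
move=> s /andP[s0 _]; have sn : s != 0 by rewrite gt_eqF.
by fld.
Qed.

Definition mid m : bool := m == (t.-1 - m)%N.
Definition y0 (m : nat) : R := if mid m then 2^-1 else 4^-1.
Definition y2 (m : nat) : R := if mid m then 0 else jj m * jj (t.-1 - m)/16.

Lemma jj_mid m : (m < t)%N -> jj m + jj (t.-1 - m) = 2 * t%:R.
Proof. by move=> mt; rewrite /jj -natrD -natrM; congr (_%:R); move: mt; clear; lia. Qed.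

Lemma jet_yF m : (m < t)%N -> jet Ps (fun s => yF t (bp s) m) (y0 m) (- (t%:R/4)) (y2 m).
move=> mt; rewrite /yF /Ly /y0 /y2 /mid; have hj := jj_mid mt; case: eqP => e.
 rewrite -e in hj; apply: (eq_jet (jet_bp m)) => //; first by move=> s _; rewrite big_seq1.
 lra.
apply: (eq_jet (jetM Ps01 (jet_bp m) (jet_bp (t.-1 - m)))) => //.
- by move=> s _; rewrite big_cons big_seq1.
all: move: hj; move: (jj m) (jj _) => u v hj; first [by [] | lra].
Qed.

Lemma sum_jj k : \sum_(i < k) jj i = k%:R^+2.
elim: k => [|k IH]; first by rewrite big_ord0 expr0n.
by rewrite big_ord_recr /= IH jjE natS; ring.
Qed.

Lemma sum_mid : \sum_(m < t) (mid m)%:R = (odd t)%:R :> R.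
have t2 := odd_double_half t; case: (boolP (odd t)) t2 => ot /= t2.
 have kt : (t./2 < t)%N by move: t0 t2; rewrite -addnn; clear; lia.
 rewrite (bigD1 (Ordinal kt)) //= big1 ?addr0.
 by rewrite /mid (_ : (t./2 == t.-1 - t./2)%N) //; move: t2; rewrite -addnn; clear; lia.
 move=> i ik; rewrite (_ : mid i = false) //; apply: contraNF ik => /eqP e.
 by apply/eqP; apply: val_inj => /=; move: e t2 (ltn_ord i); rewrite -addnn; clear; lia.
rewrite big1 // => i _; rewrite (_ : mid i = false) //; apply/negbTE/eqP => e.
by move: e t2 (ltn_ord i); rewrite -addnn; clear; lia.
Qed.

Lemma y0E m : y0 m = 4^-1 + (mid m)%:R/4.
Proof. by rewrite /y0; case: (mid m) => /=; lra. Qed.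

(** The mean for infinitely many sites: the sum of all [piF] telescopes to [cc] times the first [t]
    occupation probabilities. *)
Definition E0 s : R := 2*(cc s*\sum_(i < t) bp s i) + \sum_(m < t) yF t (bp s) m.
Definition c0 : R := - (t%:R/2) + (odd t)%:R/4.
Definition c1 : R := t%:R^+2/6.

Lemma E0_expand : exists2 C : R, 0 < C & forall s, Ps s -> `|E0 s - (s^-1/2 + c0 + c1 * s)| <= C * s^+2.
have tn0 : t%:R != 0 :> R by have := t1 => ?; rewrite gt_eqF //; lra.
have H : jet Ps (fun s => s * E0 s) (2^-1) c0 c1.
 have h1 := jet_sum (fun i (_ : (i < t)%N) => jet_bp i).
 have h2 := jet_sum jet_yF.
 have h3 := jetD (jetM Ps01 (jet_cst Ps 2) (jetM Ps01 jet_cc h1)) (jetM Ps01 (jet_id Ps) h2).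
 apply: (eq_jet h3).
 - by move=> s _; rewrite /E0; ring.
 - rewrite !sumr_const card_ord -[_ *+ t]mulr_natr; by fld.
 - rewrite !sumr_const card_ord -[_ *+ t]mulr_natr sumrN -mulr_suml sum_jj.
 under eq_bigr => m _ do rewrite y0E.
 rewrite big_split /= sumr_const card_ord -[_ *+ t]mulr_natr -mulr_suml sum_mid /c0.
 by fld.
 rewrite !sumr_const card_ord -[(2^-1) *+ t]mulr_natr -[(- (_/4)) *+ t]mulr_natr mul0rn sumrN -mulr_suml sum_jj /c1.
 by fld.
have [g [C C0 hg] e] := H; exists (C + 1); first lra.
move=> s sP; have /andP[s0 _] := sP.
have -> : E0 s - (s^-1/2 + c0 + c1 * s) = s^+2 * g s.
 have := e s sP => h; have sn : s != 0 by rewrite gt_eqF.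
 apply: (mulfI sn); rewrite mulrBr h; by fld.
rewrite normrM (ger0_norm (sqr_ge0 s)) mulrC ler_wpM2r ?sqr_ge0 //.
by lel (hg s sP); lra.
Qed.

(** A potential for the quadratic part of the variance: its difference between [i] and [i + t] is
    [piF i ^ 2 + 2 piF i piF (i + t)], so that this sum also reduces to [t] terms. *)
Definition Psi s i : R := cc s^+2 * bp s i*(bp s i - th s * bp s (i + t)).
Definition V0 s : R := 4*\sum_(i < t) (cc s * bp s i - Psi s i)
 - 4*\sum_(m < t) \sum_(i < t) (val i \in Ly t m)%:R*(piF t (bp s) i * yF t (bp s) m)
 + \sum_(m < t) \sum_(i < t) (val i \in Ly t m)%:R*(yF t (bp s) m - yF t (bp s) m^+2).

Lemma size_Ly m : (m < t)%N -> \sum_(i < t) (val i \in Ly t m)%:R = 2 - (mid m)%:R :> R.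
move=> mt; have := @sum_lmem t (Ly t m) (fun=> 1%N) (Ly_uniq t m).
have -> : all (fun i => i < t)%N (Ly t m) by apply/seq.allP => i; exact: Ly_lt.
move=> /(_ isT); rewrite sum1_size sum1_card => h.
rewrite -natr_sum -big_mkcond /= sum1_card h.
by rewrite /Ly /mid; case: eqP => _ /=; lra.
Qed.

(** The double pole of [cc^2] is softened to a simple one because [bp i - th * bp (i + t)] vanishes
    at [s = 0]; the parity term comes from the pairs counted by [mid]. *)
Lemma V0_expand : exists2 C : R, 0 < C & forall s, Ps s -> `|V0 s - (s^-1/2 - (odd t)%:R/8)| <= C * s.
have t1' := t1; have tn0 : t%:R != 0 :> R by rewrite gt_eqF //; lra.
have H : jet Ps (fun s => s * s * V0 s) 0 (2^-1) (- ((odd t)%:R/8)).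
 have jp i := jet_bp i.
 have hi i : jet Ps (fun s => s*(s * cc s) * bp s i - (s * cc s) * (s * cc s) * bp s i*(bp s i - th s * bp s (i + t)))
 0 ((8 * t%:R)^-1) (- (jj i/(32 * t%:R)) + 16^-1).
 have jit : jj (i + t) = jj i + 2 * t%:R by rewrite !jjE natrD; ring.
 have k1 := jetM Ps01 (jetM Ps01 (jet_id Ps) jet_cc) (jp i).
 have k2 := jetM Ps01 (jetM Ps01 (jetM Ps01 jet_cc jet_cc) (jp i)) (jetD (jp i) (jetN (jetM Ps01 jet_th (jp (i + t)%N)))).
 apply: (eq_jet (jetD k1 (jetN k2))) => //.
 - by field.
 - by rewrite jit; field.
 - by rewrite jit; field.
 have hs := jet_sum (fun i (_ : (i < t)%N) => hi i).
 have jpi i : J1 Ps (fun s => piF t (bp s) i) (4^-1).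
 have := J1M Ps01 (J1D (J1_cst Ps 1) (J1N (jet_J1 Ps01 (jp i)))) (jet_J1 Ps01 (jp (i + t)%N)).
 by rewrite (_ : (1 - 2^-1) * 2^-1 = 4^-1) //; lra.
 have jy m (mt : (m < t)%N) := jet_J1 Ps01 (jet_yF mt).
 have w1 := J1_sum (f := fun m s => \sum_(i < t) (val i \in Ly t m)%:R*(piF t (bp s) i * yF t (bp s) m))
 (fun m (mt : (m < t)%N) => J1_sum (f := fun i s => (i \in Ly t m)%:R*(piF t (bp s) i * yF t (bp s) m))
 (fun i (_ : (i < t)%N) => J1M Ps01 (J1_cst Ps (i \in Ly t m)%:R) (J1M Ps01 (jpi i) (jy m mt)))).
 have w2 := J1_sum (f := fun m s => \sum_(i < t) (val i \in Ly t m)%:R*(yF t (bp s) m - yF t (bp s) m^+2))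
 (fun m (mt : (m < t)%N) => J1_sum (f := fun i s => (i \in Ly t m)%:R*(yF t (bp s) m - yF t (bp s) m * yF t (bp s) m))
 (fun i (_ : (i < t)%N) => J1M Ps01 (J1_cst Ps (i \in Ly t m)%:R) (J1D (jy m mt) (J1N (J1M Ps01 (jy m mt) (jy m mt)))))).
 have h3 := jetD (jetM Ps01 (jet_cst Ps 4) hs)
 (J1_shift (J1D (J1N (J1M Ps01 (J1_cst Ps 4) w1)) w2)).
 apply: (eq_jet h3).
 - move=> s _; rewrite /V0 /Psi.
 have -> : \sum_(i < t) (s*(s * cc s) * bp s i - (s * cc s) * (s * cc s) * bp s i*(bp s i - th s * bp s (i + t))) =
 s * s*\sum_(i < t) (cc s * bp s i - cc s^+2 * bp s i*(bp s i - th s * bp s (i + t))).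
 by rewrite mulr_sumr; bigr i; ring.
 by ring.
 - by rewrite big1 // mulr0 addr0.
 - rewrite !mul0r !addr0 !sumr_const card_ord -[_ *+ t]mulr_natr; by fld.
 rewrite !mul0r !addr0.
 have -> : \sum_(i < t) (- (jj i/(32 * t%:R)) + 16^-1) = t%:R/32.
 rewrite big_split /= sumrN -mulr_suml sum_jj sumr_const card_ord -[_ *+ t]mulr_natr; by fld.
 have -> : \sum_(m < t) \sum_(i < t) (val i \in Ly t m)%:R*(4^-1 * y0 m) = t%:R/8.
 transitivity (\sum_(m < t) (8^-1 : R)); last by rewrite sumr_const card_ord -[_ *+ t]mulr_natr; field.
 bigr m; rewrite -mulr_suml size_Ly // y0E; case: (mid m) => /=; lra.
 have -> : \sum_(m < t) \sum_(i < t) (val i \in Ly t m)%:R*(y0 m - y0 m * y0 m) = 3/8 * t%:R - (odd t)%:R/8.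
 rewrite -sum_mid mulr_suml.
 have -> : 3/8 * t%:R = \sum_(m < t) (3/8 : R) by rewrite sumr_const card_ord mulr_natr.
 rewrite -sumrB; bigr m; rewrite -mulr_suml size_Ly // /y0.
 by case: (mid m); rewrite ?mulr1n ?mulr0n; field.
 by fld.
have [g [C C0 hg] e] := H; exists (C + 1); first lra.
move=> s sP; have /andP[s0 _] := sP.
have -> : V0 s - (s^-1/2 - (odd t)%:R/8) = s * g s.
 have := e s sP => h; have sn : s * s != 0 by rewrite mulf_neq0 // gt_eqF.
 have sn' : s != 0 by rewrite gt_eqF.
 apply: (mulfI sn); rewrite mulrBr h; by fld.
rewrite normrM (ger0_norm (ltW s0)) mulrC ler_wpM2r ?(ltW s0) //.
by lel (hg s sP); lra.
Qed.

End Expand.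

(** * Telescoping, and truncation to [n] sites *)

Section Truncation.
Variables (R : realType) (t : nat).
Hypothesis t0 : (0 < t)%N.
Local Notation jj := (@jj R).
Local Notation A := (@AA R).
Implicit Types (s x y : R) (n i m k : nat).
Local Notation XX := (@XX R t).
Local Notation cc := (@cc R t).

Lemma bp_shift s i : bp s (i + t) = expR (- (s * jj i)) * XX s/(1 + expR (- (s * jj i)) * XX s).
have e : expR (- (s * jj (i + t))) = expR (- (s * jj i)) * XX s.
 by rewrite -expRD; congr expR; rewrite !jjE natrD; ring.
by rewrite bpE e.
Qed.

Lemma piF_telescope s i : 0 < s -> piF t (bp s) i = cc s*(bp s i - bp s (i + t)).
move=> s0; rewrite /piF one_bpE bp_shift bpE /cc.
have /andP[] := XX01 t0 s0; have := expR_gt0 (- (s * jj i)); move: (expR _) (XX s) => u X u0 X0 X1.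
by field; rewrite !gt_eqF; nra.
Qed.

Lemma Psi_telescope s i : 0 < s ->
 Psi t s i - Psi t s (i + t) = piF t (bp s) i^+2 + 2*(piF t (bp s) i * piF t (bp s) (i + t)).
move=> s0; rewrite /Psi !piF_telescope // /th.
have -> : bp s (i + t + t) = expR (- (s * jj i)) * XX s * XX s/(1 + expR (- (s * jj i)) * XX s * XX s).
 have e : expR (- (s * jj (i + t))) = expR (- (s * jj i)) * XX s.
 by rewrite -expRD; congr expR; rewrite !jjE natrD; ring.
 by rewrite bp_shift e.
rewrite bp_shift bpE /cc.
have /andP[] := XX01 t0 s0; have := expR_gt0 (- (s * jj i)); move: (expR _) (XX s) => u X u0 X0 X1.
have uX : 0 < u * X by rewrite mulr_gt0.
have uXX : 0 < u * X * X by rewrite mulr_gt0.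
by field; rewrite !gt_eqF; lra.
Qed.

Lemma telescope_shift (f : nat -> R) n :
 \sum_(i < n) (f i - f (i + t)%N) = \sum_(i < t) f i - \sum_(i < t) f (n + i)%N.
elim: n => [|n IH]; first by rewrite big_ord0 subrr.
rewrite big_ord_recr /= IH.
have h : f n + \sum_(i < t) f (n.+1 + i)%N = \sum_(i < t) f (n + i)%N + f (n + t)%N.
 have -> : \sum_(i < t) f (n + i)%N + f (n + t)%N = \sum_(i < t.+1) f (n + i)%N by rewrite big_ord_recr.
 rewrite big_ord_recl /= addn0; congr (_ + _); bigr i.
 by rewrite /fintype.bump add1n addnS addSn.
lra.
Qed.

Lemma prod2_diff (p p' q q' d : R) : 0 <= p' <= 1 -> 0 <= q <= 1 -> `|p - p'| <= d -> `|q - q'| <= d ->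
 `|(1 - p) * q - (1 - p') * q'| <= 2 * d.
move=> /andP[a1 a2] /andP[b1 b2] h1 h2.
have -> : (1 - p) * q - (1 - p') * q' = - ((p - p') * q) + (1 - p') * (q - q') by ring.
lel (ler_normD _ _); rewrite normrN !normrM.
have d0 : 0 <= d by apply: le_trans h1.
have : `|p - p'| * `|q| <= d*1 by apply: ler_pM => //; rewrite ger0_norm.
have : `|1 - p'| * `|q - q'| <= 1 * d by apply: ler_pM => //; rewrite ger0_norm; lra.
lra.
Qed.

Lemma var_diff (p p' q q' d : R) : 0 <= p <= 1 -> 0 <= p' <= 1 -> 0 <= q <= 1 -> `|p - p'| <= d -> `|q - q'| <= d ->
 `|(p - p^+2 - 2*(p * q)) - (p' - p'^+2 - 2*(p' * q'))| <= 5 * d.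
move=> /andP[a1 a2] /andP[b1 b2] /andP[c1 c2] h1 h2.
have -> : (p - p^+2 - 2*(p * q)) - (p' - p'^+2 - 2*(p' * q')) =
 (p - p') * (1 - p - p' - 2 * q) - 2*(p' * (q - q')) by ring.
have d0 : 0 <= d by apply: le_trans h1.
lel (ler_normB _ _).
have : `|(p - p') * (1 - p - p' - 2 * q)| <= d*3.
 by rewrite normrM; apply: ler_pM => //; rewrite ler_norml; lra.
have : `|p' * (q - q')| <= 1 * d by rewrite normrM; apply: ler_pM => //; rewrite ger0_norm.
by rewrite [`|2 * _|]normrM (ger0_norm (ler0n R 2)); move: (`|_|) (`|_|) => u v; lra.
Qed.

Lemma bp01 s i : 0 < s -> 0 <= bp s i <= 1.
Proof. by move=> s0; have := one_bp_gt0 s i; have := bp_gt0 s i; lra. Qed.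

Lemma bp_tail : exists2 C : R, 0 < C & forall a s n k, 0 < a <= 1 -> a <= s -> a^+2 * n%:R = A -> (n <= k)%N ->
 bp s k <= C * a^+8.
have [C C0 h] := expN_tail R; exists C => // a s n k a01 as_ an nk.
have s0 : 0 < s by case/andP: a01 => ? _; apply: lt_le_trans as_.
lel (bp_le_exp _ _); apply: le_trans (h a s n a01 as_ an).
rewrite -expRM_natl ler_expR mulrN lerN2 mulrC ler_wpM2l ?(ltW s0) // ler_nat.
by move: nk; clear; lia.
Qed.

Lemma double_le_size a n : 0 < a -> a <= 1/80 -> a*(8 * t%:R) <= 1 -> a^+2 * n%:R = A -> (2 * t <= n)%N.
move=> a0 a1' hat an; have A6 := AA_ge R; have a20 : 0 < a^+2 by rewrite exprn_gt0.
rewrite -(ler_nat R) natrM -(ler_pM2l a20) an.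
have : a^+2*(2 * t%:R) <= 1/80*(1/4).
 have -> : a^+2*(2 * t%:R) = a*(a*(8 * t%:R)/4) by fld.
 by apply: ler_pM; rewrite ?(ltW a0) //; [rewrite divr_ge0 // mulr_ge0 ?(ltW a0) //; lra | move: hat; clra].
by move: A6; clra.
Qed.

Lemma product_moments : exists2 C : R, 0 < C & exists2 a1 : R, 0 < a1 <= 1/80 & forall a s n, 0 < a <= a1 ->
 a <= s <= 2 * a -> a^+2 * n%:R = A ->
 `|Eprod s (@Nhk R n t) - (s^-1/2 + c0 R t + c1 R t * s)| <= C * a^+2 /\
 `|Eprod s (fun D : {set 'I_n} => Nhk R t D^+2) - Eprod s (@Nhk R n t)^+2 - (s^-1/2 - (odd t)%:R/8)| <= C * a.
have [C' C'0 ht] := bp_tail; have [Ce Ce0 he] := E0_expand R t0; have [Cv Cv0 hv] := V0_expand R t0.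
have [Ci Ci0 hi] := inv_exp_expand R.
have T1 := t1 R t0.
exists (4 * Ce + 2 * Cv + (48 + 10 * t%:R) * C').
 by rewrite !addr_gt0 ?mulr_gt0 //; lra.
have it0 : 0 < (8 * t%:R)^-1 :> R by rewrite invr_gt0; lra.
exists (Num.min (1/80) (8 * t%:R)^-1).
 by rewrite lt_min it0 ge_min lexx andbT; lra.
move=> a s n; rewrite le_min => /andP[a0 /andP[a80 at8]] /andP[s1 s2] an.
have s0 : 0 < s by lra.
have a01 : 0 < a <= 1 by rewrite a0 /=; move: a80; clra.
have hat : a*(8 * t%:R) <= 1 by rewrite -ler_pdivlMr ?mul1r //; lra.
have sP : Ps t s.
 by rewrite /Ps s0 -[leRHS]mul1r ler_pdivlMr; [move: hat s2 T1; clear; nra | move: T1; clra].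
(* A bound for all occupation probabilities from site [n] on. It gets multiplied at most by
   quantities of order [a^-2], such as [n] or [cc^2], so the eighth power is ample. *)
pose eta := C' * a^+8.
have eta0 : 0 <= eta by rewrite mulr_ge0 ?exprn_ge0 // ltW.
have htl k (nk : (n <= k)%N) : bp s k <= eta := ht a s n k a01 s1 an nk.
have b01 k := bp01 k s0.
have pnd k : `|pn n s k - bp s k| <= eta.
 rewrite /pn; case: ltnP => nk; first by rewrite subrr normr0.
 by rewrite sub0r normrN ger0_norm ?htl; case/andP: (b01 k).
have pn01 k : 0 <= pn n s k <= 1 by rewrite /pn; case: ltnP => _ //; rewrite lexx ler01.
have pi01 (p : nat -> R) k : (forall i, 0 <= p i <= 1) -> 0 <= piF t p k <= 1.
 move=> h; have /andP[u1 u2] := h k; have /andP[v1 v2] := h (k + t)%N; rewrite /piF.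
 move: u1 u2 v1 v2; move: (p k) (p (k + t)%N); clear => u v ? ? ? ?.
 by apply/andP; split; [apply: mulr_ge0; lra | rewrite -[leRHS]mulr1; apply: ler_pM; lra].
have pid k : `|piF t (pn n s) k - piF t (bp s) k| <= 2 * eta by apply: prod2_diff.
have A6 := AA_ge R.
have a20 : 0 < a^+2 by rewrite exprn_gt0.
have n2t : (2 * t <= n)%N by apply: (@double_le_size a).
have tn : (t <= n)%N by apply: leq_trans n2t; rewrite leq_pmull.
have pnE k : (k < 2 * t)%N -> pn n s k = bp s k by move=> kt; rewrite /pn (leq_trans kt n2t).
have yE m : (m < t)%N -> yF t (pn n s) m = yF t (bp s) m.
 move=> mt; apply: eq_big_seq => i iL; apply: pnE.
 by apply: (leq_trans (Ly_lt t0 mt iL)); rewrite leq_pmull.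
have piE m : (m < t)%N -> piF t (pn n s) m = piF t (bp s) m.
 by move=> mt; rewrite /piF !pnE //; move: mt; clear; lia.
have nle := n_le_inv a0 an.
have /andP[X0 X1] := XX01 t0 s0.
have cle : 0 <= cc s <= a^-1.
 have x0 : 0 < 2 * t%:R * s by rewrite !mulr_gt0 //; lra.
 have x1 : 2 * t%:R * s <= 1 by move: hat s2 T1; clear; nra.
 have [lo _] := hi _ (andI x0 x1); rewrite -[expR _]/(XX s) in lo.
 have d0 : 0 < 1 - XX s by lra.
 apply/andP; split; first by apply: divr_ge0; lra.
 have la : a <= 1 - XX s by apply: le_trans lo; have : s <= t%:R * s by [rewrite ler_peMl // ltW]; move: s1; clra.
 rewrite /cc -[leRHS]mul1r; apply: ler_pM; rewrite ?invr_ge0 ?(ltW X0) ?(ltW X1) ?(ltW d0) //.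
 by rewrite lef_pV2.
have /andP[c0' cle'] := cle.
have ia1 : 1 <= a^-1 by case/andP: a01 => _ ?; rewrite invf_ge1.
have ia2 : a^-1 <= (a^+2)^-1 by rewrite lef_pV2 ?posrE // expr2 ler_piMr ?(ltW a0) //; case/andP: a01.
have tb : 0 <= \sum_(i < t) bp s (n + i) <= t%:R * eta.
 rewrite sumr_ge0 /=; last by move=> i _; case/andP: (b01 (n + i)%N).
 rewrite mulr_natl -[in leRHS](card_ord t) -sumr_const; lsum i; exact: htl (leq_addr _ _).
have E8 : eta/a^+2 = C' * a^+6 by rewrite /eta; fld.
have ctb : 0 <= cc s*\sum_(i < t) bp s (n + i) <= t%:R*(eta/a^+2).
 case/andP: tb => u1 u2; rewrite mulr_ge0 //= mulrA mulrC; apply: ler_pM => //; exact: le_trans cle' ia2.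
have neta : n%:R * eta <= eta/a^+2 by rewrite mulrC ler_wpM2l.
have a62 : C' * a^+6 <= C' * a^+2 by rewrite ler_wpM2l ?(ltW C'0) // ler_wiXn2l ?(ltW a0) //; case/andP: a01.
have a61 : C' * a^+6 <= C' * a.
 by rewrite ler_wpM2l ?(ltW C'0) // -[leRHS]expr1 ler_wiXn2l ?(ltW a0); case/andP: a01.
have a60 : 0 <= C' * a^+6 by rewrite mulr_ge0 ?exprn_ge0 ?(ltW C'0) ?(ltW a0).
have ss : s^+2 <= 4 * a^+2.
 have -> : 4 * a^+2 = (2 * a)^+2 by ring.
 by apply: lerXn2r => //; rewrite nnegrE; move: s0 a0; clra.
rewrite Eprod_Nhk_var // Eprod_Nhk //; split.
 have eE : ENf n t (pn n s) - E0 t s = 2*(\sum_(i < n) (piF t (pn n s) i - piF t (bp s) i) - cc s*\sum_(i < t) bp s (n + i)).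
 rewrite /ENf /E0 (eq_bigr (fun m : 'I_t => yF t (bp s) m)); last by move=> m _; exact: yE.
 have -> : \sum_(i < n) (piF t (pn n s) i - piF t (bp s) i) =
 \sum_(i < n) piF t (pn n s) i - cc s*(\sum_(i < t) bp s i - \sum_(i < t) bp s (n + i)).
 rewrite -telescope_shift mulr_sumr -sumrB; bigr i; by rewrite (piF_telescope _ s0).
 by ring.
 have d1 : `|\sum_(i < n) (piF t (pn n s) i - piF t (bp s) i)| <= 2*(eta/a^+2).
 lel (ler_norm_sum _ _ _); via (\sum_(i < n) 2 * eta).
 by lsum i; exact: pid.
 by rewrite sumr_const card_ord -[_ *+ n]mulr_natl mulrCA ler_pM2l.
 have := he s sP; move: d1 ctb (a62) (a60); rewrite E8.
 have -> : ENf n t (pn n s) - (s^-1/2 + c0 R t + c1 R t * s) = (ENf n t (pn n s) - E0 t s) + (E0 t s - (s^-1/2 + c0 R t + c1 R t * s)) by ring.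
 rewrite eE; move: (E0 t s - _) (\sum_(i < n) _) (cc s * _) => e z w.
 have q1 : Ce * s^+2 <= Ce*(4 * a^+2) by rewrite ler_wpM2l // ltW.
 have q2 : t%:R*(C' * a^+6) <= t%:R*(C' * a^+2) by rewrite ler_wpM2l ?ler0n.
 have q3 : 0 <= Cv * a^+2 by rewrite mulr_ge0 // ltW.
 have q4 : 0 <= t%:R*(C' * a^+6) by rewrite mulr_ge0 ?ler0n.
 have -> : (4 * Ce + 2 * Cv + (48 + 10 * t%:R) * C') * a^+2 = 
 4*(Ce * a^+2) + 2*(Cv * a^+2) + 48*(C' * a^+2) + 10*(t%:R*(C' * a^+2)) by ring.
 move: q1 q2 q3 q4 T1; rewrite !ler_norml.
 rewrite (mulrCA Ce 4); move: (Ce * s^+2) (Ce * a^+2) (Cv * a^+2) (t%:R*(C' * a^+6)) (t%:R*(C' * a^+2)) (C' * a^+6) (C' * a^+2) => ? ? ? ? ? ? ?.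
 by clear; move=> ? ? ? ? ? /andP[? ?] /andP[? ?] ? ? /andP[? ?]; apply/andP; split; lra.
have vE : VNf n t (pn n s) - V0 t s = 4*(\sum_(i < n) ((piF t (pn n s) i - piF t (pn n s) i^+2 - 2*(piF t (pn n s) i * piF t (pn n s) (i + t)))
 - (piF t (bp s) i - piF t (bp s) i^+2 - 2*(piF t (bp s) i * piF t (bp s) (i + t)))) - (cc s*\sum_(i < t) bp s (n + i) - \sum_(i < t) Psi t s (n + i))).
 have W1 : \sum_(m < t) \sum_(i < t) (val i \in Ly t m)%:R*(piF t (pn n s) i * yF t (pn n s) m) =
 \sum_(m < t) \sum_(i < t) (val i \in Ly t m)%:R*(piF t (bp s) i * yF t (bp s) m).
 by bigr m; bigr i; rewrite yE // piE.
 have W2 : \sum_(m < t) \sum_(i < t) (val i \in Ly t m)%:R*(yF t (pn n s) m - yF t (pn n s) m^+2) =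
 \sum_(m < t) \sum_(i < t) (val i \in Ly t m)%:R*(yF t (bp s) m - yF t (bp s) m^+2).
 by bigr m; bigr i; rewrite yE.
 rewrite /VNf /V0 W1 W2.
 have -> : \sum_(i < n) ((piF t (pn n s) i - piF t (pn n s) i^+2 - 2*(piF t (pn n s) i * piF t (pn n s) (i + t)))
 - (piF t (bp s) i - piF t (bp s) i^+2 - 2*(piF t (bp s) i * piF t (bp s) (i + t)))) =
 \sum_(i < n) (piF t (pn n s) i - piF t (pn n s) i^+2 - 2*(piF t (pn n s) i * piF t (pn n s) (i + t))) -
 (cc s*(\sum_(i < t) bp s i - \sum_(i < t) bp s (n + i)) - (\sum_(i < t) Psi t s i - \sum_(i < t) Psi t s (n + i))).
 rewrite -!telescope_shift mulr_sumr -!sumrB; bigr i.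
 by rewrite (Psi_telescope _ s0) (piF_telescope i s0); ring.
 have -> : \sum_(i < t) (cc s * bp s i - Psi t s i) = cc s*\sum_(i < t) bp s i - \sum_(i < t) Psi t s i.
 by rewrite sumrB -mulr_sumr.
 by ring.
have d1 : `|\sum_(i < n) ((piF t (pn n s) i - piF t (pn n s) i^+2 - 2*(piF t (pn n s) i * piF t (pn n s) (i + t)))
 - (piF t (bp s) i - piF t (bp s) i^+2 - 2*(piF t (bp s) i * piF t (bp s) (i + t))))| <= 10*(eta/a^+2).
 lel (ler_norm_sum _ _ _); via (\sum_(i < n) 5*(2 * eta)).
 by lsum i; apply: var_diff; rewrite ?pi01.
 by rewrite sumr_const card_ord -[_ *+ n]mulr_natl; move: neta; clra.
have d2 : `|\sum_(i < t) Psi t s (n + i)| <= t%:R*(eta/a^+2).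
 lel (ler_norm_sum _ _ _).
 rewrite mulr_natl -[in leRHS](card_ord t) -sumr_const; lsum i.
 have /andP[u1 u2] := b01 (n + i)%N; have /andP[v1 v2] := b01 (n + i + t)%N.
 have th01 : 0 <= th t s <= 1.
 rewrite /th mulr_ge0 ?divr_ge0 ?(ltW X0) //=; last by move: X0; clra.
 by rewrite mulrA ler_pdivrMr; move: X0 X1; clra.
 have /andP[w1 w2] := th01.
 have tp : 0 <= th t s * bp s (n + i + t) <= 1.
 by rewrite mulr_ge0 //= -[leRHS]mulr1; apply: ler_pM.
 have cb0 : 0 <= cc s^+2 * bp s (n + i) := mulr_ge0 (sqr_ge0 _) u1.
 rewrite /Psi normrM (ger0_norm cb0).
 have -> : eta/a^+2 = a^-1^+2 * eta*1 by rewrite exprVn mulr1 mulrC.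
 apply: ler_pM => //.
 apply: ler_pM => //; [exact: sqr_ge0 | apply: lerXn2r => //; rewrite nnegrE ?invr_ge0 ?(ltW a0) // | exact: htl (leq_addr _ _)].
 by move: u1 u2 tp; clear => ? ? /andP[? ?]; rewrite ler_norml; lra.
have := hv s sP; move: d1 d2 ctb (a61) (a60); rewrite E8.
have -> : VNf n t (pn n s) - (s^-1/2 - (odd t)%:R/8) = (VNf n t (pn n s) - V0 t s) + (V0 t s - (s^-1/2 - (odd t)%:R/8)) by ring.
rewrite vE; move: (V0 t s - _) (\sum_(i < n) _) (cc s * _) (\sum_(i < t) _) => e z w ps.
have q1 : Cv * s <= Cv*(2 * a) by rewrite ler_wpM2l // ltW.
have q2 : t%:R*(C' * a^+6) <= t%:R*(C' * a) by rewrite ler_wpM2l ?ler0n.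
have q3 : 0 <= Ce * a by rewrite mulr_ge0 // ltW.
have q4 : 0 <= t%:R*(C' * a^+6) by rewrite mulr_ge0 ?ler0n.
have -> : (4 * Ce + 2 * Cv + (48 + 10 * t%:R) * C') * a = 
 4*(Ce * a) + 2*(Cv * a) + 48*(C' * a) + 10*(t%:R*(C' * a)) by ring.
move: q1 q2 q3 q4 T1; rewrite !ler_norml.
rewrite (mulrCA Cv 2); move: (Cv * s) (Cv * a) (Ce * a) (t%:R*(C' * a^+6)) (t%:R*(C' * a)) (C' * a^+6) (C' * a) => ? ? ? ? ? ? ?.
by clear; move=> ? ? ? ? ? /andP[? ?] /andP[? ?] /andP[? ?] ? ? /andP[? ?]; apply/andP; split; lra.
Qed.

End Truncation.

(** * Mean and variance of the conditioned hook count *)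

Section MeanVar.
Variables (R : realType) (t : nat).
Hypothesis t0 : (0 < t)%N.
Local Notation A := (@AA R).
Local Notation asize := (@asize R).
Local Notation dl := ((odd t)%:R : R).
Local Notation c0 := (c0 R t).
Local Notation c1 := (c1 R t).

Lemma ler_norm4 (x y z w : R) : `|x + y + z + w| <= `|x| + `|y| + `|z| + `|w|.
by do 2 (lel (ler_normD _ _); rewrite lerD2r); exact: ler_normD.
Qed.

(** Normalised variables in the spirit of [rv]; what each field stands for is chosen in the lemma
    that uses it. *)
Record mv := Mv { mva : R; mv1 : R; mv2 : R; mv3 : R; mv4 : R }.
Definition Pmv C v := 0 < mva v <= 1 /\ [/\ `|mv1 v| <= C, `|mv2 v| <= C, `|mv3 v| <= C & `|mv4 v| <= C].

Lemma bd_mv C : 0 <= C -> [/\ bd (Pmv C) mva, bd (Pmv C) mv1, bd (Pmv C) mv2, bd (Pmv C) mv3 & bd (Pmv C) mv4].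
move=> C0; split.
- by exists 1 => // v [/andP[h1 h2] _]; rewrite ger0_norm // ltW.
- by exists C => // v [_ []].
- by exists C => // v [_ []].
- by exists C => // v [_ []].
by exists C => // v [_ []].
Qed.

(** Mixing is linear in second moments but not in variances, so variance plus squared mean has to be
    expanded in [s] before the average over the weights is taken. *)
Lemma second_moment (C : R) : 0 <= C -> exists2 D : R, 0 <= D & forall a s e v : R, 0 < a <= 1 -> a <= s <= 2 * a ->
 `|e - (s^-1/2 + c0 + c1 * s)| <= C * a^+2 -> `|v - e^+2 - (s^-1/2 - dl/8)| <= C * a ->
 `|v - (4^-1*(s^+2)^-1 + (c0 + 2^-1) * s^-1 + (c0^+2 + c1 - dl/8))| <= D * a.
move=> C0; pose C2 := C + 2.
have C20 : 0 <= C2 by rewrite /C2; lra.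
have [ba b1 b2 b3 b4] := bd_mv C20.
(* mv1 = s/a, mv2 = a/s, mv3 and mv4 are the two normalised errors *)
pose G w := mv4 w + 2*(mv2 w/2 + c0 * mva w + c1 * mv1 w * mva w^+2) * mv3 w + mva w^+3 * mv3 w^+2
 + 2 * c0 * c1 * mv1 w + c1^+2 * mv1 w^+2 * mva w.
have [D D0 hD] : bd (Pmv C2) G by rewrite /G; bd_tac.
exists D => // a s e v /andP[a0 a1] /andP[s1 s2] he hv.
have s0 : 0 < s by lra.
have an : a != 0 by rewrite gt_eqF.
have sn : s != 0 by rewrite gt_eqF.
pose w := Mv a (s/a) (a/s) ((e - (s^-1/2 + c0 + c1 * s))/a^+2) ((v - e^+2 - (s^-1/2 - dl/8))/a).
have Pw : Pmv C2 w.
 split; first by rewrite a0.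
 split=> /=.
 - rewrite ger0_norm; last by pz; apply: ltW.
 by rewrite ler_pdivrMr // /C2; have := mulr_ge0 C0 (ltW a0); lra.
 - rewrite ger0_norm; last by pz; apply: ltW.
 by rewrite ler_pdivrMr // /C2; have := mulr_ge0 C0 (ltW s0); lra.
 - have a2 : 0 < a^+2 by rewrite exprn_gt0.
 rewrite normrM [`|_^-1|]ger0_norm; last by rewrite invr_ge0 ltW.
 by rewrite ler_pdivrMr // /C2; lra.
 rewrite normrM [`|_^-1|]ger0_norm; last by rewrite invr_ge0 ltW.
 by rewrite ler_pdivrMr // /C2; lra.
have -> : v - (4^-1*(s^+2)^-1 + (c0 + 2^-1) * s^-1 + (c0^+2 + c1 - dl/8)) = a * G w.
 have eE : e = a^+2 * mv3 w + (s^-1/2 + c0 + c1 * s).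
 by rewrite mulrC divfK ?subrK // expf_neq0.
 have vE : v = a * mv4 w + e^+2 + (s^-1/2 - dl/8).
 by rewrite mulrC divfK //; ring.
 rewrite {1}vE eE /G; move: (mv3 w) (mv4 w) => x y /=; move: (c0) (c1) dl => k0 k1 d.
 by fld.
by rewrite normrM (ger0_norm (ltW a0)) mulrC ler_wpM2r ?(ltW a0) // hD.
Qed.

(** What remains of the mixed second moment after subtracting the squared mixed mean. The terms
    [1 / (4 a^2)] cancel, which is why [M (1 / s)] had to be known up to [O(a^2)]; the term with
    [1 / (8 a)] is the reduction of the variance caused by conditioning on the weight. *)
Definition var_main a : R := a^-1/2 + A^-1/8 - dl/8 - A^-1/(8 * a) - A^-1^+2/16.

Lemma combine (C : R) : 0 <= C -> exists2 D : R, 0 <= D & forall a I m Q : R, 0 < a <= 1 ->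
 `|I - (a^-1 + A^-1/4 + kap3 R * a)| <= C * a^+2 ->
 `|m - (I/2 + c0 + c1 * a)| <= C * a^+2 ->
 `|Q - (4^-1*((a^+2)^-1 - 24^-1/A) + (c0 + 2^-1) * I + (c0^+2 + c1 - dl/8))| <= C * a ->
 `|m - (a^-1/2 + A^-1/8 + c0)| <= D * a /\ `|Q - m^+2 - var_main a| <= D * a.
move=> C0; have [ba b1 b2 b3 b4] := bd_mv C0.
pose B := A^-1; pose k := kap3 R.
(* aI w = a * I *)
pose aI w := 1 + B/4 * mva w + k * mva w^+2 + mva w^+3 * mv1 w.
pose G1 w := k/2 + mva w * mv1 w/2 + c1 + mva w * mv2 w.
pose r w := B/4 + k * mva w + mva w^+2 * mv1 w.
pose G w := mv3 w + k/2 + mva w * mv1 w/2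
 - (2 * mv1 w + mva w * k^+2 + mva w^+3 * mv1 w^+2 + B/2 * k + B/2 * mva w * mv1 w + 2 * k * mva w^+2 * mv1 w)/4
 - c1 * r w - 2 * c0 * c1 - c1^+2 * mva w - mv2 w*(aI w + 2 * c0 * mva w + 2 * c1 * mva w^+2) - mva w^+3 * mv2 w^+2.
have [D1 D10 h1] : bd (Pmv C) G1 by rewrite /G1; bd_tac.
have [D2 D20 h2] : bd (Pmv C) G by rewrite /G /aI /r; bd_tac.
exists (D1 + D2); first exact: addr_ge0.
move=> a I m Q a01 hI hm hQ; have /andP[a0 a1] := a01.
have an : a != 0 by rewrite gt_eqF.
have a2 : 0 < a^+2 by rewrite exprn_gt0.
pose w := Mv a ((I - (a^-1 + B/4 + k * a))/a^+2) ((m - (I/2 + c0 + c1 * a))/a^+2)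
 ((Q - (4^-1*((a^+2)^-1 - 24^-1/A) + (c0 + 2^-1) * I + (c0^+2 + c1 - dl/8)))/a) 0.
have Pw : Pmv C w.
 split=> //; split=> /=; last by rewrite normr0.
 - rewrite normrM [`|_^-1|]ger0_norm; last by pz.
 by rewrite ler_pdivrMr.
 - rewrite normrM [`|_^-1|]ger0_norm; last by pz.
 by rewrite ler_pdivrMr.
 rewrite normrM [`|_^-1|]ger0_norm; last by pz.
 by rewrite ler_pdivrMr.
have IE : I = a^+2 * mv1 w + (a^-1 + B/4 + k * a).
 by rewrite mulrC divfK ?subrK // gt_eqF.
have mE : m = a^+2 * mv2 w + (I/2 + c0 + c1 * a).
 by rewrite mulrC divfK ?subrK // gt_eqF.
have QE : Q = a * mv3 w + (4^-1*((a^+2)^-1 - 24^-1 * B) + (c0 + 2^-1) * I + (c0^+2 + c1 - dl/8)).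
 by rewrite mulrC divfK ?subrK.
have e1 : m - (a^-1/2 + B/8 + c0) = a * G1 w.
 rewrite mE IE /G1; move: (mv1 w) (mv2 w) => x y /=; clearbody k; move: (c0) (c1) => k0 k1.
 by field.
have e2 : Q - m^+2 - var_main a = a * G w.
 rewrite QE mE IE /G /r /aI /var_main -/B; move: (mv1 w) (mv2 w) (mv3 w) => x y z /=.
 have kE : k = 3/32 * B^+2 - B/48 by rewrite /k /kap3 /rg -/B; lra.
 rewrite kE; clearbody B; move: (c0) (c1) dl => k0 k1 d.
 by field.
rewrite e1 e2 !normrM (ger0_norm (ltW a0)) ![a * _]mulrC !ler_wpM2r ?(ltW a0) //.
 by lel (h2 w Pw); lra.
by lel (h1 w Pw); lra.
Qed.

Theorem mean_var : exists2 C : R, 0 < C & exists n0, forall n, (n0 <= n)%N -> let a := asize n in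
 [/\ (0 < n)%N, 0 < a <= 1, 0 < sc R n,
 `|Emean (@Nhk R n t) - (a^-1/2 + A^-1/8 + c0)| <= C * a &
 `|Emean (fun D : {set 'I_n} => Nhk R t D^+2) - Emean (@Nhk R n t)^+2 - var_main a| <= C * a].
have [K [C C0 [n1 H]]] := mix_inv R t.
have [Cp Cp0 [a1 /andP[a10 _] Hp]] := product_moments R t0.
have [n2 Hn2] := asize_small a10.
have Cp0' := ltW Cp0.
have [D D0 HD] := second_moment Cp0'.
pose L := K%:R * C; have L0 : 0 <= L by rewrite mulr_ge0 ?ler0n // ltW.
pose C3 := 3 * C*(1 + `|c0| + `|c1| + `|c0 + 2^-1| + `|c0^+2 + c1 - dl/8|) + L*(Cp + D).
have C30 : 0 <= C3 by rewrite /C3 addr_ge0 // ?mulr_ge0 ?addr_ge0 // ?(ltW C0).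
have [B B0 HB] := combine C30.
exists (B + 1); first lra.
exists (maxn n1 n2) => n; rewrite geq_max => /andP[h1 h2] a.
have [n0 a80 S0 [c [[c1' c2] M1 M2 [MI Mid] [N1 N2]]]] := H n h1.
have [_ aa1] := Hn2 n h2.
have a0 : 0 < a := asize_gt0 R n0.
have a01 : 0 < a <= 1 by rewrite a0; move: a80; rewrite -/a; clra.
have a1le : a <= 1 by case/andP: a01.
have aA : a^+2 * n%:R = A := asize_sqr R n0.
rewrite -/a in c2 M1 M2 MI Mid N1 N2; set M := mx K c a in M1 M2 MI Mid.
have aa : 0 < a <= a1 by rewrite a0.
have a20 : 0 <= a^+2 by rewrite sqr_ge0.
have a32 : a^+3 <= a^+2 by rewrite ler_wiXn2l // ltW.
have a21 : a^+2 <= a by rewrite -[leRHS]expr1 ler_wiXn2l // ltW.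
have P1 : `|M (fun s => Eprod s (@Nhk R n t)) - M (fun s => s^-1/2 + c0 + c1 * s)| <= K%:R * C*(Cp * a^+2).
 apply: mx_le => // [|u uK]; first by pz.
 by case: (Hp a (tilt a u) n aa (c2 u uK) aA).
have P2 : `|M (fun s => Eprod s (fun D : {set 'I_n} => Nhk R t D^+2)) -
 M (fun s => 4^-1*(s^+2)^-1 + (c0 + 2^-1) * s^-1 + (c0^+2 + c1 - dl/8))| <= K%:R * C*(D * a).
 apply: mx_le => // [|u uK]; first by pz.
 have [e1 e2] := Hp a (tilt a u) n aa (c2 u uK) aA.
 exact: HD a01 (c2 u uK) e1 e2.
have E1 : M (fun s => s^-1/2 + c0 + c1 * s) = M (fun s => s^-1)/2 + c0 * M (fun=> 1) + c1 * M id.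
 by rewrite /M /mx mulr_suml !mulr_sumr -!big_split; apply: eq_bigr => u _ /=; ring.
have E2 : M (fun s => 4^-1*(s^+2)^-1 + (c0 + 2^-1) * s^-1 + (c0^+2 + c1 - dl/8)) =
 4^-1 * M (fun s => (s^+2)^-1) + (c0 + 2^-1) * M (fun s => s^-1) + (c0^+2 + c1 - dl/8) * M (fun=> 1).
 by rewrite /M /mx !mulr_sumr -!big_split; apply: eq_bigr => u _ /=; ring.
rewrite /mixdef -[\sum_(u < K) _]/(M (fun s => Eprod s (@Nhk R n t))) in N1.
rewrite /mixdef -[\sum_(u < K) _]/(M (fun s => Eprod s (fun D : {set 'I_n} => Nhk R t D^+2))) in N2.
set I := M (fun s => s^-1) in MI E1 E2.
set m := Emean (@Nhk R n t) in N1 *; set Q := Emean (fun D : {set 'I_n} => Nhk R t D^+2) in N2 *.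
have CP k : 0 <= C * a^+k by rewrite mulr_ge0 ?exprn_ge0 // ltW.
have C32 : C * a^+3 <= C * a^+2 by rewrite ler_wpM2l // ltW.
have C21 : C * a^+2 <= C * a by rewrite ler_wpM2l // ltW.
have bnd (x y z : R) : `|y| <= z -> `|x * y| <= `|x| * z by move=> h; rewrite normrM ler_wpM2l.
have C3E : C3 = 3 * C + 3*(C * `|c0|) + 3*(C * `|c1|) + 3*(C * `|c0 + 2^-1|) + 3*(C * `|c0^+2 + c1 - dl/8|) + L * Cp + L * D.
 by rewrite /C3; ring.
have pos (x : R) k : 0 <= C * `|x| * a^+k by rewrite mulr_ge0 ?exprn_ge0 ?(ltW a0) // mulr_ge0 // ltW.
have LC k : 0 <= L * Cp * a^+k by rewrite !mulr_ge0 ?exprn_ge0 // ltW.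
have LD k : 0 <= L * D * a^+k by rewrite !mulr_ge0 ?exprn_ge0 // ltW.
have hm : `|m - (I/2 + c0 + c1 * a)| <= C3 * a^+2.
 have q1 := bnd c0 _ _ M1; have q2 := bnd c1 _ _ Mid.
 have -> : m - (I/2 + c0 + c1 * a) = (m - M (fun s => Eprod s (@Nhk R n t))) + 
 (M (fun s => Eprod s (@Nhk R n t)) - M (fun s => s^-1/2 + c0 + c1 * s)) + c0*(M (fun=> 1) - 1) + c1*(M id - a).
 by rewrite E1; ring.
 have r1 : `|c0| * (C * a^+3) <= C * `|c0| * a^+2 by rewrite mulrCA mulrA -mulrA mulrA ler_wpM2l // mulr_ge0 // ltW.
 have r2 : `|c1| * (C * a^+2) = C * `|c1| * a^+2 by ring.
 rewrite r2 in q2.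
 have -> : C3 * a^+2 = 3*(C * a^+2) + 3*(C * `|c0| * a^+2) + 3*(C * `|c1| * a^+2) +
 3*(C * `|c0 + 2^-1| * a^+2) + 3*(C * `|c0^+2 + c1 - dl/8| * a^+2) + L * Cp * a^+2 + L * D * a^+2 by rewrite C3E; ring.
 have p1 := pos (c0 + 2^-1) 2%N; have p2 := pos (c0^+2 + c1 - dl/8) 2%N.
 have p3 := pos c0 2%N; have p4 := pos c1 2%N; have p5 := LC 2%N; have p6 := LD 2%N; have p7 := CP 2%N.
 have e3 : K%:R * C*(Cp * a^+2) = L * Cp * a^+2 by rewrite /L; ring.
 rewrite e3 in P1.
 lel (ler_norm4 _ _ _ _).
 have := lerD (lerD (lerD N1 P1) q1) q2.
 move: r1 p1 p2 p3 p4 p5 p6 p7 C32; clear; move: (`|_ - _| + `|_ - _| + _ + _) => z; lra.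
have hQ : `|Q - (4^-1*((a^+2)^-1 - 24^-1/A) + (c0 + 2^-1) * I + (c0^+2 + c1 - dl/8))| <= C3 * a.
 have q1 := bnd (c0^+2 + c1 - dl/8) _ _ M1; have q2 := bnd 4^-1 _ _ M2.
 have -> : Q - (4^-1*((a^+2)^-1 - 24^-1/A) + (c0 + 2^-1) * I + (c0^+2 + c1 - dl/8)) =
 (Q - M (fun s => Eprod s (fun D : {set 'I_n} => Nhk R t D^+2))) + 
 (M (fun s => Eprod s (fun D : {set 'I_n} => Nhk R t D^+2)) -
 M (fun s => 4^-1*(s^+2)^-1 + (c0 + 2^-1) * s^-1 + (c0^+2 + c1 - dl/8))) +
 (c0^+2 + c1 - dl/8) * (M (fun=> 1) - 1) + 4^-1*(M (fun s => (s^+2)^-1) - ((a^+2)^-1 - 24^-1/A)).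
 by rewrite E2; ring.
 set kk := c0^+2 + c1 - dl/8 in q1 *.
 have r1 : `|kk| * (C * a^+3) <= C * `|kk| * a.
 have : C * `|kk| * a^+3 <= C * `|kk| * a by rewrite ler_wpM2l ?(le_trans a32) // mulr_ge0 // ltW.
 lra.
 have q3 : `|4^-1 : R| = 4^-1 by rewrite ger0_norm.
 rewrite q3 in q2.
 have -> : C3 * a = 3*(C * a) + 3*(C * `|c0| * a) + 3*(C * `|c1| * a) +
 3*(C * `|c0 + 2^-1| * a) + 3*(C * `|kk| * a) + L * Cp * a + L * D * a by rewrite C3E; ring.
 have p1 := pos (c0 + 2^-1) 1%N; have p2 := pos kk 1%N.
 have p3 := pos c0 1%N; have p4 := pos c1 1%N; have p5 := LC 1%N; have p6 := LD 1%N; have p7 := CP 1%N.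
 rewrite !expr1 in p1 p2 p3 p4 p5 p6 p7.
 have e3 : K%:R * C*(D * a) = L * D * a by rewrite /L; ring.
 rewrite e3 in P2.
 lel (ler_norm4 _ _ _ _).
 have := lerD (lerD (lerD N2 P2) q1) q2.
 move: r1 p1 p2 p3 p4 p5 p6 p7 C32 C21; clear; move: (`|_ - _| + `|_ - _| + _ + _) => z; lra.
have hI : `|I - (a^-1 + A^-1/4 + kap3 R * a)| <= C3 * a^+2.
 lel MI; apply: ler_wpM2r => //; rewrite C3E.
 have := pos (c0 + 2^-1) 0%N; have := pos (c0^+2 + c1 - dl/8) 0%N.
 have := pos c0 0%N; have := pos c1 0%N; have := LC 0%N; have := LD 0%N; rewrite !expr0 !mulr1.
 by move: C0; clra.
have [r1 r2] := HB a I m Q a01 hI hm hQ.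
have Ba : B * a <= (B + 1) * a by rewrite ler_wpM2r ?(ltW a0) //; lra.
by split=> //; [exact: le_trans r1 Ba | exact: le_trans r2 Ba].
Qed.

End MeanVar.

Lemma ln_taylor2 (R : realType) (w : R) : 0 <= w -> `|ln (1 + w) - w + w^+2/2| <= w^+3.
move=> w0; have w1 : 0 < 1 + w by lra.
pose v := ln (1 + w).
have v0 : 0 <= v by rewrite ln_ge0 //; lra.
have wE : w = expR v - 1 by rewrite lnK ?posrE // addrC addKr.
rewrite -/v wE.
have de (x : R) : is_derive x 1 expR (expR x) := is_derive_expR x.
pose f (x : R) : R := (expR x - 1)^+3 - (x - (expR x - 1) + (expR x - 1)^+2/2).
pose g (x : R) : R := (expR x - 1)^+3 + (x - (expR x - 1) + (expR x - 1)^+2/2).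
have hf (x : R) : is_derive x 1 f (3*(expR x - 1)^+2 * expR x - (expR x - 1)^+2).
 by rewrite /f; is_der; field.
have hg (x : R) : is_derive x 1 g (3*(expR x - 1)^+2 * expR x + (expR x - 1)^+2).
 by rewrite /g; is_der; field.
have ge1 x : 0 <= x -> 1 <= expR x by move=> x0; rewrite -expR0 ler_expR.
have := @le_of_derive _ f _ 0 v v0 hf; have := @le_of_derive _ g _ 0 v v0 hg.
rewrite /f /g expR0 !subrr !expr0n /= !mul0r !(subr0, addr0) => h1 h2.
have {}h1 : 0 <= (expR v - 1)^+3 + (v - (expR v - 1) + (expR v - 1)^+2/2).
 apply: h1 => x /andP[/ge1 x1 _]; have := sqr_ge0 (expR x - 1); move: (_^+2) => q q0; nra.
have {}h2 : 0 <= (expR v - 1)^+3 - (v - (expR v - 1) + (expR v - 1)^+2/2).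
 apply: h2 => x /andP[/ge1 x1 _]; have := sqr_ge0 (expR x - 1); move: (_^+2) => q q0; nra.
rewrite ler_norml; lra.
Qed.

(** * Generating function of the hooks under a product measure *)

Section Tilt.
Variables (R : realType) (n : nat) (s : R) (t : nat) (z : R).
Hypothesis t0 : (0 < t)%N.
Hypothesis z0 : 0 <= z.
Implicit Types (i k m : nat) (F G : {set 'I_n} -> R) (D J : {set 'I_n}).
Local Notation E F := (@Eprod R n s F).
Local Notation W := (1 + z).

Definition bb i D : R := (bit D i)%:R.
Definition Xb i D : R := (~~ bit D i && bit D (i + t))%:R.

Lemma pprob_ge0 D : 0 <= pprob s D.
apply: prodr_ge0 => i _; case: ifP => _; [exact: ltW (bp_gt0 _ _) | exact: ltW (one_bp_gt0 _ _)].
Qed.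

Lemma le_Eprod F G : (forall D, F D <= G D) -> E F <= E G.
Proof. by move=> h; lsum D; rewrite ler_wpM2r ?pprob_ge0. Qed.

Lemma Eprod1 : E (fun=> 1) = 1.
rewrite /Eprod; under eq_bigr => D _ do rewrite mul1r.
have e := @Eallb R n s [::] isT; rewrite big_nil in e.
by rewrite -e /Eprod; bigr D; rewrite /allb mul1r.
Qed.

Definition indep i F := forall D D', (forall k, k <> i -> bit D k = bit D' k) -> F D = F D'.

Lemma Eprod_bit i F : indep i F -> E (fun D => bb i D * F D) = pn n s i * E F.
move=> ind; rewrite /pn; case: ltnP => iN; last first.
 rewrite mul0r /Eprod big1 // => D _; rewrite /bb; case: (boolP (bit D i)) => [/bit_lt|]; first by rewrite ltnNge iN.
 by rewrite !mul0r.
pose o := Ordinal iN.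
pose r D := \prod_(j < n | j != o) (if j \in D then bp s j else 1 - bp s j).
have bo D : bb i D = (o \in D)%:R by rewrite /bb -(bitE D o).
have rU D : r (o |: D) = r D.
 by apply: eq_bigr => j jo; rewrite !inE (negbTE jo).
have pU D : pprob s (o |: D) = bp s i * r D.
 by rewrite /pprob (bigD1 o) //= setU11 -rU.
have pD D : o \notin D -> pprob s D = (1 - bp s i) * r D.
 by move=> oD; rewrite /pprob (bigD1 o) //= (negbTE oD).
have FU D : o \notin D -> F (o |: D) = F D.
 move=> oD; apply: ind => k ki; case: (ltnP k n) => kn; last first.
 by apply/idP/idP => /bit_lt; rewrite ltnNge kn.
 rewrite (bitE _ (Ordinal kn)) (bitE D (Ordinal kn)) !inE; case: eqP => // e.
 by case: ki; move/(congr1 val): e.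
have split_o (G : {set 'I_n} -> R) : \sum_(D : {set 'I_n}) G D = \sum_(D : {set 'I_n} | o \notin D) (G (o |: D) + G D).
 rewrite (bigID (fun D => o \in D)) /= big_split /=; congr (_ + _).
 rewrite (reindex_onto (fun D => o |: D) (fun D => D :\ o)) /=; last by move=> D oD; rewrite finset.setD1K.
 apply: eq_bigl => D; rewrite setU11 /=; apply/eqP/idP => [<-|oD]; first by rewrite setD11.
 by rewrite finset.setU1K.
rewrite /Eprod !split_o mulr_sumr; apply: eq_bigr => D oD.
by rewrite !bo setU11 (negbTE oD) pU pD // FU //=; ring.
Qed.

Lemma indep_bb i k : i <> k -> indep i (bb k).
Proof. by move=> ik D D' h; rewrite /bb h //; exact/nesym. Qed.

Lemma indepM i F G : indep i F -> indep i G -> indep i (fun D => F D * G D).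
Proof. by move=> hF hG D D' h; rewrite (hF _ _ h) (hG _ _ h). Qed.

Lemma Xb_bb i D : Xb i D = bb (i + t) D - bb i D * bb (i + t) D.
Proof. by rewrite /Xb /bb; case: (bit D i); case: (bit D (i + t)) => /=; ring. Qed.

Lemma Eprod_Xb i F : indep i F -> indep (i + t) F -> E (fun D => Xb i D * F D) = piF t (pn n s) i * E F.
move=> h1 h2.
have it : i <> (i + t)%N by move: t0; clear; lia.
rewrite (eq_Eprod s (G := fun D => bb (i + t) D * F D + - (bb i D*(bb (i + t) D * F D)))); last first.
 by move=> D; rewrite Xb_bb; ring.
rewrite EprodD EprodN Eprod_bit // Eprod_bit; last by apply: indepM => //; exact: indep_bb.
by rewrite Eprod_bit // /piF; ring.
Qed.

(** For [z = exp u - 1] each factor is [exp (u Xb)], as [Xb] is 0 or 1; the product is then the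
    exponential of [u] times the number of [k] in [Q] with [Xb k D = 1]. *)
Definition fQ (Q : pred nat) D : R := \prod_(k < n | Q k) (1 + z * Xb k D).

Lemma Xb01 k D : 0 <= Xb k D <= 1.
Proof. by rewrite /Xb; case: (~~ _ && _) => /=; rewrite ?lexx ?ler01. Qed.

Lemma factor_ge1 k D : 1 <= 1 + z * Xb k D.
Proof. by rewrite lerDl mulr_ge0; case/andP: (Xb01 k D). Qed.

Lemma factor_leW k D : 1 + z * Xb k D <= W.
Proof. by rewrite lerD2l ler_piMr; case/andP: (Xb01 k D). Qed.

Lemma fQ_ge1 Q D : 1 <= fQ Q D.
by rewrite /fQ; elim/big_ind: _ => // [x y x1 y1|i _]; [rewrite -[leLHS]mulr1 ler_pM | exact: factor_ge1].
Qed.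

Lemma fQ_sub (Q Q' : pred nat) D : (forall k, Q k -> Q' k) -> fQ Q D <= fQ Q' D.
move=> sub; rewrite /fQ big_mkcond [leRHS]big_mkcond /=; apply: ler_prod => i _.
case: ifP => [/sub ->|_]; first by rewrite lexx (le_trans ler01 (factor_ge1 _ _)).
by rewrite ler01 /=; case: ifP => _; rewrite ?factor_ge1.
Qed.

Lemma EfQ_ge1 Q : 1 <= E (fQ Q).
Proof. by rewrite -Eprod1; apply: le_Eprod => D; exact: fQ_ge1. Qed.

Lemma EfQ_sub (Q Q' : pred nat) : (forall k, Q k -> Q' k) -> E (fQ Q) <= E (fQ Q').
Proof. by move=> sub; apply: le_Eprod => D; exact: fQ_sub. Qed.

Lemma fQ_rem Q i D : fQ Q D <= W * fQ (fun k => Q k && (k != i)) D.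
case: (ltnP i n) => iN; last first.
 have -> : fQ (fun k => Q k && (k != i)) D = fQ Q D.
 apply: eq_bigl => k; case: eqP => [e|_]; last by rewrite andbT.
 by move: (ltn_ord k); rewrite e ltnNge iN.
 by rewrite ler_peMl ?lerDl // (le_trans ler01) // fQ_ge1.
have f0 Q' : 0 <= fQ Q' D by apply: le_trans ler01 (fQ_ge1 _ _).
case: (boolP (Q i)) => Qi; last first.
 have -> : fQ (fun k => Q k && (k != i)) D = fQ Q D.
 by apply: eq_bigl => k; case: eqP => [->|_]; rewrite ?andbT // (negbTE Qi).
 by rewrite ler_peMl ?lerDl.
rewrite {1}/fQ (bigD1 (Ordinal iN)) //= ler_wpM2r ?factor_leW //.
by apply: prodr_ge0 => k _; exact: le_trans ler01 (factor_ge1 _ _).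
Qed.

Lemma EfQ_rem Q i : E (fQ Q) <= W * E (fQ (fun k => Q k && (k != i))).
Proof. by rewrite -EprodZ; apply: le_Eprod => D; exact: fQ_rem. Qed.

Lemma indep_Xb i k : i <> k -> i <> (k + t)%N -> indep i (Xb k).
Proof. by move=> ik ikt D D' h; rewrite /Xb !h //; exact/nesym. Qed.

Lemma indep_fQ (Q : pred nat) i : (forall k, Q k -> k <> i /\ (k + t)%N <> i) -> indep i (fQ Q).
move=> hQ D D' h; apply: eq_bigr => k Qk; have [k1 k2] := hQ k Qk.
by rewrite (indep_Xb _ _ h) //; exact/nesym.
Qed.

(** When [Xb i] is 1, site [i] is empty and site [i + t] occupied, so the indicators at [i - t] and
    [i + t] vanish. Without them, and without index [i] itself, the product no longer reads these
    two sites, which gives [peel]. *)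
Definition strip (Q : pred nat) i : pred nat := fun k => [&& Q k, k != (i + t)%N & (k + t)%N != i].

Lemma fQ_strip Q i D : Xb i D * fQ Q D = Xb i D * fQ (strip Q i) D.
rewrite {1 2}/Xb; case: (boolP (bit D i)) => bi; first by rewrite !mul0r.
case: (boolP (bit D (i + t))) => bt; last by rewrite !mul0r.
rewrite /= !mul1r /fQ big_mkcond [RHS]big_mkcond /=; bigr k.
rewrite /strip; case: (Q k) => //=.
case: eqP => [->|_] /=; first by rewrite /Xb bt mulr0 addr0.
by case: eqP => [e|_] //=; rewrite /Xb e (negbTE bi) andbF mulr0 addr0.
Qed.

Lemma peel Q i : ~~ Q i -> E (fun D => Xb i D * fQ Q D) = piF t (pn n s) i * E (fQ (strip Q i)).
move=> Qi; rewrite (eq_Eprod s (fQ_strip Q i)); apply: Eprod_Xb; apply: indep_fQ => k /and3P[Qk k1 k2].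
 by split; [move=> e; rewrite -e Qk in Qi | exact/eqP].
split; first exact/eqP.
by move/addIn => e; rewrite -e Qk in Qi.
Qed.

Lemma pn01' i : 0 <= pn n s i <= 1.
rewrite /pn; case: ltnP => _; last by rewrite lexx ler01.
by rewrite (ltW (bp_gt0 _ _)); have := one_bp_gt0 s i; lra.
Qed.

Lemma pi_01 i : 0 <= piF t (pn n s) i <= 1.
have /andP[u1 u2] := pn01' i; have /andP[v1 v2] := pn01' (i + t); rewrite /piF.
by apply/andP; split; [apply: mulr_ge0; lra | rewrite -[leRHS]mulr1; apply: ler_pM; lra].
Qed.

Definition MM m : R := E (fQ (fun k => (k < m)%N)).

(** Peeling the last factor gives [MM m.+1 = MM m + z pi_m U], where [U] misses the factor [m - t]
    if there is one; peeling that factor gives [MM m = U + z pi_(m-t) V]. The growth ratio is thus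
    explicit up to [th = V / U], and [V <= U <= (1 + z) V] because the two differ by at most one
    factor. *)
Lemma MM_step m : (m < n)%N -> exists2 th : R, W^-1 <= th <= 1 &
 MM m.+1 = MM m*(1 + z * piF t (pn n s) m/(1 + z*(if (t <= m)%N then piF t (pn n s) (m - t) else 0) * th)).
move=> mn; have W1 : 1 <= W by rewrite lerDl.
pose Q := fun k => (k < m)%N.
have Qm : ~~ Q m by rewrite /Q ltnn.
have e1 : MM m.+1 = MM m + z*(piF t (pn n s) m * E (fQ (strip Q m))).
 rewrite -peel // -EprodZ -EprodD; apply: eq_Eprod => D.
 rewrite /fQ (bigD1 (Ordinal mn)) //= mulrDl mul1r.
 have -> : \prod_(i < n | (i < m.+1)%N && (i != Ordinal mn)) (1 + z * Xb i D) = \prod_(k < n | (k < m)%N) (1 + z * Xb k D).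
 by apply: eq_bigl => k; rewrite ltnS -(inj_eq val_inj) ltn_neqAle andbC.
 by ring.
have [tm|tm] := leqP t m; last first.
 exists 1; first by rewrite lexx andbT invf_le1 // (lt_le_trans ltr01).
 rewrite mulr0 mul0r addr0 divr1 e1; have -> : E (fQ (strip Q m)) = MM m.
 apply: eq_Eprod => D; apply: eq_bigl => k; rewrite /strip /Q.
 by case: (ltnP k m) => km; move: km tm; clear; lia.
 by ring.
pose i := (m - t)%N.
pose U := E (fQ (strip Q m)).
have U1 : 1 <= U := EfQ_ge1 _.
have U0 : 0 < U by apply: lt_le_trans U1.
have iN : (i < n)%N by apply: leq_ltn_trans mn; rewrite leq_subr.
have Si : ~~ strip Q m i by rewrite /strip /i subnK // eqxx !andbF.
pose V := E (fQ (strip (strip Q m) i)).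
have e2 : MM m = U + z*(piF t (pn n s) i * V).
 rewrite -peel // -EprodZ -EprodD; apply: eq_Eprod => D.
 have im : (i < m)%N by rewrite /i; move: t0 tm; clear; lia.
 rewrite /fQ (bigD1 (Ordinal iN)) //= mulrDl mul1r.
 have -> : \prod_(k < n | (k < m)%N && (k != Ordinal iN)) (1 + z * Xb k D) = \prod_(k < n | strip Q m k) (1 + z * Xb k D).
 apply: eq_bigl => k; rewrite /strip /Q -(inj_eq val_inj) /=; case: (ltnP k m) => //= km.
 by rewrite /i; move: km tm; clear; lia.
 by ring.
have VU : V <= U by apply: EfQ_sub => k /and3P[].
have UV : U <= W * V.
 lel (EfQ_rem _ (i - t)); apply: ler_wpM2l; first exact: le_trans ler01 W1.
 apply: EfQ_sub => k /andP[/and3P[Qk k1 k2] k3]; rewrite /strip Qk k1 k2 /=.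
 by apply/andP; split; move: Qk k1 k2 k3; rewrite /Q /i; move: t0 tm; clear; lia.
have W0 : 0 < W by apply: lt_le_trans W1.
exists (V/U).
 by rewrite ler_pdivlMr // ler_pdivrMr // mul1r VU andbT mulrC ler_pdivrMr // mulrC.
have /andP[p0 _] := pi_01 i.
have V0 : 0 <= V by apply: le_trans ler01 (EfQ_ge1 _).
rewrite e1 -/U e2; have den : U + z*(piF t (pn n s) i * V) != 0.
 by rewrite gt_eqF //; apply: ltr_pwDl => //; apply: mulr_ge0 => //; exact: mulr_ge0.
rewrite -/i; field; rewrite gt_eqF //=.
have -> : U + z * piF t (pn n s) i * V = U + z*(piF t (pn n s) i * V) by ring.
by [].
Qed.

Lemma MM0 : MM 0 = 1.
Proof. by rewrite -Eprod1; apply: eq_Eprod => D; rewrite /fQ big_pred0. Qed.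

Definition pim m : R := if (t <= m)%N then piF t (pn n s) (m - t) else 0.

Lemma pim01 m : 0 <= pim m <= 1.
Proof. by rewrite /pim; case: ifP => _; rewrite ?pi_01 // lexx ler01. Qed.

(** The logarithms of the successive ratios are expanded to second order in [z]; the cubic error
    keeps a factor [piF], so that it can be summed over all sites. *)
Lemma ln_MM m : z <= 1 -> (m <= n)%N ->
 `|ln (MM m) - \sum_(i < m) (z * piF t (pn n s) i - z^+2*(piF t (pn n s) i^+2/2 + piF t (pn n s) i * pim i))|
 <= 4 * z^+3*\sum_(i < m) piF t (pn n s) i.
move=> z1; elim: m => [|m IH] mn; first by rewrite MM0 ln1 !big_ord0 subrr normr0 mulr0.
have [th /andP[th0 th1] ->] := MM_step mn; rewrite -/(pim m).
have /andP[p0 p1] := pi_01 m; have /andP[q0 q1] := pim01 m.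
have W0 : 0 < W by have := z0; lra.
have thp : 0 < th by apply: lt_le_trans th0; rewrite invr_gt0.
have th2 : 1 - z <= th.
 apply: le_trans th0; rewrite -[W^-1]mul1r ler_pdivlMr //.
 by have := sqr_ge0 z; rewrite expr2; lra.
have MM1 : 1 <= MM m := EfQ_ge1 _.
set p := piF t (pn n s) m in p0 p1 *; set q := pim m in q0 q1 *.
pose x := z * q * th.
have x0 : 0 <= x by rewrite !mulr_ge0 // ltW.
have xz : x <= z by rewrite /x -mulrA ler_piMr // -[leRHS]mulr1; apply: ler_pM => //; exact: ltW.
pose w := z * p/(1 + x).
have zp : 0 <= z * p by rewrite mulr_ge0.
have d0 : 0 < 1 + x by lra.
have w0 : 0 <= w by rewrite divr_ge0 // ltW.
have wz : w <= z * p by rewrite ler_pdivrMr // ler_peMr //; lra.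
rewrite lnM ?posrE; [|lra|by rewrite -/x -/w; lra].
rewrite !big_ord_recr /= -/p -/q -/x -/w.
have hl := ln_taylor2 w0.
have z3p : 0 <= z^+3 * p by rewrite mulr_ge0 // exprn_ge0.
have w3 : w^+3 <= z^+3 * p.
 have h3 : w^+3 <= (z * p)^+3 by apply: lerXn2r; rewrite ?nnegrE.
 lel h3; rewrite exprMn ler_wpM2l ?exprn_ge0 // exprS ler_piMr // exprn_ile1 //.
have wd : `|w - (z * p - z^+2*(p * q))| <= 2*(z^+3 * p).
 have -> : w - (z * p - z^+2*(p * q)) = z * p*(z * q*(1 - th) + x^+2/(1 + x)).
 by rewrite /w /x; field; rewrite -/x gt_eqF.
 rewrite normrM (ger0_norm zp).
 have -> : 2*(z^+3 * p) = z * p*(z * z + z * z) by ring.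
 apply: ler_wpM2l => //; rewrite ger0_norm; last first.
 by apply: addr_ge0; [rewrite !mulr_ge0 //; lra | rewrite divr_ge0 ?sqr_ge0 // ltW].
 apply: lerD.
 apply: ler_pM; rewrite ?mulr_ge0 //; try lra.
 by rewrite ler_piMr.
 rewrite ler_pdivrMr //; via (z * z).
 by rewrite expr2; apply: ler_pM.
 by rewrite ler_peMr ?mulr_ge0 //; lra.
have w2 : `|w^+2 - z^+2 * p^+2| <= 2*(z^+3 * p).
 have -> : w^+2 - z^+2 * p^+2 = - ((z * p - w) * (z * p + w)) by ring.
 rewrite normrN normrM ger0_norm ?subr_ge0 // ger0_norm ?addr_ge0 //.
 have hd : z * p - w <= z * p * z.
 have -> : z * p - w = z * p*(x/(1 + x)) by rewrite /w; fld.
 apply: ler_wpM2l => //; rewrite ler_pdivrMr //; lel xz.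
 by rewrite ler_peMr //; lra.
 have -> : 2*(z^+3 * p) = z * p * z*(z + z) by ring.
 apply: ler_pM; rewrite ?subr_ge0 ?addr_ge0 //; apply: lerD => //; last first.
 by lel wz; rewrite ler_piMr.
 by rewrite ler_piMr.
have := IH (ltnW mn).
move: hl wd w2 w3; rewrite !ler_norml.
move: (ln (MM m)) (ln (1 + w)) (\sum_(_ < m) _) (\sum_(_ < m) _) (w^+3) (w^+2) => l1 l2 s1 s2 v3 v2.
rewrite mulrDr -(mulrA 4 (z^+3) p); move: (z^+3 * p) z3p (4 * z^+3 * s2) => z3 z3p zs.
have -> : z^+2*(p^+2/2 + p * q) = z^+2 * p^+2/2 + z^+2*(p * q) by ring.
move: (z^+2 * p^+2) (z^+2*(p * q)) (z * p) => zz zq zp'; clear.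
lra.
Qed.

End Tilt.

(** * Expansion over sets of hooks *)

Section TiltSums.
Variables (R : realType) (n : nat) (s : R) (t : nat) (z : R).
Hypothesis t0 : (0 < t)%N.
Hypothesis z0 : 0 <= z.
Implicit Types (i k l : 'I_n) (D J B : {set 'I_n}).
Local Notation E F := (@Eprod R n s F).
Local Notation W := (1 + z).
Local Notation X := (@Xb R n t).
Local Notation p_ i := (piF t (pn n s) i).
Local Notation f_ := (@fQ R n t z).
Local Notation M := (E (f_ xpredT)).

Definition XJ J D : R := \prod_(i in J) X i D.
(** For [z >= 0] these numbers are nonnegative with sum [M], so dividing by [M] gives a probability
    on sets of hooks, against which errors are averaged by first and second moments. This positivity
    is what ties the method to [l >= 0]. *)
Definition qJ J : R := z^+#|J| * E (XJ J).

Lemma sum_sup B D (Q : pred nat) : (forall k, Q k = (k \notin B)) ->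
 \sum_(J : {set 'I_n} | B \subset J) z^+#|J| * XJ J D = \prod_(k in B) (z * X k D) * f_ Q D.
move=> hQ; pose G k : R := (k \notin B)%:R.
transitivity (\prod_(k < n) (z * X k D + G k)).
 rewrite bigA_distr big_mkcond /=; bigr J.
 case: (boolP (B \subset J)) => [/fintype.subsetP BJ|].
 rewrite /XJ -prodr_const -big_split big_mkcond /=; bigr k.
 by case: (boolP (k \in J)) => // kJ; rewrite /G; case: (boolP (k \in B)) => [/BJ|//]; rewrite (negbTE kJ).
 by move/fintype.subsetPn => [k kB kJ]; rewrite (bigD1 k) //= (negbTE kJ) /G kB mul0r.
rewrite (bigID (mem B)) /= /fQ; congr (_ * _).
 by apply: eq_bigr => k kB; rewrite /G kB addr0.
rewrite [RHS](eq_bigl (fun k => k \notin B)); last by move=> k; rewrite hQ.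
by apply: eq_bigr => k kB; rewrite /G kB addrC.
Qed.

Lemma sum_qJ_sup B : \sum_(J : {set 'I_n} | B \subset J) qJ J =
 E (fun D => \sum_(J : {set 'I_n} | B \subset J) z^+#|J| * XJ J D).
rewrite /Eprod; under [RHS]eq_bigr => D _ do rewrite mulr_suml.
rewrite [RHS]exchange_big /=; bigr J; rewrite /qJ /Eprod mulr_sumr.
by bigr D; rewrite mulrA.
Qed.

Lemma sum_qJ : \sum_(J : {set 'I_n}) qJ J = M.
rewrite (eq_bigl (fun J => finset.set0 \subset J)) ?sum_qJ_sup; last by move=> J; rewrite finset.sub0set.
apply: eq_Eprod => D; rewrite (sum_sup _ (Q := xpredT)) ?big_set0 ?mul1r // => k; by rewrite inE.
Qed.

Lemma fQ_sumJ D : f_ xpredT D = \sum_(J : {set 'I_n}) z^+#|J| * XJ J D.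
rewrite [RHS](eq_bigl (fun J => finset.set0 \subset J)); last by move=> J; rewrite finset.sub0set.
rewrite (sum_sup _ (Q := xpredT)) ?big_set0 ?mul1r // => k; by rewrite inE.
Qed.

Lemma XJ_ge0 J D : 0 <= XJ J D.
Proof. by apply: prodr_ge0 => i _; case/andP: (@Xb01 R n t i D). Qed.

Lemma qJ_ge0 J : 0 <= qJ J.
rewrite mulr_ge0 ?exprn_ge0 //; apply: sumr_ge0 => D _; by rewrite mulr_ge0 ?XJ_ge0 ?pprob_ge0.
Qed.

Lemma M_ge1 : 1 <= M. Proof. exact: EfQ_ge1. Qed.
Lemma M_ge0 : 0 <= M. Proof. by apply: le_trans M_ge1. Qed.

Lemma p_01 i : 0 <= p_ i <= 1. Proof. exact: pi_01. Qed.

(** Forcing a hook at [i] removes the factors [i], [i - t] and [i + t] at most, so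
    [M <= (1 + z)^3 U], and [(1 - 3 z) (1 + z)^3 <= 1]. *)
Lemma sum1_qJ i : exists2 U, (1 - 3 * z) * M <= U <= M &
 \sum_(J : {set 'I_n} | i \in J) qJ J = z * p_ i * U.
pose Q : pred nat := fun k : nat => k != i.
exists (E (f_ (strip t Q i))); last first.
 rewrite (eq_bigl (fun J => [set i] \subset J)) ?sum_qJ_sup; last by move=> J; rewrite finset.sub1set.
 rewrite -mulrA -(@peel R n s t z t0 Q i) ?/Q ?eqxx // -EprodZ; apply: eq_Eprod => D.
 rewrite (sum_sup _ (Q := Q)) ?big_set1 ?mulrA // => k; by rewrite inE /Q.
apply/andP; split; last by apply: EfQ_sub.
set U := E (f_ (strip t Q i)).
have U1 : 1 <= U by exact: EfQ_ge1.
have h : M <= W*(W*(W * U)).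
 lel (EfQ_rem n s t z0 _ i); apply: ler_wpM2l; first by pz.
 lel (EfQ_rem n s t z0 _ (i + t)); apply: ler_wpM2l; first by pz.
 lel (EfQ_rem n s t z0 _ (i - t)); apply: ler_wpM2l; first by pz.
 apply: EfQ_sub => [//|k /andP[/andP[/andP[_ k1] k2] k3]].
 by rewrite /strip /Q k1 k2; move: k1 k2 k3 t0; clear; lia.
have M1 := M_ge1.
have [z3|z3] := lerP (1 - 3 * z) 0.
 by apply: le_trans (_ : 0 <= _); [rewrite mulr_le0_ge0 // (le_trans ler01) | exact: le_trans ler01 U1].
via ((1 - 3 * z) * (W*(W*(W * U)))); first by pz.
have -> : (1 - 3 * z) * (W*(W*(W * U))) = U - (6 * z^+2 + 8 * z^+3 + 3 * z^+4) * U by ring.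
rewrite gerBl mulr_ge0 //; last exact: le_trans ler01 U1.
by rewrite !addr_ge0 // mulr_ge0 // exprn_ge0.
Qed.

(** Indicators at distance [t] exclude each other and contribute 0; any other two are peeled off one
    after the other. *)
Lemma sum2_qJ i k : i != k ->
 \sum_(J : {set 'I_n} | (i \in J) && (k \in J)) qJ J <= z^+2*(p_ i * p_ k) * M.
move=> ik; pose Q : pred nat := fun l : nat => (l != i) && (l != k).
have ikn : (i != k :> nat) by [].
rewrite (eq_bigl (fun J => [set i; k] \subset J)) ?sum_qJ_sup; last by move=> J; rewrite finset.subUset !finset.sub1set.
rewrite (eq_Eprod s (G := fun D => z^+2*(X i D*(X k D * f_ Q D)))); last first.
 move=> D; rewrite (sum_sup _ (Q := Q)); last by move=> l; rewrite !inE negb_or.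
 rewrite big_setU1 ?inE //= big_set1; ring.
rewrite EprodZ -mulrA ler_wpM2l ?exprn_ge0 //.
have /andP[pi0 _] := p_01 i; have /andP[pk0 _] := p_01 k.
have hz (F : {set 'I_n} -> R) : (forall D, X i D * X k D = 0) -> E (fun D => X i D*(X k D * F D)) <= p_ i * p_ k * M.
 move=> h; rewrite (eq_Eprod s (G := fun D => 0*1)); last by move=> D; rewrite mulrA h !mul0r.
 rewrite EprodZ mul0r; apply: mulr_ge0 M_ge0; exact: mulr_ge0.
have [e|ne] := eqVneq (k : nat) (i + t)%N.
 by apply: hz => D; rewrite /Xb e; case: (bit D i); case: (bit D (i + t)); rewrite ?mulr0 ?mul0r.
have [e|ne'] := eqVneq (i : nat) (k + t)%N.
 by apply: hz => D; rewrite /Xb e; case: (bit D k); case: (bit D (k + t)); rewrite ?mulr0 ?mul0r.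
rewrite (eq_Eprod s (G := fun D => X i D*(X k D * f_ (strip t Q i) D))); last first.
 by move=> D; rewrite [LHS]mulrCA [X i D * f_ Q D]fQ_strip mulrCA.
have nQ : forall l : nat, strip t Q i l -> [/\ l <> i, (l + t)%N <> i, l <> (i + t)%N & (l + t)%N <> (i + t)%N].
 move=> l /and3P[/andP[/eqP l1 _] /eqP l2 /eqP l3]; split => //; move: l1; clear; lia.
rewrite Eprod_Xb //.
- rewrite peel //; last by rewrite /strip /Q eqxx andbF.
 by rewrite -[leRHS]mulrA ler_wpM2l // ler_wpM2l //; apply: EfQ_sub.
- apply: indepM; first by apply: indep_Xb; move: ikn ne'; clear; lia.
 by apply: indep_fQ => l /nQ[].
- apply: indepM; first by apply: indep_Xb; move: ikn ne t0; clear; lia.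
 by apply: indep_fQ => l /nQ[].
Qed.

Section Moments.
Variable c : 'I_n -> R.
Hypothesis c0 : forall i, 0 <= c i.
Let S := \sum_i c i * p_ i.

Let exch (g : 'I_n -> {set 'I_n} -> R) :
 \sum_(J : {set 'I_n}) qJ J*(\sum_(i in J) g i J) = \sum_i \sum_(J : {set 'I_n} | i \in J) qJ J * g i J.
rewrite (eq_bigr (fun J => \sum_(i in J) qJ J * g i J)); last by move=> J _; rewrite mulr_sumr.
by rewrite (exchange_big_dep xpredT).
Qed.

Lemma mean_qJ : (1 - 3 * z) * (z * S * M) <= \sum_(J : {set 'I_n}) qJ J*(\sum_(i in J) c i) <= z * S * M.
rewrite (exch (fun i _ => c i)).
have -> : \sum_i \sum_(J : {set 'I_n} | i \in J) qJ J * c i = \sum_i c i*(\sum_(J : {set 'I_n} | i \in J) qJ J).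
 by bigr i; rewrite mulr_sumr; bigr J; rewrite mulrC.
rewrite /S.
have -> : z*(\sum_i c i * p_ i) * M = \sum_i c i*(z * p_ i * M).
 by rewrite mulr_sumr mulr_suml; bigr i; ring.
rewrite mulr_sumr; apply/andP; split; lsum i; have [U /andP[U1 U2] ->] := sum1_qJ i.
 rewrite mulrCA ler_wpM2l // mulrCA ler_wpM2l // mulr_ge0; by case/andP: (p_01 i).
by rewrite ler_wpM2l // ler_wpM2l // mulr_ge0; case/andP: (p_01 i).
Qed.

(** The hooks are almost uncorrelated from above by [sum2_qJ]. The cross term needs the lower bound
    of [mean_qJ], whose loss [3 z] is the origin of the summand [6 m z^2 S]. *)
Lemma sqr_qJ m : 0 <= m -> \sum_(J : {set 'I_n}) qJ J*(\sum_(i in J) c i - m)^+2 <=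
 M*(z*\sum_i c i^+2 * p_ i + (z * S - m)^+2 + 6 * m * z^+2 * S).
move=> m0.
have S0 : 0 <= S by apply: sumr_ge0 => i _; rewrite mulr_ge0 //; case/andP: (p_01 i).
have M1 := M_ge1.
have e2 : \sum_(J : {set 'I_n}) qJ J*(\sum_(i in J) c i)^+2 <= M*(z*\sum_i c i^+2 * p_ i + (z * S)^+2).
 rewrite (eq_bigr (fun J => qJ J*\sum_(i in J) (c i*\sum_(k in J) c k))); last first.
 by move=> J _; rewrite expr2 mulr_suml.
 rewrite exch.
 have -> : M*(z*(\sum_i c i^+2 * p_ i) + (z * S)^+2) =
 \sum_i \sum_k c i * c k*((i == k)%:R*(z * p_ i * M) + z^+2*(p_ i * p_ k) * M).
 rewrite mulrDr; have -> : M*(z * S)^+2 = \sum_i \sum_k c i * c k*(z^+2*(p_ i * p_ k) * M).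
 have -> : M*(z * S)^+2 = M * z^+2*(S * S) by ring.
 rewrite {1}/S mulr_suml !mulr_sumr; bigr i.
 rewrite /S !mulr_sumr; bigr k; ring.
 rewrite !mulr_sumr -big_split; bigr i.
 have -> : M*(z*(c i^+2 * p_ i)) = \sum_k c i * c k*((i == k)%:R*(z * p_ i * M)).
 rewrite (bigD1 i) //= eqxx big1 => [|k ki]; first by rewrite addr0 mul1r; ring.
 by rewrite eq_sym (negbTE ki) mul0r mulr0.
 by rewrite -big_split; apply: eq_bigr => k _ /=; ring.
 lsum i.
 rewrite (eq_bigr (fun J => \sum_(k in J) qJ J*(c i * c k))); last by move=> J _; rewrite mulrA mulrC mulr_suml; bigr k; ring.
 rewrite (exchange_big_dep xpredT) //=; lsum k.
 rewrite -mulr_suml mulrC ler_wpM2l ?mulr_ge0 //.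
 have /andP[pi0 _] := p_01 i; have /andP[pk0 _] := p_01 k.
 have M0 : 0 <= M by apply: le_trans M1.
 case: (eqVneq i k) => [<-|ik].
 rewrite mul1r (eq_bigl (fun J => i \in J)); last by move=> J; rewrite andbb.
 have [U /andP[U1 U2] ->] := sum1_qJ i.
 via (z * p_ i * M); first by pz.
 by rewrite lerDl; apply: mulr_ge0 M0; apply: mulr_ge0; [exact: exprn_ge0 | exact: mulr_ge0].
 by rewrite mul0r add0r; exact: sum2_qJ.
have /andP[e1 _] := mean_qJ.
rewrite (eq_bigr (fun J => qJ J*(\sum_(i in J) c i)^+2 - 2 * m*(qJ J*(\sum_(i in J) c i)) + m^+2 * qJ J)); last first.
 by move=> J _; ring.
rewrite big_split sumrB -!mulr_sumr sum_qJ /=.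
have h := ler_wpM2l m0 e1.
move: h e2; lra.
Qed.
End Moments.

(** If every index in [J] is a hook, the sites of [J] are empty ([inJ]) and their translates by [t]
    occupied ([inJt]); [VJ] is the set of all frozen sites and [wJ] the weight thereby forced.
    [goodJ] says that these demands are compatible; otherwise [XJ] vanishes. *)
Definition inJ J : pred nat := fun k : nat => [exists i : 'I_n, (i \in J) && (k == i)].
Definition inJt J : pred nat := fun k : nat => [exists i : 'I_n, (i \in J) && (k == i + t)%N].
Definition VJ J : pred nat := predU (inJ J) (inJt J).
Definition wJ J : nat := (\sum_(i < n | inJt J i) i.*2.+1)%N.

Definition goodJ J := (forall k : nat, ~~ (inJ J k && inJt J k)) /\ (forall i, i \in J -> (i + t < n)%N).

Lemma XJ_pattern J D : goodJ J ->
 XJ J D = [forall i : 'I_n, (inJt J i ==> (i \in D)) && (inJ J i ==> (i \notin D))]%:R.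
move=> [dis ltn]; case: forallP => h.
 rewrite /XJ big1 // => i iJ; rewrite /Xb bitE (bitE D (Ordinal (ltn i iJ))).
 have /andP[_ /implyP h1] := h i; have /andP[/implyP h2 _] := h (Ordinal (ltn i iJ)).
 rewrite h1 ?h2 //; apply/existsP; exists i; by rewrite iJ eqxx.
rewrite /=; case: (pickP (fun i => (i \in J) && (X i D == 0))) => [i /andP[iJ /eqP e]|none].
 by rewrite /XJ (bigD1 i) //= e mul0r.
case: h => k; have hX i : i \in J -> (i \notin D) /\ bit D (i + t).
 move=> iJ; have := none i; rewrite iJ /= /Xb bitE; case: (i \in D) => /=; first by rewrite eqxx.
 by case: (bit D (i + t)) => //=; rewrite eqxx.
apply/andP; split; apply/implyP => /existsP[i /andP[iJ /eqP e]].
 by rewrite -(bitE D k) e; case: (hX i iJ).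
by have -> : k = i; [exact: val_inj | case: (hX i iJ)].
Qed.

Lemma XJ_bad J D : ~ goodJ J -> XJ J D = 0.
move=> h; apply/eqP; apply: contrapT => /negP nz; apply: h.
have hX i : i \in J -> ~~ bit D i && bit D (i + t).
 move=> iJ; apply: contrapT => /negP e; case/negP: nz; rewrite /XJ (bigD1 i) //= /Xb (negbTE e) mul0r.
 by [].
split; last by move=> i /hX /andP[_ /bit_lt].
move=> k; apply/negP => /andP[/existsP[i /andP[iJ /eqP ei]] /existsP[j /andP[jJ /eqP ej]]].
by move/hX: iJ => /andP[]; rewrite -ei ej; move/hX: jJ => /andP[_ ->].
Qed.

Lemma goodJP J : goodJ J \/ ~ goodJ J. Proof. exact: EM. Qed.

Lemma pprobE D : pprob s D = cnorm s pred0 n * expR (- s)^+weight D.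
rewrite /pprob /cnorm /weight -expRM_natl.
have -> : (weight D)%:R*(- s) = \sum_(i < n) (if i \in D then - (s * jj R i) else 0) :> R.
 rewrite /weight natr_sum mulr_suml big_mkcond; bigr i; case: ifP => // _.
 by ring.
rewrite expR_sum -big_split; apply: eq_bigr => i _ /=; case: ifP => _; last by rewrite expR0 mulr1.
by rewrite one_bpM.
Qed.

(** For good [J], the probability of weight [n] at parameter [s] given that all of [J] are hooks. *)
Definition cJ J : R := ('X^(wJ J) * bpoly (bpV s (VJ J)) n)`_n.

Lemma EXJ J : goodJ J -> E (XJ J) = cnorm s pred0 n/cnorm s (VJ J) n * expR (- s)^+(wJ J).
move=> gJ; have [dis ltn] := gJ.
have := congr1 (fun P : {poly R} => P.[expR (- s)]) (@pattern_poly R n (inJ J) (inJt J) dis).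
rewrite horner_sum hornerM hornerXn => h.
have hV : (cpoly R (VJ J) n).[expR (- s)] = (cnorm s (VJ J) n)^-1.
 rewrite /cpoly horner_prod /cnorm -prodfV; bigr i; case: ifP => _.
 by rewrite hornerE invr1.
 rewrite one_bpE invrK !hornerE -expRM_natl /jj; congr (1 + expR _); ring.
rewrite -mulrA -hV -[X in _ * X]mulrC -h /Eprod big_mkcond /= mulr_sumr.
rewrite [RHS]big_mkcond /=; bigr D; rewrite XJ_pattern // pprobE.
by case: ifP => _; rewrite ?mul1r ?mul0r // hornerXn.
Qed.

Lemma wtsum_XJ J : \sum_(D : {set 'I_n} | weight D == n) XJ J D =
 expR s^+n/cnorm s pred0 n*(E (XJ J) * cJ J).
have [gJ|bJ] := goodJP J; last first.
 rewrite (eq_Eprod s (G := fun=> 0*1)) ?EprodZ; last by move=> D; rewrite XJ_bad // mul0r.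
 by rewrite big1 ?mul0r ?mulr0 // => D _; exact: XJ_bad.
have [dis ltn] := gJ.
under eq_bigr => D _ do rewrite XJ_pattern //.
rewrite (@count_pattern R n _ _ dis) EXJ // /cJ coef_shift_geom expRN !exprVn -/(wJ J) -/(VJ J).
have e0 := expR_gt0 s; have c1 := cnorm_gt0 s pred0 n; have c2 := cnorm_gt0 s (VJ J) n.
field; by rewrite !gt_eqF ?exprn_gt0.
Qed.

(** Bayes' rule summed over [J]: the prefactor is the reciprocal of the probability of weight [n] at
    parameter [s]. The left side does not involve [s], which leaves [s] free for recentring. *)
Lemma Emean_fQ : Emean (f_ xpredT) =
 expR s^+n/cnorm s pred0 n/(cpoly R pred0 n)`_n*\sum_(J : {set 'I_n}) qJ J * cJ J.
rewrite /Emean count_all; under eq_bigr => D _ do rewrite fQ_sumJ.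
rewrite exchange_big /= (eq_bigr (fun J => expR s^+n/cnorm s pred0 n*(qJ J * cJ J))); last first.
 by move=> J _; rewrite -mulr_sumr wtsum_XJ /qJ; ring.
by rewrite -mulr_sumr; ring.
Qed.

Lemma sum_VJ J : (\sum_(i < n) nat_of_bool (VJ J i) <= 2 * #|J|)%N.
apply: (@leq_trans (\sum_(i < n) (inJ J i + inJt J i))).
 by apply: leq_sum => i _; rewrite /VJ /=; case: (inJ J i); case: (inJt J i).
have le1 (g : 'I_n -> nat) : injective g -> (\sum_(i < n) nat_of_bool [exists k : 'I_n, (k \in J) && (i == g k :> nat)] <= #|J|)%N.
 move=> gi; rewrite -sum1_card (@leq_trans (\sum_(i < n) \sum_(k in J) nat_of_bool (i == g k :> nat))) //.
 apply: leq_sum => i _; case: existsP => //= -[k /andP[kJ e]].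
 by rewrite (bigD1 k) //= e.
 rewrite exchange_big /=; apply: leq_sum => k kJ.
 case: (ltnP (g k) n) => h; last by rewrite big1 // => i _; case: eqP => // e; move: h; rewrite -e leqNgt ltn_ord.
 rewrite (bigD1 (Ordinal h)) //= eqxx big1 // => i ie; case: eqP => // e; case/eqP: ie; exact: val_inj.
rewrite big_split mul2n -addnn leq_add //; first by apply: (le1 (fun k => k)); exact: val_inj.
by apply: (le1 (fun k => k + t)%N) => k k' /addIn /val_inj.
Qed.

Lemma sum_VJE J (g : nat -> R) : goodJ J ->
 \sum_(i < n | VJ J i) g i = \sum_(i in J) (g i + g (i + t)%N).
move=> [dis ltn]; rewrite big_split /=.
transitivity (\sum_(i < n | inJ J i) g i + \sum_(i < n | inJt J i) g i).
 rewrite (bigID (fun i : 'I_n => inJ J i)) /=; congr (_ + _); apply: eq_bigl => i; rewrite /VJ /=.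
 by case: (inJ J i); rewrite ?andbF.
 by have := dis i; case: (inJ J i); case: (inJt J i).
congr (_ + _).
 apply: eq_bigl => i; apply/existsP/idP => [[k /andP[kJ /eqP/val_inj ->]] //|iJ].
 by exists i; rewrite iJ eqxx.
pose h i : 'I_n := insubd i (i + t)%N.
have hE i : i \in J -> h i = (i + t)%N :> nat by move=> iJ; rewrite val_insubd ltn.
rewrite (eq_bigr (fun i => g (h i))); last by move=> i iJ; rewrite hE.
rewrite -(@big_imset _ _ _ _ _ h (fun x => x \in J) (fun k : 'I_n => g k)) /=; last first.
 by move=> i j iJ jJ /(congr1 val) /=; rewrite !hE // => /addIn /val_inj.
apply: eq_bigl => k; apply/existsP/imsetP => [[i /andP[iJ /eqP e]]|[i iJ e]].
 exists i; first exact: iJ.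
 apply: val_inj; rewrite /= hE //.
by exists i; rewrite iJ e hE // eqxx.
Qed.

Lemma wJE J : goodJ J -> (wJ J)%:R = \sum_(i in J) jj R (i + t) :> R.
move=> gJ; have e := sum_VJE (fun k : nat => (inJt J k)%:R * jj R k) gJ; have [dis ltn] := gJ.
rewrite /wJ natr_sum.
transitivity (\sum_(i < n | VJ J i) (inJt J i)%:R * jj R i : R).
 rewrite [LHS]big_mkcond [RHS]big_mkcond; apply: eq_bigr => i _ /=; rewrite /VJ /=.
 by case: (inJt J i); rewrite ?orbT ?mul1r ?mul0r ?if_same.
rewrite e; apply: eq_bigr => i iJ.
have h1 : inJ J i by apply/existsP; exists i; rewrite iJ eqxx.
have h2 : inJt J (i + t)%N by apply/existsP; exists i; rewrite iJ eqxx.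
by have := dis i; rewrite h1 /= => /negbTE ->; rewrite h2 mul0r add0r mul1r.
Qed.

End TiltSums.

(** * Sums of hook probabilities over the sites *)

Section TiltedSums.
Variables (R : realType) (t : nat).
Hypothesis t0 : (0 < t)%N.
Local Notation A := (@AA R).
Local Notation jj := (@jj R).
Implicit Types (a s : R) (n i k m : nat).
Local Notation p_ n s i := (piF t (pn n s) i).
Local Notation cc := (@cc R t).

(** The change of the mean weight caused by a hook at [i], which fills site [i + t] and empties site
    [i]. [TT] is a potential for [xi * piF], see [xi_telescope]. *)
Definition xi s i : R := jj (i + t) * (1 - bp s (i + t)) - jj i * bp s i.
Definition TT s i : R := 2 * t%:R*(cc s*(cc s + 1)) * bp s i + cc s*(jj i*(bp s i*(1 - bp s i))).

Lemma jj_shift i : jj (i + t) = jj i + 2 * t%:R.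
Proof. by rewrite !jjE natrD; ring. Qed.

Lemma xi_ge0 s i : 0 <= s -> 0 <= xi s i.
move=> s0; have h1 := bp_half i s0; have h2 := bp_half (i + t) s0; rewrite /xi jj_shift.
have j0 := jj_ge0 R i; have b0 := bp_gt0 s i; have : 0 <= t%:R :> R by [].
move: (bp s i) (bp s (i + t)) (jj i) (t%:R : R) h1 h2 j0 b0; clear => *; nra.
Qed.

Lemma xi_le s i : 0 < s -> xi s i <= jj (i + t).
move=> s0; rewrite /xi; have h1 := jj_ge0 R (i + t); have h2 := jj_ge0 R i; have h3 := bp_gt0 s i.
have h4 := bp_gt0 s (i + t); move: (jj _) (jj _) (bp _ _) (bp _ _) h1 h2 h3 h4; clear => *; nra.
Qed.

Lemma xi_telescope s i : 0 < s -> xi s i * piF t (bp s) i = TT s i - TT s (i + t).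
move=> s0; rewrite /xi /TT /piF jj_shift bp_shift bpE /cc.
have /andP[] := XX01 t0 s0; have := expR_gt0 (- (s * jj i)); move: (expR _) (XX t s) => u X u0 X0 X1.
have d3 : 0 < u * X by rewrite mulr_gt0.
by field; rewrite !gt_eqF; move: u0 X0 X1 d3; clra.
Qed.

Lemma cc_le s : 0 < s -> 0 <= cc s <= s^-1.
move=> s0; have /andP[X0 X1] := XX01 t0 s0; rewrite divr_ge0 ?(ltW X0) ?subr_ge0 ?(ltW X1) //=.
rewrite /cc ler_pdivrMr; last by rewrite subr_gt0.
have h := expR_ge1Dx (2 * t%:R * s); have T1 := t1 R t0.
have e : XX t s * expR (2 * t%:R * s) = 1 by rewrite -expRD addNr expR0.
have h2 : s <= 2 * t%:R * s by rewrite ler_peMl ?(ltW s0) //; move: T1; clra.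
have h3 : XX t s*(1 + s) <= 1.
 by rewrite -[leRHS]e ler_wpM2l ?(ltW X0); move: h h2; clra.
rewrite mulrC ler_pdivlMr //; move: h3; clra.
Qed.

Lemma head_TT : exists2 C : R, 0 < C & forall s, Ps t s -> `|\sum_(i < t) TT s i - (4 * s^+2)^-1| <= C/s.
have T1 := t1 R t0.
have P01 := @Ps01 R t t0.
have ji := jet_J1 P01 (jet_id (Ps t)).
have jc := jet_J1 P01 (jet_cc R t0).
have jb i := jet_J1 P01 (jet_bp R t i).
have [g [C C0 bg] eg] : J1 (Ps t) (fun s => s * s*\sum_(i < t) TT s i) 4^-1.
 have jT i : J1 (Ps t) (fun s => 2 * t%:R*(s * cc s*(s * cc s + s)) * bp s i + s*(s * cc s) * (jj i*(bp s i*(1 + - bp s i))))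
 (2 * t%:R*((2 * t%:R)^-1*((2 * t%:R)^-1 + 0)) * 2^-1 + 0*(2 * t%:R)^-1*(jj i*(2^-1*(1 + - 2^-1)))).
 apply: J1D.
 apply: (J1M P01) => //; apply: (J1M P01); first exact: J1_cst.
 by apply: (J1M P01) => //; apply: J1D.
 apply: (J1M P01); first exact: (J1M P01).
 apply: (J1M P01); first exact: J1_cst.
 apply: (J1M P01) => //; apply: J1D; first exact: J1_cst.
 exact: J1N.
 have [g bg eg] := J1_sum (fun i (_ : (i < t)%N) => jT i).
 exists g => // s Hs; have -> : s * s*\sum_(i < t) TT s i = \sum_(i < t) (2 * t%:R*(s * cc s*(s * cc s + s)) * bp s i + s*(s * cc s) * (jj i*(bp s i*(1 + - bp s i)))).
 by rewrite mulr_sumr; bigr i; rewrite /TT; ring.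
 rewrite eg //; congr (_ + _).
 under eq_bigr => i _ do rewrite !mul0r !addr0.
 rewrite sumr_const card_ord -[_ *+ t]mulr_natl; field; lra.
exists (C + 1); first by rewrite ltr_wpDl.
move=> s Hs; have /andP[s0 _] := P01 s Hs.
have -> : \sum_(i < t) TT s i - (4 * s^+2)^-1 = g s/s.
 apply: (mulfI (x := s * s)); first by pz.
 by rewrite mulrBr eg //; fld.
rewrite normrM normfV (gtr0_norm s0) ler_wpM2r ?invr_ge0 ?(ltW s0) //.
by lel (bg s Hs); rewrite lerDl.
Qed.

Lemma sum_pim n s : (t <= n)%N -> \sum_(i < n) p_ n s i * pim n s t i = \sum_(i < n) p_ n s i * p_ n s (i + t).
move=> tn; rewrite -(big_mkord xpredT (fun i => p_ n s i * pim n s t i)) -(big_mkord xpredT (fun i => p_ n s i * p_ n s (i + t))) (big_cat_nat (n := t)) //= [in RHS](big_cat_nat (n := n - t)) ?leq_subr //=.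
rewrite [X in X + _ = _]big1_seq ?add0r; last first.
 by move=> i /andP[_]; rewrite mem_index_iota => /andP[_ it]; rewrite /pim leqNgt it mulr0.
rewrite [X in _ = _ + X]big1_seq ?addr0; last first.
 move=> i /andP[_]; rewrite mem_index_iota => /andP[it _]; rewrite (piF_out _ _ (i := i + t)) ?mulr0 //.
 by rewrite -leq_subLR in it *; move: it; clear; lia.
rewrite -{1}[t]add0n big_addn; bigr i.
by rewrite /pim leq_addl addnK mulrC.
Qed.

(** The first two sums are recovered from the mean and the variance expanded before, up to bounded
    boundary terms; the third telescopes through [TT]; for the fourth a crude bound suffices. *)
Lemma sums : exists2 C : R, 0 < C & exists2 a1 : R, 0 < a1 <= 1/80 & forall a s n, 0 < a <= a1 ->
 a <= s <= 2 * a -> a^+2 * n%:R = A ->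
 [/\ `|\sum_(i < n) p_ n s i - (4 * s)^-1| <= C,
 `|\sum_(i < n) (p_ n s i^+2/2 + p_ n s i * pim n s t i) - (16 * s)^-1| <= C,
 `|\sum_(i < n) xi s i * p_ n s i - (4 * s^+2)^-1| <= C/a
 & \sum_(i < n) xi s i^+2 * p_ n s i <= C/a^+3].
have [Cm Cm0 [a1 /andP[a10 a180] hm]] := product_moments R t0; have [Ch Ch0 hh] := head_TT.
have T1 := t1 R t0; have A6 := AA_ge R.
have it0 : 0 < (8 * t%:R)^-1 :> R by rewrite invr_gt0; lra.
pose C1 := Cm + `|c0 R t| + `|c1 R t| + t%:R.
pose C := 16 + Ch + 40 * t%:R * t%:R + 2 * C1 + 4 * t%:R * t%:R.
have C10 : 0 < C1 by rewrite /C1; have := normr_ge0 (c0 R t); have := normr_ge0 (c1 R t); lra.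
have tt0 : 0 <= t%:R * t%:R :> R by rewrite mulr_ge0 // ler0n.
exists C; first by rewrite /C; lra.
exists (Num.min a1 (8 * t%:R)^-1); first by rewrite lt_min a10 it0 ge_min a180.
move=> a s n; rewrite le_min => /andP[a0 /andP[a80 at8]] /andP[s1 s2] an.
have s0 : 0 < s by lra.
have a1' : a <= 1/80 by apply: le_trans a180.
have hat : a*(8 * t%:R) <= 1 by rewrite -ler_pdivlMr ?mul1r //; lra.
have sP : Ps t s.
 by rewrite /Ps s0 -[leRHS]mul1r ler_pdivlMr; [move: hat s2 T1; clear; nra | move: T1; clra].
have a20 : 0 < a^+2 by rewrite exprn_gt0.
have n2t : (2 * t <= n)%N by apply: (@double_le_size R t a).
have tn : (t <= n)%N by apply: leq_trans n2t; rewrite leq_pmull.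
have si : s^-1 <= a^-1 by rewrite lef_pV2.
have p01 i : 0 <= p_ n s i <= 1 := pi_01 n s t i.
have y01 m : 0 <= yF t (pn n s) m <= 1.
 rewrite /yF; elim/big_ind: _ => [|x y /andP[x0 x1] /andP[y0 y1]|i _]; first by rewrite ler01 lexx.
 by rewrite mulr_ge0 //= -[leRHS]mulr1 ler_pM.
 exact: pn01'.
have [hE hV] := hm a s n (andI a0 a80) (andI s1 s2) an.
rewrite Eprod_Nhk // in hE; rewrite Eprod_Nhk_var // in hV.
have cst_sum (f : nat -> R) : (forall m, 0 <= f m <= 1) -> 0 <= \sum_(m < t) f m <= t%:R.
 move=> h; rewrite sumr_ge0 /=; last by move=> m _; case/andP: (h m).
 by rewrite -[leRHS]mulr1 mulr_natl -[in leRHS](card_ord t) -sumr_const; lsum m; case/andP: (h m).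
have sd (f : nat -> nat -> R) : (forall m i, 0 <= f m i <= 1) -> 0 <= \sum_(m < t) \sum_(i < t) f m i <= t%:R * t%:R.
 move=> h; rewrite sumr_ge0 /=; last by move=> m _; rewrite sumr_ge0 // => i _; case/andP: (h m i).
 rewrite mulr_natl -[in leRHS](card_ord t) -sumr_const; lsum m.
 by have /andP[] := cst_sum _ (h m); rewrite card_ord.
have b01 (b : bool) (x : R) : 0 <= x <= 1 -> 0 <= b%:R * x <= 1.
 by case: b; rewrite ?mul1r // mul0r lexx ler01.
have hY := cst_sum _ y01.
have P1 : `|\sum_(i < n) p_ n s i - (4 * s)^-1| <= C1.
 have -> : (4 * s)^-1 = s^-1/4 by rewrite invfM mulrC.
 have k1 : `|c1 R t * s| <= `|c1 R t|.
 by rewrite normrM (gtr0_norm s0) ler_piMr //; move: s2 a1'; clra.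
 have k2 : Cm * a^+2 <= Cm.
 by rewrite ler_piMr ?(ltW Cm0) // exprn_ile1 ?(ltW a0); move: a1'; clra.
 move: hE hY k1 k2; rewrite /ENf /C1; have := ler_norm (c0 R t); have := ler_norm (- c0 R t).
 rewrite normrN; move: (\sum_(i < n) _) (\sum_(m < t) _) (c1 R t * s) (Cm * a^+2) (`|c0 R t|) (`|c1 R t|) => x y z w u v.
 rewrite !ler_norml; move: (c0 R t) (s^-1) => u' r; move: T1 Cm0; clear.
 lra.
have tC : t%:R * t%:R >= t%:R :> R by rewrite ler_peMl //; move: T1; clra.
split.
- by lel P1; rewrite /C; move: Ch0 C10 tt0; clra.
- have -> : (16 * s)^-1 = s^-1/16 by rewrite invfM mulrC.
 have e : \sum_(i < n) (p_ n s i^+2/2 + p_ n s i * pim n s t i) =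
 (\sum_(i < n) p_ n s i - \sum_(i < n) (p_ n s i - p_ n s i^+2 - 2*(p_ n s i * p_ n s (i + t))))/2.
 by rewrite big_split sum_pim // -sumrB mulr_suml -big_split /=; bigr i; field.
 rewrite e; move: P1 hV; rewrite /VNf (_ : (4 * s)^-1 = s^-1/4); last by rewrite invfM mulrC.
 have /sd := fun m i => b01 (i \in Ly t m) _ (andI (mulr_ge0 (proj1 (andP (p01 i))) (proj1 (andP (y01 m)))) (mulr_ile1 (proj1 (andP (p01 i))) (proj1 (andP (y01 m))) (proj2 (andP (p01 i))) (proj2 (andP (y01 m))))).
 have y2 m : 0 <= yF t (pn n s) m - yF t (pn n s) m^+2 <= 1.
 have := y01 m; move: (yF _ _ _) => y /andP[? ?]; rewrite expr2; apply/andP; split; nra.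
 have /sd := fun m i => b01 (i \in Ly t m) _ (y2 m).
 have k2 : Cm * a <= C1.
 via Cm; first by rewrite ler_piMr ?(ltW Cm0); move: a1'; clra.
 by rewrite /C1; have := normr_ge0 (c0 R t); have := normr_ge0 (c1 R t); move: T1; clra.
 have k3 : 0 <= ((odd t)%:R : R) <= 1 by case: (odd t); rewrite ?ler01 ?lexx.
 move: k2 k3 T1 tC C10 Ch0 s0; rewrite /C !ler_norml; move: (s^-1) (Cm * a) ((odd t)%:R : R) (t%:R * t%:R : R) (t%:R : R) => r ca o tt tr.
 by clear; move=> ? /andP[? ?] ? ? ? ? ? /andP[? ?] /andP[? ?] /andP[? ?] /andP[? ?]; apply/andP; split; lra.
- pose m := (n - t)%N.
 have nE : n = (m + t)%N by rewrite /m subnK.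
 have e : \sum_(i < n) xi s i * p_ n s i = \sum_(i < t) TT s i - \sum_(i < t) TT s (m + i).
 rewrite -telescope_shift -(big_mkord xpredT (fun i => xi s i * p_ n s i)) -(big_mkord xpredT (fun i => TT s i - TT s (i + t))) (big_cat_nat (n := m)) ?leq_subr //=.
 rewrite [X in _ + X]big1_seq ?addr0; last first.
 move=> i /andP[_]; rewrite mem_index_iota => /andP[im _].
 have h : (n <= i + t)%N by rewrite nE leq_add2r.
 by rewrite /piF /pn [(i + t < n)%N]ltnNge h !mulr0.
 apply: eq_big_seq => i; rewrite mem_index_iota => /andP[_ im].
 have h : (i + t < n)%N by rewrite nE ltn_add2r.
 by rewrite -xi_telescope // /piF /pn h (leq_ltn_trans (leq_addr t i) h).
 have tail : 0 <= \sum_(i < t) TT s (m + i) <= (24 * t%:R + 12) * t%:R/a.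
 have /andP[c0' c1'] := cc_le s0.
 have b i : 0 <= TT s (m + i) <= (24 * t%:R + 12)/a.
 set k := (m + i)%N; have pk := bp_gt0 s k; have qk := one_bp_gt0 s k; have jk := jj_ge0 R k.
 apply/andP; split.
 apply: addr_ge0; last by apply: mulr_ge0 => //; apply: mulr_ge0 => //; apply: mulr_ge0; exact: ltW.
 by apply: mulr_ge0 (ltW pk); apply: mulr_ge0; [rewrite mulr_ge0 | apply: mulr_ge0 => //; exact: addr_ge0].
 have y0 : 1/(6 * a) <= s * jj k.
 have hk : n%:R <= jj k.
 by rewrite jjE -natrM natr1 ler_nat /k /m; move: n2t; clear; lia.
 have -> : 1/(6 * a) = a*((1/6)/a^+2) by fld.
 by apply: ler_pM => //; rewrite ?(ltW a0) ?divr_ge0 ?(ltW a20) //; apply: le_trans hk; rewrite ler_pdivrMr // [leRHS]mulrC an.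
 have yp : 0 < s * jj k by pz.
 have iy : (s * jj k)^-1 <= 6 * a.
 by rewrite -[6 * a]invrK lef_pV2 ?posrE ?invr_gt0 ?mulr_gt0; rewrite mul1r in y0.
 have e1 : bp s k <= 6 * a.
 lel (bp_le_exp _ _); apply: le_trans iy.
 rewrite -[leRHS]mul1r ler_pdivlMr // mulrC; have := pow_expRN 1 (ltW yp); by [].
 have e2 : s*(jj k * bp s k) <= 12 * a.
 rewrite mulrA; via (2/(s * jj k)).
 rewrite ler_pdivlMr // mulrC mulrA -expr2; apply: le_trans (pow_expRN 2 (ltW yp)).
 by rewrite ler_wpM2l ?sqr_ge0 // bp_le_exp.
 have -> : 12 * a = 2*(6 * a) by ring.
 by rewrite ler_wpM2l.
 have sa2 : s^+2 >= a^+2 by rewrite lerXn2r ?nnegrE ?(ltW a0) ?(ltW s0).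
 have r1 : cc s*(cc s + 1) <= 2/a^+2.
 have -> : 2/a^+2 = a^-1*(a^-1 + a^-1) by fld.
 apply: ler_pM => //; [by rewrite addr_ge0 | exact: le_trans si | apply: lerD; first exact: le_trans si].
 by rewrite invf_ge1 //; move: a1'; clra.
 have r2 : cc s*(jj k*(bp s k*(1 - bp s k))) <= 12/a.
 via (s^-1*(jj k * bp s k)).
 apply: ler_pM => //; first by rewrite !mulr_ge0 // ltW.
 by rewrite ler_wpM2l // ler_piMr; move: pk; clra.
 have -> : s^-1*(jj k * bp s k) = s*(jj k * bp s k)/s^+2 by fld.
 via (12 * a/a^+2); last by le_eq; fld.
 apply: ler_pM => //; first by rewrite !mulr_ge0 // ltW.
 by rewrite invr_ge0 sqr_ge0.
 by rewrite lef_pV2 ?posrE // exprn_gt0.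
 have r3 : 2 * t%:R*(cc s*(cc s + 1)) * bp s k <= 24 * t%:R/a.
 have -> : 24 * t%:R/a = 2 * t%:R*(2/a^+2) * (6 * a) by fld.
 apply: ler_pM => //; [|by pz|].
 by apply: mulr_ge0; [rewrite mulr_ge0 | apply: mulr_ge0 => //; exact: addr_ge0].
 by pz.
 by rewrite /TT [leRHS]mulrDl lerD.
 rewrite sumr_ge0 /=; last by move=> i _; case/andP: (b i).
 have -> : (24 * t%:R + 12) * t%:R/a = t%:R*((24 * t%:R + 12)/a) by ring.
 rewrite mulr_natl -[in leRHS](card_ord t) -sumr_const; lsum i; case/andP: (b i) => _; by rewrite !card_ord.
 have := hh s sP; rewrite e.
 have k1 : Ch/s <= Ch/a by rewrite ler_wpM2l // ltW.
 have k3 : (24 * t%:R + 12) * t%:R/a <= (40 * t%:R * t%:R)/a.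
 rewrite ler_wpM2r ?invr_ge0 ?(ltW a0); move: tC T1; clra.
 have ia0 : 0 < a^-1 by rewrite invr_gt0.
 have k4 : Ch/a + (40 * t%:R * t%:R)/a <= C/a.
 by rewrite -mulrDl ler_wpM2r ?(ltW ia0) /C; move: C10 tt0 Ch0; clra.
 move: tail k1 k3 k4; move: (\sum_(i < t) _) (\sum_(i < t) _) (Ch/s) (Ch/a) (_ * _/a) (_ * _/a) (C/a) => x y z w u v c.
 by clear; rewrite !ler_norml; lra.
via (\sum_(i < n) jj (t + i)^+2 * bpV s pred0 (t + i)).
 lsum i; have x0 := xi_ge0 i (ltW s0); have /andP[q0 _] := p01 i.
 apply: ler_pM => //; first exact: sqr_ge0.
 by rewrite [(t + i)%N]addnC lerXn2r ?nnegrE // xi_le.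
 rewrite [(t + i)%N]addnC /bpV /piF; have /andP[u0 u1] := pn01' n s i; have /andP[v0 v1] := pn01' n s (i + t).
 via (pn n s (i + t)); first by rewrite ler_piMl //; move: u0; clra.
 by rewrite /pn; case: ifP => _ //; exact: ltW (bp_gt0 _ _).
via (\sum_(i < t + n) jj i^+2 * bpV s pred0 i).
 rewrite big_split_ord /= lerDr; apply: sumr_ge0 => i _; apply: mulr_ge0; first exact: sqr_ge0.
 exact: ltW (bp_gt0 _ _).
lel (sum_jj_bpV 2 (t + n) pred0 s0).
have -> : 2`!%:R*2^+3 = 16 :> R by rewrite (_ : 2`! = 2)%N //; ring.
apply: ler_pM => //; first by rewrite invr_ge0 exprn_ge0 // ltW.
 by rewrite /C; move: C10 Ch0 tt0; clra.
by rewrite lef_pV2 ?posrE ?exprn_gt0 // lerXn2r ?nnegrE ?(ltW a0) ?(ltW s0).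
Qed.

End TiltedSums.

Lemma coef_01 (R : realType) (p : nat -> R) M k m : (forall i, 0 <= p i <= 1) -> 0 <= ('X^k * bpoly p M)`_m <= 1.
move=> p01; rewrite coefXnM; case: ifP => _; first by rewrite lexx ler01.
have c0 i := bpoly_coef_ge0 M i p01; rewrite c0 /=; set l := (m - k)%N.
case: (ltnP l (size (bpoly p M))) => h; last by rewrite nth_default // ler01.
rewrite -[leRHS](@bpoly1 _ p M) horner_coef (bigD1 (Ordinal h)) //= expr1n mulr1 lerDl.
by apply: sumr_ge0 => i _; rewrite expr1n mulr1.
Qed.

Lemma sqr_le_norm (R : realType) (x y : R) : `|x| <= y -> x^+2 <= y^+2.
move=> h; rewrite -real_normK ?num_real // lerXn2r //; exact: le_trans h.
Qed.

(** The value [d = z / (8 A)] solves, to first order, [A / s^2 + z / (4 s^2) = A / a^2 = n]: the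
    mean weight at [s] plus the mean extra weight of the random set of hooks is again [n]. *)
Lemma tilt_scale_bounds (R : realType) (a z : R) : 0 < a -> 0 <= z <= 1 ->
 let d := z/(8 * AA R) in let s := a*(1 + d) in [/\ 0 <= d, d <= z, a <= s, s <= 2 * a & 0 < s].
move=> a0 /andP[z0 z1] d s; have A8 : 1 <= 8 * AA R by have := ler_wpM2l (ler0n R 8) (AA_ge R); apply: le_trans; lra.
have d0 : 0 <= d by rewrite divr_ge0 // (le_trans ler01).
have dz : d <= z by apply: ler_piMr => //; rewrite -[leRHS]invr1 lef_pV2 ?posrE //; exact: lt_le_trans A8.
have as_ : a <= s by rewrite ler_peMr ?(ltW a0) // lerDl.
split => //; last exact: lt_le_trans as_.
by rewrite /s mulrC ler_wpM2r ?(ltW a0) //; move: dz z1; clra.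
Qed.

Lemma tilt_le1 (R : realType) (L a z : R) : 0 < L -> a <= 1/L^+2 -> z <= L * sqrt a -> z <= 1.
move=> L0 aL zL; lel zL; rewrite -[L]gtr0_norm // -sqrtr_sqr -sqrtrM ?sqr_ge0 // -[leRHS]sqrtr1 ler_sqrt //.
by rewrite mulrC -ler_pdivlMr ?exprn_gt0.
Qed.

(** * Comparison of the conditional local probabilities *)

Section Compare.
Variables (R : realType) (t : nat).
Hypothesis t0 : (0 < t)%N.
Local Notation A := (@AA R).
Local Notation jj := (@jj R).
Local Notation xi := (xi t).
Implicit Types (a s z : R) (n i k m : nat).

Lemma MM_le n s z m : 0 <= z -> (m <= n)%N -> MM n s t z m <= expR (z*\sum_(i < m) piF t (pn n s) i).
move=> z0; elim: m => [|m IH] mn; first by rewrite MM0 big_ord0 mulr0 expR0.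
have [th /andP[th0 _] ->] := MM_step s t0 z0 mn; rewrite big_ord_recr /= (mulrDr z) expRD.
have /andP[p0 _] := pi_01 n s t m.
have th1 : 0 <= th by apply: le_trans th0; rewrite invr_ge0 addr_ge0.
have q0 : 0 <= z*(if (t <= m)%N then piF t (pn n s) (m - t) else 0) * th.
 by rewrite !mulr_ge0 //; case: ifP => _; case/andP: (pi_01 n s t (m - t)).
apply: ler_pM; [|by rewrite addr_ge0 // divr_ge0 ?addr_ge0 // mulr_ge0|exact: IH (ltnW mn)|].
 by apply: le_trans (EfQ_ge1 _ _ _ z0 _).
apply: le_trans (expR_ge1Dx _); rewrite lerD2l ler_pdivrMr ?ltr_pwDl //.
by apply: ler_peMr; [exact: mulr_ge0 | rewrite lerDl].
Qed.

Lemma bp_diff a s i : a <= s -> 0 <= bp a i - bp s i <= (s - a) * (jj i * bp a i).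
move=> as_; have j0 := jj_ge0 R i; have b0 := bp_gt0 a i.
have ea := expR_gt0 (a * jj i); have es := expR_gt0 (s * jj i).
have le1 : expR (a * jj i) <= expR (s * jj i) by rewrite ler_expR ler_wpM2r.
apply/andP; split.
 by rewrite subr_ge0 /bp lef_pV2 ?posrE // lerD2l.
have -> : bp a i - bp s i = bp a i*(1 - (1 + expR (a * jj i))/(1 + expR (s * jj i))).
 by rewrite /bp; fld.
rewrite mulrCA mulrC mulrA ler_wpM2r ?(ltW b0) // mulrC lerBlDr -lerBlDl.
rewrite [leRHS]mulrC ler_pdivlMr //.
have h := expR_ge1Dx (- ((s - a) * jj i)).
have e : expR (a * jj i) = expR (s * jj i) * expR (- ((s - a) * jj i)).
 by rewrite -expRD; congr expR; ring.
have d0 : 0 <= jj i*(s - a) by rewrite mulr_ge0 // subr_ge0.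
rewrite e mulrDr mulr1; apply: lerD; first by rewrite gerBl.
by rewrite mulrC ler_wpM2l //; apply: le_trans h; rewrite [jj i * _]mulrC lexx.
Qed.

Lemma bvar_tilt a s n : 0 < a -> a <= s -> `|bvar (bp s) n - bvar (bp a) n| <= 96*(s - a)/a^+4.
move=> a0 as_; have s0 : 0 < s by apply: lt_le_trans as_.
rewrite /bvar -sumrB; lel (ler_norm_sum _ _ _).
via (\sum_(i < n) (s - a) * (jj i^+3 * bpV a pred0 i)); last first.
 rewrite -mulr_sumr; have := sum_jj_bpV 3 n pred0 a0.
 have -> : 3`!%:R*2^+4 = 96 :> R by rewrite (_ : 3`! = 6)%N //; ring.
 by move=> h; rewrite [96 * _]mulrC -mulrA ler_wpM2l // subr_ge0.
lsum i; rewrite -mulrBr normrM ger0_norm ?sqr_ge0 //.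
have /andP[d0 d1] := bp_diff i as_; have /andP[x0 x1] := bp01 i s0; have /andP[y0 y1] := bp01 i a0.
have -> : (s - a) * (jj i^+3 * bpV a pred0 i) = jj i^+2*((s - a) * (jj i * bp a i)) by rewrite /bpV /=; ring.
rewrite ler_wpM2l ?sqr_ge0 //; apply: le_trans d1.
have -> : bp s i*(1 - bp s i) - bp a i*(1 - bp a i) = (bp a i - bp s i) * (bp a i + bp s i - 1) by ring.
rewrite normrM (ger0_norm d0) ler_piMr // ler_norml; move: x0 x1 y0 y1; clra.
Qed.

Lemma bmean_V n s (J : {set 'I_n}) : goodJ t J ->
 bmean (bpV s (VJ t J)) n = bmean (bp s) n - \sum_(i in J) (jj i * bp s i + jj (i + t) * bp s (i + t)).
move=> gJ; rewrite -(sum_VJE (fun k => jj k * bp s k) gJ) /bmean [in RHS](bigID (fun i : 'I_n => VJ t J i)) /=.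
rewrite [X in _ = X - _]addrC addrK [RHS]big_mkcond; bigr i; rewrite /bpV.
by case: (VJ t J i); rewrite ?mulr0.
Qed.

Lemma bvar_V n s (J : {set 'I_n}) : 0 < s ->
 `|bvar (bpV s (VJ t J)) n - bvar (bp s) n| <= 4 * #|J|%:R/s^+2.
move=> s0; rewrite /bvar -sumrB; lel (ler_norm_sum _ _ _).
via (\sum_(i < n) (nat_of_bool (VJ t J i))%:R*(2/s^+2)).
 lsum i; rewrite /bpV; case: (VJ t J i); last by rewrite subrr normr0 mul0r.
 have /andP[x0 x1] := bp01 i s0; have y0 : 0 <= s * jj i by rewrite mulr_ge0 ?jj_ge0 ?ltW.
 rewrite mul0r mulr0 sub0r normrN ger0_norm ?mulr_ge0 ?sqr_ge0 ?subr_ge0 // mul1r.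
 rewrite ler_pdivlMr ?exprn_gt0 //.
 apply: le_trans (pow_expRN 2 y0).
 have -> : jj i^+2*(bp s i*(1 - bp s i)) * s^+2 = (s * jj i)^+2*(bp s i*(1 - bp s i)) by ring.
 rewrite ler_wpM2l ?sqr_ge0 //; apply: le_trans (bp_le_exp s i); rewrite ler_piMr; move: x0; clra.
rewrite -mulr_suml -natr_sum mulrA ler_wpM2r ?invr_ge0 ?sqr_ge0 //.
have : (\sum_(i < n) nat_of_bool (VJ t J i))%:R <= (2 * #|J|)%:R :> R by rewrite ler_nat sum_VJ.
rewrite natrM; move: (_%:R) (#|J|%:R) => x y; clra.
Qed.

Lemma cdiff (L : R) : 0 < L -> exists2 C : R, 0 < C & exists2 a1 : R, 0 < a1 <= 1/80 &
 forall a n z (J : {set 'I_n}), 0 < a <= a1 -> a^+2 * n%:R = A -> 0 <= z <= L * sqrt a ->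
 let s := a*(1 + z/(8 * A)) in goodJ t J -> 12*10*10*10 * a * #|J|%:R <= 1 ->
 `|cJ s t J - (bpoly (bp a) n)`_n| <= C * scale a*(eps a +
 a^+3*(\sum_(i in J) xi s i - z/(4 * s^+2))^+2 + a * #|J|%:R).
move=> L0; have [Cl Cl0 hl] := llt_compare R; have [D D0 hD] := bmean_asymp R; have [Cf Cf0 hf] := fd_bound R 0.
have A6 := AA_ge R; have A1 := AA_le R; have A0 := AA_gt0 R.
pose C1 := L^+2 + D + 1.
have L2 : 0 < L^+2 by rewrite exprn_gt0.
have C10 : 0 < C1 by rewrite /C1; lra.
pose K := 3 * C1^+2 + 96 * L + 10.
have K0 : 0 < K by rewrite /K; have := sqr_ge0 C1; lra.
exists (Cl * K + 100 * Cf); first by rewrite addr_gt0 ?mulr_gt0.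
pose a1 := Num.min (1/(10*10*10)) ((100 * L)^+2)^-1.
have a10 : 0 < a1 by rewrite lt_min invr_gt0 exprn_gt0 ?mulr_gt0 // andbT; lra.
exists a1; first by rewrite a10 ge_min; apply/orP; left; lra.
move=> a n z J; rewrite le_min => /andP[a0 /andP[a80 aL]] an /andP[z0 zL] s gJ hJ.
have r0 : 0 < sqrt a by rewrite sqrtr_gt0.
have rs : sqrt a^+2 = a by rewrite sqr_sqrtr // ltW.
have rL : sqrt a*(100 * L) <= 1.
 rewrite -[leRHS]sqrtr1 -[100 * L]gtr0_norm ?mulr_gt0 // -sqrtr_sqr -sqrtrM ?(ltW a0) // ler_sqrt //.
 by rewrite -ler_pdivlMr ?exprn_gt0 ?mulr_gt0 // mul1r.
have z1 : z <= 1/100 by move: zL rL; clra.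
have a11 : a <= 1 by move: a80; clra.
have a1_ : a <= 1/80 by move: a80; clra.
pose d := z/(8 * A).
have sE : s = a*(1 + d) by [].
have [d0 dz as_ s2a s0] : [/\ 0 <= d, d <= z, a <= s, s <= 2 * a & 0 < s].
 by apply: tilt_scale_bounds; rewrite ?z0 //; move: z1; clra.
have a20 : 0 < a^+2 by rewrite exprn_gt0.
have s20 : 0 < s^+2 by rewrite exprn_gt0.
have sa2 : a^+2 <= s^+2 by rewrite lerXn2r ?nnegrE ?(ltW a0) ?(ltW s0).
have nE : n%:R = A/a^+2 by rewrite -an mulrC mulKf // gt_eqF.
have mean_s x : a <= x -> x <= 2 * a -> `|bmean (bp x) n - A/x^+2| <= D + 1.
 move=> ax x2; have x0 : 0 < x by apply: lt_le_trans ax.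
 have h1 : 0 < x <= 1/6 by rewrite x0 /=; move: x2 a1_; clra.
 have h2 : A/2 <= x^+2 * n%:R.
 via A; first by rewrite ler_pdivrMr // ler_peMr ?(ltW A0) // ler1n.
 by rewrite -an ler_wpM2r // lerXn2r ?nnegrE ?(ltW a0) ?(ltW x0).
 have := hD x n h1 h2; have : D * x^+2 <= D.
 by rewrite ler_piMr ?(ltW D0) // exprn_ile1 ?(ltW x0); move: x2 a1_; clra.
 rewrite !ler_norml; move: (bmean _ _) (A/_) (D * _) => u v w; clear; move=> ? /andP[? ?]; apply/andP; split; lra.
pose m := z/(4 * s^+2); pose X := \sum_(i in J) xi s i.
pose err := n%:R - bmean (bp s) n - m.
have errb : `|err| <= C1/a.
 (* By the choice of [s] the terms of first order in [d] cancel. *)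
 have e : n%:R - m - A/s^+2 = A * d^+2/s^+2.
 have zE : z = 8 * A * d by rewrite /d; fld.
 rewrite nE /m sE {1}zE; field; rewrite gt_eqF ?gt_eqF //.
 by rewrite ltr_pwDl.
 have b1 : 0 <= A * d^+2/s^+2 <= L^+2/a.
 have Ad0 : 0 <= A * d^+2 by apply: mulr_ge0; [exact: ltW | exact: sqr_ge0].
 have is0 : 0 <= (s^+2)^-1 by rewrite invr_ge0 ltW.
 rewrite mulr_ge0 //=.
 have -> : L^+2/a = (L * sqrt a)^+2/a^+2 by rewrite exprMn rs; fld.
 apply: ler_pM => //; last by pz.
 via (d^+2); first by apply: ler_piMl; first exact: sqr_ge0.
 by rewrite lerXn2r ?nnegrE // (le_trans _ zL) // (le_trans dz) (le_trans z0).
 have b2 : D + 1 <= (D + 1)/a by rewrite ler_peMr ?invf_ge1 //; move: D0; clra.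
 have := mean_s s as_ s2a; have -> : C1/a = L^+2/a + (D + 1)/a by rewrite /C1; ring.
 have -> : err = (n%:R - m - A/s^+2) - (bmean (bp s) n - A/s^+2) by rewrite /err; ring.
 rewrite e; move: b1 b2; move: (A * _/_) (bmean _ _ - _) (_/a) ((D + 1)/a) => x y u v; clear.
 by rewrite !ler_norml; lra.
have sc0 := scale_gt0 a0; have sc2 := scale_sqr a0.
have e0 := eps_gt0 a0; have re := sqrt_le_eps a0 a11.
have ar : a <= sqrt a by rewrite -{1}rs expr2 ler_piMl ?(ltW r0) // sqrt_le1.
have ae : a <= eps a := le_trans ar re.
have J0 : 0 <= #|J|%:R :> R by rewrite ler0n.
have T0 : 0 <= a^+3*(X - m)^+2 by rewrite mulr_ge0 ?sqr_ge0 ?exprn_ge0 ?ltW.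
have aJ0 : 0 <= a * #|J|%:R by apply: mulr_ge0 => //; exact: ltW.
have gV : good a n (bpV s (VJ t J)).
 apply: good_bpV => //; first by rewrite as_ s2a.
 apply: le_trans hJ.
 have h : (\sum_(i < n) nat_of_bool (VJ t J i))%:R <= 2 * #|J|%:R :> R by rewrite -natrM ler_nat sum_VJ.
 have -> : 12*10*10*10 * a * #|J|%:R = 6*10*10*10 * a*(2 * #|J|%:R) by ring.
 by pz.
have ga : good a n (bp a).
 have -> : bp a = bpV a pred0 by [].
 apply: good_bpV => //; first by rewrite lexx ler_peMl ?(ltW a0) // ler1n.
 by rewrite big1 // mulr0.
have dev : (wJ t J)%:R + bmean (bpV s (VJ t J)) n = n%:R - err - m + X.
 rewrite (wJE _ gJ) bmean_V // /err /X.
 have -> : \sum_(i in J) xi s i = \sum_(i in J) jj (i + t) - \sum_(i in J) (jj i * bp s i + jj (i + t) * bp s (i + t)).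
 by rewrite -sumrB; bigr i; rewrite /xi; ring.
 by ring.
rewrite -/X -/m /cJ coefXnM; case: ltnP => hw; last first.
 lel (hl a n (bpV s (VJ t J)) (n - wJ t J)%N n (bp a) n a0 a11 gV ga).
 have v1 := bvar_V J s0; have v2 := bvar_tilt n a0 as_.
 have u1 : 4 * #|J|%:R/s^+2 <= 4 * #|J|%:R/a^+2 by rewrite ler_wpM2l ?mulr_ge0 // lef_pV2.
 have u2 : 96*(s - a)/a^+4 <= 96*(L * sqrt a)/a^+3.
 have -> : 96*(s - a)/a^+4 = 96 * d/a^+3 by rewrite sE; fld.
 by rewrite ler_wpM2r ?invr_ge0 ?exprn_ge0 ?(ltW a0) // ler_wpM2l // (le_trans dz).
 have m2 := mean_s a (lexx a) (le_trans as_ s2a).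
 have d2 : (n%:R - bmean (bp a) n)^+2 <= C1^+2/a^+2.
 rewrite -expr_div_n; apply: sqr_le_norm; rewrite nE distrC; lel m2; via C1; first by rewrite /C1; move: L2; clra.
 by rewrite ler_peMr ?(ltW C10) // invf_ge1.
 have d1 : ((n - wJ t J)%N%:R - bmean (bpV s (VJ t J)) n)^+2 <= 2*(X - m)^+2 + 2*(C1^+2/a^+2).
 rewrite natrB //; have -> : n%:R - (wJ t J)%:R - bmean (bpV s (VJ t J)) n = err - (X - m) by move: dev; clra.
 have : err^+2 <= C1^+2/a^+2.
 by rewrite -expr_div_n; apply: sqr_le_norm.
 move: (X - m) (_/_) => x y; have := sqr_ge0 (err + x); clear; nra.
 have vv : `|bvar (bpV s (VJ t J)) n - bvar (bp a) n| <= 4 * #|J|%:R/a^+2 + 96*(L * sqrt a)/a^+3.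
 have -> : bvar (bpV s (VJ t J)) n - bvar (bp a) n = (bvar (bpV s (VJ t J)) n - bvar (bp s) n) + (bvar (bp s) n - bvar (bp a) n) by ring.
 lel (ler_normD _ _); apply: lerD; [exact: le_trans u1 | exact: le_trans u2].
 rewrite sc2.
 have tot : ((n - wJ t J)%N%:R - bmean (bpV s (VJ t J)) n)^+2 + (n%:R - bmean (bp a) n)^+2 +
 `|bvar (bpV s (VJ t J)) n - bvar (bp a) n| <= 2*(X - m)^+2 + 3*(C1^+2/a^+2) + (4 * #|J|%:R/a^+2 + 96*(L * sqrt a)/a^+3).
 move: d1 d2 vv; clra.
 have a30 : 0 <= a^+3 by rewrite exprn_ge0 // ltW.
 have := ler_wpM2r a30 tot.
 have -> : (2*(X - m)^+2 + 3*(C1^+2/a^+2) + (4 * #|J|%:R/a^+2 + 96*(L * sqrt a)/a^+3)) * a^+3 =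
 2*(a^+3*(X - m)^+2) + 3 * C1^+2 * a + (4*(a * #|J|%:R) + 96 * L * sqrt a) by fld.
 move=> h.
 have Q0 : 0 <= eps a + a^+3*(X - m)^+2 + a * #|J|%:R by rewrite !addr_ge0 // ltW.
 via (Cl * scale a*(K*(eps a + a^+3*(X - m)^+2 + a * #|J|%:R))); last first.
 rewrite mulrA; apply: ler_wpM2r => //.
 have -> : (Cl * K + 100 * Cf) * scale a = Cl * scale a * K + 100*(Cf * scale a) by ring.
 by rewrite lerDl; apply: mulr_ge0 => //; apply: mulr_ge0; exact: ltW.
 apply: ler_wpM2l; first by rewrite mulr_ge0 // ltW.
 have k1 : 3 * C1^+2 * a <= 3 * C1^+2 * eps a by rewrite ler_wpM2l // mulr_ge0 // sqr_ge0.
 have k2 : 96 * L * sqrt a <= 96 * L * eps a by rewrite ler_wpM2l // mulr_ge0 // ltW.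
 have k3 : 10 <= K by rewrite /K; move: L0; have := sqr_ge0 C1; clra.
 have k4 := ler_wpM2r T0 k3; have k5 := ler_wpM2r aJ0 k3.
 have -> : K*(eps a + a^+3*(X - m)^+2 + a * #|J|%:R) = (3 * C1^+2 * eps a + 96 * L * eps a + 10 * eps a) + K*(a^+3*(X - m)^+2) + K*(a * #|J|%:R).
 by rewrite /K; ring.
 move: h k1 k2 k4 k5 T0 aJ0 e0; move: (_ * a^+3).
 move: (a^+3*(X - m)^+2) (a * #|J|%:R) (3 * C1^+2 * a) (96 * L * sqrt a) (3 * _ * eps a) (96 * L * eps a) => q x y u v w p; clra.
rewrite sub0r normrN.
(* The remaining case is [wJ t J > n], where [cJ] is 0. Then [X - m] is at least of order [n], so
   [a^3 (X - m)^2] is bounded below and the general bound [O(scale a)] for the other coefficient is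
   enough. *)
have X1 : 1/10 <= a^+2*(X - m).
 have hX : n%:R <= X - m + n%:R - bmean (bpV s (VJ t J)) n - err.
 have : n%:R <= (wJ t J)%:R :> R by rewrite ler_nat ltnW.
 move: dev; clra.
 have bV : bmean (bp s) n - bmean (bpV s (VJ t J)) n <= 1/(100 * a^+2).
 rewrite bmean_V // opprB addrC subrK.
 via (\sum_(i in J) 2/a).
 have h k : jj k * bp s k <= a^-1.
 have y0 : 0 <= s * jj k by rewrite mulr_ge0 ?jj_ge0 ?ltW.
 apply: (@le_trans _ _ s^-1); last by rewrite lef_pV2.
 rewrite -[leRHS]mul1r ler_pdivlMr // mulrC mulrA.
 by have := pow_expRN 1 y0; rewrite expr1; apply: le_trans; rewrite ler_wpM2l // bp_le_exp.
 lsum i; have := h i; have := h (i + t)%N; clra.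
 rewrite sumr_const -[_ *+ _]mulr_natl ler_pdivlMr ?mulr_gt0 //.
 have -> : #|J|%:R*(2/a) * (100 * a^+2) = 200*(a * #|J|%:R) by fld.
 move: hJ; rewrite -(mulrA _ a); move: (a * _) => u; clra.
 have hm : m <= 1/(400 * a^+2).
 via (1/100/(4 * a^+2)); last by le_eq; fld.
 by apply: ler_pM => //; [rewrite invr_ge0 mulr_ge0 // ltW | rewrite lef_pV2; [exact: ler_wpM2l | exact: mulr_gt0 | exact: mulr_gt0]].
 have hb : X - m >= n%:R - m - 1/(100 * a^+2).
 move: hX bV; rewrite /err; clra.
 have : a^+2*(n%:R - m - 1/(100 * a^+2)) <= a^+2*(X - m) by rewrite ler_wpM2l ?(ltW a20).
 have : a^+2 * m <= 1/400.
 have -> : 1/400 = a^+2*(1/(400 * a^+2)) by fld.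
 by rewrite ler_wpM2l ?(ltW a20).
 have -> : a^+2*(n%:R - m - 1/(100 * a^+2)) = A - a^+2 * m - 1/100 by rewrite !mulrBr an; fld.
 move: A6; move: (a^+2 * m) (a^+2*(X - m)) => u v; lra.
have X2 : 1/100 <= a^+3*(X - m)^+2.
 have h : (1/10)^+2 <= (a^+2*(X - m))^+2.
 have p0 : 0 <= a^+2*(X - m) by apply: le_trans X1; rewrite divr_ge0.
 by pz.
 have e : a^+3*(X - m)^+2 = (a^+2*(X - m))^+2/a by fld.
 rewrite e ler_pdivlMr //; apply: le_trans h; move: a11 a0; clra.
have hc := hf a n (bp a) 0%N n a0 a11 ga; rewrite !expr0 !mul1r expr1 in hc.
lel hc; via (100 * Cf * scale a*(a^+3*(X - m)^+2)).
 move: (ler_wpM2l (ltW (mulr_gt0 Cf0 sc0)) X2); clra.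
apply: ler_pM => //; [by rewrite !mulr_ge0 ?ltW | rewrite ler_wpM2r ?(ltW sc0) // lerDr mulr_ge0 ?ltW // | ].
rewrite -addrA [_ + a * _]addrC addrA lerDr addr_ge0 // ltW //.
Qed.

End Compare.

(** * The expansion over sets of hooks combined with the local limit theorem *)

Section LogMgf.
Variables (R : realType) (t : nat).
Hypothesis t0 : (0 < t)%N.
Local Notation A := (@AA R).
Local Notation jj := (@jj R).
Local Notation xi := (xi t).
Implicit Types (a s z : R) (n i k m : nat).
Local Notation p_ n s i := (piF t (pn n s) i).
Local Notation f_ n z := (@fQ R n t z xpredT).
Local Notation kp := ((24*10*10*10)^-1 : R).

Lemma MM_full n s z : MM n s t z n = Eprod s (f_ n z).
Proof. by apply: eq_Eprod => D; apply: eq_bigl => k; rewrite ltn_ord. Qed.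

Lemma qJ_double n s z (J : {set 'I_n}) : qJ s t (2 * z) J = 2^+#|J| * qJ s t z J.
Proof. by rewrite /qJ exprMn mulrA. Qed.

(** Sets too large for [cdiff] satisfy [2^|J| >= exp (kp / a)], so by [qJ_double] their share is at
    most [exp (- kp / a)] times the generating function at [2 z]. The latter is at most
    [exp (B / sqrt a)], and [exp_small] compares the two. *)
Lemma bad_factor a k : 0 < a -> 1 < 12*10*10*10 * a * k%:R -> 1 <= 2^+k * expR (- (kp/a)) :> R.
move=> a0 h; have h2 : expR (2^-1 * k%:R) <= 2^+k :> R.
 rewrite mulrC expRM_natl lerXn2r ?nnegrE //.
 have := expR_ge1Dx (- (2^-1) : R); rewrite expRN.
 have e0 := expR_gt0 (2^-1 : R); have -> : 1 + - 2^-1 = 2^-1 :> R by fld.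
 by rewrite lef_pV2 ?posrE.
via (expR (2^-1 * k%:R) * expR (- (kp/a))); last by rewrite ler_wpM2r ?expR_ge0.
rewrite -expRD -[leLHS]expR0 ler_expR subr_ge0 ler_pdivrMr //.
move: h; rewrite -mulrA; have -> : 2^-1 * k%:R * a = 2^-1*(a * k%:R) by ring.
move: (a * _) => u; clra.
Qed.

Lemma exp_small (B : R) : exists2 C : R, 0 < C & forall a, 0 < a <= 1 ->
 expR (- (kp/a)) * expR (B*(sqrt a/a)) <= C * a^+2.
have k0 : 0 < kp/2 by rewrite divr_gt0 // invr_gt0.
have [C C0 h] := exp_decay 2 k0; exists (expR (B^+2/(2 * kp)) * C); first by rewrite mulr_gt0 ?expR_gt0.
move=> a /andP[a0 a1]; have ia : 0 < a^-1 by rewrite invr_gt0.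
have := h _ ia; rewrite exprVn invrK => hd.
rewrite -[leRHS]mulrA; via (expR (B^+2/(2 * kp)) * expR (- (kp/2 * a^-1))); last by apply: ler_wpM2l; [exact: expR_ge0 | exact: hd].
rewrite -!expRD ler_expR.
have rs : sqrt a^+2 = a by rewrite sqr_sqrtr // ltW.
have kk : 0 < kp by rewrite invr_gt0.
have e : B^+2/(2 * kp) - kp/2 * a^-1 - (- (kp/a) + B*(sqrt a/a)) = (B * sqrt a - kp)^+2/(2 * kp * a).
 have -> : (B * sqrt a - kp)^+2 = B^+2 * a - 2 * B * sqrt a * kp + kp^+2 by rewrite -{2}rs; ring.
 move: kk; move: (kp) => K K0; field; by pz.
rewrite -subr_ge0 e divr_ge0 ?sqr_ge0 // !mulr_ge0 ?ltW //.
Qed.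

(** The bound of [cdiff] is averaged under [qJ]. By [sqr_qJ] the mean square of [X - m] is
    [O(a^(-5/2))], small against the variance [a^-3] of the weight, and the mean of [|J|] is
    [O(a^(-1/2))]; both contributions are [O(eps a)]. *)
Lemma total (L : R) : 0 < L -> exists2 C : R, 0 < C & exists2 a1 : R, 0 < a1 <= 1/80 &
 forall a n z s, 0 < a <= a1 -> a^+2 * n%:R = A -> 0 <= z <= L * sqrt a ->
 s = a*(1 + z/(8 * A)) ->
 `|\sum_(J : {set 'I_n}) qJ s t z J * cJ s t J - Eprod s (f_ n z) * (bpoly (bp a) n)`_n|
 <= C*(eps a * scale a) * Eprod s (f_ n z).
move=> L0; have [Cc Cc0 [a1 /andP[a10 a180] hc]] := cdiff t L0.
have [Cs Cs0 [a2 /andP[a20 a280] hs]] := sums R t0.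
pose B := 2 * L*(1 + Cs).
have [C2 C20 he] := exp_small B.
have A6 := AA_ge R; have A1 := AA_le R; have A0 := AA_gt0 R.
pose C3 := 1 + L * Cs + L^+2 * Cs^+2 + 2*(1 + Cs) * L^+3 + L*(1 + Cs).
have C30 : 0 < C3.
 have := mulr_gt0 L0 Cs0; have := exprn_gt0 2 L0; have := exprn_gt0 3 L0; have := exprn_gt0 2 Cs0.
 move=> u v w x; have := mulr_gt0 w u; have := mulr_gt0 (addr_gt0 (@ltr01 R) Cs0) v; rewrite /C3; move: L0 x; clra.
exists (Cc * C3 + C2); first by pz.
pose a3 := Num.min (Num.min a1 a2) (1/L^+2).
have a30 : 0 < a3 by rewrite !lt_min a10 a20 divr_gt0 // exprn_gt0.
exists a3; first by rewrite a30 ge_min ge_min a180.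
move=> a n z s; rewrite !le_min => /andP[a0 /andP[/andP[aa1 aa2] aL]] an /andP[z0 zL] sE.
have r0 : 0 < sqrt a by rewrite sqrtr_gt0.
have rs : sqrt a^+2 = a by rewrite sqr_sqrtr // ltW.
have a11 : a <= 1 by move: aa1 a180; clra.
have z1 := tilt_le1 L0 aL zL.
pose d := z/(8 * A).
have [d0 dz as_ s2a s0] : [/\ 0 <= d, d <= z, a <= s, s <= 2 * a & 0 < s].
 by rewrite sE; apply: tilt_scale_bounds; rewrite ?z0.
have [P1 _ P3 P4] := hs a s n (andI a0 aa2) (andI as_ s2a) an.
have sc0 := scale_gt0 a0; have sc2 := scale_sqr a0.
have e0 := eps_gt0 a0; have re := sqrt_le_eps a0 a11.
have ar : a <= sqrt a by rewrite -{1}rs expr2 ler_piMl ?(ltW r0) // sqrt_le1.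
have ae : a <= eps a := le_trans ar re.
have z20 : 0 <= 2 * z by rewrite mulr_ge0.
have M1 : 1 <= Eprod s (f_ n z) := M_ge1 n s t z0.
set M := Eprod s (f_ n z) in M1 *; set c0 := (bpoly (bp a) n)`_n.
have M0 : 0 <= M by apply: le_trans M1.
pose m := z/(4 * s^+2).
have m0 : 0 <= m by rewrite divr_ge0 // mulr_ge0 // sqr_ge0.
pose X (J : {set 'I_n}) := \sum_(i in J) xi s i.
have step (J : {set 'I_n}) : qJ s t z J * `|cJ s t J - c0| <=
 Cc * scale a*(eps a * qJ s t z J + a^+3*(qJ s t z J*(X J - m)^+2) + a*(qJ s t z J*\sum_(i in J) 1)) +
 expR (- (kp/a)) * qJ s t (2 * z) J.
 have q0 := qJ_ge0 s t z0 J.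
 have cnt : \sum_(i in J) 1 = #|J|%:R :> R by rewrite sumr_const.
 have T0 : 0 <= eps a * qJ s t z J + a^+3*(qJ s t z J*(X J - m)^+2) + a*(qJ s t z J*\sum_(i in J) 1).
 rewrite cnt; apply: addr_ge0; [apply: addr_ge0|].
 - by pz.
 - by pz.
 - by pz.
 have cs0 : 0 <= Cc * scale a by apply: mulr_ge0; exact: ltW.
 have E00 : 0 <= expR (- (kp/a)) * qJ s t (2 * z) J by apply: mulr_ge0; [exact: expR_ge0 | exact: qJ_ge0].
 have [bJ|gJ] := EM (~ goodJ t J).
 have -> : qJ s t z J = 0.
 rewrite /qJ (eq_Eprod s (G := fun=> 0*1)); last by move=> D; rewrite XJ_bad // mul0r.
 by rewrite EprodZ mul0r mulr0.
 by rewrite !mul0r !mulr0 !addr0 mulr0 add0r.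
 have {}gJ : goodJ t J by apply: contrapT.
 have [hJ|hJ] := leP (12*10*10*10 * a * #|J|%:R) 1.
 apply: le_trans (_ : _ <= Cc * scale a*(eps a * qJ s t z J + a^+3*(qJ s t z J*(X J - m)^+2) + a*(qJ s t z J*\sum_(i in J) 1))) _; last by rewrite lerDl.
 have h := hc a n z J (andI a0 aa1) an (andI z0 zL) gJ hJ.
 have := ler_wpM2l q0 h; rewrite -sE -/c0 -/m -/(X J) cnt => h2; lel h2.
 by le_eq; ring.
 apply: le_trans (_ : _ <= expR (- (kp/a)) * qJ s t (2 * z) J) _; last by rewrite lerDr; apply: mulr_ge0.
 have -> : expR (- (kp/a)) * qJ s t (2 * z) J = qJ s t z J*(2^+#|J| * expR (- (kp/a))).
 by rewrite qJ_double; move: (expR _) => ee; ring.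
 apply: ler_wpM2l => //.
 apply: le_trans (bad_factor a0 hJ).
 have p01 : forall i : nat, 0 <= bpV s (VJ t J) i <= 1.
 by move=> i; have /andP[-> h] := bpV_le s (VJ t J) i; apply: le_trans h (bp_le1 _ _).
 have /andP[u0 u1] := coef_01 n (wJ t J) n p01.
 have /andP[v0 v1] := coef_01 n 0 n (fun i => bp01 i a0); rewrite expr0 mul1r in v0 v1.
 by rewrite /cJ /c0 ler_norml; move: u0 u1 v0 v1; clra.
have lhs : `|\sum_(J : {set 'I_n}) qJ s t z J * cJ s t J - M * c0| <= \sum_(J : {set 'I_n}) qJ s t z J * `|cJ s t J - c0|.
 rewrite /M -(sum_qJ n s t z) mulr_suml -sumrB; lel (ler_norm_sum _ _ _).
 by lsum J; rewrite -mulrBr normrM ger0_norm // qJ_ge0.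
lel lhs; lel (ler_sum _ (fun J _ => step J)).
rewrite big_split -!mulr_sumr !big_split -!mulr_sumr /= !sum_qJ // -/M.
have xi0 (i : 'I_n) : 0 <= xi s i by exact: xi_ge0 (ltW s0).
have h2 := @sqr_qJ R n s t z t0 z0 (fun i : 'I_n => xi s i) xi0 m m0.
have /andP[_ h1] := @mean_qJ R n s t z t0 z0 (fun _ : 'I_n => 1) (fun _ => ler01).
have eS : \sum_(i < n) 1 * p_ n s i = \sum_(i < n) p_ n s i by bigr i; rewrite mul1r.
rewrite eS in h1; rewrite -/M in h1 h2.
move: P1 P3 P4 h1 h2; set Sp := \sum_(i < n) p_ n s i; set Sx := \sum_(i < n) xi s i * _; set Sxx := \sum_(i < n) xi s i^+2 * _.
move=> P1 P3 P4 h1 h2.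
have Sp1 : Sp <= (1 + Cs)/a.
 have u1 : (4 * s)^-1 <= a^-1 by rewrite lef_pV2 ?posrE ?mulr_gt0 //; move: as_ a0; clra.
 have u2 : Cs <= Cs/a by rewrite ler_peMr ?(ltW Cs0) // invf_ge1.
 rewrite mulrDl mul1r; via ((4 * s)^-1 + Cs); last exact: lerD.
 by move: P1; rewrite ler_norml => /andP[_]; rewrite lerBlDl.
have h3 : Eprod s (f_ n (2 * z)) <= expR (B*(sqrt a/a)).
 rewrite -MM_full; lel (MM_le t0 s z20 (leqnn n)); rewrite ler_expR -/Sp.
 have -> : B*(sqrt a/a) = 2*(L * sqrt a) * ((1 + Cs)/a) by rewrite /B; ring.
 apply: ler_pM => //; last by pz.
 by apply: sumr_ge0 => i _; case/andP: (pi_01 n s t i).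
have h4 : expR (- (kp/a)) * Eprod s (f_ n (2 * z)) <= C2*(eps a * scale a) * M.
 via (C2*(eps a * scale a)); last by rewrite ler_peMr // !mulr_ge0 // ltW.
 via (C2 * a^+2); last by rewrite ler_wpM2l ?(ltW C20) // sqr_le_eps.
 apply: le_trans (he a (andI a0 a11)); rewrite ler_wpM2l ?expR_ge0 //.
have ia0 : 0 < a^-1 by rewrite invr_gt0.
have si : s^-1 <= a^-1 by rewrite lef_pV2.
have sa2 : (s^+2)^-1 <= (a^+2)^-1 by rewrite lef_pV2 ?posrE ?exprn_gt0 // lerXn2r ?nnegrE ?(ltW a0) ?(ltW s0).
have a3p : 0 < a^+3 by rewrite exprn_gt0.
have Sp0 : 0 <= Sp by apply: sumr_ge0 => i _; case/andP: (pi_01 n s t i).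
have Sx0 : 0 <= Sx by apply: sumr_ge0 => i _; apply: mulr_ge0 => //; case/andP: (pi_01 n s t i).
have Sx1 : Sx <= (1 + Cs)/a^+2.
 have u1 : (4 * s^+2)^-1 <= (a^+2)^-1.
 apply: le_trans sa2; rewrite lef_pV2 ?posrE ?mulr_gt0 // ler_peMl ?sqr_ge0 // ler1n //.
 have u2 : Cs/a <= Cs/a^+2.
 by rewrite ler_wpM2l ?(ltW Cs0) // lef_pV2 ?posrE ?exprn_gt0 // expr2 ler_piMr // ltW.
 rewrite mulrDl mul1r; via ((4 * s^+2)^-1 + Cs/a); last exact: lerD.
 by move: P3; rewrite ler_norml => /andP[_]; rewrite lerBlDl.
have k1 : a^+3*(z * Sxx) <= L * Cs * eps a.
 via (a^+3*(L * sqrt a*(Cs/a^+3))).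
 apply: ler_wpM2l; first exact: ltW.
 apply: ler_pM => //; apply: sumr_ge0 => i _; apply: mulr_ge0; [exact: sqr_ge0 | by case/andP: (pi_01 n s t i)].
 have -> : a^+3*(L * sqrt a*(Cs/a^+3)) = L * Cs * sqrt a by fld.
 by apply: ler_wpM2l => //; apply: mulr_ge0; exact: ltW.
have k2 : a^+3*(z * Sx - m)^+2 <= L^+2 * Cs^+2 * eps a.
 have hd : (z * Sx - m)^+2 <= (L * sqrt a*(Cs/a))^+2.
 apply: sqr_le_norm; have -> : z * Sx - m = z*(Sx - (4 * s^+2)^-1) by rewrite /m; ring.
 by rewrite normrM (ger0_norm z0); apply: ler_pM.
 via (a^+3*(L * sqrt a*(Cs/a))^+2); first by pz; exact: ltW.
 have -> : a^+3*(L * sqrt a*(Cs/a))^+2 = L^+2 * Cs^+2*(a * a).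
 by rewrite !exprMn rs; fld.
 apply: ler_wpM2l; first by apply: mulr_ge0; exact: sqr_ge0.
 by apply: le_trans ae; rewrite ler_piMr // ltW.
have k3 : a^+3*(6 * m * z^+2 * Sx) <= 2*(1 + Cs) * L^+3 * eps a.
 have zz : z^+2 <= (L * sqrt a)^+2 by rewrite lerXn2r ?nnegrE // (le_trans z0).
 have mm : m <= L * sqrt a/(4 * a^+2).
 apply: ler_pM => //; first by rewrite invr_ge0 mulr_ge0 // sqr_ge0.
 rewrite lef_pV2 ?posrE; [rewrite ler_wpM2l // lerXn2r ?nnegrE // ltW // | by pz | by pz].
 via (a^+3*(6*(L * sqrt a/(4 * a^+2)) * (L * sqrt a)^+2*((1 + Cs)/a^+2))).
 apply: ler_wpM2l; first exact: ltW.
 apply: ler_pM => //; first by apply: mulr_ge0; [apply: mulr_ge0 | exact: sqr_ge0].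
 apply: ler_pM => //; [by apply: mulr_ge0 | exact: sqr_ge0 | exact: ler_wpM2l].
 have -> : a^+3*(6*(L * sqrt a/(4 * a^+2)) * (L * sqrt a)^+2*((1 + Cs)/a^+2)) = 3/2*((1 + Cs) * L^+3 * sqrt a).
 by rewrite exprMn rs; fld.
 have q0 : 0 <= (1 + Cs) * L^+3 by apply: mulr_ge0; [rewrite addr_ge0 // ltW | rewrite exprn_ge0 // ltW].
 have := ler_wpM2l q0 re; have : 0 <= (1 + Cs) * L^+3 * sqrt a by apply: mulr_ge0 => //; exact: ltW.
 rewrite -!(mulrA 2) ; move: (_ * sqrt a) (_ * eps a) => x y; clra.
have k4 : a*(z * Sp) <= L*(1 + Cs) * eps a.
 via (a*(L * sqrt a*((1 + Cs)/a))).
 by apply: ler_wpM2l; [exact: ltW | apply: ler_pM].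
 have -> : a*(L * sqrt a*((1 + Cs)/a)) = L*(1 + Cs) * sqrt a by fld.
 by apply: ler_wpM2l => //; apply: mulr_ge0; [exact: ltW | rewrite addr_ge0 // ltW].
rewrite (mulrDl (Cc * C3)) mulrDl; apply: lerD => //.
have -> : Cc * C3*(eps a * scale a) * M = Cc * scale a*(C3 * eps a * M) by ring.
apply: ler_wpM2l; first by apply: mulr_ge0; exact: ltW.
have h2' : a^+3*(\sum_(J : {set 'I_n}) qJ s t z J*(X J - m)^+2) <= (L * Cs * eps a + L^+2 * Cs^+2 * eps a + 2*(1 + Cs) * L^+3 * eps a) * M.
 lel (ler_wpM2l (ltW a3p) h2); rewrite mulrCA mulrC; apply: ler_wpM2r => //.
 by rewrite 2!(mulrDr (a^+3)); apply: lerD => //; apply: lerD.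
have h1' : a*(\sum_(J : {set 'I_n}) qJ s t z J*\sum_(i in J) 1) <= L*(1 + Cs) * eps a * M.
 by lel (ler_wpM2l (ltW a0) h1); rewrite mulrA; apply: ler_wpM2r.
have -> : C3 * eps a * M = eps a * M + (L * Cs * eps a + L^+2 * Cs^+2 * eps a + 2*(1 + Cs) * L^+3 * eps a) * M + L*(1 + Cs) * eps a * M.
 by rewrite /C3; ring.
by apply: lerD => //; apply: lerD.
Qed.

End LogMgf.

(** * Logarithm of the conditioned generating function *)

Section LogAsymp.
Variables (R : realType) (t : nat).
Hypothesis t0 : (0 < t)%N.
Local Notation A := (@AA R).
Local Notation jj := (@jj R).
Implicit Types (a s z : R) (n i k m : nat).
Local Notation p_ n s i := (piF t (pn n s) i).
Local Notation f_ n z := (@fQ R n t z xpredT).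

Lemma ln_near1 (r e : R) : 0 <= e <= 1/2 -> `|r - 1| <= e -> 0 < r /\ `|ln r| <= 2 * e.
move=> /andP[e0 e1]; rewrite ler_norml => /andP[h1 h2].
have r0 : 0 < r by move: h1 e1; clra.
split => //; have l1 : ln r <= r - 1.
 have h : -1 < r - 1 by move: r0; clra.
 by have := le_ln1Dx h; rewrite addrC subrK.
have l2 : - ln r <= r^-1 - 1.
 have ri : 0 < r^-1 by rewrite invr_gt0.
 rewrite -lnV //.
 have h : -1 < r^-1 - 1 by move: ri; clra.
 by have := le_ln1Dx h; rewrite addrC subrK.
have l3 : r^-1 - 1 <= 2 * e.
 have -> : r^-1 - 1 = (1 - r)/r by fld.
 rewrite ler_pdivrMr; move: h1 h2 e0 e1 r0; clear; nra.
by rewrite ler_norml; apply/andP; split; move: l1 l2 l3 h1 h2 e0; clra.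
Qed.

Lemma ln_cnormE n s : ln (cnorm s pred0 n) = - \sum_(i < n) ln (1 + expR (- (s * jj i))).
rewrite /cnorm /= -sumrN; elim: n => [|n IH]; first by rewrite !big_ord0 ln1.
have c0 := cnorm_gt0 s pred0 n; rewrite /cnorm /= in c0.
by rewrite !big_ord_recr lnM ?posrE ?one_bp_gt0 // IH one_bpE lnV ?posrE.
Qed.

(** The logarithmic variable keeps the parameter [exp y] positive for every real [y], so that the
    derivative exists everywhere, as [le_of_derive] demands. *)
Lemma is_derive_cnorm n (y : R) :
 is_derive y 1 (fun y : R => ln (cnorm (expR y) pred0 n)) (expR y * bmean (bp (expR y)) n).
have -> : (fun y : R => ln (cnorm (expR y) pred0 n)) = \sum_(i < n) (fun y : R => - ln (1 + expR (- (expR y * jj i)))).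
 by apply/funext => x; rewrite ln_cnormE fct_sumE sumrN.
rewrite /bmean mulr_sumr; apply: is_derive_sum => i.
have du : is_derive y 1 (fun y : R => 1 + expR (- (expR y * jj i))) (- (expR y * jj i * expR (- (expR y * jj i)))).
 by is_der; ring.
have u0 : 0 < 1 + expR (- (expR y * jj i)) by rewrite addr_gt0 ?expR_gt0.
have dl := is_derive1_ln u0.
have dc := @is_derive1_comp R (@ln R) (fun y : R => 1 + expR (- (expR y * jj i))) y _ _ dl du.
have := is_deriveN dc => h.
apply: (is_derive_eq h); rewrite bpE; field; by [].
Qed.

(** Integration of [bmean = A / s^2 + O(1)] from [a] to [s], carried out by monotonicity of two
    comparison functions in [ln s]. *)
Lemma cnorm_diff : exists2 K : R, 0 < K & forall a s n, 0 < a <= 1/80 -> a <= s <= 2 * a -> a^+2 * n%:R = A ->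
 `|ln (cnorm s pred0 n) - ln (cnorm a pred0 n) - A*(a^-1 - s^-1)| <= K*(s - a).
have [D D0 hD] := bmean_asymp R; have A6 := AA_ge R; have A0 := AA_gt0 R.
exists (D + 1); first by pz.
move=> a s n /andP[a0 a80] /andP[as_ s2a] an; set K := D + 1.
have s0 : 0 < s by apply: lt_le_trans as_.
have mean x : a <= x -> x <= 2 * a -> `|bmean (bp x) n - A/x^+2| <= K.
 move=> ax x2; have x0 : 0 < x by apply: lt_le_trans ax.
 have h1 : 0 < x <= 1/6 by rewrite x0 /=; move: x2 a80; clra.
 have h2 : A/2 <= x^+2 * n%:R.
 via A; first by rewrite ler_pdivrMr // ler_peMr ?(ltW A0) // ler1n.
 by rewrite -an ler_wpM2r // lerXn2r ?nnegrE ?(ltW a0) ?(ltW x0).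
 have := hD x n h1 h2; have : D * x^+2 <= D.
 by rewrite ler_piMr ?(ltW D0) // exprn_ile1 ?(ltW x0); move: x2 a80; clra.
 rewrite /K !ler_norml; move: (bmean _ _) (A/_) (D * _) => u v w; clear; move=> ? /andP[? ?]; apply/andP; split; lra.
pose F (y : R) := ln (cnorm (expR y) pred0 n).
have lnle : ln a <= ln s by rewrite ler_ln.
have dexp (y : R) : is_derive y 1 (fun y : R => A * expR (- y)) (- (A * expR (- y))).
 by is_der; ring.
have dK (y : R) : is_derive y 1 (fun y : R => K * expR y) (K * expR y).
 by is_der; ring.
have dF (y : R) : is_derive y 1 F (expR y * bmean (bp (expR y)) n) := is_derive_cnorm n y.
have d1 (y : R) : is_derive y 1 (fun y : R => (F y + A * expR (- y)) + K * expR y) (expR y * bmean (bp (expR y)) n - A * expR (- y) + K * expR y).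
 exact: is_deriveD (is_deriveD (dF y) (dexp y)) (dK y).
have d2 (y : R) : is_derive y 1 (fun y : R => K * expR y - (F y + A * expR (- y))) (K * expR y - (expR y * bmean (bp (expR y)) n - A * expR (- y))).
 exact: is_deriveB (dK y) (is_deriveD (dF y) (dexp y)).
have fact (y : R) : expR y * bmean (bp (expR y)) n - A * expR (- y) = expR y*(bmean (bp (expR y)) n - A/expR y^+2).
 by rewrite expRN; field; rewrite gt_eqF ?expR_gt0.
have rng (y : R) : ln a <= y <= ln s -> `|bmean (bp (expR y)) n - A/expR y^+2| <= K.
 move=> /andP[y1 y2]; apply: mean; first by rewrite -[leLHS]lnK // ler_expR.
 by apply: le_trans s2a; rewrite -[leRHS]lnK // ler_expR.
have h1 := le_of_derive lnle d1; have h2 := le_of_derive lnle d2.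
have {}h1 : F (ln a) + A * expR (- ln a) + K * expR (ln a) <= F (ln s) + A * expR (- ln s) + K * expR (ln s).
 apply: h1 => y /rng; rewrite fact -[K * _]mulrC -mulrDr ler_norml => /andP[u _]; rewrite mulr_ge0 //.
 by rewrite -lerBlDr sub0r.
have {}h2 : K * expR (ln a) - (F (ln a) + A * expR (- ln a)) <= K * expR (ln s) - (F (ln s) + A * expR (- ln s)).
 apply: h2 => y /rng; rewrite fact [K * _]mulrC -mulrBr ler_norml => /andP[_ u]; rewrite mulr_ge0 //.
 by rewrite subr_ge0.
move: h1 h2; rewrite /F !expRN !lnK //.
move: (ln (cnorm _ _ _)) (ln (cnorm _ _ _)) (a^-1) (s^-1) => u v x y.
rewrite ler_norml; clear; move=> h1 h2; lra.
Qed.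

(** [z / (4 a) - z^2 / (16 a)] is the expansion of [ln M] at parameter [a]. Moving the parameter to
    [s] changes it by [- z^2 / (32 A a)], half of which is returned by the normalising constants.
    The remaining [- z^2 / (64 A a)] is the effect of conditioning on the weight. *)
Definition target a z := z/(4 * a) - z^+2/(64 * A * a) - z^+2/(16 * a).

Theorem log_mgf (L : R) : 0 < L -> exists2 C : R, 0 < C & exists2 a1 : R, 0 < a1 <= 1/80 &
 forall a n z, 0 < a <= a1 -> a^+2 * n%:R = A -> 0 <= z <= L * sqrt a ->
 0 < Emean (f_ n z) /\ `|ln (Emean (f_ n z)) - target a z| <= C * eps a.
move=> L0; have [Ct Ct0 [a1 /andP[a10 a180] ht]] := total t0 L0.
have [Cs Cs0 [a2 /andP[a20 a280] hs]] := sums R t0.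
have [c c0 [a4 /andP[a40 a480] hp]] := prob_lower R.
have [K K0 hK] := cnorm_diff.
have A6 := AA_ge R; have A1 := AA_le R; have A0 := AA_gt0 R.
pose e1 := c/(2 * Ct).
have e10 : 0 < e1 by rewrite divr_gt0 // mulr_gt0.
pose L3 := L^+3; have L30 : 0 < L3 by rewrite exprn_gt0.
pose C := 2*(Ct/c) + K * L + 4 * L3*(1 + Cs) + L * Cs + L^+2 * Cs + 3 * L3.
have C0 : 0 < C.
 have u1 : 0 < 2*(Ct/c) by rewrite mulr_gt0 // divr_gt0.
 have u2 := mulr_gt0 K0 L0; have u3 := mulr_gt0 L0 Cs0; have u4 := mulr_gt0 (exprn_gt0 2 L0) Cs0.
 have u5 : 0 < L3*(1 + Cs) by rewrite mulr_gt0 // addr_gt0.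
 by rewrite /C; move: u1 u2 u3 u4 u5 L30; rewrite -!(mulrA 4); move: (L3 * _); clear => *; lra.
exists C => //.
pose a3 := Num.min (Num.min a1 a2) (Num.min a4 (Num.min (e1^+8) (1/L^+2))).
have a30 : 0 < a3 by rewrite !lt_min a10 a20 a40 exprn_gt0 //= divr_gt0 // exprn_gt0.
exists a3; first by rewrite a30 ge_min ge_min a180.
move=> a n z; rewrite !le_min => /andP[a0 /andP[/andP[aa1 aa2] /andP[aa4 /andP[ae1 aL]]]] an /andP[z0 zL].
have r0 : 0 < sqrt a by rewrite sqrtr_gt0.
have rs : sqrt a^+2 = a by rewrite sqr_sqrtr // ltW.
have a80 : a <= 1/80 by apply: le_trans a180.
have a11 : a <= 1 by move: a80; clra.
have z1 := tilt_le1 L0 aL zL.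
have A8 : 1 <= 8 * A by have := ler_wpM2l (ler0n R 8) A6; apply: le_trans; lra.
have A80 : 0 < 8 * A by apply: lt_le_trans A8.
pose d := z/(8 * A); pose s := a*(1 + z/(8 * A)).
have sE : s = a*(1 + d) by [].
have zE : z = 8 * A * d by rewrite /d mulrCA divff ?mulr1 // gt_eqF.
have [d0 dz as_ s2a s0] : [/\ 0 <= d, d <= z, a <= s, s <= 2 * a & 0 < s].
 by apply: tilt_scale_bounds; rewrite ?z0.
have [P1 P2 _ _] := hs a s n (andI a0 aa2) (andI as_ s2a) an.
have hK' := hK a s n (andI a0 a80) (andI as_ s2a) an.
have hT := ht a n z s (andI a0 aa1) an (andI z0 zL) erefl.
have hP := hp a n a0 aa4 an.
have sc0 := scale_gt0 a0.
have e0 := eps_gt0 a0; have re := sqrt_le_eps a0 a11.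
have ar : a <= sqrt a by rewrite -{1}rs expr2 ler_piMl ?(ltW r0) // sqrt_le1.
have M1 : 1 <= Eprod s (f_ n z) := M_ge1 n s t z0.
have lM := @ln_MM R n s t z t0 z0 n z1 (leqnn n); rewrite MM_full in lM.
move: M1 hT lM; set M := Eprod s (f_ n z); set c0' := (bpoly (bp a) n)`_n in hP *; set Q := \sum_(J : {set 'I_n}) _ => M1 hT lM.
have M0 : 0 < M by apply: lt_le_trans M1.
have c00 : 0 < c0' by apply: lt_le_trans hP; rewrite mulr_gt0.
have he : eps a <= e1.
 have : eps a^+8 <= e1^+8.
 by rewrite (_ : 8 = 4*2)%N // exprM eps4 rs.
 by rewrite ler_pXn2r // nnegrE ltW.
pose r := Q/(M * c0').
have rb : `|r - 1| <= Ct/c * eps a.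
 have -> : r - 1 = (Q - M * c0')/(M * c0') by rewrite /r; fld.
 rewrite normrM normfV (gtr0_norm (mulr_gt0 M0 c00)) ler_pdivrMr ?mulr_gt0 //.
 lel hT; have -> : Ct/c * eps a*(M * c0') = Ct*(eps a*(c0' / c)) * M by fld.
 by apply: ler_wpM2r; [exact: ltW | apply: ler_wpM2l; [exact: ltW | apply: ler_wpM2l; [exact: ltW | rewrite ler_pdivlMr // mulrC]]].
have rb2 : 0 <= Ct/c * eps a <= 1/2.
 rewrite mulr_ge0 ?divr_ge0 ?(ltW Ct0) ?(ltW c0) ?(ltW e0) //=.
 have -> : 1/2 = Ct/c * e1 by rewrite /e1; fld.
 by apply: ler_wpM2l => //; rewrite divr_ge0 ?ltW.
have [rp lr] := ln_near1 rb2 rb.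
have cs0 := cnorm_gt0 s pred0 n; have ca0 := cnorm_gt0 a pred0 n.
have EE : Emean (f_ n z) = expR ((s - a) * n%:R) * (cnorm a pred0 n/cnorm s pred0 n) * M * r.
 rewrite (Emean_fQ n s t z) -/Q.
 have cE : c0' = cnorm a pred0 n * expR (- a)^+n*(cpoly R pred0 n)`_n := bpoly_geom a pred0 n n.
 have cp0 : (cpoly R pred0 n)`_n != 0.
 by apply/eqP => h; move: c00; rewrite cE h mulr0 ltxx.
 rewrite /r cE mulrBl expRD -mulNr !(mulrC _ n%:R) !expRM_natl.
 have ea0 := expR_gt0 (- a); field; by rewrite cp0 !gt_eqF ?exprn_gt0.
have p0 : 0 < cnorm a pred0 n/cnorm s pred0 n by exact: divr_gt0.
have p1 : 0 < expR ((s - a) * n%:R) * (cnorm a pred0 n/cnorm s pred0 n) by apply: mulr_gt0 => //; exact: expR_gt0.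
have p2 := mulr_gt0 p1 M0.
have Epos : 0 < Emean (f_ n z) by rewrite EE; exact: mulr_gt0.
split => //.
have lE : ln (Emean (f_ n z)) = (s - a) * n%:R + (ln (cnorm a pred0 n) - ln (cnorm s pred0 n)) + ln M + ln r.
 rewrite EE lnM ?posrE // lnM ?posrE // lnM ?posrE ?expR_gt0 // expRK.
 by rewrite lnM ?posrE ?invr_gt0 // lnV.
rewrite lE.
have sumE : \sum_(i < n) (z * p_ n s i - z^+2*(p_ n s i^+2/2 + p_ n s i * pim n s t i)) =
 z*\sum_(i < n) p_ n s i - z^+2*\sum_(i < n) (p_ n s i^+2/2 + p_ n s i * pim n s t i).
 by rewrite sumrB -!mulr_sumr.
rewrite sumE in lM; move: P1 P2 lM; set Sp := \sum_(i < n) p_ n s i; set Sv := \sum_(i < n) (_ + _) => P1 P2 lM.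
have d1 : 0 < 1 + d by rewrite ltr_pwDl.
have E1 : (s - a) * n%:R - A*(a^-1 - s^-1) = z^+2/(64 * A * a) - A/a*(d^+3/(1 + d)).
 have -> : n%:R = A/a^+2 by rewrite -an mulrC mulKf // gt_eqF // exprn_gt0.
 by rewrite sE zE; fld.
have E2 : z/(4 * s) = z/(4 * a) - z^+2/(32 * A * a) + z*(d^+2/(1 + d))/(4 * a).
 by rewrite sE zE; fld.
have E3 : z^+2/(16 * s) = z^+2/(16 * a) - z^+2*(d/(1 + d))/(16 * a).
 by rewrite sE; fld.
have z3 : z^+3/a <= L3 * sqrt a.
 have : z^+3 <= (L * sqrt a)^+3 by rewrite lerXn2r ?nnegrE // (le_trans z0).
 rewrite ler_pdivrMr // => h; lel h; rewrite exprMn -/L3 -{3}rs; have -> : sqrt a^+3 = sqrt a * sqrt a^+2 by ring.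
 by rewrite mulrA.
have z30 : 0 <= z^+3/a by rewrite divr_ge0 ?exprn_ge0 // ltW.
have dd : d/(1 + d) <= d by rewrite ler_pdivrMr // ler_peMr // lerDl.
have dd0 : 0 <= d/(1 + d) by rewrite divr_ge0 // ltW.
have F1 : 0 <= A/a*(d^+3/(1 + d)) <= z^+3/a.
 have q0 : 0 <= A/a by rewrite divr_ge0 // ltW.
 have q1 : 0 <= d^+3/(1 + d) by rewrite divr_ge0 ?exprn_ge0 // ltW.
 rewrite mulr_ge0 //= mulrAC ler_wpM2r ?invr_ge0 ?(ltW a0) //.
 via (d^+3/(1 + d)); first by rewrite ler_piMl.
 via (d^+3); first by rewrite ler_piMr ?exprn_ge0 // invf_le1 // lerDl.
 by pz.
have F2 : 0 <= z*(d^+2/(1 + d))/(4 * a) <= z^+3/a.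
 have q1 : 0 <= d^+2/(1 + d) by rewrite divr_ge0 ?exprn_ge0 // ltW.
 have q2 : d^+2/(1 + d) <= z^+2.
 via (d^+2); first by rewrite ler_piMr ?exprn_ge0 // invf_le1 // lerDl.
 by pz.
 have ia4 : 0 <= (4 * a)^-1 by rewrite invr_ge0; apply: mulr_ge0 => //; exact: ltW.
 have nn : 0 <= z*(d^+2/(1 + d)) by apply: mulr_ge0.
 rewrite mulr_ge0 //=; apply: ler_pM => //.
 by rewrite exprS ler_wpM2l.
 by rewrite lef_pV2 ?posrE ?mulr_gt0 // ler_peMl ?(ltW a0) // ler1n.
have F3 : 0 <= z^+2*(d/(1 + d))/(16 * a) <= z^+3/a.
 have ia16 : 0 <= (16 * a)^-1 by rewrite invr_ge0; apply: mulr_ge0 => //; exact: ltW.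
 have nn : 0 <= z^+2*(d/(1 + d)) by apply: mulr_ge0 => //; exact: sqr_ge0.
 rewrite mulr_ge0 //=; apply: ler_pM => //.
 by rewrite [z^+3]exprSr; apply: ler_wpM2l; [exact: sqr_ge0 | exact: le_trans dz].
 by rewrite lef_pV2 ?posrE ?mulr_gt0 // ler_peMl ?(ltW a0) // ler1n.
have G1 : `|z * Sp - z/(4 * s)| <= L * Cs * eps a.
 have -> : z * Sp - z/(4 * s) = z*(Sp - (4 * s)^-1) by ring.
 rewrite normrM (ger0_norm z0); via (L * sqrt a * Cs); first by pz.
 by rewrite mulrAC ler_wpM2l // mulr_ge0 // ltW.
have G2 : `|z^+2 * Sv - z^+2/(16 * s)| <= L^+2 * Cs * eps a.
 have -> : z^+2 * Sv - z^+2/(16 * s) = z^+2*(Sv - (16 * s)^-1) by ring.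
 rewrite normrM (ger0_norm (sqr_ge0 z)); via ((L * sqrt a)^+2 * Cs).
 by apply: ler_pM => //; [exact: sqr_ge0 | rewrite lerXn2r ?nnegrE // (le_trans z0)].
 rewrite exprMn rs mulrAC ler_wpM2l //; first by rewrite mulr_ge0 ?sqr_ge0 // ltW.
 exact: le_trans ar re.
have G3 : 4 * z^+3 * Sp <= 4 * L3*(1 + Cs) * eps a.
 have Sp1 : Sp <= (1 + Cs)/a.
 have u1 : (4 * s)^-1 <= a^-1 by rewrite lef_pV2 ?posrE ?mulr_gt0 //; move: as_ a0; clra.
 have u2 : Cs <= Cs/a by rewrite ler_peMr ?(ltW Cs0) // invf_ge1.
 rewrite mulrDl mul1r; via ((4 * s)^-1 + Cs); last exact: lerD.
 by move: P1; rewrite ler_norml => /andP[_]; rewrite lerBlDl.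
 rewrite -!(mulrA 4) ler_wpM2l //; via (z^+3*((1 + Cs)/a)).
 by rewrite ler_wpM2l ?exprn_ge0.
 have -> : z^+3*((1 + Cs)/a) = z^+3/a*(1 + Cs) by ring.
 have -> : L3*(1 + Cs) * eps a = L3 * eps a*(1 + Cs) by ring.
 apply: ler_wpM2r; first by pz.
 by lel z3; rewrite ler_wpM2l // ltW.
have G4 : K*(s - a) <= K * L * eps a.
 rewrite -mulrA ler_wpM2l ?(ltW K0) //; have -> : s - a = a * d by rewrite sE; ring.
 via d; first by rewrite ler_piMl.
 lel dz; lel zL; by pz.
have G5 : z^+3/a <= L3 * eps a by lel z3; rewrite ler_wpM2l // ltW.
have Z32 : z^+2/(32 * A * a) = 2*(z^+2/(64 * A * a)) by fld.
have CE : C * eps a = 2*(Ct/c * eps a) + K * L * eps a + 4 * L3*(1 + Cs) * eps a + L * Cs * eps a + L^+2 * Cs * eps a + 3*(L3 * eps a).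
 by rewrite /C; ring.
rewrite CE /target.
move: hK' lr lM F1 F2 F3 G1 G2 G3 G4 G5; rewrite E2 E3 Z32.
have -> : (s - a) * n%:R = A*(a^-1 - s^-1) + (z^+2/(64 * A * a) - A/a*(d^+3/(1 + d))) by rewrite -E1; ring.
move: (A*(a^-1 - s^-1)) (ln (cnorm s _ _)) (ln (cnorm a _ _)) (ln M) (ln r) (A/a * _) (z * _/(4 * a)) (z^+2 * _/(16 * a)) (z/(4 * a)) (z^+2/(64 * A * a)) (z^+2/(16 * a)) (z^+3/a) (z * Sp) (z^+2 * Sv) (4 * z^+3 * Sp) (K*(s - a)) (Ct/c * eps a) (K * L * eps a) (4 * L3*(1 + Cs) * eps a) (L * Cs * eps a) (L^+2 * Cs * eps a) (L3 * eps a).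
clear => x1 x2 x3 x4 x5 x6 x7 x8 x9 y1 y2 y3 y4 y5 y6 y7 y8 y9 u1 u2 u3 u4.
rewrite !ler_norml; lra.
Qed.

End LogAsymp.

Local Open Scope classical_set_scope.
Local Open Scope ring_scope.

(** * Gaussian integrals of functions of exponential growth *)

Section GaussianIntegral.
Variable R : realType.
Implicit Types (f g : R -> R) (c m x y : R).
Local Notation mu := (@lebesgue_measure R).

Definition gpdf : R -> R := normal_pdf 0 1.

(** Completing the square: the integral of an exponential becomes the total mass of a shifted normal
    density. *)
Lemma gpdfE m y : expR (m * y) * gpdf y = expR (m^+2/2) * normal_pdf m 1 y.
rewrite /gpdf !normal_pdfE // /normal_fun mulrCA [RHS]mulrCA; congr (_ * _).
by rewrite -!expRD; congr expR; field.
Qed.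

Lemma gpdf_ge0 y : 0 <= gpdf y. Proof. exact: normal_pdf_ge0. Qed.

Lemma gpdf_le1 y : gpdf y <= 1.
lel (normal_pdf_ub _ _ _) => //; rewrite /normal_peak expr1n mul1r invf_le1; last first.
 by rewrite sqrtr_gt0 mulrn_wgt0 // pi_gt0.
have h : 1 <= pi *+ 2 :> R.
 by rewrite mulr2n; via (2 + 0); [rewrite addr0 ler1n | apply: lerD; [exact: pi_ge2 | exact: pi_ge0]].
by rewrite -[leLHS]sqrtr1 ler_sqrt // (le_trans ler01).
Qed.

Lemma measurable_gpdf : measurable_fun setT gpdf.
Proof. exact: measurable_normal_pdf. Qed.

Lemma integrable_exp m : mu.-integrable setT (EFin \o (fun y => expR (m * y) * gpdf y)).
have -> : EFin \o (fun y => expR (m * y) * gpdf y) = (fun y => (expR (m^+2/2))%:E*(normal_pdf m 1 y)%:E)%E.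
 by apply/funext => y /=; rewrite gpdfE EFinM.
by apply: integrableZl => //; exact: integrable_normal_pdf.
Qed.

Definition LL f : R := Rintegral mu setT (fun y => f y * gpdf y).

Lemma LL_exp m : LL (fun y => expR (m * y)) = expR (m^+2/2).
rewrite /LL; under eq_Rintegral => y _ do rewrite gpdfE.
rewrite RintegralZl //; last exact: integrable_normal_pdf.
by rewrite /Rintegral integral_normal_pdf mulr1.
Qed.

(** Measurability and exponential growth ensure integrability against the Gaussian and pass to sums
    and products, which covers all test functions below. *)
Definition dom f := measurable_fun setT f /\ exists2 m : R, 0 <= m & exists2 C : R, 0 <= C & forall y, `|f y| <= C * expR (m * `|y|).

Lemma dom_int f : dom f -> mu.-integrable setT (EFin \o (fun y => f y * gpdf y)).
move=> [mf [m m0 [C C0 hf]]].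
have ig : mu.-integrable setT (fun y => C%:E*((expR (m * y) * gpdf y)%:E + (expR (- m * y) * gpdf y)%:E))%E.
 by apply: integrableZl => //; apply: integrableD => //; exact: integrable_exp.
apply: le_integrable ig => //.
 by apply/measurable_EFinP; apply: measurable_funM => //; exact: measurable_gpdf.
move=> y _ /=; rewrite lee_fin [leRHS]ger0_norm; last first.
 by rewrite mulr_ge0 // addr_ge0 // mulr_ge0 ?gpdf_ge0.
rewrite -mulrDl mulrA normrM (ger0_norm (gpdf_ge0 y)) ler_wpM2r ?gpdf_ge0 //.
lel (hf y); rewrite ler_wpM2l //.
by case: (ger0P y) => _; rewrite ?mulrN ?mulNr ?lerDl ?lerDr.
Qed.

Lemma dom_add f g : dom f -> dom g -> dom (fun y => f y + g y).
move=> [mf [m m0 [C C0 hf]]] [mg [m' m'0 [C' C'0 hg]]]; split; first exact: measurable_funD.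
exists (m + m'); first exact: addr_ge0.
exists (C + C'); first exact: addr_ge0.
move=> y; lel (ler_normD _ _); rewrite mulrDl; apply: lerD.
 by lel (hf y); rewrite ler_wpM2l // ler_expR ler_wpM2r // lerDl.
by lel (hg y); rewrite ler_wpM2l // ler_expR ler_wpM2r // lerDr.
Qed.

Lemma dom_mul f g : dom f -> dom g -> dom (fun y => f y * g y).
move=> [mf [m m0 [C C0 hf]]] [mg [m' m'0 [C' C'0 hg]]]; split; first exact: measurable_funM.
exists (m + m'); first exact: addr_ge0.
exists (C * C'); first exact: mulr_ge0.
by move=> y; rewrite normrM mulrDl expRD mulrACA ler_pM.
Qed.

Lemma dom_bounded f C : measurable_fun setT f -> 0 <= C -> (forall y, `|f y| <= C) -> dom f.
move=> mf C0 h; split => //; exists 0 => //; exists C => // y.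
by rewrite mul0r expR0 mulr1.
Qed.

Lemma dom_cst c : dom (fun=> c).
Proof. by apply: (dom_bounded (C := `|c|)). Qed.

Lemma dom_exp m : dom (fun y => expR (m * y)).
split; first by apply: measurableT_comp => //; exact: measurable_funM.
exists `|m| => //; exists 1 => // y; rewrite mul1r ger0_norm ?expR_ge0 // ler_expR -normrM.
exact: ler_norm.
Qed.

Lemma dom_id : dom id.
split => //; exists 1 => //; exists 1 => // y; rewrite !mul1r.
by have := expR_ge1Dx `|y|; lra.
Qed.

Lemma dom_pow f k : dom f -> dom (fun y => f y^+k).
move=> df; elim: k => [|k IH]; first by have := dom_cst 1.
have -> : (fun y => f y^+k.+1) = (fun y => f y * f y^+k) by apply/funext => y; rewrite exprS.
exact: dom_mul.
Qed.

Lemma dom_sin L : dom (fun y => sin (y/L)).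
apply: (dom_bounded (C := 1)) => //; last by move=> y; rewrite ler_norml sin_geN1 sin_le1.
apply: measurableT_comp; first exact: continuous_measurable_fun (@continuous_sin R).
exact: measurable_funM.
Qed.

Definition ind x : R -> R := \1_(`]x, +oo[).

Lemma indE x y : ind x y = (x < y)%R%:R.
rewrite /ind indicE; congr (_%:R); case: (boolP (x < y)) => h.
 by rewrite mem_set //= in_itv /= h.
by rewrite memNset //= in_itv /= (negbTE h).
Qed.

Lemma dom_ind x : dom (ind x).
apply: (dom_bounded (C := 1)) => //; first by apply: measurable_indic; exact: measurable_itv.
by move=> y; rewrite indE; case: (x < y); rewrite ?normr1 ?normr0.
Qed.

Lemma LL_add f g : dom f -> dom g -> LL (fun y => f y + g y) = LL f + LL g.
move=> df dg; rewrite /LL -RintegralD //; [|exact: dom_int|exact: dom_int].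
by apply: eq_Rintegral => y _; rewrite mulrDl.
Qed.

Lemma LL_scale c f : dom f -> LL (fun y => c * f y) = c * LL f.
move=> df; rewrite /LL -RintegralZl //; last exact: dom_int.
by apply: eq_Rintegral => y _; rewrite mulrA.
Qed.

Lemma LL_le f g : dom f -> dom g -> (forall y, f y <= g y) -> LL f <= LL g.
move=> df dg h; apply: le_Rintegral => //; [exact: dom_int | exact: dom_int | ].
by move=> y _; rewrite ler_wpM2r ?gpdf_ge0.
Qed.

(** The normal density is at most 1, so the distribution function is 1-Lipschitz; this closes the
    final squeeze. *)
Lemma LL_ind_diff x d : 0 <= d -> LL (ind (x - d)) - LL (ind x) <= d.
move=> d0; have dn f : dom f -> dom (fun y => - 1 * f y) by move=> df; exact: dom_mul (dom_cst _) df.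
have -> : LL (ind (x - d)) - LL (ind x) = LL (fun y => ind (x - d) y + - 1 * ind x y).
 rewrite LL_add ?LL_scale ?mulN1r //; [exact: dom_ind | exact: dom_ind | exact: dn (dom_ind x)].
have mi : measurable (`](x - d), x] : set R) by exact: measurable_itv.
have fin_mu : mu (`](x - d), x] : set R) = d%:E.
 rewrite lebesgue_measure_itv /= lte_fin; case: ltP => h; first by rewrite -EFinB opprB addrC subrK.
 by congr EFin; move: h d0; lra.
have ii : (\int[mu]_y (\1_(`](x - d), x] : set R) y)%:E = d%:E)%E.
 by rewrite integral_indic //; rewrite setIT; exact: fin_mu.
have e : LL (fun y => ind (x - d) y + - 1 * ind x y) <= Rintegral mu setT (\1_(`](x - d), x]) : R -> R).
 apply: le_Rintegral => //.
 - by apply: dom_int; apply: dom_add (dom_ind _) (dn _ (dom_ind _)).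
 - apply/integrableP; split; first by apply/measurable_EFinP; exact: measurable_indic.
 under eq_integral => y _ do rewrite /= ger0_norm ?indicE //.
 under eq_integral => y _ do rewrite -indicE.
 exact: (@eq_ind_r _ d%:E (fun z => (z < +oo)%E) (ltry d) _ ii).
 - move=> y _; rewrite !indE mulN1r.
 have [h|h] := ltP (x - d) y; have [h'|h'] := ltP x y; rewrite ?subrr ?mul0r //.
 + by rewrite subr0 mul1r mem_set ?gpdf_le1 //= in_itv /= h h'.
 + lra.
lel e; have -> : Rintegral mu setT (\1_(`](x - d), x]) : R -> R) = d by exact: (congr1 (@fine R) ii).
by [].
Qed.

Lemma LL_ind_cdf x : (1 - LL (ind x))%:E = normal_prob 0 1 `]-oo, x].
have -> : 1 - LL (ind x) = LL (fun y => 1 + - 1 * ind x y).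
 rewrite LL_add ?LL_scale ?mulN1r; [|exact: dom_ind|exact: dom_cst|exact: dom_mul (dom_cst _) (dom_ind _)].
 have -> : LL (fun=> 1) = LL (fun y => expR (0 * y)) by congr LL; apply/funext => y; rewrite mul0r expR0.
 by rewrite LL_exp expr0n mul0r expR0.
rewrite /LL /Rintegral fineK; last first.
 apply: integrable_fin_num => //; apply: (dom_int (f := fun y => 1 + - 1 * ind x y)).
 exact: dom_add (dom_cst _) (dom_mul (dom_cst _) (dom_ind _)).
rewrite /normal_prob [RHS]integral_mkcond; apply: eq_integral => y _; rewrite patchE indE mulN1r.
case: ifPn => h.
 by move: h; rewrite inE /= in_itv /= leNgt => /negbTE ->; rewrite subr0 mul1r.
by move: h; rewrite notin_setE /= in_itv => /negP; rewrite -ltNge => ->; rewrite subrr mul0r.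
Qed.

End GaussianIntegral.

(** * Taylor bounds for sine and exponential, and a polynomial step function *)

Section SinTaylor.
Variable R : realType.
Implicit Types (x y u : R).

Definition sg (i : nat) : R := if odd i then (-1)^+i./2 else 0.
Definition cg (i : nat) : R := if odd i then 0 else (-1)^+i./2.
Definition ES (a : nat -> R) (m : nat) x : R := \sum_(i < m) a i/i`!%:R * x^+i.

Lemma sgS i : sg i.+1 = cg i. Proof. by rewrite /sg /cg /= uphalf_half; case: (odd i); rewrite ?add0n. Qed.
Lemma cgS i : cg i.+1 = - sg i.
Proof. by rewrite /sg /cg /= uphalf_half; case: (odd i); rewrite ?oppr0 //= exprS mulN1r. Qed.

Lemma is_derive_ES a m x : is_derive x 1 (ES a m.+1) (ES (fun i => a i.+1) m x).
elim: m => [|m IH].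
 have -> : ES a 1 = fun=> a 0%N by apply/funext => y; rewrite /ES big_ord1 fact0 divr1 expr0 mulr1.
 by rewrite /ES big_ord0; exact: is_derive_cst.
have -> : ES a m.+2 = fun y => ES a m.+1 y + a m.+1/(m.+1)`!%:R * y^+m.+1.
 by apply/funext => y; rewrite /ES big_ord_recr.
have dp : is_derive x 1 (fun y : R => a m.+1/(m.+1)`!%:R * y^+m.+1) (a m.+1/m`!%:R * x^+m).
 have E : (fun y : R => a m.+1/(m.+1)`!%:R * y^+m.+1) = (a m.+1/(m.+1)`!%:R) \*: ((id : R -> R)^+m.+1).
 apply/funext => y; rewrite /= /GRing.scale /=; congr (_ * _).
 by elim: (m.+1) => [|k IHk]; rewrite // !exprS IHk.
 rewrite E; apply: (is_derive_eq (is_deriveZ (a m.+1/(m.+1)`!%:R) (is_deriveX m.+1 (is_derive_id x (1 : R))))).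
 rewrite /GRing.scale /= mulr1 factS natrM; field.
 by pz.
have -> : ES (fun i => a i.+1) m.+1 x = ES (fun i => a i.+1) m x + a m.+1/m`!%:R * x^+m.
 by rewrite /ES big_ord_recr.
exact: is_deriveD IH dp.
Qed.

Lemma sin_cos_ES m : forall x, 0 <= x ->
 `|sin x - ES sg m x| <= x^+m/m`!%:R /\ `|cos x - ES cg m x| <= x^+m/m`!%:R.
elim: m => [|m IH] x x0.
 by rewrite /ES !big_ord0 !subr0 expr0 fact0 divr1 !ler_norml sin_geN1 sin_le1 cos_geN1 cos_le1.
have z0 a : ES a m.+1 0 = a 0%N.
 rewrite /ES big_ord_recl /= fact0 divr1 expr0 mulr1 big1 ?addr0 // => i _.
 by rewrite exprS mul0r mulr0.
have fE : x^+m.+1/(m.+1)`!%:R = (m`!%:R)^-1/m.+1%:R * x^+m.+1.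
 rewrite factS natrM; field; by pz.
rewrite fE; split.
 apply: (@abs_le_pow R (fun y => sin y - ES sg m.+1 y) (fun y => cos y - ES cg m y) m (m`!%:R)^-1 x).
 - move=> y; have -> : ES cg m y = ES (fun i => sg i.+1) m y by bigr i; rewrite sgS.
 exact: is_deriveB (is_derive_sin y) (is_derive_ES sg m y).
 - by rewrite sin0 z0 /sg subrr.
 - by move=> y /andP[y0 _]; have [_] := IH y y0; rewrite mulrC.
 - by rewrite x0 lexx.
apply: (@abs_le_pow R (fun y => cos y - ES cg m.+1 y) (fun y => - sin y - ES (fun i => cg i.+1) m y) m (m`!%:R)^-1 x).
- by move=> y; exact: is_deriveB (is_derive_cos y) (is_derive_ES cg m y).
- by rewrite cos0 z0 /cg expr0 subrr.
- move=> y /andP[y0 _]; have [h _] := IH y y0.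
 have -> : ES (fun i => cg i.+1) m y = - ES sg m y by rewrite /ES -sumrN; bigr i; rewrite cgS !mulNr.
 by rewrite -opprD normrN mulrC.
- by rewrite x0 lexx.
Qed.

Lemma sin_ES m x : `|sin x - ES sg m x| <= `|x|^+m/m`!%:R.
have [x0|x0] := lerP 0 x; first by have [h _] := sin_cos_ES m x0; rewrite (ger0_norm x0).
have nx : 0 <= - x by rewrite oppr_ge0 ltW.
have [h _] := sin_cos_ES m nx.
have e : ES sg m (- x) = - ES sg m x.
 rewrite /ES -sumrN; bigr i; rewrite exprNn -signr_odd /sg.
 by case: (odd i); rewrite ?mul0r ?oppr0 // expr1 mulN1r mulrN.
by move: h; rewrite sinN e -opprD normrN (ltr0_norm x0).
Qed.

Lemma expR_sub1 u : `|expR u - 1| <= `|u| * (1 + expR u).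
have e0 := expR_gt0 u; have h1 := expR_ge1Dx u.
have h2 : (1 - u) * expR u <= 1.
 rewrite -[leRHS](expRxMexpNx_1 u) mulrC ler_wpM2l //; exact: expR_ge1Dx.
have [u0|u0] := ger0P u.
 by rewrite ger0_norm; [move: h2; rewrite mulrBl mul1r mulrDr; lra | lra].
have : expR u <= 1 by rewrite -expR0 ler_expR ltW.
rewrite ler_norml mulrDr => e1; have : 0 <= - u * expR u by apply: mulr_ge0; [rewrite oppr_ge0 ltW | exact: ltW].
lra.
Qed.

Lemma expR_sub2 u : `|expR u - 1 - u| <= u^+2*(1 + expR u).
have e0 := expR_gt0 u; have h1 := expR_ge1Dx u; have u2 := sqr_ge0 u.
rewrite ger0_norm; last lra.
have [u0|u0] := lerP 0 u.
 have h2 : (1 - u) * expR u <= 1.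
 rewrite -[leRHS](expRxMexpNx_1 u) mulrC ler_wpM2l //; exact: expR_ge1Dx.
 have : (1 + u) * ((1 - u) * expR u) <= (1 + u) * 1 by pz.
 rewrite mulrA (_ : (1 + u) * (1 - u) = 1 - u^+2); last by ring.
 rewrite mulrBl mul1r mulrDr; lra.
have d0 : 0 < 1 - u by lra.
have h2 : expR u*(1 - u) <= 1.
 rewrite -[leRHS](expRxMexpNx_1 u) ler_wpM2l //; exact: expR_ge1Dx.
have h3 : expR u <= (1 - u)^-1 by rewrite -[leRHS]mul1r ler_pdivlMr.
have h4 : (1 - u)^-1 <= 1 + u + u^+2.
 rewrite -[leLHS]mul1r ler_pdivrMr // (_ : (1 + u + u^+2) * (1 - u) = 1 - u^+3); last by ring.
 have : 0 <= u^+2 * - u by rewrite mulr_ge0 // oppr_ge0 ltW.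
 lra.
have : 0 <= u^+2 * expR u by pz.
rewrite mulrDr; lra.
Qed.

Lemma geom_small (r e : R) : 0 < r -> 0 < e -> exists N : nat, ((1 + r)^+N)^-1 <= e.
move=> r0 e0; have bern N : 1 + N%:R * r <= (1 + r)^+N.
 elim: N => [|N IH]; first by rewrite expr0 mul0r addr0.
 rewrite exprS -natr1; have : (1 + r) * (1 + N%:R * r) <= (1 + r) * (1 + r)^+N by pz.
 have : 0 <= N%:R * r * r by pz.
 lra.
pose N := Num.bound (e^-1/r); exists N.
have h : e^-1/r < N%:R by apply: archi_boundP; apply: divr_ge0; [rewrite invr_ge0 ltW | exact: ltW].
have p0 : 0 < (1 + r)^+N by rewrite exprn_gt0 // addr_gt0.
rewrite -[e]invrK lef_pV2 ?posrE ?invr_gt0 //; apply: le_trans (bern N).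
by move: h; rewrite ltr_pdivrMr // => /ltW; lra.
Qed.

(* The polynomials [(1 - w ^ N) ^ (2 ^ N)] converge to the indicator of [w < 1/2] on [0, 1]. *)
Lemma step_poly (w r : R) (N : nat) : 0 <= w <= 1 -> 0 < r ->
 [/\ 0 <= (1 - w^+N)^+(2 ^ N) <= 1,
 1/2 + r <= w -> (1 - w^+N)^+(2 ^ N) <= ((1 + 2 * r)^+N)^-1
 & w <= 1/2 - r -> 1 - (1 - w^+N)^+(2 ^ N) <= ((1 + 2 * r)^+N)^-1].
move=> /andP[w0 w1] r0; have wN0 : 0 <= w^+N by rewrite exprn_ge0.
have wN1 : w^+N <= 1 by rewrite exprn_ile1.
have d0 : 0 <= 1 - w^+N by lra.
have d1 : 1 - w^+N <= 1 by lra.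
have q0 : 0 < 1 + 2 * r by rewrite addr_gt0 // mulr_gt0.
split.
- by rewrite exprn_ge0 //= exprn_ile1.
- move=> h; have h1 : (1 + 2 * r)^+N <= 2^+N * w^+N.
 by rewrite -exprMn lerXn2r ?nnegrE ?mulr_ge0 ?(ltW q0) //; lra.
 via (expR (- (w^+N))^+(2 ^ N)).
 by rewrite lerXn2r ?nnegrE //; exact: expR_ge1Dx.
 rewrite -expRM_natl natrX mulrN expRN lef_pV2 ?posrE ?expR_gt0 ?exprn_gt0 //.
 by have := expR_ge1Dx (2^+N * w^+N); lra.
- move=> h; have bern k : 1 - k%:R * w^+N <= (1 - w^+N)^+k.
 elim: k => [|k IH]; first by rewrite expr0 mul0r subr0.
 rewrite exprS -natr1; have := ler_wpM2l d0 IH.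
 have : 0 <= k%:R * w^+N * w^+N by rewrite !mulr_ge0.
 lra.
 via (2^+N * w^+N); first by have := bern (2 ^ N)%N; rewrite natrX; lra.
 rewrite -exprMn -exprVn lerXn2r ?nnegrE ?mulr_ge0 ?invr_ge0 ?(ltW q0) //.
 rewrite -[leRHS]mul1r ler_pdivlMr //.
 have : 2 * w*(1 + 2 * r) <= (1 - 2 * r) * (1 + 2 * r) by rewrite ler_wpM2r ?(ltW q0) //; lra.
 have : 0 <= r * r by pz.
 rewrite (_ : (1 - 2 * r) * (1 + 2 * r) = 1 - 4*(r * r)); last by ring.
 lra.
Qed.
End SinTaylor.

(** * From one-sided exponential moments to the distribution function *)

Section Convergence.
Variable R : realType.
Implicit Types (f g h : R -> R) (c x y e : R).
Variable EE : nat -> (R -> R) -> R.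
Hypothesis EE_add : forall n f g, EE n (fun y => f y + g y) = EE n f + EE n g.
Hypothesis EE_scale : forall n c f, EE n (fun y => c * f y) = c * EE n f.
Hypothesis EE_le : forall n f g, (forall y, f y <= g y) -> EE n f <= EE n g.
Hypothesis EE_exp : forall l : R, 0 <= l -> forall e, 0 < e -> exists N, forall n, (N <= n)%N ->
 `|EE n (fun y => expR (l * y)) - expR (l^+2/2)| <= e.
Ltac slra := clear - EE_add EE_scale EE_le EE_exp; lra.
Local Notation LL := (@LL R).

Definition tame f := dom f /\ forall e, 0 < e -> exists N, forall n, (N <= n)%N -> `|EE n f - LL f| <= e.

Lemma good_exp l : 0 <= l -> tame (fun y => expR (l * y)).
Proof. by move=> l0; split; [exact: dom_exp | rewrite LL_exp; exact: EE_exp]. Qed.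

Lemma good_add f g : tame f -> tame g -> tame (fun y => f y + g y).
move=> [df hf] [dg hg]; split; first exact: dom_add.
move=> e e0; have e20 : 0 < e/2 by rewrite divr_gt0.
have [N1 h1] := hf _ e20; have [N2 h2] := hg _ e20; exists (maxn N1 N2) => n; rewrite geq_max => /andP[n1 n2].
rewrite EE_add LL_add //; have := h1 n n1; have := h2 n n2; rewrite !ler_norml => /andP[? ?] /andP[? ?].
lra.
Qed.

Lemma good_scale c f : tame f -> tame (fun y => c * f y).
move=> [df hf]; split; first exact: dom_mul (dom_cst c) df.
move=> e e0; have e20 : 0 < e/(`|c| + 1) by rewrite divr_gt0 // ltr_wpDl.
have [N h] := hf _ e20; exists N => n nN; rewrite EE_scale LL_scale // -mulrBr normrM.
have := h n nN; rewrite ler_pdivlMr ?ltr_wpDl // => hh; apply: le_trans hh.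
by rewrite mulrC ler_wpM2l // lerDl.
Qed.

Lemma good_eq f g : f =1 g -> tame f -> tame g.
Proof. by move/funext => ->. Qed.

Lemma good0 : tame (fun=> 0).
apply: (good_eq (f := fun y => 0 * expR (0 * y))); first by move=> y; rewrite mul0r.
by apply: good_scale; apply: good_exp.
Qed.

Lemma good_sum (m : nat) (f : nat -> R -> R) : (forall i, tame (f i)) -> tame (fun y => \sum_(i < m) f i y).
move=> h; elim: m => [|m IH]; first by apply: good_eq good0 => y; rewrite big_ord0.
by apply: (good_eq (f := fun y => \sum_(i < m) f i y + f m y)); [move=> y; rewrite big_ord_recr | exact: good_add].
Qed.

Lemma LL_ge0 f : dom f -> (forall y, 0 <= f y) -> 0 <= LL f.
move=> df h; have hz := LL_scale 0 (dom_cst (0 : R)); rewrite [RHS]mul0r in hz.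
by rewrite -[leLHS]hz; apply: LL_le => // [|y]; [exact: dom_mul (dom_cst _) (dom_cst _) | rewrite mul0r].
Qed.

(** Approximation up to a small multiple of a fixed tame [h] is enough, since [EE n h] and [LL h]
    stay bounded; pointwise closeness without such an [h] would give no control of the tails. *)
Lemma good_approx f h : dom f -> tame h ->
 (forall e, 0 < e -> exists2 g, tame g & forall y, `|f y - g y| <= e * h y) -> tame f.
move=> df [dh hh] H; split => // e e0.
have h0 y : 0 <= h y.
 have [g _ hg] := H 1 ltr01; have := hg y; rewrite mul1r; exact: le_trans.
have Lh0 := LL_ge0 dh h0.
pose B := LL h + 1; have B0 : 0 < B by rewrite ltr_wpDl.
pose ep := e/(4 * B); have ep0 : 0 < ep by rewrite divr_gt0 // mulr_gt0.
have epB : ep * B = e/4 by rewrite /ep; fld.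
have [g [dg hg] fg] := H ep ep0.
have e20 : 0 < e/2 by rewrite divr_gt0.
have [N1 h1] := hh 1 ltr01; have [N2 h2] := hg _ e20; exists (maxn N1 N2) => n; rewrite geq_max => /andP[n1 n2].
have deh : dom (fun y => ep * h y) := dom_mul (dom_cst ep) dh.
have u1 y : f y <= g y + ep * h y by have := fg y; rewrite ler_norml => /andP[_]; rewrite lerBlDl.
have u2 y : g y <= f y + ep * h y by have := fg y; rewrite ler_norml lerNl opprB lerBlDl => /andP[].
have E1 := EE_le n u1; have E2 := EE_le n u2; rewrite !EE_add !EE_scale in E1 E2.
have L1 := LL_le df (dom_add dg deh) u1; have L2 := LL_le dg (dom_add df deh) u2.
rewrite !LL_add // !LL_scale // in L1 L2.
have Eh : ep * EE n h <= e/4.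
 rewrite -epB ler_wpM2l ?(ltW ep0) //; have := h1 n n1; rewrite ler_norml => /andP[_]; rewrite lerBlDl addrC /B addrC => hx.
 by [].
have Lh : ep * LL h <= e/4 by rewrite -epB ler_wpM2l ?(ltW ep0) // lerDl.
have := h2 n n2; move: E1 E2 L1 L2 Eh Lh; rewrite !ler_norml.
move: (EE n f) (EE n g) (LL f) (LL g) (ep * EE n h) (ep * LL h) => a b a' b' x x'; clear => ? ? ? ? ? ? /andP[? ?].
lra.
Qed.

(** On the left [exp (c y)] absorbs the power and the factor [exp (q |y|)], on the right a larger
    exponential does. Both dominating rates are positive, as they must be when only [l >= 0] is
    available. *)
Lemma dominate (k : nat) c q : 0 < c -> 0 <= q <= c/2 -> exists2 B : R, 0 <= B & forall y,
 `|y|^+k * expR (c * y) * expR (q * `|y|) <= B*(expR ((c + q + 1) * y) + expR (c/4 * y)).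
move=> c0 /andP[q0 q1]; have c4 : 0 < c/4 by rewrite divr_gt0.
have k0 : 0 <= k`!%:R :> R by rewrite ler0n.
have kk : 0 <= k`!%:R/(c/4)^+k by rewrite divr_ge0 // exprn_ge0 // ltW.
exists (k`!%:R + k`!%:R/(c/4)^+k); first exact: addr_ge0.
move=> y; have [y0|y0] := ger0P y.
 via (k`!%:R * expR ((c + q + 1) * y)); last first.
 by apply: ler_pM; rewrite ?lerDl.
 rewrite -mulrA -expRD [in leRHS](_ : (c + q + 1) * y = y + (c * y + q * y)); last by ring.
 rewrite (expRD y) mulrA ler_wpM2r //.
 by have := pow_expRN k y0; rewrite expRN ler_pdivrMr ?expR_gt0.
pose u := - y; have u0 : 0 < u by rewrite oppr_gt0.
have yE : y = - u by rewrite opprK.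
via (k`!%:R/(c/4)^+k * expR (c/4 * y)); last first.
 by apply: ler_pM; rewrite ?lerDr.
rewrite -/u -mulrA -expRD; via (u^+k*(expR (- (c/4 * u)) * expR (c/4 * y))).
 rewrite ler_wpM2l ?exprn_ge0 ?(ltW u0) // -expRD ler_expR yE.
 have := ler_wpM2r (ltW u0) q1; lra.
rewrite mulrA ler_wpM2r ?expR_ge0 // ler_pdivlMr ?exprn_gt0 //.
have := @pow_expRN R k (c/4 * u) (ltW (mulr_gt0 c4 u0)); rewrite exprMn; lra.
Qed.

Lemma good_dominant c q : 0 < c -> 0 <= q -> tame (fun y => expR ((c + q + 1) * y) + expR (c/4 * y)).
by move=> c0 q0; apply: good_add; apply: good_exp; rewrite ?addr_ge0 ?divr_ge0 // ltW.
Qed.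

(** [y^(k+1) exp (c y)] is the derivative of [y^k exp (c y)] in [c]; difference quotients with step
    [h] approximate it within [O(h)] times a dominating function. *)
Lemma good_pow (k : nat) c : 0 < c -> tame (fun y => y^+k * expR (c * y)).
elim: k c => [|k IH] c c0.
 by apply: (good_eq (f := fun y => expR (c * y))); [move=> y; rewrite expr0 mul1r | apply: good_exp; exact: ltW].
pose h0 := Num.min 1 (c/2).
have h00 : 0 < h0 by rewrite lt_min ltr01 divr_gt0.
have h0c : 0 <= h0 <= c/2 by rewrite (ltW h00) ge_min lexx orbT.
have [B B0 hB] := dominate k.+2 c0 h0c.
apply: (good_approx (h := fun y => 2 * B*(expR ((c + h0 + 1) * y) + expR (c/4 * y)))).
- exact: dom_mul (dom_pow k.+1 (dom_id R)) (dom_exp c).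
- by apply: good_scale; apply: good_dominant => //; exact: ltW.
move=> e e0; pose h := Num.min e h0.
have hp : 0 < h by rewrite lt_min e0.
have he : h <= e by rewrite ge_min lexx.
have hh0 : h <= h0 by rewrite ge_min lexx orbT.
exists (fun y => h^-1*(y^+k * expR ((c + h) * y) + -1*(y^+k * expR (c * y)))).
 apply: good_scale; apply: good_add; first by apply: IH; rewrite addr_gt0.
 by apply: good_scale; exact: IH.
move=> y.
have -> : y^+k.+1 * expR (c * y) - h^-1*(y^+k * expR ((c + h) * y) + -1*(y^+k * expR (c * y))) =
 - (h^-1*(y^+k * expR (c * y) * (expR (h * y) - 1 - h * y))).
 by rewrite mulrDl expRD exprS; fld.
rewrite normrN !normrM normfV (gtr0_norm hp) normrX (ger0_norm (expR_ge0 _)).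
have h2 := expR_sub2 (h * y).
have e1 : 1 + expR (h * y) <= 2 * expR (h0 * `|y|).
 have a1 : 1 <= expR (h0 * `|y|) by rewrite -[leLHS]expR0 ler_expR mulr_ge0 // ltW.
 have a2 : expR (h * y) <= expR (h0 * `|y|).
 rewrite ler_expR; via (h * `|y|); first by rewrite ler_wpM2l ?(ltW hp) // ler_norm.
 by pz.
 lra.
via (h^-1*(`|y|^+k * expR (c * y) * ((h * y)^+2*(2 * expR (h0 * `|y|))))).
 rewrite ler_wpM2l ?invr_ge0 ?(ltW hp) // ler_wpM2l //.
 by lel h2; rewrite ler_wpM2l ?sqr_ge0.
have -> : h^-1*(`|y|^+k * expR (c * y) * ((h * y)^+2*(2 * expR (h0 * `|y|)))) =
 h*(2*(`|y|^+k.+2 * expR (c * y) * expR (h0 * `|y|))).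
 by rewrite exprMn -(real_normK (num_real y)) !exprS; fld.
have p0 : 0 <= `|y|^+k.+2 * expR (c * y) * expR (h0 * `|y|).
 by [].
apply: (ler_pM (ltW hp) _ he); first exact: mulr_ge0.
by rewrite -[leRHS]mulrA ler_wpM2l.
Qed.

(** One factor [sin (y / L)] is replaced by a Taylor polynomial, which leads back to fewer sine
    factors. Its remainder is at most [2^-M exp (2 |y| / L)], and [2 / L <= c / 2] lets [dominate]
    absorb it. *)
Lemma good_sin (j k : nat) c L : 0 < c -> 0 < L -> 2/L <= c/2 ->
 tame (fun y => y^+k * expR (c * y) * sin (y/L)^+j).
move=> c0 L0 Lc; have q0 : 0 <= 2/L <= c/2 by rewrite Lc divr_ge0 // ltW.
elim: j k => [|j IH] k.
 by apply: (good_eq (f := fun y => y^+k * expR (c * y))); [move=> y; rewrite expr0 mulr1 | exact: good_pow].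
have [B B0 hB] := dominate k c0 q0.
apply: (good_approx (h := fun y => B*(expR ((c + 2/L + 1) * y) + expR (c/4 * y)))).
- exact: dom_mul (dom_mul (dom_pow k (dom_id R)) (dom_exp c)) (dom_pow j.+1 (dom_sin L)).
- by apply: good_scale; apply: good_dominant => //; case/andP: q0.
move=> e e0; have [M hM] := geom_small ltr01 e0.
exists (fun y => \sum_(i < M) sg R i/i`!%:R/L^+i*(y^+(k + i) * expR (c * y) * sin (y/L)^+j)).
 by apply: (good_sum M (f := fun i y => sg R i/i`!%:R/L^+i*(y^+(k + i) * expR (c * y) * sin (y/L)^+j))) => i; exact: good_scale.
move=> y.
have -> : \sum_(i < M) sg R i/i`!%:R/L^+i*(y^+(k + i) * expR (c * y) * sin (y/L)^+j) =
 y^+k * expR (c * y) * sin (y/L)^+j * ES (sg R) M (y/L).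
 by rewrite /ES mulr_sumr; bigr i; rewrite exprMn exprVn exprD; ring.
have -> : y^+k * expR (c * y) * sin (y/L)^+j.+1 - y^+k * expR (c * y) * sin (y/L)^+j * ES (sg R) M (y/L) =
 y^+k * expR (c * y) * sin (y/L)^+j*(sin (y/L) - ES (sg R) M (y/L)).
 by rewrite exprSr; ring.
rewrite !normrM !normrX (ger0_norm (expR_ge0 _)).
have s1 : `|sin (y/L)|^+j <= 1 by rewrite exprn_ile1 // ler_norml sin_geN1 sin_le1.
have p0 : 0 <= `|y|^+k * expR (c * y) by rewrite mulr_ge0 ?exprn_ge0 ?expR_ge0.
have t1 := sin_ES M (y/L).
have t2 : `|y/L|^+M/M`!%:R <= e * expR (2/L * `|y|).
 have := @expR_ge_pow R M (2/L * `|y|) (mulr_ge0 (proj1 (andP q0)) (normr_ge0 y)).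
 rewrite normrM normfV (gtr0_norm L0).
 have -> : (2/L * `|y|)^+M/M`!%:R = 2^+M*((`|y| / L)^+M/M`!%:R) by rewrite !exprMn; ring.
 rewrite (_ : 1 + 1 = 2 :> R) // in hM.
 set T := (`|y| / L)^+M/_ => hT; have p2 : 0 < 2^+M :> R by rewrite exprn_gt0.
 have -> : T = (2^+M)^-1*(2^+M * T) by rewrite mulrA mulVf ?mul1r // gt_eqF.
 by apply: ler_pM => //; rewrite mulr_ge0 // divr_ge0 // exprn_ge0 // divr_ge0 // ltW.
via (`|y|^+k * expR (c * y) * (e * expR (2/L * `|y|))).
 apply: (ler_pM _ (normr_ge0 _) _ (le_trans t1 t2)); first by pz; exact: exprn_ge0.
 exact: ler_piMr.
by rewrite mulrCA ler_wpM2l ?(ltW e0).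
Qed.

Lemma good_horner (p : {poly R}) c L : 0 < c -> 0 < L -> 2/L <= c/2 ->
 tame (fun y => expR (c * y) * p.[sin (y/L)]).
move=> c0 L0 Lc.
apply: (good_eq (f := fun y => \sum_(i < size p) p`_i*(y^+0 * expR (c * y) * sin (y/L)^+i))).
 by move=> y; rewrite horner_coef mulr_sumr; bigr i; rewrite expr0 mul1r mulrCA.
by apply: (good_sum (size p) (f := fun i y => p`_i*(y^+0 * expR (c * y) * sin (y/L)^+i))) => i; apply: good_scale; exact: good_sin.
Qed.

Lemma sandwich x0 d e : 0 < d -> d <= 1 -> 0 < e -> exists U V : R -> R, [/\ tame U, tame V, LL V <= e,
 forall y, ind (x0 + d) y <= U y + V y & forall y, U y <= ind (x0 - d) y + V y].
move=> d0 d1 e0; pose a := `|x0| + 2; have a0 : 0 < a by rewrite ltr_wpDl.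
pose H y := (a + expR y) * (2 + expR y).
have gH : tame H.
 apply: (good_eq (f := fun y => (2 * a * expR (0 * y) + (2 + a) * expR (1 * y)) + expR (2 * y))).
 move=> y; rewrite /H mul0r expR0 mul1r (_ : 2 * y = y + y); last by ring.
 by rewrite expRD; ring.
 by apply: good_add; [apply: good_add; apply: good_scale|]; exact: good_exp.
have pos f := @LL_ge0 f.
have H0 y : 0 <= H y by rewrite mulr_ge0 // addr_ge0 ?expR_ge0 // ltW.
have LH0 := pos H gH.1 H0.
pose c := Num.min 1 (e/(4*(LL H + 1))).
have LH1 : 0 < LL H + 1 by rewrite ltr_wpDl.
have c0 : 0 < c by rewrite lt_min ltr01 divr_gt0 // mulr_gt0.
have c1 : c <= 1 by rewrite ge_min lexx.
have cH : c * LL H <= e/4.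
 via (e/(4*(LL H + 1)) * (LL H + 1)); last by le_eq; fld.
 by apply: ler_pM => //; [exact: ltW | rewrite ge_min lexx orbT | rewrite lerDl].
pose T y := expR (0 * y) + expR (2 * c * y).
have gT : tame T by apply: good_add; apply: good_exp => //; rewrite mulr_ge0 // ltW.
have TE y : T y = 1 + expR (2 * c * y) by rewrite /T mul0r expR0.
have LT0 : 0 <= LL T by apply: pos gT.1 _ => y; rewrite TE addr_ge0 ?expR_ge0.
pose l := a + 4 * LL T/(c * e).
have l0 : 0 < l by rewrite ltr_wpDr // divr_ge0 ?mulr_ge0 // ltW .
have la : a <= l by rewrite lerDl divr_ge0 ?mulr_ge0 // ltW.
have lT : expR (- (c * l)) * LL T <= e/4.
 have h1 : 4 * LL T/e <= c * l.
 rewrite /l mulrDr; have -> : c*(4 * LL T/(c * e)) = 4 * LL T/e by fld.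
 by rewrite lerDr mulr_ge0 // ltW.
 have h2 := expR_ge1Dx (c * l); rewrite expRN mulrC ler_pdivrMr ?expR_gt0 //.
 have h3 : 4 * LL T/e <= expR (c * l) by lel h1; apply: le_trans h2; rewrite lerDr.
 by move: h3; rewrite ler_pdivrMr //; lra.
have gE : tame (fun y => expR (c * y)) by apply: good_exp; exact: ltW.
have LE0 : 0 <= LL (fun y => expR (c * y)) by apply: pos gE.1 _ => y; exact: expR_ge0.
have LE1 : 0 < LL (fun y => expR (c * y)) + 1 by rewrite ltr_wpDl.
pose ep := e/(4*(LL (fun y => expR (c * y)) + 1)).
have ep0 : 0 < ep by rewrite divr_gt0 // mulr_gt0.
have epE : ep * LL (fun y => expR (c * y)) <= e/4.
 via (ep*(LL (fun y => expR (c * y)) + 1)); first by rewrite ler_wpM2l ?(ltW ep0) // lerDl.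
 by le_eq; rewrite /ep; fld.
pose L := l + 4/c.
have L0 : 0 < L by rewrite addr_gt0 // divr_gt0.
have lL : l <= L by rewrite lerDl divr_ge0 // ltW.
have Lc : 2/L <= c/2.
 rewrite ler_pdivrMr // /L mulrDr; have -> : c/2*(4/c) = 2 by fld.
 by rewrite lerDr mulr_ge0 ?divr_ge0 // ltW.
have unit y : `|y| <= l -> y/L \in `[(- (pi/2)), (pi/2)].
 move=> yl; have p1 : 1 <= pi/2 :> R by rewrite ler_pdivlMr // mul1r pi_ge2.
 have : `|y/L| <= 1 by rewrite normrM normfV (gtr0_norm L0) ler_pdivrMr // mul1r (le_trans yl).
 by rewrite ler_norml in_itv /= => /andP[u1 u2]; lra.
have le_sin y y' : `|y| <= l -> `|y'| <= l -> y <= y' -> sin (y/L) <= sin (y' / L).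
 move=> h1 h2; rewrite le_eqVlt => /orP[/eqP -> //|h]; apply: ltW; rewrite ltr_sin ?unit //.
 by rewrite ltr_pM2r ?invr_gt0.
have lt_sin y y' : `|y| <= l -> `|y'| <= l -> y < y' -> sin (y/L) < sin (y' / L).
 by move=> h1 h2 h; rewrite ltr_sin ?unit // ltr_pM2r ?invr_gt0.
have xl : `|x0| <= l by apply: le_trans la; rewrite lerDl.
have xdl : `|x0 + d| <= l by apply: le_trans la; rewrite (le_trans (ler_normD _ _)) // lerD2l (gtr0_norm d0); lra.
have xdl' : `|x0 - d| <= l.
 by apply: le_trans la; rewrite (le_trans (ler_normD _ _)) // lerD2l normrN (gtr0_norm d0); lra.
pose v0 := sin (x0/L).
have sp : 0 < sin ((x0 + d)/L) - v0 by rewrite subr_gt0 lt_sin // ltrDl.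
have sm : 0 < v0 - sin ((x0 - d)/L) by rewrite subr_gt0 lt_sin // gtrBl.
pose r := Num.min (sin ((x0 + d)/L) - v0) (v0 - sin ((x0 - d)/L))/4.
have r0 : 0 < r by rewrite divr_gt0 // lt_min sp sm.
have r1 : 4 * r <= sin ((x0 + d)/L) - v0 by rewrite /r mulrC divfK // ge_min lexx.
have r2 : 4 * r <= v0 - sin ((x0 - d)/L) by rewrite /r mulrC divfK // ge_min lexx orbT.
have r20 : 0 < 2 * r by rewrite mulr_gt0.
have [N hN] := geom_small r20 ep0.
pose w y := 1/2 - v0/4 + 1/4 * sin (y/L).
pose p : {poly R} := 1%:P - (1%:P - ((1/2 - v0/4)%:P + (1/4)%:P * 'X)^+N)^+(2 ^ N).
have pE y : p.[sin (y/L)] = 1 - (1 - w y^+N)^+(2 ^ N).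
 by rewrite /p hornerD hornerN hornerC horner_exp hornerD hornerN hornerC horner_exp hornerD hornerC hornerM hornerC hornerX.
have w01 y : 0 <= w y <= 1.
 rewrite /w /v0; have := sin_geN1 (y/L); have := sin_le1 (y/L); have := sin_geN1 (x0/L); have := sin_le1 (x0/L).
 slra.
pose U y := expR (c * y) * p.[sin (y/L)].
pose V y := c * H y + ep * expR (c * y) + expR (- (c * l)) * T y.
have gV : tame V by apply: good_add; [apply: good_add|]; exact: good_scale.
have V1 y : c * H y <= V y.
 by rewrite /V -addrA lerDl addr_ge0 // mulr_ge0 ?(ltW ep0) // TE addr_ge0.
have V2 y : c * H y + ep * expR (c * y) <= V y by rewrite lerDl mulr_ge0 ?expR_ge0 // TE addr_ge0 ?expR_ge0.
have V3 y : c * H y + expR (- (c * l)) * T y <= V y by rewrite /V addrAC lerDl mulr_ge0 ?expR_ge0 // ltW.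
have cH0 y : 0 <= c * H y by rewrite mulr_ge0 // ltW.
have near1 y : x0 - 1 < y -> `|expR (c * y) - 1| <= c * H y.
 move=> hy; lel (expR_sub1 _); rewrite normrM (gtr0_norm c0) -mulrA ler_wpM2l ?(ltW c0) // /H.
 have eb := expR_gt0 y; have ey := expR_ge1Dx y.
 apply: (ler_pM (normr_ge0 _) (addr_ge0 ler01 (expR_ge0 _))).
 rewrite /a; have := ler_norm (- x0); rewrite normrN => hx; have := normr_ge0 x0 => hx'.
 by move: eb ey hx hx' hy; case: (ger0P y) => _; slra.
 have : expR (c * y) <= 1 + expR y.
 have [y0|y0] := lerP 0 y.
 by via (expR y); [rewrite ler_expR ler_piMl | rewrite lerDr].
 by via 1; [rewrite -[leRHS]expR0 ler_expR mulr_ge0_le0 // ltW | rewrite lerDl ltW].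
 by slra.
have tail y : l < `|y| -> expR (c * y) <= expR (- (c * l)) * T y.
 rewrite TE mulrDr mulr1 -expRD => hy.
 have e1 := expR_ge0 (- (c * l)); have e2 := expR_ge0 (- (c * l) + 2 * c * y).
 have [y0|y0] := lerP 0 y.
 rewrite (ger0_norm y0) in hy.
 via (expR (- (c * l) + 2 * c * y)); last by rewrite lerDr.
 rewrite ler_expR; have := ler_wpM2l (ltW c0) (ltW hy); slra.
 rewrite (ltr0_norm y0) in hy.
 via (expR (- (c * l))); last by rewrite lerDl.
 rewrite ler_expR; have := ler_wpM2l (ltW c0) (ltW hy); slra.
have U01 y : 0 <= p.[sin (y/L)] <= 1.
 by rewrite pE; have [h _ _] := step_poly N (w01 y) r0; move: h; slra.
have U0 y : 0 <= U y by rewrite mulr_ge0 ?expR_ge0 //; case/andP: (U01 y).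
have Ue y : U y <= expR (c * y) by rewrite /U ler_piMr ?expR_ge0 //; case/andP: (U01 y).
exists U, V; split => //.
- exact: good_horner.
- have [dH _] := gH; have [dT _] := gT; have [dE _] := gE.
 have s1 := dom_mul (dom_cst c) dH; have s2 := dom_mul (dom_cst ep) dE; have s3 := dom_mul (dom_cst (expR (- (c * l)))) dT.
 rewrite /V LL_add //; last exact: dom_add.
 by rewrite LL_add // !LL_scale //; move: cH epE lT e0; slra.
- move=> y; rewrite indE; case: ltP => [hy|_]; last by rewrite addr_ge0 // (le_trans (cH0 y)).
 have n1 : 1 <= expR (c * y) + c * H y.
 have hx : x0 - 1 < y by move: hy d0; slra.
 by have := near1 y hx; rewrite ler_norml => /andP[]; slra.
 lel n1.
 have [yl|yl] := lerP `|y| l.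
 have hs : 1/2 + r <= w y.
 move: r1 (le_sin _ _ xdl yl (ltW hy)); rewrite /w; slra.
 have [_ st _] := step_poly N (w01 y) r0; have {}st := le_trans (st hs) hN.
 have : expR (c * y) * (1 - ep) <= U y.
 by rewrite /U pE ler_wpM2l //; move: st; slra.
 by have := V2 y; rewrite mulrBr mulr1 [expR _ * ep]mulrC; slra.
 by have := tail y yl; have := V3 y; have := U0 y; slra.
move=> y; rewrite indE; case: ltP => [hy|hy].
 have hx : x0 - 1 < y by move: hy d1; slra.
 have := near1 y hx; rewrite ler_norml => /andP[_]; have := Ue y; have := V1 y.
 by rewrite -[true%:R]/1%:R; slra.
rewrite -[false%:R]/0 add0r; have [yl|yl] := lerP `|y| l.
 have hs : w y <= 1/2 - r by move: r2 (le_sin _ _ yl xdl' hy); rewrite /w; slra.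
 have [_ _ st] := step_poly N (w01 y) r0; have {}st := le_trans (st hs) hN.
 have : U y <= ep * expR (c * y) by rewrite /U pE mulrC ler_wpM2r.
 by have := V2 y; have := cH0 y; slra.
by have := tail y yl; have := V3 y; have := Ue y; have := cH0 y; slra.
Qed.

Theorem cvg_ind x e : 0 < e -> exists N, forall n, (N <= n)%N -> `|EE n (ind x) - LL (ind x)| <= e.
move=> e0; pose e8 := e/8; have e80 : 0 < e8 by rewrite divr_gt0.
pose d := Num.min 1 e8.
have d0 : 0 < d by rewrite lt_min ltr01.
have d1 : d <= 1 by rewrite ge_min lexx.
have de : d <= e8 by rewrite ge_min lexx orbT.
have [U1 [V1 [[dU1 hU1] [dV1 hV1] L1 a1 b1]]] := sandwich (x - d) d0 d1 e80.
have [U2 [V2 [[dU2 hU2] [dV2 hV2] L2 a2 b2]]] := sandwich (x + d) d0 d1 e80.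
have [N1 n1] := hU1 _ e80; have [N2 n2] := hV1 _ e80; have [N3 n3] := hU2 _ e80; have [N4 n4] := hV2 _ e80.
exists (maxn (maxn N1 N2) (maxn N3 N4)) => n; rewrite !geq_max => /andP[/andP[m1 m2] /andP[m3 m4]].
have E1 := EE_le n a1; have E2 := EE_le n b2; rewrite subrK addrK !EE_add in E1 E2.
have K1 := LL_le dU1 (dom_add (dom_ind _) dV1) b1; have K2 := LL_le (dom_ind _) (dom_add dU2 dV2) a2.
rewrite !LL_add // in K1 K2; try exact: dom_ind.
have d20 : 0 <= d + d by rewrite addr_ge0 // ltW.
have D1 := LL_ind_diff x d20; have D2 := LL_ind_diff (x + d + d) d20.
rewrite opprD addrA in D1; rewrite (_ : x + d + d - (d + d) = x) in D2; last by ring.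
have := n1 n m1; have := n2 n m2; have := n3 n m3; have := n4 n m4.
have ee : e = 8 * e8 by rewrite /e8; field.
rewrite ee; move: E1 E2 K1 K2 D1 D2 L1 L2 de.
move: (EE n _) (EE n _) (EE n _) (EE n _) (EE n _) (LL U1) (LL V1) (LL U2) (LL V2) (LL (ind _)) (LL (ind _)) (LL (ind _)) => a b b' q q' f1 f2 f3 f4 g1 g2 g3.
rewrite !ler_norml; slra.
Qed.

End Convergence.

(** * Standardised hook counts and assembly of the statements *)

Section Final.
Variables (R : realType) (t : nat).
Hypothesis t0 : (0 < t)%N.
Local Notation A := (@AA R).
Implicit Types (a x e l : R) (n : nat).

Lemma alt_sum_ge (k : nat) : (0 < k)%N -> 3/4 <= alt_sum R (k + k).
case: k => // k _; elim: k => [|k IH].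
 by rewrite /alt_sum !big_nat_recr //= big_geq // expr0 expr1; lra.
rewrite addSn addnS /alt_sum big_nat_recr //= big_nat_recr //= -/(alt_sum R _).
have e1 : (-1)^+(k.+1 + k.+1) = 1 :> R by rewrite addnn -mul2n exprM sqrrN !expr1n.
have e2 : (-1)^+(k.+1 + k.+1).+1 = -1 :> R by rewrite exprS e1 mulr1.
rewrite e1 e2.
lel IH; rewrite -addrA lerDl mulN1r subr_ge0 mul1r.
by rewrite lef_pV2 ?posrE // lerXn2r ?nnegrE // ler_nat.
Qed.

(** This is [pi^2 > 6], needed for a positive leading coefficient of the variance. The alternating
    sum is at least [1 - 1/4] and within 1/8 of [2 A]. *)
Lemma AA_gt_quarter : 1/4 < A.
have := alt_sum_lim R 4; have := @alt_sum_ge (2 ^ 4) isT.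
rewrite /AA (_ : 2/2^+4 = 1/8 :> R); last by fld.
by rewrite ler_norml => h /andP[_]; lra.
Qed.

Definition vv : R := 1/2 - (8 * A)^-1.
Lemma vv_gt0 : 0 < vv.
have h := AA_gt_quarter; have A8 : 0 < 8 * A by apply: mulr_gt0 => //; exact: AA_gt0.
rewrite /vv subr_gt0 mul1r ltf_pV2 ?posrE //.
have : 8*(1/4) < 8 * A by rewrite ltr_pM2l.
lra.
Qed.

Lemma card_SC n : #|SC n|%:R = \sum_(D : {set 'I_n} | weight D == n) 1 :> R.
Proof. by rewrite -(@SC_big R n t (fun=> 1) t0) -sum1_card natr_sum. Qed.

Lemma unif_Emean n (F : nat -> R) :
 unif_mean (SC n) (fun la => F (hooks t la)) = Emean (fun D : {set 'I_n} => F (cfg_hooks t D)).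
Proof. by rewrite /unif_mean /Emean (SC_big _ F t0) card_SC. Qed.

Lemma unif_meanD (T : finType) (S : {set T}) (X Y : T -> R) :
 unif_mean S (fun w => X w + Y w) = unif_mean S X + unif_mean S Y.
Proof. by rewrite /unif_mean big_split mulrDl. Qed.

Lemma unif_meanZ (T : finType) (S : {set T}) (c : R) (X : T -> R) :
 unif_mean S (fun w => c * X w) = c * unif_mean S X.
Proof. by rewrite /unif_mean -mulr_sumr mulrA. Qed.

Lemma unif_mean_le (T : finType) (S : {set T}) (X Y : T -> R) :
 (forall w, X w <= Y w) -> unif_mean S X <= unif_mean S Y.
Proof. by move=> h; rewrite /unif_mean ler_wpM2r //; apply: ler_sum. Qed.

Lemma unif_mean_cst (T : finType) (S : {set T}) (c : R) : #|S|%:R != 0 :> R ->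
 unif_mean S (fun=> c) = c.
Proof. by move=> S0; rewrite /unif_mean sumr_const -[_ *+ _]mulr_natr mulfK. Qed.

Lemma unif_varianceE (T : finType) (S : {set T}) (X : T -> R) : #|S|%:R != 0 :> R ->
 unif_variance S X = unif_mean S (fun w => X w^+2) - unif_mean S X^+2.
move=> S0; rewrite /unif_variance; set m := unif_mean S X.
have -> : (fun w => (X w - m)^+2) = (fun w => X w^+2 + (- 2 * m * X w + m^+2)).
 by apply/funext => w; ring.
by rewrite !unif_meanD unif_meanZ unif_mean_cst // -/m; ring.
Qed.

Lemma hook_meanE n : hook_mean R t n = Emean (@Nhk R n t).
Proof. exact: (unif_Emean n (fun k => k%:R)). Qed.

Lemma hook_varE n : 0 < sc R n ->
 hook_variance R t n = Emean (fun D : {set 'I_n} => Nhk R t D^+2) - Emean (@Nhk R n t)^+2.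
move=> s0; have c0 : #|SC n|%:R != 0 :> R by rewrite card_SC count_all gt_eqF.
rewrite /hook_variance unif_varianceE //; congr (_ - _^+2).
 exact: (unif_Emean n (fun k => k%:R^+2)).
exact: hook_meanE.
Qed.

Lemma moments_bound : exists2 C : R, 0 < C & exists n0, forall n, (n0 <= n)%N -> let a := asize R n in
 [/\ (0 < n)%N, 0 < a <= 1, 0 < sc R n,
 `|hook_mean R t n - (a^-1/2 + A^-1/8 + c0 R t)| <= C * a &
 `|hook_variance R t n - var_main t a| <= C * a].
have [C C0 [n0 H]] := mean_var R t0; exists C => //; exists n0 => n /H [h1 h2 h3 h4 h5].
by split => //; rewrite ?hook_meanE ?hook_varE.
Qed.

Lemma Xf_Xb n i (D : {set 'I_n}) : Xf R t i D = Xb R t i D.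
rewrite /Xf /Xb /allb /= !andbT.
by case: (bit D i); case: (bit D (i + t)); rewrite ?subr0 ?subrr.
Qed.

(** The boundary pairs add between 0 and [t] to the count, hence a factor between 1 and
    [exp (u t / 2)], which tends to 1 with [u]. *)
Lemma exp_hooks n (D : {set 'I_n}) (u : R) : 0 <= u ->
 fQ t (expR u - 1) xpredT D <= expR (u/2 * Nhk R t D) <= expR (u * t%:R/2) * fQ t (expR u - 1) xpredT D.
move=> u0; rewrite NhkXY.
have -> : \sum_(i < n) Xf R t i D = \sum_(i < n) Xb R t i D by bigr i; rewrite Xf_Xb.
set S := \sum_(i < n) _; set B := \sum_(m < t) _.
have fE : fQ t (expR u - 1) xpredT D = expR (u * S).
 rewrite /fQ mulr_sumr expR_sum; bigr i.
 by rewrite /Xb; case: (~~ _ && _); rewrite ?mulr1 ?mulr0 ?expR0 ?addr0 // addrC subrK.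
have B0 : 0 <= B <= t%:R.
 have b m : 0 <= Yf R t m D <= 1 by rewrite /Yf /allb; case: (all _ _); rewrite ?lexx ?ler01.
 rewrite /B sumr_ge0 /=; last by move=> m _; case/andP: (b m).
 rewrite -[leRHS]mulr1 mulr_natl -[in leRHS](card_ord t) -sumr_const; by lsum m; case/andP: (b m).
have /andP[b0 b1] := B0.
rewrite fE -expRD !ler_expR; apply/andP; split.
 by have := mulr_ge0 u0 b0; lra.
by have := ler_wpM2l u0 b1; lra.
Qed.

Lemma Emean_le n (F G : {set 'I_n} -> R) : (forall D, F D <= G D) -> Emean F <= Emean G.
move=> h; rewrite /Emean ler_wpM2r ?invr_ge0 ?sumr_ge0 //; exact: ler_sum.
Qed.

Lemma EmeanZ n (c : R) (F : {set 'I_n} -> R) : Emean (fun D => c * F D) = c * Emean F.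
Proof. by rewrite /Emean -mulr_sumr mulrA. Qed.

Definition EE n (f : R -> R) : R :=
 unif_mean (SC n) (fun la => f ((hookRV R t la - hook_mean R t n)/hook_sigma R t n)).

Lemma exp_small_quad (u : R) : 0 <= u <= 1/2 -> let z := expR u - 1 in
 [/\ u <= z, z <= 2 * u, `|z - (u + u^+2/2)| <= u^+3 & `|z^+2 - u^+2| <= 5 * u^+3].
move=> /andP[u0 u1] z; have h1 : u <= z by rewrite lerBrDl expR_ge1Dx.
have u30 : 0 <= u^+3 by rewrite exprn_ge0.
have d1 (y : R) : is_derive y 1 (fun y : R => expR y - 1 - y) (expR y - 1).
 by apply: is_derive_eq; rewrite /GRing.scale; ring.
have d2 (y : R) : is_derive y 1 (fun y : R => expR y - 1 - y - y^+2/2) (expR y - 1 - y).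
 by is_der; field.
have b0 (y : R) : 0 <= y <= 1/2 -> `|expR y - 1| <= 3 * y^+1.
 move=> /andP[y0 y1]; lel (expR_sub1 y); rewrite (ger0_norm y0) mulrC expr1 ler_wpM2r //.
 have h := expR_ge1Dx (- y); have e1 := expRxMexpNx_1 y; have ey := expR_gt0 y.
 have : expR y*(1 - y) <= 1 by rewrite -[leRHS]e1 ler_wpM2l // ltW.
 have : expR y*(1/2) <= expR y*(1 - y) by rewrite ler_wpM2l //; lra.
 by move: (expR y) => w; clra.
have b1 (y : R) : 0 <= y <= 1/2 -> `|expR y - 1 - y| <= 3/2 * y^+2.
 by move=> hy; apply: (abs_le_pow d1 _ b0) => //; rewrite expR0 !subrr.
have b2 : `|z - (u + u^+2/2)| <= u^+3.
 have hu : 0 <= u <= 1/2 by rewrite u0.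
 have := @abs_le_pow _ _ _ 2 (3/2) (1/2) d2 _ b1 u hu; rewrite expR0 !subrr expr0n /= mul0r oppr0 addr0 => /(_ erefl) h.
 rewrite (_ : z - _ = expR u - 1 - u - u^+2/2); last by rewrite /z; ring.
 lra.
have b3 : z - u <= 3/2 * u^+2.
 have := b1 u (andI u0 u1); rewrite ler_norml => /andP[_]; exact.
have uu : u^+2 <= 1/2 * u by rewrite expr2 ler_wpM2r.
have z2 : z <= 2 * u by lra.
split => //; rewrite (_ : z^+2 - u^+2 = (z - u) * (z + u)); last by ring.
rewrite ger0_norm; last by rewrite mulr_ge0 ?subr_ge0 // addr_ge0 // (le_trans u0).
via (3/2 * u^+2*(3 * u)).
 by apply: ler_pM => //; [rewrite subr_ge0 | rewrite addr_ge0 // (le_trans u0) | lra].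
rewrite (_ : 3/2 * u^+2*(3 * u) = 9/2 * u^+3); last by ring.
lra.
Qed.

Lemma tilt_error_sum (q f g x4 x5 x6 x7 x8 y1 y2 y3 y4 y5 : R) :
 `|x4| <= y1 -> x8 <= y2 -> `|x5| <= y4/4 -> `|x6| <= 5 * y4 -> `|x7| <= y5 -> `|f - g| <= y3 ->
 f <= q -> q <= x8 + f -> 0 <= y4 ->
 `|- x4 + (q - f) + (f - g) + (x5 - x6) - x7| <= y1 + y2 + y3 + 6 * y4 + y5.
by rewrite !ler_norml; lra.
Qed.

(** With [u = 2 l / sigma] and [z = exp u - 1], the standardised exponential is
    [exp (u/2 (N - mu))]. In [target] the part linear in [u] cancels against [mu], which is near
    [1 / (2 a)], and the quadratic part is [vv u^2 / (8 a)]; this agrees with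
    [l^2 / 2 = u^2 sigma^2 / 8] because [sigma^2 = vv / a + O(1)]. *)
Lemma mgf_limit (l : R) : 0 <= l -> forall e, 0 < e -> exists N, forall n, (N <= n)%N ->
 `|EE n (fun y => expR (l * y)) - expR (l^+2/2)| <= e.
move=> l0 e e0; have [Cm Cm0 [n0 hm]] := moments_bound.
have v0 := vv_gt0; have A0 := AA_gt0 R; have A4 := AA_gt_quarter.
(* From [sigma^2 >= vv / (2 a)] follows [u <= L0 sqrt a], and [z <= 2 u]; the summand 1 in [L] keeps
   it positive when [l = 0]. *)
pose L0 := sqrt (8 * l^+2/vv); have L00 : 0 <= L0 by rewrite sqrtr_ge0.
pose L := 2 * L0 + 1; have Lp : 0 < L by rewrite ltr_wpDl ?mulr_ge0.
have [C1 C10 [a1 /andP[a10 a180] hl]] := log_mgf t0 Lp.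
pose c1' : R := A^-1/8 - (odd t)%:R/8 - A^-1^+2/16.
pose C2 := Cm + `|c1'|; have C20 : 0 < C2 by rewrite ltr_wpDr.
pose C3 := Cm + `|A^-1/8 + c0 R t|; have C30 : 0 < C3 by rewrite ltr_wpDr.
pose C' := L0 * C3/2 + L0 * t%:R/2 + C1 + 6 * L0^+3 + L0 * C2/8.
have C'0 : 0 < C'.
 have q1 : 0 <= L0 * C3/2 by rewrite divr_ge0 // mulr_ge0 // ltW.
 have q2 : 0 <= L0 * t%:R/2 by rewrite divr_ge0 // mulr_ge0 ?ler0n.
 have q3 : 0 <= L0^+3 by rewrite exprn_ge0.
 have q4 : 0 <= L0 * C2/8 by rewrite divr_ge0 // mulr_ge0 // ltW.
 by rewrite /C'; move: q1 q2 q3 q4 C10; clra.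
pose B0 := expR (l^+2/2) * (1 + expR 1); have B00 : 0 < B0 by rewrite mulr_gt0 ?addr_gt0 ?expR_gt0.
pose w := Num.min 1 (e/B0)/C'; have w0 : 0 < w by rewrite divr_gt0 // lt_min ltr01 divr_gt0.
pose a2 := Num.min (Num.min a1 (vv/(2 * C2))) (Num.min (w^+8) ((2*(L0 + 1))^+2)^-1).
have L1 : 0 < L0 + 1 by rewrite ltr_wpDl.
have a20 : 0 < a2.
 have q1 : 0 < vv/(2 * C2) by apply: divr_gt0 => //; exact: mulr_gt0.
 have q2 : 0 < ((2*(L0 + 1))^+2)^-1 by rewrite invr_gt0; apply: exprn_gt0; exact: mulr_gt0.
 have q3 : 0 < w^+8 by exact: exprn_gt0.
 by rewrite /a2 !lt_min a10 q1 q2 q3.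
have [n1 hn1] := asize_small a20.
exists (maxn n0 n1) => n; rewrite geq_max => /andP[nn0 nn1].
have [np /andP[a0 a11] s0] := hm n nn0; have [_] := hn1 n nn1.
rewrite hook_meanE (hook_varE s0); move: (asize_sqr R np) a0 a11.
set a := asize R n => an a0 a11; rewrite !le_min => /andP[/andP[aa1 aa2] /andP[aa3 aa4]].
set mu := Emean (@Nhk R n t); set V := Emean _ - _ => hmu hV.
have r0 : 0 < sqrt a by rewrite sqrtr_gt0.
have rs : sqrt a^+2 = a by rewrite sqr_sqrtr // ltW.
have re := sqrt_le_eps a0 a11; have ep0 := eps_gt0 a0.
have ia0 : 0 < a^-1 by rewrite invr_gt0.
have hV' : `|V - vv * a^-1| <= C2.
 have -> : V - vv * a^-1 = (V - var_main t a) + c1'.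
 by rewrite /var_main /c1' /vv; fld.
 lel (ler_normD _ _); rewrite lerD2r; lel hV; by rewrite ler_piMr // ltW.
have hmu' : `|mu - a^-1/2| <= C3.
 have -> : mu - a^-1/2 = (mu - (a^-1/2 + A^-1/8 + c0 R t)) + (A^-1/8 + c0 R t) by ring.
 lel (ler_normD _ _); rewrite lerD2r; lel hmu; by rewrite ler_piMr // ltW.
have Vlo : vv/(2 * a) <= V.
 have : C2 <= vv/(2 * a).
 rewrite ler_pdivlMr; move: aa2; rewrite ler_pdivlMr ?mulr_gt0 //; move: (vv) => q; clra.
 have e2 : vv * a^-1 = vv/(2 * a) + vv/(2 * a) by fld.
 move: hV'; rewrite e2 ler_norml => /andP[h _]; move: h; move: (vv/_) => q; clra.
have Vp : 0 < V by apply: lt_le_trans Vlo; apply: divr_gt0 => //; exact: mulr_gt0.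
pose sg := sqrt V; have sg0 : 0 < sg by rewrite sqrtr_gt0.
have sg2 : sg^+2 = V by rewrite sqr_sqrtr // ltW.
pose u := 2 * l/sg.
have u0 : 0 <= u by rewrite divr_ge0 ?mulr_ge0 // ltW.
have u2 : u^+2 * V = 4 * l^+2 by rewrite -sg2 /u; fld.
have uL : u <= L0 * sqrt a.
 have : u^+2 <= (L0 * sqrt a)^+2.
 rewrite [leRHS]exprMn rs sqr_sqrtr; last by apply: divr_ge0; [apply: mulr_ge0 => //; exact: sqr_ge0 | exact: ltW].
 have h : u^+2*(vv/(2 * a)) <= 4 * l^+2 by rewrite -u2 ler_wpM2l ?sqr_ge0.
 have -> : 8 * l^+2/vv * a = 4 * l^+2/(vv/(2 * a)) by fld.
 by rewrite ler_pdivlMr //; apply: divr_gt0 => //; exact: mulr_gt0.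
 by rewrite ler_sqr ?nnegrE // mulr_ge0 // ltW.
have ra : sqrt a*(2*(L0 + 1)) <= 1.
 rewrite -[leRHS]sqrtr1 -[2*(L0 + 1)]gtr0_norm ?mulr_gt0 // -sqrtr_sqr -sqrtrM ?(ltW a0) // ler_sqrt //.
 by rewrite -ler_pdivlMr ?mulr_gt0 // mul1r.
have u12 : u <= 1/2 by lel uL; move: ra r0; clra.
pose z := expR u - 1.
have [z1 z2 z3 z4] := exp_small_quad (andI u0 u12); rewrite -/z in z1 z2 z3 z4.
have z0 : 0 <= z by apply: le_trans z1.
have zL : z <= L * sqrt a.
 lel z2; have -> : L * sqrt a = 2*(L0 * sqrt a) + sqrt a by rewrite /L mulrDl mul1r mulrA.
 by rewrite -[leLHS]addr0; apply: lerD; [rewrite ler_pM2l | exact: ltW].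
have [Ep lE] := hl a n z (andI a0 aa1) an (andI z0 zL).
set Ef := Emean _ in Ep lE.
pose Q := Emean (fun D : {set 'I_n} => expR (u/2 * Nhk R t D)).
have Q1 : Ef <= Q by apply: Emean_le => D; case/andP: (exp_hooks D u0).
have Q2 : Q <= expR (u * t%:R/2) * Ef by rewrite -EmeanZ; apply: Emean_le => D; case/andP: (exp_hooks D u0).
have Qp : 0 < Q by apply: lt_le_trans Q1.
have lQ1 : ln Ef <= ln Q by rewrite ler_ln ?posrE.
have lQ2 : ln Q <= u * t%:R/2 + ln Ef.
 by rewrite -[u * _/2]expRK -lnM ?posrE ?expR_gt0 // ler_ln ?posrE // mulr_gt0 ?expR_gt0.
have EEE : EE n (fun y => expR (l * y)) = expR (- (u/2 * mu)) * Q.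
 rewrite /EE /hook_sigma hook_meanE (hook_varE s0) -/mu -/V -/sg.
 rewrite (unif_Emean n (fun k => expR (l*((k%:R - mu)/sg)))) -EmeanZ /Emean; congr (_/_).
 by bigr D; rewrite -expRD; congr expR; rewrite /Nhk /u; fld.
pose x := - (u/2 * mu) + ln Q - l^+2/2.
have EE2 : EE n (fun y => expR (l * y)) = expR (l^+2/2) * expR x.
 by rewrite EEE -{1}[Q]lnK // -!expRD; congr expR; rewrite /x; ring.
have xb : `|x| <= C' * eps a.
 pose kq : R := (64 * A)^-1 + 1/16.
 have k0 : 0 <= kq <= 1.
 rewrite /kq addr_ge0 ?invr_ge0 //=; last by apply: mulr_ge0 => //; exact: ltW.
 have : (64 * A)^-1 <= (16)^-1.
 rewrite lef_pV2 ?posrE //; last by pz.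
 by move: A4; move: A; clear => q; lra.
 by move: (_^-1) => q; clra.
 have kv : 1/8 - kq = vv/8 by rewrite /kq /vv; fld.
 have tE : target a z = a^-1*(u/4 + u^+2/8 + (z - (u + u^+2/2))/4) - kq * a^-1*(u^+2 + (z^+2 - u^+2)).
 by rewrite /target /kq; fld.
 have lV : l^+2/2 = u^+2 * V/8 by rewrite u2; field.
 have xE : x = - (u/2*(mu - a^-1/2)) + (ln Q - ln Ef) + (ln Ef - target a z) +
 (a^-1*(z - (u + u^+2/2))/4 - kq*(a^-1*(z^+2 - u^+2))) - u^+2/8*(V - vv * a^-1).
 rewrite /x lV tE (_ : vv = 8*(1/8 - kq)); last by rewrite kv; field.
 by fld.
 have u3 : a^-1 * u^+3 <= L0^+3 * eps a.
 have : u^+3 <= (L0 * sqrt a)^+3 by rewrite lerXn2r ?nnegrE // (le_trans u0).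
 have -> : (L0 * sqrt a)^+3 = a*(L0^+3 * sqrt a) by rewrite [LHS]exprMn [sqrt a^+3]exprSr rs mulrCA.
 move=> h; rewrite mulrC ler_pdivrMr // [leRHS]mulrC; lel h.
 by rewrite ler_wpM2l ?(ltW a0) // ler_wpM2l ?exprn_ge0.
 have ue : u <= L0 * eps a by lel uL; rewrite ler_wpM2l.
 have uu : u^+2 <= u by rewrite expr2 ler_piMr //; move: u12; clra.
 have t1 : `|u/2*(mu - a^-1/2)| <= L0 * C3/2 * eps a.
 have p2 : 0 <= u/2 by rewrite divr_ge0.
 have -> : L0 * C3/2 * eps a = L0 * eps a/2 * C3 by clearbody L0 C3; ring.
 by rewrite normrM (ger0_norm p2); apply: ler_pM => //; rewrite ler_wpM2r.
 have t2 : u * t%:R/2 <= L0 * t%:R/2 * eps a.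
 have -> : L0 * t%:R/2 * eps a = L0 * eps a * t%:R/2 by ring.
 by rewrite ler_wpM2r // ler_wpM2r // ler0n.
 have t3 : `|a^-1*(z - (u + u^+2/2))/4| <= L0^+3 * eps a/4.
 rewrite normrM [X in _ * X]ger0_norm ?invr_ge0 // ler_wpM2r //.
 by rewrite normrM (gtr0_norm ia0); apply: le_trans u3; rewrite ler_wpM2l // ltW.
 have t4 : `|kq*(a^-1*(z^+2 - u^+2))| <= 5*(L0^+3 * eps a).
 case/andP: k0 => k0 k1; rewrite normrM (ger0_norm k0); via (`|a^-1*(z^+2 - u^+2)|).
 by rewrite ler_piMl.
 rewrite normrM (gtr0_norm ia0); via (a^-1*(5 * u^+3)); first by pz.
 by rewrite mulrCA ler_wpM2l.
 have t5 : `|u^+2/8*(V - vv * a^-1)| <= L0 * C2/8 * eps a.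
 have p8 : 0 <= u^+2/8 by rewrite divr_ge0 // sqr_ge0.
 rewrite normrM (ger0_norm p8); via (L0 * eps a/8 * C2); last by clearbody L0 C2; le_eq; ring.
 by apply: ler_pM => //; rewrite ler_wpM2r // (le_trans uu).
 have CE : C' * eps a = L0 * C3/2 * eps a + L0 * t%:R/2 * eps a + C1 * eps a + 6*(L0^+3 * eps a) + L0 * C2/8 * eps a.
 by rewrite /C'; ring.
 have p3 : 0 <= L0^+3 * eps a by rewrite mulr_ge0 ?exprn_ge0 // ltW.
 by rewrite CE xE; apply: tilt_error_sum t1 t2 t3 t4 t5 lE lQ1 lQ2 p3.
have ew : eps a <= w.
 have : eps a^+8 <= w^+8 by rewrite (_ : 8 = 4*2)%N // exprM eps4 rs.
 by rewrite ler_pXn2r // nnegrE ltW.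
have xw : `|x| <= Num.min 1 (e/B0).
 by lel xb; via (C' * w); [rewrite ler_wpM2l // ltW | rewrite /w mulrC divfK // gt_eqF].
have xw1 : `|x| <= 1 by lel xw; rewrite ge_min lexx.
have xw2 : `|x| <= e/B0 by lel xw; rewrite ge_min lexx orbT.
rewrite EE2 -{2}[expR (l^+2/2)]mulr1 -mulrBr normrM (ger0_norm (expR_ge0 _)).
via (expR (l^+2/2) * (`|x| * (1 + expR 1))).
 rewrite ler_wpM2l ?expR_ge0 //; lel (expR_sub1 x); rewrite ler_wpM2l // lerD2l ler_expR.
 exact: le_trans (ler_norm x) xw1.
by rewrite mulrCA -/B0 -ler_pdivlMr.
Qed.

Lemma EE_ind x : forall e, 0 < e -> exists N, forall n, (N <= n)%N -> `|EE n (ind x) - LL (ind x)| <= e.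
move=> e; apply: (cvg_ind (EE := EE)).
- by move=> n f g; rewrite /EE unif_meanD.
- by move=> n c f; rewrite /EE unif_meanZ.
- by move=> n f g h; rewrite /EE; apply: unif_mean_le.
- exact: mgf_limit.
Qed.

Lemma unif_prob_EE n x : 0 < sc R n ->
 unif_prob R (SC n) (fun la => (hookRV R t la - hook_mean R t n)/hook_sigma R t n <= x) = 1 - EE n (ind x).
move=> s0; have c0 : #|SC n|%:R != 0 :> R by rewrite card_SC count_all gt_eqF.
have -> : 1 - EE n (ind x) =
 unif_mean (SC n) (fun la => 1 + -1 * ind x ((hookRV R t la - hook_mean R t n)/hook_sigma R t n)).
 by rewrite unif_meanD unif_meanZ (unif_mean_cst _ c0) mulN1r.
rewrite /unif_prob /unif_mean; congr (_/_).
rewrite -sum1_card natr_sum big_mkcond [RHS]big_mkcond; bigr la.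
rewrite inE; case: (la \in SC n) => //=; rewrite indE ltNge mulN1r.
by case: (_ <= x); rewrite ?subr0 ?subrr.
Qed.

Lemma sqrt6E n : (0 < n)%N -> sqrt (6 * n%:R)/pi = (asize R n)^-1/2.
move=> n0; have a0 := asize_gt0 R n0; have p0 := pi_gt0 R; have nn : 0 < n%:R :> R by rewrite ltr0n.
apply/eqP; rewrite -(@eqrXn2 _ 2) ?divr_ge0 ?invr_ge0 ?(ltW a0) ?(ltW p0) //.
rewrite !expr_div_n sqr_sqrtr ?mulr_ge0 ?ler0n // exprVn.
have -> : asize R n^+2 = pi^+2/24/n%:R by rewrite -/A -(asize_sqr R n0) mulfK // gt_eqF.
by apply/eqP; move: (pi : R) p0 => p p0; fld.
Qed.

Lemma asize_sqrt n : (0 < n)%N -> asize R n = sqrt A*(sqrt n%:R)^-1.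
move=> n0; have nn : 0 <= (n%:R)^-1 :> R by rewrite invr_ge0 ler0n.
by rewrite /asize sqrtrM ?(ltW (AA_gt0 R)) // sqrtrV // ler0n.
Qed.

Lemma bigO_of_asize (f g : nat -> R) : (exists2 C : R, 0 < C & exists n0, forall n, (n0 <= n)%N ->
 (0 < n)%N /\ `|f n - g n| <= C * asize R n) ->
 f = g +O_\oo (fun n : nat => (sqrt n%:R)^-1).
move=> [C C0 [n0 h]]; apply/eqaddOP; near=> k; near=> n.
have [np hn] : (0 < n)%N /\ `|f n - g n| <= C * asize R n by apply: h; near: n; exact: nbhs_infty_ge.
lel hn; rewrite (asize_sqrt np) mulrA [leRHS](_ : _ = k*(sqrt n%:R)^-1); last first.
 by rewrite ger0_norm // invr_ge0 sqrtr_ge0.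
rewrite ler_wpM2r ?invr_ge0 ?sqrtr_ge0 //; near: k; apply: nbhs_pinfty_ge; exact: num_real.
Unshelve. all: by end_near. Qed.

End Final.

Theorem theorem1p2 (R : realType) (t : nat) (ht : (1 <= t)%N) :
  [/\ (fun n : nat => hook_mean R t n) =
        (fun n : nat => Num.sqrt (6 * n%:R) / pi - t%:R / 2 + 3 / pi ^+ 2
                        + (odd t)%:R / 4)
        +O_\oo (fun n : nat => (Num.sqrt n%:R)^-1),
      (fun n : nat => hook_variance R t n) =
        (fun n : nat => (pi ^+ 2 - 6) * Num.sqrt (6 * n%:R) / pi ^+ 3
                        + 3 * (pi ^+ 2 - 12) / pi ^+ 4 - (odd t)%:R / 8)
        +O_\oo (fun n : nat => (Num.sqrt n%:R)^-1)
    & forall x : R,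
        (unif_prob R (SC n) (fun la =>
           (hookRV R t la - hook_mean R t n) / hook_sigma R t n <= x))%:E
          @[n --> \oo] --> normal_prob (0 : R) 1 `]-oo, x] ].
Proof.
have [C C0 [n0 h]] := moments_bound R ht; have p0 := pi_gt0 R.
split.
- apply: bigO_of_asize; exists C => //; exists n0 => n /h [np _ _ hm _]; split => //.
 apply: le_trans hm; le_eq; congr `|_ - _|.
 rewrite (sqrt6E R np) /c0 /AA; move: (asize_gt0 R np) p0; move: (asize R n) (pi : R) => a p a0 p0.
 by fld.
- apply: bigO_of_asize; exists C => //; exists n0 => n /h [np _ _ _ hv]; split => //.
 apply: le_trans hv; le_eq; congr `|_ - _|.
 have -> : (pi^+2 - 6) * sqrt (6 * n%:R)/pi^+3 = (pi^+2 - 6)/pi^+2*(sqrt (6 * n%:R)/pi) :> R.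
 by move: (pi : R) p0 => p p0; fld.
 rewrite (sqrt6E R np) /var_main /AA; move: (asize_gt0 R np) p0; move: (asize R n) (pi : R) => a p a0 p0.
 by fld.
(* The event in question is the complement of [ind x]. For large [n] the number [sc R n] is
   positive, so the uniform measure on [SC n] has total mass 1. *)
move=> x; rewrite -LL_ind_cdf; apply: cvg_EFin; first by near=> n.
apply/cvgrPdist_le => e e0.
have [N hN] := EE_ind ht x e0; near=> n.
have [_ _ s0 _ _] : [/\ (0 < n)%N, 0 < asize R n <= 1, 0 < sc R n,
 `|hook_mean R t n - ((asize R n)^-1/2 + (AA R)^-1/8 + c0 R t)| <= C * asize R n &
 `|hook_variance R t n - var_main t (asize R n)| <= C * asize R n].
 by apply: h; near: n; exact: nbhs_infty_ge.
rewrite /= unif_prob_EE // (_ : _ - _ = EE t n (ind x) - LL (ind x)); last by ring.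
by apply: hN; near: n; exact: nbhs_infty_ge.
Unshelve. all: by end_near. Qed.
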